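(* Let $r\ge1$ and let $n_1,\ldots,n_r\ge2$ be integers. Then, with $q=e^{2\pi\sqrt{-1}\tau}$, \[ G^{\mathrm{sh}}_{n_1,\ldots,n_r}(q)=G_{n_1,\ldots,n_r}(\tau). \]
   Context: Hopf algebra. Let $\mathcal{I}_\bullet$ be the $\mathbb{Q}$-vector space spanned by symbols $\mathbb{I}(a_0;a_1,\ldots,a_N;a_{N+1})$ ($N\ge 0$, $a_i\in\{0,1\}$) subject to: (I1) $\mathbb{I}(a;\emptyset;b)=1$; (I2) the product is the shuffle product: $\mathbb{I}(a_0;a_1,\ldots,a_N;a_{N+N'+1})\,\mathbb{I}(a_0;a_{N+1},\ldots,a_{N+N'};a_{N+N'+1})=\sum_{\sigma\in\Sigma(N,N')}\mathbb{I}(a_0;a_{\sigma^{-1}(1)},\ldots,a_{\sigma^{-1}(N+N')};a_{N+N'+1})$, $\Sigma(N,N')$ being the $\sigma\in\mathfrak{S}_{N+N'}$ with $\sigma(1)<\cdots<\sigma(N)$, $\sigma(N+1)<\cdots<\sigma(N+N')$; (I3) for $x\in\{0,1\}$, $\mathbb{I}(a_0;a_1,\ldots,a_N;a_{N+1})=\sum_{k=0}^N\mathbb{I}(a_0;a_1,\ldots,a_k;x)\mathbb{I}(x;a_{k+1},\ldots,a_N;a_{N+1})$; (I4) $\mathbb{I}(a;a_1,\ldots,a_N;a)=0$ for $N\ge1$. It is a commutative graded Hopf algebra with Goncharov coproduct $\Delta\,\mathbb{I}(a_0;a_1,\ldots,a_N;a_{N+1})=\sum_{k=0}^{N}\sum_{0=i_0<i_1<\cdots<i_k<i_{k+1}=N+1}\prod_{p=0}^k\mathbb{I}(a_{i_p};a_{i_p+1},\ldots,a_{i_{p+1}-1};a_{i_{p+1}})\otimes\mathbb{I}(a_0;a_{i_1},\ldots,a_{i_k};a_{N+1})$.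 Let $\mathcal{I}^1_\bullet=\mathcal{I}_\bullet/\mathbb{I}(0;0;1)\mathcal{I}_\bullet$ (a quotient Hopf algebra, $\mathbb{I}(0;0;1)$ being primitive), $I(\cdots)$ the images, $\Delta$ the induced coproduct. Put $I(n_1,\ldots,n_r)=I(0;1,0^{n_1-1},\ldots,1,0^{n_r-1};1)$ ($n_i\ge1$, $0^m$ = $m$ zeros), $I()=1$; these form a $\mathbb{Q}$-basis of $\mathcal{I}^1_\bullet$. Regularised MZVs. $\zeta(n_1,\ldots,n_r)=\sum_{0<m_1<\cdots<m_r}m_1^{-n_1}\cdots m_r^{-n_r}$ ($n_r\ge2$). In $\mathfrak{H}=\mathbb{Q}\langle\mathbf{0},\mathbf{1}\rangle$ with shuffle product, $\mathfrak{H}^1=\mathbb{Q}+\mathbf{1}\mathfrak{H}$, $\mathfrak{H}^0=\mathbb{Q}+\mathbf{1}\mathfrak{H}\mathbf{0}$, $\mathbf{n}=\mathbf{1}\mathbf{0}^{n-1}$; $Z:\mathfrak{H}^0\to\mathbb{R}$, $\mathbf{n}_1\cdots\mathbf{n}_r\mapsto\zeta(n_1,\ldots,n_r)$, is a shuffle-algebra homomorphism, and $Z^{\mathrm{sh}}:\mathfrak{H}^1\to\mathbb{R}[T]$ is the unique shuffle-algebra homomorphism extending $Z$ with $\mathbf{1}\mapsto T$. $\zeta^{\mathrm{sh}}(n_1,\ldots,n_r)$ is the constant term of $Z^{\mathrm{sh}}(\mathbf{n}_1\cdots\mathbf{n}_r)$; $\mathfrak{z}^{\mathrm{sh}}:\mathcal{I}^1_\bullet\to\mathbb{R}$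 is the $\mathbb{Q}$-linear map $I(n_1,\ldots,n_r)\mapsto\zeta^{\mathrm{sh}}(n_1,\ldots,n_r)$, $1\mapsto1$. The map $\mathfrak{g}^{\mathrm{sh}}$. For positive integers $n_i$ and variables $x_i$, let $H\binom{n_1,\ldots,n_r}{x_1,\ldots,x_r}=\sum_{0<u_1<\cdots<u_r}\prod_{j=1}^r e^{u_jx_j}\big(\frac{q^{u_j}}{1-q^{u_j}}\big)^{n_j}\in\mathbb{Q}[[q]][[x_1,\ldots,x_r]]$. Let $h(x_1,\ldots,x_r)=\sum_{(i_1,\ldots,i_m)}\frac{1}{i_1!\cdots i_m!}H\binom{i_1,\ldots,i_m}{y_1,\ldots,y_m}$, summed over all compositions $i_1+\cdots+i_m=r$ ($i_j\ge1$), where $y_1=x_1+\cdots+x_{i_1}$, $y_2=x_{i_1+1}+\cdots+x_{i_1+i_2}$, ..., $y_m=x_{i_1+\cdots+i_{m-1}+1}+\cdots+x_r$. Let $g_{\mathrm{sh}}(x_1,\ldots,x_r)=h(x_r-x_{r-1},\ldots,x_2-x_1,x_1)$ and let $g^{\mathrm{sh}}_{n_1,\ldots,n_r}(q)$ be the coefficient of $x_1^{n_1-1}\cdots x_r^{n_r-1}$ in $g_{\mathrm{sh}}(-2\pi\sqrt{-1}x_1,\ldots,-2\pi\sqrt{-1}x_r)$. Define $\mathfrak{g}^{\mathrm{sh}}:\mathcal{I}^1_\bullet\to\mathbb{C}[[q]]$ $\mathbb{Q}$-linearly by $I(n_1,\ldots,n_r)\mapsto g^{\mathrm{sh}}_{n_1,\ldots,n_r}(q)$,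 $1\mapsto 1$. Regularised multiple Eisenstein series: $G^{\mathrm{sh}}_{n_1,\ldots,n_r}(q)=(\mathfrak{z}^{\mathrm{sh}}\otimes\mathfrak{g}^{\mathrm{sh}})\circ\Delta(I(n_1,\ldots,n_r))$, where $(\mathfrak{z}^{\mathrm{sh}}\otimes\mathfrak{g}^{\mathrm{sh}})(a\otimes b)=\mathfrak{z}^{\mathrm{sh}}(a)\mathfrak{g}^{\mathrm{sh}}(b)$. Multiple Eisenstein series. For $\tau$ in the upper half-plane, $l\tau+m\succ0$ ($l,m\in\mathbb{Z}$) iff $l>0$, or $l=0$ and $m>0$; $\lambda\succ\lambda'$ iff $\lambda-\lambda'\succ0$. For $n_i\ge2$, $G_{n_1,\ldots,n_r}(\tau)=\lim_{L\to\infty}\lim_{M\to\infty}\sum\lambda_1^{-n_1}\cdots\lambda_r^{-n_r}$ over $0\prec\lambda_1\prec\cdots\prec\lambda_r$, $\lambda_i=l_i\tau+m_i$, $|l_i|\le L$, $|m_i|\le M$.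
   Formalization: The series g^sh_{n_1,...,n_r}(q) is taken as (-2πi)^r times the coefficient of x_1^{n_1-1}...x_r^{n_r-1} in g_sh(-2πi x_1,...,-2πi x_r); without the factor (-2πi)^r the identity already fails for r=1, n_1=2. *)

(* Defs.v *)
From HB Require Import structures.
From mathcomp Require Import all_boot all_order perm all_algebra.
From mathcomp Require Import finmap multinomials.monalg.
From mathcomp Require Import all_classical all_reals all_analysis.
From mathcomp Require Import complex.

Set Implicit Arguments.
Unset Strict Implicit.
Unset Printing Implicit Defensive.

Import Order.TTheory GRing.Theory Num.Theory.
Import numFieldNormedType.Exports.

Local Open Scope classical_set_scope.
Local Open Scope ring_scope.
Local Open Scope quotient_scope.

(* The A-linear combinations of elements of G: for A acting on itself this is *)
(* the ideal generated by G, for a vector space over A the subspace.          *)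
Definition lin_span (A : pzRingType) (V : lmodType A) (G : set V) : {pred V} :=
  fun x => `[< exists2 s : seq (A * V),
                 forall p, p \in s -> G p.2 & x = \sum_(p <- s) p.1 *: p.2 >].

Section LinSpan.
Variables (A : pzRingType) (V : lmodType A) (G : set V).

Lemma lin_span_gen x : G x -> x \in lin_span G.
Proof.
move=> Gx; apply/asboolP; exists [:: (1, x)]; last first.
  by rewrite big_seq1 scale1r.
by move=> p; rewrite inE => /eqP->.
Qed.

Lemma lin_span0 : 0 \in lin_span G.
Proof. by apply/asboolP; exists [::]; rewrite ?big_nil. Qed.

Lemma lin_spanP a x y :
  x \in lin_span G -> y \in lin_span G -> a *: x + y \in lin_span G.
Proof.
move=> /asboolP[s Gs ->] /asboolP[t Gt ->]; apply/asboolP.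
exists ([seq (a * p.1, p.2) | p <- s] ++ t) => [p|].
  by rewrite mem_cat => /orP[/mapP[p' /Gs ? ->]//|/Gt].
rewrite big_cat big_map /= scaler_sumr; congr (_ + _).
by apply: eq_bigr => p _; rewrite scalerA.
Qed.

Lemma lin_span_submod : submod_closed (lin_span G).
Proof. by split; [exact: lin_span0 | move=> a x y; exact: lin_spanP]. Qed.

End LinSpan.

Section IdealQuotAlgebra.
Variables (K : comNzRingType) (A : comAlgType K) (I : idealr A).
Local Notation Q := {ideal_quot I}.

Definition ideal_quot_scale (a : K) : Q -> Q := lift_op1 Q ( *:%R a).

Lemma pi_ideal_quot_scale a :
  {morph \pi_Q : x / a *: x >-> ideal_quot_scale a x}.
Proof.
move=> x; unlock ideal_quot_scale; apply/eqP; rewrite piE Quotient.equivE.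
by rewrite -scalerBr -mulr_algl idealMr // Quotient.idealrBE reprK.
Qed.
Canonical pi_ideal_quot_scale_morph a := PiMorph1 (pi_ideal_quot_scale a).

Fact ideal_quot_scaleA a b v :
  ideal_quot_scale a (ideal_quot_scale b v) = ideal_quot_scale (a * b) v.
Proof. by rewrite -[v]reprK !piE scalerA. Qed.

Fact ideal_quot_scale1 : left_id 1 ideal_quot_scale.
Proof. by move=> v; rewrite -[v]reprK !piE scale1r. Qed.

Fact ideal_quot_scaleDr : right_distributive ideal_quot_scale +%R.
Proof.
by move=> a u v; rewrite -[u]reprK -[v]reprK !piE scalerDr.
Qed.

Fact ideal_quot_scaleDl v : {morph ideal_quot_scale^~ v : a b / a + b}.
Proof. by move=> a b; rewrite -[v]reprK !piE scalerDl. Qed.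

HB.instance Definition _ := GRing.Zmodule_isLmodule.Build K Q
  ideal_quot_scaleA ideal_quot_scale1 ideal_quot_scaleDr ideal_quot_scaleDl.

Fact ideal_quot_scaleAl (a : K) (u v : Q) : a *: (u * v) = (a *: u) * v.
Proof.
have sE (w : Q) : a *: w = ideal_quot_scale a w by [].
by rewrite !sE -[u]reprK -[v]reprK !piE scalerAl.
Qed.

HB.instance Definition _ :=
  GRing.Lmodule_isLalgebra.Build K Q ideal_quot_scaleAl.
HB.instance Definition _ := GRing.Lalgebra_isComAlgebra.Build K Q.

End IdealQuotAlgebra.

Section IdealSpan.
Variables (A : comNzRingType) (G : set A).

Definition ideal_span : {pred A} := @lin_span A A^o G.

Lemma ideal_span_gen x : G x -> x \in ideal_span.
Proof. exact: (@lin_span_gen A A^o). Qed.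

(* A ring morphism to rat killing G witnesses that the ideal is proper, which *)
(* the quotient structures of the library require.                            *)
Lemma ideal_span_idealr (eps : {rmorphism A -> rat}) :
  (forall x, G x -> eps x = 0) ->
  idealr_closed ideal_span /\ {in ideal_span, forall x, eps x = 0}.
Proof.
move=> epsG; have eps0 : {in ideal_span, forall x, eps x = 0}.
  move=> x /asboolP[s Gs ->]; rewrite rmorph_sum big_seq big1 // => p /Gs Gp.
  by rewrite rmorphM [X in _ * X]epsG // mulr0.
split=> //; split; first exact: (@lin_span0 A A^o).
  by apply/negP => /eps0 /eqP; rewrite rmorph1 oner_eq0.
by move=> a x y Gx Gy; exact: (@lin_spanP A A^o).
Qed.

End IdealSpan.

Section IdealQuotLift.
Variables (A B : comNzRingType) (I : idealr A) (f : {rmorphism A -> B}).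
Hypothesis fI : {in I, forall x, f x = 0}.
Local Notation Q := {ideal_quot I}.

Definition ideal_quot_lift of {in I, forall x, f x = 0} :=
  fun x : Q => f (repr x).
Local Notation lift := (ideal_quot_lift fI).

Lemma ideal_quot_liftE x : lift (\pi_Q x) = f x.
Proof.
apply/eqP; rewrite -subr_eq0 -rmorphB fI //.
by rewrite Quotient.idealrBE reprK.
Qed.

Fact ideal_quot_lift_zmod : zmod_morphism lift.
Proof.
by move=> x y; rewrite -[x]reprK -[y]reprK -rmorphB !ideal_quot_liftE rmorphB.
Qed.

Fact ideal_quot_lift_monoid : monoid_morphism lift.
Proof.
split.
  by rewrite -(rmorph1 (\pi_Q : {rmorphism A -> Q})) ideal_quot_liftE rmorph1.
move=> x y; rewrite -[x]reprK -[y]reprK.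
by rewrite -rmorphM !ideal_quot_liftE rmorphM.
Qed.

HB.instance Definition _ :=
  GRing.isZmodMorphism.Build Q B lift ideal_quot_lift_zmod.
HB.instance Definition _ :=
  GRing.isMonoidMorphism.Build Q B lift ideal_quot_lift_monoid.

End IdealQuotLift.

Section Tensor.
Variables (K : comNzRingType) (U V : lmodType K).
Local Notation F := {malg K[(U * V)%type]}.

Variant bilin_rel : F -> Prop :=
| BilinAddl u u' v :
    bilin_rel (<< (u + u', v) >> - << (u, v) >> - << (u', v) >>)
| BilinAddr u v v' :
    bilin_rel (<< (u, v + v') >> - << (u, v) >> - << (u, v') >>)
| BilinScalel a u v : bilin_rel (<< (a *: u, v) >> - a *: << (u, v) >>)
| BilinScaler a u v : bilin_rel (<< (u, a *: v) >> - a *: << (u, v) >>).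

Definition bilin_span : {pred F} := lin_span (bilin_rel : set F).

HB.instance Definition _ :=
  GRing.isSubmodClosed.Build K F bilin_span (lin_span_submod bilin_rel).

Definition tensor := Quotient.quot bilin_span.
HB.instance Definition _ := GRing.Zmodule.on tensor.
HB.instance Definition _ : EqQuotient F (Quotient.equiv bilin_span) tensor :=
  EqQuotient.on tensor.

Definition tens (u : U) (v : V) : tensor := \pi_tensor << (u, v) >>.

Definition tensor_scale (a : K) (t : tensor) : tensor :=
  \pi_tensor (a *: repr t).

Lemma pi_tensor_scale a (x : F) :
  tensor_scale a (\pi_tensor x) = \pi_tensor (a *: x).
Proof.
apply/eqP; rewrite -[_ == _]Quotient.idealrBE -scalerBr.
by apply: rpredZ; rewrite Quotient.idealrBE reprK.
Qed.

Fact tensor_scaleA a b t :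
  tensor_scale a (tensor_scale b t) = tensor_scale (a * b) t.
Proof.
by rewrite -[t]reprK (pi_tensor_scale b) !pi_tensor_scale scalerA.
Qed.

Fact tensor_scale1 : left_id 1 tensor_scale.
Proof. by move=> t; rewrite -[t]reprK pi_tensor_scale scale1r. Qed.

Fact tensor_scaleDr : right_distributive tensor_scale +%R.
Proof.
move=> a s t; rewrite -[s]reprK -[t]reprK -raddfD !pi_tensor_scale.
by rewrite scalerDr raddfD.
Qed.

Fact tensor_scaleDl t : {morph tensor_scale^~ t : a b / a + b}.
Proof.
by move=> a b; rewrite -[t]reprK !pi_tensor_scale scalerDl raddfD.
Qed.

HB.instance Definition _ := GRing.Zmodule_isLmodule.Build K tensor
  tensor_scaleA tensor_scale1 tensor_scaleDr tensor_scaleDl.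

(* Independent of the chosen representative when b is bilinear, K acting on S *)
(* through phi: see tensor_lift_pi.                                           *)
Definition tensor_lift (S : comNzRingType) (phi : {rmorphism K -> S})
  (b : U -> V -> S) (t : tensor) : S := mmap phi (fun p => b p.1 p.2) (repr t).

Lemma tensor_lift_pi (S : comNzRingType) (phi : {rmorphism K -> S})
    (b : U -> V -> S) (x : F) :
    (forall v, linear_for (phi \; *%R) (b^~ v)) ->
    (forall u, linear_for (phi \; *%R) (b u)) ->
  tensor_lift phi b (\pi_tensor x) = mmap phi (fun p => b p.1 p.2) x.
Proof.
move=> bl br; set f := mmap phi _.
have fZ a y : f (a *: y) = phi a * f y.
  rewrite /f (mmapEw (msuppZ_le _ _)) mmapE mulr_sumr.
  by apply: eq_bigr => p _; rewrite mcoeffZ /= rmorphM mulrA.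
have fB y z : f (y - z) = f y - f z by exact: raddfB.
have fU p : f << p >> = b p.1 p.2 by rewrite /f mmapU /= rmorph1 mul1r.
have blD v u u' : b (u + u') v = b u v + b u' v.
  by have := bl v 1 u u'; rewrite /= scale1r rmorph1 mul1r.
have brD u v v' : b u (v + v') = b u v + b u v'.
  by have := br u 1 v v'; rewrite /= scale1r rmorph1 mul1r.
have b0 u : b u 0 = 0 by apply: (addIr (b u 0)); rewrite -brD !add0r.
have b0' v : b 0 v = 0 by apply: (addIr (b 0 v)); rewrite -blD !add0r.
suff f0 : {in bilin_span, forall y, f y = 0}.
  by apply/eqP; rewrite -subr_eq0 /tensor_lift -fB f0 //
    Quotient.idealrBE reprK.
have f00 : f 0 = 0 by rewrite -(subrr 0) fB subrr.
move=> y /asboolP[s Gs ->]; rewrite big_seq.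
apply: (big_ind (fun z => f z = 0)) => // [z z' fz fz'|p /Gs Gp].
  by rewrite -[z']opprK fB -sub0r fB f00 fz fz' !subr0.
rewrite fZ; case: Gp => [u u' v|u v v'|a u v|a u v].
- by rewrite !fB !fU /= blD -addrA -opprD subrr mulr0.
- by rewrite !fB !fU /= brD -addrA -opprD subrr mulr0.
- rewrite fB fZ !fU /=.
  by have /= := bl v a u 0; rewrite !addr0 b0' addr0 => ->; rewrite subrr mulr0.
- rewrite fB fZ !fU /=.
  by have /= := br u a v 0; rewrite !addr0 b0 addr0 => ->; rewrite subrr mulr0.
Qed.

End Tensor.

(* (a_0, [:: a_1; ...; a_N], a_N+1) stands for I(a_0; a_1, ..., a_N; a_N+1),  *)
(* the letters 0 and 1 being false and true.                                  *)
Definition symb := (bool * seq bool * bool)%type.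

Definition is_shuffle (m n : nat) (s : 'S_(m + n)) : bool :=
  [forall i : 'I_(m + n), forall j : 'I_(m + n),
     (i < j)%N && ((j < m)%N || (m <= i)%N) ==> (s i < s j)%N].

(* One word for each shuffle, hence with repetitions.                         *)
Definition shuffles (u v : seq bool) : seq (seq bool) :=
  let N := (size u + size v)%N in
  [seq [seq nth false (u ++ v) (((s^-1)%g : 'S_N) i) | i : 'I_N]
     | s : 'S_N in [pred s | is_shuffle s]].

Lemma size_shuffles u v w : w \in shuffles u v -> size w = (size u + size v)%N.
Proof. by move=> /mapP[s _ ->]; rewrite size_map -cardE card_ord. Qed.

Variant goncharov_rel (A : comNzRingType) (I : symb -> A) : A -> Prop :=
| RelUnit a b : goncharov_rel I (I (a, [::], b) - 1)
| RelShuffle a u v b : goncharov_rel I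
    (I (a, u, b) * I (a, v, b) - \sum_(w <- shuffles u v) I (a, w, b))
| RelPath a w b x : goncharov_rel I
    (I (a, w, b) -
     \sum_(k < (size w).+1) I (a, take k w, x) * I (x, drop k w, b))
| RelLoop a w : w != [::] -> goncharov_rel I (I (a, w, a)).

Lemma augmentation_rel (A : comNzRingType) (I : symb -> A)
    (eps : {rmorphism A -> rat}) :
  (forall s, eps (I s) = (s.1.2 == [::])%:R) ->
  forall x, goncharov_rel I x -> eps x = 0.
Proof.
move=> epsI _ [a b|a u v b|a w b y|a w w0].
- by rewrite rmorphB rmorph1 epsI subrr.
- rewrite rmorphB rmorphM rmorph_sum !epsI /= -natrM mulnb.
  under eq_bigr do rewrite epsI /=.
  have [/andP[/eqP-> /eqP->]|uv0] := boolP (_ && _).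
    rewrite big_map (eq_bigr (fun=> 1)) => [|s _]; last first.
      by rewrite -size_eq0 size_map -cardE card_ord.
    rewrite big_const_seq count_predT iter_addr_0 -cardE.
    rewrite (_ : #|_| = 1%N) ?subrr // -[RHS]/(0`!) -[RHS]card_Sn.
    by apply: eq_card => s; rewrite !inE; apply/forallP => -[].
  rewrite big_seq big1 ?subrr // => w /size_shuffles ws.
  by rewrite -size_eq0 ws addn_eq0 !size_eq0 (negPf uv0).
- rewrite rmorphB rmorph_sum epsI /=.
  under eq_bigr do rewrite rmorphM !epsI /= -natrM mulnb.
  case: w => [|c w]; first by rewrite big_ord1 /= subrr.
  by rewrite big1 ?subrr // => -[[|k] ?] _.
- by rewrite epsI (negPf w0).
Qed.

Definition free_symb : comAlgType rat := {malg rat[{cmonom symb}]}.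

Definition gen (s : symb) : free_symb :=
  (<< ucm s >> : {malg rat[{cmonom symb}]}).

Definition augm (m : {cmonom symb}) : rat :=
  (all (fun s : symb => s.1.2 == [::]) (finsupp m))%:R.

Fact augm_mmorphism : mmorphism augm.
Proof.
split=> [m1 m2|]; rewrite /augm /= ?mdom1 // mdomD -natrM mulnb.
congr (nat_of_bool _)%:R; apply/allP/andP => [h|[/allP h1 /allP h2] s].
  by split; apply/allP => s sm; apply: h; rewrite in_fsetU sm ?orbT.
by rewrite in_fsetU => /orP[/h1|/h2].
Qed.

HB.instance Definition _ :=
  isMultiplicative.Build {cmonom symb} rat augm augm_mmorphism.

Definition augmentation : {rmorphism free_symb -> rat} :=
  GRing.RMorphism.clone {malg rat[{cmonom symb}]} rat (mmap idfun augm) _.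

Lemma augmentationE s : augmentation (gen s) = (s.1.2 == [::])%:R.
Proof.
rewrite [LHS](@mmapU _ _ _ idfun augm) mul1r /augm mdomU.
congr (nat_of_bool _)%:R.
apply/allP/idP => [h|h t]; first by apply: h; rewrite in_fset1.
by rewrite in_fset1 => /eqP->.
Qed.

Definition goncharov_ideal : {pred free_symb} :=
  ideal_span (goncharov_rel gen : set free_symb).

HB.instance Definition _ := isIdealr.Build free_symb goncharov_ideal
  (ideal_span_idealr (augmentation_rel augmentationE)).1.

Definition calI : comAlgType rat := {ideal_quot goncharov_ideal}.

Definition II (s : symb) : calI := \pi_{ideal_quot goncharov_ideal} (gen s).

Definition augmentation_calI : {rmorphism calI -> rat} :=
  ideal_quot_lift (I := goncharov_ideal)
    (ideal_span_idealr (augmentation_rel augmentationE)).2.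

Lemma augmentation_calIE s : augmentation_calI (II s) = (s.1.2 == [::])%:R.
Proof. by rewrite [LHS]ideal_quot_liftE augmentationE. Qed.

Definition ideal_I001 : {pred calI} :=
  ideal_span [set II (false, [:: false], true)].

Lemma augmentation_I001 x :
  [set II (false, [:: false], true)] x -> augmentation_calI x = 0.
Proof. by move=> ->; rewrite augmentation_calIE. Qed.

HB.instance Definition _ := isIdealr.Build calI ideal_I001
  (ideal_span_idealr augmentation_I001).1.

Definition calI1 : comAlgType rat := {ideal_quot ideal_I001}.

Definition I1 (s : symb) : calI1 := \pi_{ideal_quot ideal_I001} (II s).

(* The word 1 0^(n_1 - 1) ... 1 0^(n_r - 1).                                  *)
Definition index_word (n : seq nat) : seq bool :=
  flatten [seq true :: nseq k.-1 false | k <- n].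

Definition I1_index (n : seq nat) : calI1 := I1 (false, index_word n, true).

(* The Goncharov coproduct of the symbol (a_0, w, a_(N+1)), in I^1 (x) I^1.   *)
(* The sets S = {i_1 < ... < i_k} range over the subsets of {1, ..., N},      *)
(* element i of 'I_N standing for i + 1.                                      *)
Section GoncharovFormula.
Variable s : symb.
Let w := s.1.2.
Let letters : seq bool := s.1.1 :: rcons w s.2.

Definition positions (S : {set 'I_(size w)}) : seq nat :=
  [seq (val i).+1 | i <- enum S].

Definition segment (i j : nat) : symb :=
  (nth false letters i, take (j - i.+1) (drop i.+1 letters),
   nth false letters j).

Definition left_factor (S : {set 'I_(size w)}) : calI1 :=
  let idx := 0%N :: rcons (positions S) (size w).+1 in
  \prod_(p < #|S|.+1) I1 (segment (nth 0%N idx p) (nth 0%N idx p.+1)).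

Definition right_factor (S : {set 'I_(size w)}) : calI1 :=
  I1 (s.1.1, [seq nth false letters i | i <- positions S], s.2).

Definition goncharov_formula : tensor calI1 calI1 :=
  \sum_(S : {set 'I_(size w)}) tens (left_factor S) (right_factor S).

End GoncharovFormula.

(* The symbols span I^1 over Q, so there is only one such map.                *)
Definition is_coproduct (D : calI1 -> tensor calI1 calI1) : Prop :=
  linear D /\ forall s, D (I1 s) = goncharov_formula s.

Definition coproduct : calI1 -> tensor calI1 calI1 :=
  xget (fun=> 0) is_coproduct.

Section MultipleZeta.
Variable R : realType.

Definition admissible (n : seq nat) : bool :=
  all (leq 1) n && (2 <= last 2 n)%N.

Definition mzeta (n : seq nat) : R :=
  fine (\esum_(m in [set m : seq nat | size m = size n /\ path ltn 0%N m])
          (\prod_(p <- zip m n) (p.1%:R ^- p.2))%:E).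

(* A Q-linear map on the span H^1 of the words that are empty or start with 1 *)
(* is given by its values on these words; other words are irrelevant. The     *)
(* words of H^0 are the index_word n, for n admissible.                       *)
Definition in_H1 (w : seq bool) : bool := head true w.

Definition is_Zsh (Z : seq bool -> {poly R}) : Prop :=
  [/\ Z [::] = 1,
      forall u v, in_H1 u -> in_H1 v ->
        Z u * Z v = \sum_(w <- shuffles u v) Z w,
      forall n, admissible n -> Z (index_word n) = (mzeta n)%:P &
      Z [:: true] = 'X].

Definition Zsh : seq bool -> {poly R} := xget (fun=> 0) is_Zsh.

Definition zeta_sh (n : seq nat) : R := (Zsh (index_word n)).[0].

(* The I(n_1, ..., n_r), n_i >= 1, form a basis of I^1 over Q.                *)
Definition is_zsh (z : calI1 -> R) : Prop :=
  linear_for (ratr \; *%R) z /\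
  forall n, all (leq 1) n -> z (I1_index n) = zeta_sh n.

Definition zsh : calI1 -> R := xget (fun=> 0) is_zsh.

End MultipleZeta.

Definition Cplx (R : realType) : numClosedFieldType := R[i].

(* A power series in q is given by its sequence of coefficients.              *)
Definition qseries (R : realType) := nat -> Cplx R.

Section QSeries.
Variable R : realType.
Local Notation C := (Cplx R).

Definition two_pi_i : C := (0 +i* (2 * pi))%C.

Definition cst (c : C) : {poly C} := c%:P.

(* The coefficient of q^N x^k in a power series in q and x_1, ..., x_r is     *)
(* computed in C[q][x_1, ..., x_r]: q^u / (1 - q^u) = sum_(v >= 1) q^(u v) is *)
(* truncated after v = N, and exp y after its term of degree D in y, where D  *)
(* is the total degree of x^k and all the arguments y of exponentials are     *)
(* linear forms. The omitted terms are divisible by q^(N+1), or of total      *)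
(* degree > D in x_1, ..., x_r.                                               *)
Section Truncated.
Variables (N D r : nat).
Local Notation P := {malg {poly C}['X_{1..r}]}.

Definition qfrac (u : nat) : {poly C} := \sum_(1 <= v < N.+1) 'X^(u * v).

Definition expx (y : P) : P := \sum_(d < D.+1) cst (d`!%:R^-1) *: y ^+ d.

(* The terms with u_r > N are divisible by q^(N+1).                           *)
Definition Hser (n : seq nat) (y : seq P) : P :=
  \sum_(u : (size n).-tuple 'I_N.+1 | path ltn 0%N [seq val i | i <- u])
    \prod_(j < size n)
      (qfrac (tnth u j) ^+ nth 0%N n j *: expx (nth 0 y j *+ tnth u j)).

Definition hser (x : seq P) : P :=
  \sum_(m < (size x).+1)
    \sum_(i : m.-tuple 'I_(size x).+1 |
            all (leq 1) [seq val j | j <- i] &&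
            (sumn [seq val j | j <- i] == size x))
      cst ((\prod_(j <- i) (val j)`!)%N%:R^-1) *:
      Hser [seq val j | j <- i]
           [seq \sum_(z <- b) z | b <- reshape [seq val j | j <- i] x].

(* h(x_r - x_(r-1), ..., x_2 - x_1, x_1)                                      *)
Definition gser (x : seq P) : P :=
  hser (rev (pairmap (fun a b => b - a) 0 x)).

Definition scaled_vars : seq P :=
  [seq cst (- two_pi_i) *: << ucm i >> | i : 'I_r].

End Truncated.

Definition index_monom (n : seq nat) : 'X_{1..size n} :=
  \big[mmul/mone]_(i < size n) expcmn (ucm i) (nth 0%N n i).-1.

(* Normalised by (- 2 pi i)^r, as the Fourier expansion                       *)
(* G_n = zeta(n) + (- 2 pi i)^n / (n-1)! sum_(u, v >= 1) u^(n-1) q^(u v) of   *)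
(* the Eisenstein series requires.                                            *)
Definition gsh_index (n : seq nat) : qseries R := fun k =>
  (- two_pi_i) ^+ size n *
  (mcoeff (index_monom n)
     (gser k (sumn [seq j.-1 | j <- n]) (scaled_vars (size n))))`_k.

Definition is_gsh (g : calI1 -> qseries R) : Prop :=
  (forall k, linear_for (ratr \; *%R) (fun x => g x k)) /\
  forall n, all (leq 1) n -> g (I1_index n) = gsh_index n.

Definition gsh : calI1 -> qseries R := xget (fun _ _ => 0) is_gsh.

(* Coefficientwise, (z (x) g) (a (x) b) = z(a) g(b).                          *)
Definition Gsh (n : seq nat) : qseries R := fun k =>
  tensor_lift (ratr : {rmorphism rat -> C})
    (fun a b => ((zsh R a)%:C)%C * gsh b k) (coproduct (I1_index n)).

End QSeries.

Section MultipleEisenstein.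
Variable R : realType.
Local Notation C := (Cplx R).

(* (l, m) stands for l tau + m.                                               *)
Definition lattice_pos (p : int * int) : bool :=
  (0 < p.1) || (p.1 == 0) && (0 < p.2).

Definition lattice_lt (p p' : int * int) : bool :=
  lattice_pos (p'.1 - p.1, p'.2 - p.2).

Definition lattice_pt (tau : C) (p : int * int) : C := p.1%:~R * tau + p.2%:~R.

(* An element of {-L, ..., L} x {-M, ..., M}.                                 *)
Definition box_pt (L M : nat) (p : 'I_(L.*2.+1) * 'I_(M.*2.+1)) : int * int :=
  ((p.1 : nat)%:Z - L%:Z, (p.2 : nat)%:Z - M%:Z).

Definition eisenstein_sum (n : seq nat) (tau : C) (L M : nat) : C :=
  \sum_(a : (size n).-tuple ('I_(L.*2.+1) * 'I_(M.*2.+1)) |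
          path lattice_lt (0, 0) [seq box_pt p | p <- a])
    \prod_(j < size n) lattice_pt tau (box_pt (tnth a j)) ^- nth 0%N n j.

Definition eisenstein_inner (n : seq nat) (tau : C) (L : nat) : C :=
  lim (eisenstein_sum n tau L M @[M --> \oo]).

Definition multiple_eisenstein (n : seq nat) (tau : C) : C :=
  lim (eisenstein_inner n tau L @[L --> \oo]).

Definition cexp (z : C) : C :=
  (expR (complex.Re z) * cos (complex.Im z) +i*
   (expR (complex.Re z) * sin (complex.Im z)))%C.

Definition nome (tau : C) : C := cexp (two_pi_i R * tau).

End MultipleEisenstein.

(* Main.v *)
Require Import Defs.
From HB Require Import structures.
From mathcomp Require Import all_boot all_order perm all_algebra.
From mathcomp Require Import finmap multinomials.monalg.
From mathcomp Require Import all_classical all_reals all_analysis.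
From mathcomp Require Import complex.
From mathcomp Require Import zify ring lra.

Set Implicit Arguments.
Unset Strict Implicit.
Unset Printing Implicit Defensive.

Import Order.TTheory GRing.Theory Num.Theory.
Import numFieldNormedType.Exports.

Local Open Scope classical_set_scope.
Local Open Scope ring_scope.
Local Open Scope quotient_scope.

(* Both sides are sums over the ways of cutting (n_1, ..., n_r) into consecutive
   blocks.  On the analytic side the points of the chain lying on one row
   u tau + Z, u > 0, form a block and contribute a multitangent function, the sum
   over m_1 < ... < m_s of the product of the (u tau + m_i)^(-n_i); the row u = 0
   contributes a multiple zeta value.  Partial fractions turn a multitangent into
   a combination of monotangents, the coefficients being finite sums which
   converge to products of regularised multiple zeta values; the coefficient of
   the monotangent of order one is such a value of I(1; ...; 1) expanded by path
   composition, hence is zero.  The Lipschitz formula evaluates the monotangents as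
   q-series.  On the algebraic side the Goncharov coproduct keeps some letters of
   the word of I(n_1, ..., n_r); the segments between equal letters vanish, and
   the surviving ones regroup, block by block, into the very same products of
   regularised zeta values.  So both sides are one linear operator applied to two
   functions of k_1, ..., k_s >= 2: a sum of products of monotangents over rows
   u_1 < ... < u_s, and g^sh.  These agree because the exponentials in the
   generating series of g^sh resum to the sum over u_i, d_i of the
   d_i^(k_i - 1) q^(u_i d_i).

   The regularised maps are unique and exist because the I(n_1, ..., n_r) form a
   basis: a word is brought to this form by exp(-x_b d/dx_b), the projection of the
   shuffle algebra onto the kernel of the derivation removing a first letter b. *)

(** * Shuffles and the shuffle algebra *)

(** The delicate case is the monotangent of order one. Its symmetric sums converge only
    conditionally, and their limit is the value of the Lipschitz formula plus a constant [- pi i],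
    so its coefficient has to vanish. Before the limit the coefficients depend on the point of the
    row and must be replaced by their limits under a sum of [1 / |w + m|], which has logarithmic
    size. Convergence alone would not do: truncated zeta values are given a rate [O(1/K)], small in
    the middle of the row, while [1 / |w + m|] is small at its ends. As all exponents are at least
    2, no divergent series arises on the analytic side: regularised values enter through words
    [0^c 1 ...], for which the relation [I(0;0;1) = 0] is the rule for differentiating sums of
    products of the [(m_i + X) ^- n_i]. The same condition kills all compositions but [(1, ..., 1)]
    in [h]. The Lipschitz formula is proved without complex analysis: a distribution relation over
    roots of unity transfers the pole at 1 of a polylogarithm of negative order to the sum over a
    row. *)

Section RecursiveShuffle.
Variable T : Type.
Implicit Types (u v w : seq T) (a b : T).

(** Either word may lose its first letter, hence the inner fixpoint. This form replaces permutations
    everywhere; [sum_shuffles] links the two. *)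
Fixpoint sh u : seq T -> seq (seq T) :=
  fix sh_u v : seq (seq T) :=
    match u, v with
    | [::], _ => [:: v]
    | _, [::] => [:: u]
    | a :: u', b :: v' => map (cons a) (sh u' v) ++ map (cons b) (sh_u v')
    end.
Arguments sh : simpl never.

Lemma sh0s v : sh [::] v = [:: v]. Proof. by case: v. Qed.

Lemma shs0 u : sh u [::] = [:: u]. Proof. by case: u. Qed.

Lemma sh_cons a u b v : sh (a :: u) (b :: v) =
  map (cons a) (sh u (b :: v)) ++ map (cons b) (sh (a :: u) v).
Proof. by []. Qed.

Variable V : zmodType.
Implicit Type phi : seq T -> V.

Lemma sum_sh_cons phi a u b v :
  \sum_(w <- sh (a :: u) (b :: v)) phi w =
  \sum_(w <- sh u (b :: v)) phi (a :: w) +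
  \sum_(w <- sh (a :: u) v) phi (b :: w).
Proof. by rewrite sh_cons big_cat !big_map. Qed.

Lemma sum_shC phi u v : \sum_(w <- sh u v) phi w = \sum_(w <- sh v u) phi w.
Proof.
elim: u v phi => [|a u IHu] v phi; first by rewrite sh0s shs0.
elim: v phi => [|b v IHv] phi; first by rewrite sh0s shs0.
by rewrite !sum_sh_cons IHu IHv addrC.
Qed.

(** A shuffle can be split by its last letter as well as by its first; reversal of words is then
    compatible with shuffling. *)
Lemma sum_sh_rcons phi a u b v :
  \sum_(w <- sh (rcons u a) (rcons v b)) phi w =
  \sum_(w <- sh u (rcons v b)) phi (rcons w a) +
  \sum_(w <- sh (rcons u a) v) phi (rcons w b).
Proof.
elim: u v phi => [|c u IHu]; elim=> [|d v IHv] phi.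
- by rewrite /= !big_cons !big_nil !addr0 addrC.
- rewrite [rcons [::] a]/= [rcons (d :: v) b]/=.
  rewrite sum_sh_cons (IHv (fun w => phi (d :: w))) sum_sh_cons.
  by rewrite !sh0s !big_seq1 /= addrCA.
- rewrite [rcons [::] b]/= [rcons (c :: u) a]/=.
  rewrite sum_sh_cons (IHu [::] (fun w => phi (c :: w))) sum_sh_cons.
  by rewrite !shs0 !big_seq1 /= -!addrA; congr (_ + _); rewrite addrC.
- rewrite [rcons (d :: v) b]/= [rcons (c :: u) a]/=.
  rewrite sum_sh_cons (IHu (d :: v) (fun w => phi (c :: w))).
  rewrite (IHv (fun w => phi (d :: w))) !sum_sh_cons /= addrACA.
  by congr (_ + _); rewrite sum_sh_cons.
Qed.

Lemma sum_sh_rev phi u v :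
  \sum_(w <- sh (rev u) (rev v)) phi w = \sum_(w <- sh u v) phi (rev w).
Proof.
elim: u v phi => [|a u IHu] v phi; first by rewrite !sh0s !big_seq1.
elim: v phi => [|b v IHv] phi; first by rewrite !shs0 !big_seq1.
rewrite !rev_cons sum_sh_rcons sum_sh_cons -!rev_cons.
rewrite (IHu _ (fun w => phi (rcons w a))) (IHv (fun w => phi (rcons w b))).
by congr (_ + _); apply: eq_bigr => w _; rewrite rev_cons.
Qed.

End RecursiveShuffle.

Arguments sh : simpl never.

Lemma sh_map (T U : Type) (f : T -> U) u v :
  sh (map f u) (map f v) = map (map f) (sh u v).
Proof.
elim: u v => [|a u IHu] v; first by rewrite !sh0s.
elim: v => [|b v IHv]; first by rewrite !shs0.
rewrite !map_cons !sh_cons -map_cons IHu -map_cons IHv map_cat -!map_comp.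
by congr (_ ++ _); apply: eq_map.
Qed.

Lemma size_sh (T : eqType) (u v w : seq T) :
  w \in sh u v -> size w = (size u + size v)%N.
Proof.
elim: u v w => [|a u IHu] v w; first by rewrite sh0s inE => /eqP->.
elim: v w => [|b v IHv] w; first by rewrite shs0 inE addn0 => /eqP->.
rewrite sh_cons mem_cat => /orP[] /mapP[w' w'P ->] /=.
  by rewrite (IHu _ _ w'P).
by rewrite (IHv _ w'P) addnS.
Qed.

Section ShuffleFilter.
Variables (T : eqType) (P : pred T).

(** As [P] tells the letters of [a] from those of [b], a shuffle remembers which letter came from
    which word, and its two subwords characterise it. *)
Lemma mem_sh_filter a b w : all P a -> all (predC P) b ->
  (w \in sh a b) = (seq.filter P w == a) && (seq.filter (predC P) w == b).
Proof.
elim: a b w => [|x a IHa] b w Pa Pb.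
  rewrite sh0s inE; apply/eqP/andP => [->|[/eqP h /eqP <-]].
    split; last by rewrite (all_filterP Pb).
    by rewrite -(filter_pred0 b) (eq_in_filter (a2 := pred0)) // => z /(allP Pb)/negPf.
  by apply/esym/all_filterP; rewrite all_predC has_filter h.
case/andP: (Pa) => Px Pa'.
elim: b w Pb => [|y b IHb] w Pb.
  rewrite shs0 inE; apply/eqP/andP => [->|[/eqP <- /eqP h]].
    split; first by rewrite (all_filterP Pa).
    by rewrite -(filter_pred0 (x :: a)) (eq_in_filter (a2 := pred0)) // => z /(allP Pa) /= ->.
  apply/esym/all_filterP; apply/negPn; rewrite -has_predC has_filter.
  by rewrite h.
case/andP: (Pb) => /= Py Pb'.
rewrite sh_cons mem_cat; case: w => [|z w].
  by rewrite andFb; apply/negP => /orP[] /mapP[].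
have mz c s : (z :: w \in map (cons c) s) = (z == c) && (w \in s).
  by apply/mapP/andP => [[w' w's [-> ->]]|[/eqP-> ws]]; [|exists w].
rewrite !mz IHa // IHb //=; case: (boolP (P z)) => Pz /=.
  rewrite !eqseq_cons; case: eqP => [zx|_] //=; last first.
    by case: eqP => // zy; rewrite -zy Pz in Py.
  case: (z =P y) => [zy|_]; first by rewrite -zy Pz in Py.
  by rewrite orbF.
rewrite !eqseq_cons; case: (z =P x) => [zx|_]; first by rewrite zx Px in Pz.
by rewrite /= andbCA.
Qed.

Lemma uniq_sh a b : all P a -> all (predC P) b -> uniq (sh a b).
Proof.
elim: a b => [|x a IHa] b Pa Pb; first by rewrite sh0s.
case/andP: (Pa) => Px Pa'.
elim: b Pb => [|y b IHb] Pb; first by rewrite shs0.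
case/andP: (Pb) => /= Py Pb'.
rewrite sh_cons cat_uniq !map_inj_uniq ?IHa ?IHb //; try by move=> ? ? [].
rewrite andbT; apply/hasPn => _ /mapP[w _ ->]; apply/negP => /mapP[w' _ [yx _]].
by rewrite yx Px in Py.
Qed.

End ShuffleFilter.

Section ShufflePerm.
Variables m n : nat.
Local Notation N := (m + n)%N.

(** Positions are shuffled instead of letters: being distinct, they turn an equality of lists with
    repetitions into an equality of sets. *)
Definition perm_word (s : 'S_N) : seq nat := [seq val ((s^-1)%g i) | i : 'I_N].

Lemma size_perm_word s : size (perm_word s) = N.
Proof. by rewrite size_map -cardE card_ord. Qed.

Lemma nth_perm_word s (i : 'I_N) : nth 0%N (perm_word s) i = (s^-1)%g i.
Proof.
rewrite (nth_map i) ?size_enum_ord //; congr (nat_of_ord ((s^-1)%g _)).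
by apply: val_inj; rewrite /= nth_enum_ord.
Qed.

Lemma perm_word_inj : injective perm_word.
Proof.
move=> s t st; apply: invg_inj; apply/permP => i; apply: val_inj => /=.
by rewrite -!nth_perm_word st.
Qed.

Lemma mem_perm_word s x : (x \in perm_word s) = (x < N)%N.
Proof.
apply/mapP/idP => [[i _ ->]|xN]; first exact: ltn_ord.
by exists (s (Ordinal xN)); rewrite ?mem_enum // permK.
Qed.

(** The condition on [Q] says that it selects positions on which a shuffle permutation is
    increasing, such as those of one of the two words. *)
Lemma perm_word_sorted s (Q : pred nat) : is_shuffle s ->
    (forall i j, Q i -> Q j -> (i < j)%N -> (j < m)%N || (m <= i)%N) ->
  sorted ltn (seq.filter Q (perm_word s)).
Proof.
move=> /forallP sP QP; rewrite filter_map.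
set r := seq.filter _ _; have rQ : all (fun i => Q ((s^-1)%g i)) r.
  exact: filter_all.
apply: (homo_sorted_in (P := fun i => Q ((s^-1)%g i)) (e := relpre val ltn)) => //.
  move=> i j; rewrite /in_mem /= => Qi Qj ij.
  rewrite ltnNge leq_eqVlt; apply/negP => /orP[/eqP/val_inj/perm_inj ji|ji].
    by rewrite ji ltnn in ij.
  have /forallP/(_ ((s^-1)%g i))/implyP := sP ((s^-1)%g j).
  by rewrite !permKV ji (QP _ _ Qj Qi ji) => /(_ isT) /(ltn_trans ij); rewrite ltnn.
apply: sorted_filter => [? ? ?|]; first exact: ltn_trans.
by rewrite -sorted_map val_enum_ord iota_ltn_sorted.
Qed.

Lemma perm_word_sh s : is_shuffle s -> perm_word s \in sh (iota 0 m) (iota m n).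
Proof.
move=> sP; rewrite (@mem_sh_filter _ (fun x => x < m)%N); first last.
- by apply/allP => x; rewrite mem_iota /= -leqNgt => /andP[].
- by apply/allP => x; rewrite mem_iota.
have eqF Q a : sorted ltn (seq.filter Q (perm_word s)) -> sorted ltn a ->
    seq.filter Q (perm_word s) =i a -> seq.filter Q (perm_word s) == a.
  move=> h1 h2 h3; apply/eqP.
  by apply: (irr_sorted_eq ltn_trans ltnn).
apply/andP; split; apply: eqF; rewrite ?iota_ltn_sorted //.
- by apply: perm_word_sorted => // i j _ ->.
- by move=> x; rewrite mem_filter mem_perm_word mem_iota /=; lia.
- by apply: perm_word_sorted => // i j; rewrite /= -leqNgt => -> _ _; rewrite orbT.
- by move=> x; rewrite mem_filter mem_perm_word mem_iota /=; lia.
Qed.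

Lemma sh_perm_word w : w \in sh (iota 0 m) (iota m n) ->
  exists2 s : 'S_N, is_shuffle s & w = perm_word s.
Proof.
rewrite (@mem_sh_filter _ (fun x => x < m)%N); first last.
- by apply/allP => x; rewrite mem_iota /= -leqNgt => /andP[].
- by apply/allP => x; rewrite mem_iota.
move=> /andP[/eqP wl /eqP wr].
have wperm : perm_eq w (iota 0 N).
  rewrite -(perm_filterC (fun x => x < m)%N w) wl wr.
  by rewrite -iotaD.
have ws : size w = N by rewrite (perm_size wperm) size_iota.
have wN (i : 'I_N) : (nth 0%N w i < N)%N.
  have : nth 0%N w i \in w by rewrite mem_nth // ws.
  by rewrite (perm_mem wperm) mem_iota.
have f_inj : injective (fun i => Ordinal (wN i)).
  move=> i j [] /eqP; rewrite nth_uniq ?ws ?(perm_uniq wperm) ?iota_uniq //.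
  by move=> /eqP/val_inj.
exists (perm f_inj)^-1%g; last first.
  apply: (@eq_from_nth _ 0%N) => [|i]; rewrite ?size_perm_word // ws => iN.
  have /= -> := nth_perm_word (perm f_inj)^-1 (Ordinal iN).
  by rewrite invgK permE.
(* The letters of [w] satisfying [Q] read [iota c k], so of two such letters the smaller comes first
   in [w]. *)
have before (Q : pred nat) c k x y : seq.filter Q w = iota c k -> Q x -> Q y ->
    x \in w -> y \in w -> (x < y)%N -> (index x w < index y w)%N.
  move=> wQ Qx Qy xw yw xy; rewrite ltnNge leq_eqVlt.
  apply/negP => /orP[/eqP/(congr1 (nth 0%N w))|yx].
    by rewrite !nth_index // => yx; rewrite yx ltnn in xy.
  have xw2 : x \in drop (index y w).+1 w.
    rewrite -(nth_index 0%N xw) -(subnKC yx) -nth_drop mem_nth // size_drop.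
    by rewrite ltn_sub2r // ?(leq_ltn_trans yx) ?index_mem.
  have := iota_ltn_sorted c k; rewrite -wQ -(cat_take_drop (index y w) w).
  rewrite (drop_nth 0%N) ?index_mem // nth_index // filter_cat /= Qy.
  move=> /cat_sorted2[_] /= /(order_path_min ltn_trans)/allP/(_ x).
  by rewrite mem_filter Qx xw2 => /(_ isT)/(ltn_trans xy); rewrite ltnn.
have wmem (i : 'I_N) : val i \in w by rewrite (perm_mem wperm) mem_iota /=.
have invE (i : 'I_N) : val ((perm f_inj)^-1%g i) = index (val i) w.
  have idx_lt : (index (val i) w < N)%N by have := wmem i; rewrite -index_mem ws.
  apply: (congr1 val (y := Ordinal idx_lt)); apply: (@perm_inj _ (perm f_inj)).
  rewrite permKV permE; apply: val_inj; rewrite /= nth_index //; exact: wmem.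
apply/forallP => i; apply/forallP => j; apply/implyP => /andP[ij ijm].
rewrite !invE; have [jm|mi] := orP ijm.
  by apply: (before _ _ _ _ _ wl); rewrite ?wmem // (ltn_trans ij).
apply: (before _ _ _ _ _ wr); rewrite ?wmem //= -leqNgt //.
exact: leq_trans mi (ltnW ij).
Qed.

End ShufflePerm.

(** Both lists are images, under the map from positions to letters, of duplicate-free lists of words
    of positions, and these have the same elements. *)
Lemma sum_shuffles (V : zmodType) (phi : seq bool -> V) u v :
  \sum_(w <- shuffles u v) phi w = \sum_(w <- sh u v) phi w.
Proof.
set N := (size u + size v)%N.
have -> : sh u v = [seq map (nth false (u ++ v)) w |
    w <- sh (iota 0 (size u)) (iota (size u) (size v))].
  rewrite -sh_map; congr sh; apply: (@eq_from_nth _ false);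
    rewrite ?size_map ?size_iota // => i iN.
    by rewrite (nth_map 0%N) ?size_iota // nth_iota // nth_cat iN.
  rewrite (nth_map 0%N) ?size_iota // nth_iota // nth_cat addKn.
  by rewrite ltnNge leq_addr.
have -> : shuffles u v = [seq map (nth false (u ++ v)) w |
    w <- [seq perm_word s | s <- enum [pred s : 'S_N | is_shuffle s]]].
  by rewrite -map_comp; apply: eq_map => s /=; rewrite /perm_word -map_comp.
apply/perm_big/perm_map/uniq_perm.
- by rewrite map_inj_uniq ?enum_uniq //; exact: perm_word_inj.
- apply: (@uniq_sh _ (fun x => x < size u)%N).
    by apply/allP => x; rewrite mem_iota.
  by apply/allP => x; rewrite mem_iota /= -leqNgt => /andP[].
- move=> w; apply/mapP/idP => [[s]|/sh_perm_word[s sP ->]].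
    by rewrite mem_enum => sP ->; exact: perm_word_sh.
  by exists s; rewrite ?mem_enum.
Qed.

Section LinearExtension.
Variable K : choiceType.

Lemma malg_lin_ind (R : nzRingType) (P : {malg R[K]} -> Prop) :
    P 0 -> (forall k, P << k >>) ->
    (forall a x y, P x -> P y -> P (a *: x + y)) ->
  forall x, P x.
Proof.
move=> P0 PU PD x; rewrite [x]monalgE.
elim/big_ind: _ => // [y z Py Pz|k _].
  by rewrite -[y]scale1r; apply: PD.
have -> : << x@_k *g k >> = x@_k *: << k >> + 0 :> {malg R[K]}.
  by rewrite addr0; apply/malgP => j; rewrite mcoeffZ !mcoeffU mulrnAr mulr1.
exact: PD.
Qed.

Variables (R : nzRingType) (V : lmodType R).

Definition lext (h : K -> V) (x : {malg R[K]}) : V :=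
  \sum_(k <- msupp x) x@_k *: h k.

Lemma lextEw (d : {fset K}) h x : (msupp x `<=` d)%fset ->
  lext h x = \sum_(k <- d) x@_k *: h k.
Proof.
move=> le; rewrite /lext (big_fset_incl _ le) // => k _ kx.
by rewrite mcoeff_outdom // scale0r.
Qed.

Fact lext_is_linear h : linear (lext h).
Proof.
move=> a x y; rewrite (lextEw (d := (msupp x `|` msupp y)%fset)); last first.
  apply: fsubset_trans (msuppD_le _ _) _; apply: fsetSU.
  exact: msuppZ_le.
rewrite (lextEw h (fsubsetUl (msupp x) (msupp y))).
rewrite (lextEw h (fsubsetUr (msupp x) (msupp y))).
rewrite scaler_sumr -big_split; apply: eq_bigr => k _.
by rewrite mcoeffD mcoeffZ scalerDl scalerA.
Qed.

HB.instance Definition _ h :=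
  GRing.isLinear.Build R {malg R[K]} V *:%R (lext h) (lext_is_linear h).

Lemma lextU h k : lext h << k >> = h k.
Proof. by rewrite /lext msuppU oner_eq0 big_seq_fset1 mcoeffUU scale1r. Qed.

End LinearExtension.

Definition sha_def := {malg rat[seq bool]}.
HB.instance Definition _ := GRing.Lmodule.on sha_def.

Definition wd_def (w : seq bool) : sha_def := << w >>.

Lemma sha_def_ind (P : sha_def -> Prop) :
    P 0 -> (forall w, P (wd_def w)) ->
    (forall a x y, P x -> P y -> P (a *: x + y)) ->
  forall x, P x.
Proof. exact: malg_lin_ind. Qed.

Section sha_defRing.
Implicit Types (u v w t : seq bool) (x y z : sha_def).

Definition shp u v : sha_def := \sum_(w <- sh u v) wd_def w.

Definition sha_mul x y : sha_def :=
  lext (fun u => lext (shp u) y : sha_def) x.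

(** Both sides run over the shuffles of three words; the induction sorts them by the word that
    supplies the first letter. *)
Lemma sum_shA (V : zmodType) (phi : seq bool -> V) u v t :
  \sum_(w <- sh u v) \sum_(z <- sh w t) phi z =
  \sum_(w <- sh v t) \sum_(z <- sh u w) phi z.
Proof.
elim: u v t phi => [|a u IHu] v t phi.
  rewrite sh0s big_seq1; apply: eq_bigr => w _.
  by rewrite sh0s big_seq1.
elim: v t phi => [|b v IHv] t phi; first by rewrite shs0 sh0s !big_seq1.
elim: t phi => [|c t IHt] phi.
  rewrite shs0 big_seq1; apply: eq_bigr => w _.
  by rewrite shs0 big_seq1.
rewrite sum_sh_cons [RHS]sum_sh_cons.
under eq_bigr do rewrite sum_sh_cons.
under [X in _ + X]eq_bigr do rewrite sum_sh_cons.
under [X in _ = X + _]eq_bigr do rewrite sum_sh_cons.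
under [X in _ = _ + X]eq_bigr do rewrite sum_sh_cons.
rewrite !big_split /= IHu IHv.
rewrite [X in X + _ + _]sum_sh_cons.
(* On the left the shuffles starting with [c] are spread over two groups, according to the first
   letter, [a] or [b], of the word into which [c :: t] is shuffled. *)
have := IHt (fun z : seq bool => phi (c :: z)); rewrite sum_sh_cons => E.
rewrite -E -!addrA; congr (_ + _); rewrite [in RHS]addrCA; congr (_ + _).
by rewrite addrCA.
Qed.

Fact sha_mull_linear y : linear (sha_mul^~ y).
Proof. by move=> a x x'; rewrite /sha_mul linearP. Qed.

Fact sha_mulr_linear x : linear (sha_mul x).
Proof.
move=> a y y'.
have E z : sha_mul x z = \sum_(k <- msupp x) x@_k *: (lext (shp k) z : sha_def) by [].
rewrite !E scaler_sumr -big_split; apply: eq_bigr => k _.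
by rewrite linearP scalerDr !scalerA mulrC.
Qed.

Lemma sha_mulU u v : sha_mul (wd_def u) (wd_def v) = shp u v.
Proof. by rewrite /sha_mul !lextU. Qed.

Fact sha_mul0 x : sha_mul x 0 = 0.
Proof.
have := sha_mulr_linear x 1 0 0; rewrite !scale1r addr0 => h.
by apply: (addrI (sha_mul x 0)); rewrite -h addr0.
Qed.

Fact sha_mul0l y : sha_mul 0 y = 0.
Proof. by rewrite /sha_mul linear0. Qed.

Fact sha_mulC : commutative sha_mul.
Proof.
move=> x y; elim/sha_def_ind: x => [|u|a x x' IH IH'].
- by rewrite sha_mul0 sha_mul0l.
- elim/sha_def_ind: y => [|v|a y y' IH IH'].
  + by rewrite sha_mul0 sha_mul0l.
  + by rewrite !sha_mulU /shp sum_shC.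
  + by rewrite sha_mulr_linear sha_mull_linear IH IH'.
- by rewrite sha_mulr_linear sha_mull_linear IH IH'.
Qed.

Fact sha_mulA : associative sha_mul.
Proof.
move=> x y z; elim/sha_def_ind: x => [|u|a x x' IH IH'].
- by rewrite !sha_mul0l.
- elim/sha_def_ind: y => [|v|a y y' IH IH'].
  + by rewrite !(sha_mul0l, sha_mul0).
  + elim/sha_def_ind: z => [|t|a y y' IH IH'].
    * by rewrite !sha_mul0.
    * rewrite !sha_mulU /shp.
      have lin_sum f (r : seq (seq bool)) : linear f ->
          f (\sum_(w <- r) wd_def w) = \sum_(w <- r) f (wd_def w) :> sha_def.
        move=> fl; elim: r => [|w r IHr].
          rewrite !big_nil; have := fl 1 0 0; rewrite !scale1r addr0 => h.
          by apply: (addrI (f 0)); rewrite -h addr0.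
        by rewrite !big_cons -[wd_def w]scale1r fl scale1r IHr scale1r.
      rewrite (lin_sum _ _ (sha_mulr_linear _)).
      rewrite (lin_sum (sha_mul^~ _) _ (sha_mull_linear _)).
      under eq_bigr do rewrite sha_mulU.
      under [RHS]eq_bigr do rewrite sha_mulU.
      by rewrite -sum_shA.
    * by rewrite !sha_mulr_linear IH IH'.
  + by rewrite sha_mulr_linear !sha_mull_linear sha_mulr_linear IH IH'.
- by rewrite !sha_mull_linear IH IH'.
Qed.

Fact sha_mul1 : left_id (wd_def [::]) sha_mul.
Proof.
move=> x; elim/sha_def_ind: x => [|u|a x x' IH IH'].
- by rewrite sha_mul0.
- by rewrite sha_mulU /shp sh0s big_seq1.
- by rewrite sha_mulr_linear IH IH'.
Qed.

Fact sha_mulDl : left_distributive sha_mul +%R.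
Proof. by move=> x y z; rewrite -[x]scale1r sha_mull_linear !scale1r. Qed.

Fact sha_one_neq0 : wd_def [::] != 0 :> sha_def.
Proof. by rewrite -[_ == _]/(<< _ *g _ >> == 0) monalgU_eq0 oner_eq0. Qed.

End sha_defRing.

HB.instance Definition _ := GRing.Zmodule_isComNzRing.Build sha_def
  sha_mulA sha_mulC sha_mul1 sha_mulDl sha_one_neq0.

Fact sha_scaleAl (a : rat) (x y : sha_def) : a *: (x * y) = (a *: x) * y.
Proof.
have := sha_mull_linear y a x 0.
by rewrite addr0 sha_mul0l addr0 => <-.
Qed.

HB.instance Definition _ := GRing.Lmodule_isLalgebra.Build rat sha_def sha_scaleAl.
HB.instance Definition _ := GRing.Lalgebra_isComAlgebra.Build rat sha_def.

(* The shuffle algebra is hidden behind this interface, since conversion is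
   very slow on its concrete construction. *)
Record shuffle_algebra := ShuffleAlgebra {
  sa_alg : comAlgType rat;
  sa_word : seq bool -> sa_alg;
  sa_lext : forall V : lmodType rat, (seq bool -> V) -> sa_alg -> V;
  sa_lext_linear : forall (V : lmodType rat) (h : seq bool -> V),
    linear (sa_lext h);
  sa_lextU : forall (V : lmodType rat) (h : seq bool -> V) w,
    sa_lext h (sa_word w) = h w;
  sa_ind : forall P : sa_alg -> Prop, P 0 -> (forall w, P (sa_word w)) ->
    (forall a x y, P x -> P y -> P (a *: x + y)) -> forall x, P x;
  sa_word0 : sa_word [::] = 1;
  sa_wordM : forall u v, sa_word u * sa_word v = \sum_(w <- sh u v) sa_word w
}.

Fact shuffle_algebra_exists : shuffle_algebra.
Proof.
apply: (@ShuffleAlgebra sha_def wd_def (fun V h => lext h)).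
- by move=> V h; exact: lext_is_linear.
- by move=> V h w; exact: lextU.
- exact: sha_def_ind.
- by [].
- exact: sha_mulU.
Qed.

Definition Sha : comAlgType rat := sa_alg shuffle_algebra_exists.
Definition wd : seq bool -> Sha := @sa_word shuffle_algebra_exists.
Definition slext (V : lmodType rat) (h : seq bool -> V) : Sha -> V :=
  @sa_lext shuffle_algebra_exists V h.

HB.instance Definition _ (V : lmodType rat) (h : seq bool -> V) :=
  GRing.isLinear.Build rat Sha V *:%R (@slext V h) (@sa_lext_linear _ V h).

Lemma slextU (V : lmodType rat) (h : seq bool -> V) w : slext h (wd w) = h w.
Proof. exact: sa_lextU. Qed.

Lemma Sha_ind (P : Sha -> Prop) : P 0 -> (forall w, P (wd w)) ->
    (forall a x y, P x -> P y -> P (a *: x + y)) -> forall x, P x.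
Proof. exact: sa_ind. Qed.

Lemma wd0 : wd [::] = 1. Proof. exact: sa_word0. Qed.

Lemma wdM u v : wd u * wd v = \sum_(w <- sh u v) wd w.
Proof. exact: sa_wordM. Qed.

(** Multiplying by the denominator of [a] reduces to integers: a ring morphism between rational
    algebras is automatically linear. *)
Lemma rat_alg_morphZ (A B : algType rat) (f : {rmorphism A -> B}) (a : rat) x :
  f (a *: x) = a *: f x.
Proof.
have e : (denq a)%:~R * a = (numq a)%:~R :> rat.
  by rewrite -[X in _ * X]divq_num_den mulrCA divff ?intr_eq0 ?denq_neq0 // mulr1.
apply: (scalerI (a := (denq a)%:~R)); first by rewrite intr_eq0 denq_neq0.
transitivity (f ((denq a)%:~R *: (a *: x))); first by rewrite !scaler_int raddfMz.
by rewrite !scalerA e !scaler_int raddfMz.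
Qed.

(** * Removal of a first letter and the regularising projection *)

Section LeftDerivation.
Variable b : bool.
Implicit Types (u v w : seq bool) (x y : Sha).

Definition dletter w : Sha :=
  if w is c :: w' then (if c == b then wd w' else 0) else 0.

Definition dl : Sha -> Sha := slext dletter.

HB.instance Definition _ :=
  GRing.isLinear.Build rat Sha Sha *:%R dl (linearP (slext dletter)).

Lemma dlU w : dl (wd w) = dletter w. Proof. exact: slextU. Qed.

Lemma dl_cons c w : dl (wd (c :: w)) = (c == b)%:R *: wd w.
Proof. by rewrite dlU /=; case: eqP; rewrite ?scale1r ?scale0r. Qed.

Lemma dl1 : dl 1 = 0. Proof. by rewrite -wd0 dlU. Qed.

(** The first letter of a shuffle comes from exactly one of the two words, which is Leibniz's
    rule. *)
Lemma dlM x y : dl (x * y) = dl x * y + x * dl y.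
Proof.
elim/Sha_ind: x => [|u|a x x' IH IH']; first by rewrite !(mul0r, linear0, addr0).
  elim/Sha_ind: y => [|v|a y y' IH IH'].
  - by rewrite !(mulr0, linear0, addr0).
  - case: u => [|c u]; first by rewrite wd0 mul1r dl1 mul0r add0r mul1r.
    case: v => [|d v]; first by rewrite wd0 mulr1 dl1 mulr0 addr0 mulr1.
    rewrite !dl_cons -scalerAl -scalerAr !wdM raddf_sum sum_sh_cons.
    by congr (_ + _); rewrite scaler_sumr; apply: eq_bigr => w _; rewrite -dl_cons.
  - by rewrite mulrDr linearD -scalerAr linearZ /= IH IH' linearP mulrDr
       -scalerAr scalerDr addrACA [in RHS]mulrDr -scalerAr.
by rewrite mulrDl linearD -scalerAl linearZ /= IH IH' linearP !mulrDl
   -!scalerAl scalerDr addrACA.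
Qed.

(** Divided powers, for which Leibniz's rule has no binomial coefficients ([ddlM]). *)
Definition ddl n x : Sha := (n`!%:R^-1) *: iter n dl x.

Lemma ddl0 x : ddl 0 x = x. Proof. by rewrite /ddl invr1 scale1r. Qed.

Lemma dl_ddl n x : dl (ddl n x) = ddl n.+1 x *+ n.+1.
Proof.
rewrite /ddl linearZ /= -scaler_nat scalerA factS natrM invfM mulrA divff ?mul1r // pnatr_eq0.
Qed.

Fact ddl_is_linear n : linear (ddl n).
Proof.
move=> a x y; rewrite /ddl.
have -> : iter n dl (a *: x + y) = a *: iter n dl x + iter n dl y.
  by elim: n => //= n ->; rewrite linearP.
by rewrite scalerDr !scalerA mulrC.
Qed.

HB.instance Definition _ n :=
  GRing.isLinear.Build rat Sha Sha *:%R (ddl n) (ddl_is_linear n).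

Lemma ddlM n x y : ddl n (x * y) = \sum_(i < n.+1) ddl i x * ddl (n - i) y.
Proof.
elim: n => [|n IHn]; first by rewrite big_ord1 !ddl0.
apply: (scalerI (a := n.+1%:R)); first by rewrite pnatr_eq0.
rewrite scaler_nat -dl_ddl IHn raddf_sum /=.
under eq_bigr => i _ do rewrite dlM !dl_ddl mulrnAl mulrnAr.
rewrite big_split /= scaler_nat -sumrMnl.
transitivity (\sum_(i < n.+2) (ddl i x * ddl (n.+1 - i) y *+ i +
                               ddl i x * ddl (n.+1 - i) y *+ (n.+1 - i))).
  rewrite big_split /=; congr (_ + _).
    by rewrite [RHS]big_ord_recl mulr0n add0r; apply: eq_bigr.
  rewrite [RHS]big_ord_recr /= subnn mulr0n addr0; apply: eq_bigr => i _.
  by rewrite -subSn // -ltnS.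
apply: eq_bigr => i _; rewrite -mulrnDr subnKC //.
by rewrite -ltnS.
Qed.

Lemma ddl_wd0 n w : (size w < n)%N -> ddl n (wd w) = 0.
Proof.
move=> wn; rewrite /ddl; suff -> : iter n dl (wd w) = 0 by rewrite scaler0.
elim: n w wn => [//|n IHn] [|c w] wn; rewrite iterSr.
  by rewrite dlU /=; elim: n {IHn wn} => //= n ->; rewrite linear0.
rewrite dl_cons; have -> : iter n dl ((c == b)%:R *: wd w) = (c == b)%:R *: iter n dl (wd w).
  by elim: n {IHn wn} => //= n ->; rewrite linearZ.
by rewrite IHn ?scaler0.
Qed.

Fact ddl_bounded x : exists n, forall k, (n <= k)%N -> ddl k x = 0.
Proof.
elim/Sha_ind: x => [|w|a x y [n nP] [m mP]].
- by exists 0%N => k _; rewrite linear0.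
- by exists (size w).+1 => k; exact: ddl_wd0.
- exists (maxn n m) => k; rewrite geq_max linearP /= => /andP[nk mk].
  by rewrite nP // mP // scaler0 addr0.
Qed.

Definition sha_deg x : nat := projT1 (cid (ddl_bounded x)).

Lemma ddl_deg n x : (sha_deg x <= n)%N -> ddl n x = 0.
Proof. exact: (projT2 (cid (ddl_bounded x))). Qed.

(** This is [exp(T d)] applied to [x], a polynomial in [T] because the derivation is locally
    nilpotent, and multiplicative because it is the exponential of a derivation. *)
Definition taylor x : {poly Sha} := \poly_(k < sha_deg x) ddl k x.

Lemma coef_taylor x k : (taylor x)`_k = ddl k x.
Proof. by rewrite coef_poly; case: ltnP => // /ddl_deg. Qed.

Fact taylor_zmod : zmod_morphism taylor.
Proof. by move=> x y; apply/polyP => k; rewrite coefB !coef_taylor linearB. Qed.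

Fact taylor_monoid : monoid_morphism taylor.
Proof.
split; last by move=> x y; apply/polyP => k; rewrite coefM coef_taylor ddlM;
  apply: eq_bigr => i _; rewrite !coef_taylor.
apply/polyP => k; rewrite coef_taylor coef1; case: k => [|k]; first by rewrite ddl0.
by rewrite -wd0 ddl_wd0.
Qed.

HB.instance Definition _ := GRing.isZmodMorphism.Build Sha {poly Sha} taylor taylor_zmod.
HB.instance Definition _ := GRing.isMonoidMorphism.Build Sha {poly Sha} taylor taylor_monoid.

(* exp(-b d/db), the projection onto the kernel of the derivation d/db that kills b *)
Definition lreg x : Sha := (taylor x).[- wd [:: b]].

Fact lreg_zmod : zmod_morphism lreg.
Proof. by move=> x y; rewrite /lreg raddfB hornerD hornerN. Qed.

Fact lreg_monoid : monoid_morphism lreg.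
Proof.
by split; rewrite /lreg ?rmorph1 ?hornerC // => x y; rewrite rmorphM hornerM.
Qed.

HB.instance Definition _ := GRing.isZmodMorphism.Build Sha Sha lreg lreg_zmod.
HB.instance Definition _ := GRing.isMonoidMorphism.Build Sha Sha lreg lreg_monoid.

Lemma lregE n x : (forall k, (n <= k)%N -> ddl k x = 0) ->
  lreg x = \sum_(k < n) (- wd [:: b]) ^+ k * ddl k x.
Proof.
move=> xn; rewrite /lreg (@horner_coef_wide _ n); last first.
  by apply/leq_sizeP => k nk; rewrite coef_taylor xn.
by apply: eq_bigr => k _; rewrite coef_taylor mulrC.
Qed.

Lemma lreg_letter : lreg (wd [:: b]) = 0.
Proof.
rewrite (@lregE 2); last by move=> k k2; apply: ddl_wd0.
rewrite !big_ord_recl big_ord0 ddl0 expr0 expr1 mul1r addr0 /ddl /= dl_cons eqxx.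
by rewrite wd0 /bump /= invr1 !scale1r mulr1 subrr.
Qed.

Lemma lreg_id w : ~~ (if w is c :: _ then c == b else false) -> lreg (wd w) = wd w.
Proof.
move=> wb; rewrite (@lregE (size w).+1) => [|k]; last exact: ddl_wd0.
rewrite big_ord_recl ddl0 expr0 mul1r.
rewrite big1 ?addr0 // => i _; rewrite /ddl iterSr.
have -> : dl (wd w) = 0.
  clear i; case: w wb => [|c w] /= cb; first by rewrite wd0 dl1.
  by rewrite dl_cons (negPf cb) scale0r.
have -> : iter i dl 0 = 0 by elim: (nat_of_ord i) => //= n ->; rewrite linear0.
by rewrite scaler0 mulr0.
Qed.

Lemma dl_exp x n : dl (x ^+ n) = dl x * x ^+ n.-1 *+ n.
Proof.
elim: n => [|n IHn]; first by rewrite dl1 mulr0n.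
rewrite exprS dlM IHn /= mulrnAr mulrS; congr (_ + _).
by case: n {IHn} => [|n]; rewrite ?mulr0n //= exprS mulrCA.
Qed.

Lemma dl_lreg x : dl (lreg x) = 0.
Proof.
set a := wd [:: b]; have da : dl (- a) = -1 by rewrite linearN /= dl_cons eqxx scale1r wd0.
rewrite (@lregE (sha_deg x)) => [|k]; last exact: ddl_deg.
rewrite -/a.
(* The derivative of a partial sum telescopes to one boundary term, which vanishes once [n] reaches
   the degree of [x]. *)
suff -> n : dl (\sum_(k < n) (- a) ^+ k * ddl k x) = (- a) ^+ n.-1 * ddl n x *+ n.
  by rewrite ddl_deg // mulr0 mul0rn.
elim: n => [|n IHn]; first by rewrite big_ord0 linear0 mulr0n.
rewrite big_ord_recr linearD /= IHn dlM dl_exp da dl_ddl mulN1r mulrnAr.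
by rewrite mulNrn mulNr mulrnAl addNKr.
Qed.

End LeftDerivation.

(** * Iterated integrals as shuffles *)

Definition srev : Sha -> Sha := slext (wd \o rev).

HB.instance Definition _ :=
  GRing.isLinear.Build rat Sha Sha *:%R srev (linearP (slext (wd \o rev))).

Lemma srevU w : srev (wd w) = wd (rev w). Proof. exact: slextU. Qed.

Fact srev_monoid : monoid_morphism srev.
Proof.
split=> [|x y]; first by rewrite -wd0 srevU.
elim/Sha_ind: x => [|u|a x x' IH IH'].
- by rewrite mul0r linear0 mul0r.
- elim/Sha_ind: y => [|v|a y y' IH IH'].
  + by rewrite mulr0 linear0 mulr0.
  + rewrite !srevU !wdM raddf_sum sum_sh_rev.
    by apply: eq_bigr => w _; rewrite -srevU.
  + by rewrite mulrDr -scalerAr !linearP /= mulrDr -scalerAr IH IH'.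
- by rewrite mulrDl -scalerAl !linearP /= mulrDl -scalerAl IH IH'.
Qed.

HB.instance Definition _ := GRing.isMonoidMorphism.Build Sha Sha srev srev_monoid.

Section Antipode.
Implicit Types (u v w : seq bool).

Definition pre (a : bool) : Sha -> Sha := slext (wd \o cons a).

HB.instance Definition _ a :=
  GRing.isLinear.Build rat Sha Sha *:%R (pre a) (linearP (slext (wd \o cons a))).

Lemma preU a w : pre a (wd w) = wd (a :: w). Proof. exact: slextU. Qed.

Lemma wdM_cons a u b v : wd (a :: u) * wd (b :: v) =
  pre a (wd u * wd (b :: v)) + pre b (wd (a :: u) * wd v).
Proof.
rewrite !wdM sum_sh_cons !raddf_sum.
by congr (_ + _); apply: eq_bigr => w _; rewrite -preU.
Qed.

(* The sum over k telescopes, a shuffle of two nonempty words splitting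
   according to its first letter. *)
Lemma antipode_catrev u v :
  \sum_(k < (size v).+1) (-1) ^+ k *: (wd (catrev (take k v) u) * wd (drop k v)) =
  if u is a :: u' then pre a (wd u' * wd v) else (v == [::])%:R *: 1.
Proof.
elim: v u => [|b v IHv] u.
  rewrite big_ord1 /= expr0 scale1r wd0 mulr1; case: u => [|a u].
    by rewrite scale1r wd0.
  by rewrite mulr1 preU.
rewrite big_ord_recl expr0 scale1r /=.
under eq_bigr => k _ do rewrite exprS mulN1r scaleNr.
rewrite sumrN IHv; case: u => [|a u]; last by rewrite wdM_cons addrK.
by rewrite wd0 !mul1r preU subrr scale0r.
Qed.

Lemma antipodel w : w != [::] ->
  \sum_(k < (size w).+1) (-1) ^+ k *: (wd (rev (take k w)) * wd (drop k w)) = 0.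
Proof. by move=> w0; rewrite antipode_catrev (negPf w0) scale0r. Qed.

(** Image of [antipodel] under reversal, a morphism of the shuffle algebra; the factor
    [(-1) ^+ size w] turns the sign exponent [k] into [size w - k]. *)
Lemma antipoder w : w != [::] ->
  \sum_(k < (size w).+1)
    (-1) ^+ (size w - k) *: (wd (take k w) * wd (rev (drop k w))) = 0.
Proof.
move=> w0; have := congr1 (fun x => (-1) ^+ size w *: srev x) (antipodel w0).
rewrite linear0 scaler0 linear_sum scaler_sumr => {2}<-.
apply: eq_bigr => k _; rewrite linearZ /= scalerA -exprD rmorphM /= !srevU revK.
congr (_ *: _); rewrite -signr_odd -[RHS]signr_odd oddD oddB //.
by rewrite -ltnS.
Qed.

End Antipode.

(** * Universal property of the Hopf algebra, its model in words and its basis *)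

Section FreeEvaluation.
Variables (A : comAlgType rat) (v : symb -> A).

Definition cmon_eval (m : {cmonom symb}) : A := \prod_(s <- finsupp m) v s ^+ m s.

Lemma cmon_evalEw (d : {fset symb}) (m : {cmonom symb}) : (finsupp m `<=` d)%fset ->
  cmon_eval m = \prod_(s <- d) v s ^+ m s.
Proof.
move=> le; rewrite /cmon_eval (big_fset_incl _ le) // => s _.
by rewrite -cmE_eq0 => /eqP->.
Qed.

Fact cmon_eval_mmorphism : mmorphism cmon_eval.
Proof.
split=> [m1 m2|]; last by rewrite /cmon_eval mdom1 big_seq_fset0.
rewrite (cmon_evalEw (d := (finsupp m1 `|` finsupp m2)%fset)) ?mdomD //.
rewrite (cmon_evalEw (fsubsetUl (finsupp m1) (finsupp m2))).
rewrite (cmon_evalEw (fsubsetUr (finsupp m1) (finsupp m2))).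
by rewrite -big_split; apply: eq_bigr => s _; rewrite cmM exprD.
Qed.

HB.instance Definition _ :=
  isMultiplicative.Build {cmonom symb} A cmon_eval cmon_eval_mmorphism.

Definition free_eval : {rmorphism free_symb -> A} :=
  GRing.RMorphism.clone {malg rat[{cmonom symb}]} A
    (mmap (GRing.in_alg A) cmon_eval) _.

Lemma free_evalE s : free_eval (gen s) = v s.
Proof.
rewrite [LHS](@mmapU _ _ _ (GRing.in_alg A) cmon_eval) /= scale1r mul1r.
by rewrite /cmon_eval mdomU big_seq_fset1 cmUU expr1.
Qed.

End FreeEvaluation.

Lemma goncharov_rel_morph (A B : comNzRingType) (f : {rmorphism A -> B})
    (I : symb -> A) (J : symb -> B) x :
  (forall s, f (I s) = J s) -> goncharov_rel I x -> goncharov_rel J (f x).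
Proof.
move=> fI [a b|a u v b|a w b y|a w w0].
- by rewrite rmorphB rmorph1 fI; apply: RelUnit.
- rewrite rmorphB rmorphM rmorph_sum !fI; under eq_bigr do rewrite fI.
  exact: RelShuffle.
- rewrite rmorphB rmorph_sum fI; under eq_bigr do rewrite rmorphM !fI.
  exact: RelPath.
- by rewrite fI; apply: RelLoop.
Qed.

Lemma ideal_span_ker (A B : comNzRingType) (f : {rmorphism A -> B}) (G : set A) :
  (forall x, G x -> f x = 0) -> {in ideal_span G, forall x, f x = 0}.
Proof.
move=> fG x /asboolP[s Gs ->]; rewrite rmorph_sum big_seq big1 // => p /Gs Gp.
by rewrite rmorphM [X in _ * X]fG // mulr0.
Qed.

Section CalILift.
Variables (A : comAlgType rat) (v : symb -> A).
Hypothesis vrel : forall x, goncharov_rel v x -> x = 0.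

Fact free_eval_ker : {in goncharov_ideal, forall x, free_eval v x = 0}.
Proof.
apply: ideal_span_ker => x xrel; apply: vrel.
exact: goncharov_rel_morph (free_evalE v) xrel.
Qed.

Definition calI_lift : {rmorphism calI -> A} := ideal_quot_lift free_eval_ker.

Lemma calI_liftE s : calI_lift (II s) = v s.
Proof. by rewrite [LHS]ideal_quot_liftE free_evalE. Qed.

End CalILift.

Section CalI1Lift.
Variables (A : comAlgType rat) (f : {rmorphism calI -> A}).
Hypothesis f001 : f (II (false, [:: false], true)) = 0.

Fact calI_morph_ker : {in ideal_I001, forall x, f x = 0}.
Proof. by apply: ideal_span_ker => x ->. Qed.

Definition calI1_lift : {rmorphism calI1 -> A} := ideal_quot_lift calI_morph_ker.

Lemma calI1_liftE s : calI1_lift (I1 s) = f (II s).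
Proof. by rewrite [LHS]ideal_quot_liftE. Qed.

End CalI1Lift.

(** A model of the symbols in words. A path from 1 to 0 receives the antipode of its word, as the
    reversal of paths demands. *)
Definition sha_symb (s : symb) : Sha :=
  let: (a, w, b) := s in
  if a == b then (w == [::])%:R else
  if b then wd w else (-1) ^+ size w *: wd (rev w).

Lemma sha_symb_rel x : goncharov_rel sha_symb x -> x = 0.
Proof.
case=> [a b|a u v b|a w b y|a w w0] /=.
- by case: a b => -[]; rewrite /= ?expr0 ?scale1r ?wd0 subrr.
- case: eqP => [_|ab].
    rewrite sum_shuffles; case: u => [|c u].
      by rewrite sh0s big_seq1 mul1r subrr.
    rewrite mul0r big_seq big1 ?subrr // => w /size_sh ws.
    by case: w ws.
  case: b ab => ab; first by rewrite wdM sum_shuffles subrr.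
  rewrite sum_shuffles -scalerAl -scalerAr scalerA -exprD wdM sum_sh_rev.
  apply/eqP; rewrite subr_eq0 scaler_sumr; apply/eqP; apply: eq_big_seq => w.
  by move=> /size_sh->.
(* If the intermediate point is an endpoint, a single cut survives. Otherwise the two ends are
   equal, and for a nonempty word the relation is one of the two antipode identities. *)
- apply/eqP; rewrite subr_eq0; apply/eqP; have [ay|ay] := eqVneq a y.
    rewrite big_ord_recl take0 eqxx mul1r drop0 big1 ?addr0 ?ay // => k _.
    by case: w k => [|c w] k /=; [case: k|rewrite mul0r].
  have [yb|yb] := eqVneq y b.
    rewrite big_ord_recr /= take_size drop_size eqxx mulr1 big1 ?add0r -?yb ?(negPf ay) //.
    move=> k _; have /negPf-> : drop k w != [::].
      by rewrite -size_eq0 size_drop subn_eq0 -ltnNge.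
    by rewrite mulr0.
  have ab : a = b by case: (a) (y) (b) ay yb => -[] [].
  rewrite -ab eqxx; have [->|w0] := eqVneq w [::].
    by rewrite big_ord1 /= wd0 scale1r; case: ifP => _; case: ifP => _; rewrite mulr1.
  case: y ay {yb ab} => ay; case: a ay => // _.
    rewrite -[LHS](antipoder w0); apply: eq_bigr => k _.
    by rewrite scalerAr size_drop.
  rewrite -[LHS](antipodel w0); apply: eq_bigr => k _.
  by rewrite scalerAl size_take_min (minn_idPl _) // -ltnS.
- by rewrite eqxx (negPf w0).
Qed.

Definition sha_of_calI : {rmorphism calI -> Sha} := calI_lift sha_symb_rel.

Definition reg_of_calI : {rmorphism calI -> Sha} := lreg false \o sha_of_calI.

Lemma reg_of_calIE s : reg_of_calI (II s) = lreg false (sha_symb s).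
Proof. transitivity (lreg false (sha_of_calI (II s))); first by [].
by congr (lreg false _); exact: calI_liftE. Qed.

Fact reg_of_calI001 : reg_of_calI (II (false, [:: false], true)) = 0.
Proof. by rewrite reg_of_calIE /= lreg_letter. Qed.

(** It sends [I1_index n] to the word of [n] ([kappa_index]). Distinct words being independent,
    linear maps with prescribed values on these elements are obtained by composing with [kappa]. *)
Definition kappa : {rmorphism calI1 -> Sha} := calI1_lift reg_of_calI001.

Lemma kappaE s : kappa (I1 s) = lreg false (sha_symb s).
Proof. by rewrite [LHS]calI1_liftE reg_of_calIE. Qed.

Lemma kappaZ a x : kappa (a *: x) = a *: kappa x.
Proof. exact: rat_alg_morphZ. Qed.

Lemma kappa_index n : kappa (I1_index n) = wd (index_word n).
Proof. by rewrite kappaE /= lreg_id //; case: n. Qed.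

Section Span.
Variables (A : pzRingType) (V : lmodType A).
Implicit Types G H : set V.

Lemma lin_span_sum (T : Type) G (r : seq T) (P : pred T) (F : T -> V) :
  (forall i, P i -> F i \in lin_span G) -> \sum_(i <- r | P i) F i \in lin_span G.
Proof.
move=> FG; elim/big_ind: _ => //; first exact: lin_span0.
by move=> x y Gx Gy; rewrite -[x]scale1r lin_spanP.
Qed.

Lemma lin_spanZ G a x : x \in lin_span G -> a *: x \in lin_span G.
Proof. by move=> Gx; rewrite -[_ *: _]addr0 lin_spanP // lin_span0. Qed.

Lemma lin_span_ind G (P : V -> Prop) : P 0 -> (forall x, G x -> P x) ->
    (forall a x y, P x -> P y -> P (a *: x + y)) ->
  forall x, x \in lin_span G -> P x.
Proof.
move=> P0 PG PD x /asboolP[s Gs ->]; elim: s Gs => [|p s IHs] Gs.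
  by rewrite big_nil.
rewrite big_cons; apply: PD; first by apply/PG/Gs/mem_head.
by apply: IHs => q qs; apply: Gs; rewrite inE qs orbT.
Qed.

End Span.

Definition starts b (w : seq bool) : bool := if w is c :: _ then c == b else false.

(** Every [x] is its part on the words not starting with [b], plus [b] prepended to [dl b x]. *)
Lemma dl0_span b x : dl b x = 0 -> x \in lin_span [set wd w | w in [set w | ~~ starts b w]].
Proof.
move=> dx.
have -> : x = slext (fun w => if starts b w then 0 else wd w : Sha) x + pre b (dl b x).
  elim/Sha_ind: (x) => [|w|a y z IH IH'].
  - by rewrite !linear0 addr0.
  - rewrite slextU; case: w => [|c w] /=; first by rewrite dlU linear0 addr0.
    rewrite dl_cons; case: eqP => [->|_]; last by rewrite scale0r linear0 addr0.
    by rewrite scale1r preU add0r.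
  - by rewrite !linearP /= addrACA -scalerDr -IH -IH'.
rewrite dx linear0 addr0; elim/Sha_ind: (x) => [|w|a y z IH IH'].
- by rewrite linear0 lin_span0.
- rewrite slextU; case: ifPn => wb; first exact: lin_span0.
  by apply: lin_span_gen; exists w.
- by rewrite linearP lin_spanP.
Qed.

Lemma lreg_span b x :
  lreg b x \in lin_span [set wd w | w in [set w | ~~ starts b w]].
Proof. exact/dl0_span/dl_lreg. Qed.

(** All terms of [exp(- b d/db)] but the zeroth are multiples of the letter [b]. *)
Lemma linear_lreg (V : lmodType rat) (f : {linear Sha -> V}) b x :
  (forall y, f (wd [:: b] * y) = 0) -> f (lreg b x) = f x.
Proof.
move=> f0; rewrite (@lregE _ (sha_deg b x).+1) => [|k]; last first.
  by move=> /ltnW; exact: ddl_deg.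
rewrite big_ord_recl expr0 mul1r ddl0 linearD linear_sum /= big1 ?addr0 // => i _.
by rewrite /bump leq0n add1n exprS -mulrA mulNr linearN f0 oppr0.
Qed.

Lemma starts_index w : ~~ starts false w ->
  exists2 n, all (leq 1) n & w = index_word n.
Proof.
have aux u : exists k n, all (leq 1) n /\ u = nseq k false ++ index_word n.
  elim: u => [|[] u [k [n [n1 ->]]]]; first by exists 0%N, [::].
    by exists 0%N, (k.+1 :: n).
  by exists k.+1, n.
case: w => [|[] w] // _; first by exists [::].
by have [k [n [n1 ->]]] := aux w; exists (k.+1 :: n).
Qed.

Lemma starts_index_word n : ~~ starts false (index_word n).
Proof. by case: n. Qed.

Lemma head_starts w : in_H1 w = ~~ starts false w.
Proof. by case: w => [|[]]. Qed.

Lemma sh_starts b u v w : ~~ starts b u -> ~~ starts b v -> w \in sh u v ->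
  ~~ starts b w.
Proof.
case: u => [|c u] ub; first by rewrite sh0s inE => vb /eqP->.
case: v => [|d v] vb; first by rewrite shs0 inE => /eqP->.
by rewrite sh_cons mem_cat => /orP[] /mapP[w' _ ->].
Qed.

Section SymbolRelations.

Definition calI1_pi : {rmorphism free_symb -> calI1} :=
  (\pi_{ideal_quot ideal_I001} : {rmorphism calI -> calI1}) \o
  (\pi_{ideal_quot goncharov_ideal} : {rmorphism free_symb -> calI}).

Lemma calI1_pi_gen s : calI1_pi (gen s) = I1 s. Proof. by []. Qed.

Lemma calI1_pi_rel x : goncharov_rel gen x -> calI1_pi x = 0.
Proof.
move=> xrel; rewrite /calI1_pi /=.
have -> : \pi_{ideal_quot goncharov_ideal} x = 0; last by rewrite rmorph0.
apply/eqP; rewrite -[0](rmorph0 (\pi_{ideal_quot goncharov_ideal} : {rmorphism free_symb -> calI})).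
by rewrite -Quotient.idealrBE subr0; apply: ideal_span_gen.
Qed.

Lemma calI1_piM (x y : free_symb) : calI1_pi (x * y) = calI1_pi x * calI1_pi y.
Proof. exact: rmorphM. Qed.

Lemma calI1_pi_surj x : exists y, x = calI1_pi y.
Proof. by exists (repr (repr x)); rewrite /calI1_pi /= !reprK. Qed.

Lemma I1_unit a b : I1 (a, [::], b) = 1.
Proof.
apply/eqP; rewrite -subr_eq0 -calI1_pi_gen -(rmorph1 calI1_pi) -rmorphB.
by apply/eqP/calI1_pi_rel/RelUnit.
Qed.

Lemma I1_loop a w : w != [::] -> I1 (a, w, a) = 0.
Proof. by move=> w0; rewrite -calI1_pi_gen; apply/calI1_pi_rel/RelLoop. Qed.

Lemma I1_shuffle a u v b :
  I1 (a, u, b) * I1 (a, v, b) = \sum_(w <- sh u v) I1 (a, w, b).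
Proof.
rewrite -sum_shuffles; apply/eqP; rewrite -subr_eq0.
under eq_bigr do rewrite -calI1_pi_gen.
rewrite -!calI1_pi_gen -rmorphM -rmorph_sum -rmorphB.
by apply/eqP/calI1_pi_rel/RelShuffle.
Qed.

Lemma I1_path a w b x : I1 (a, w, b) =
  \sum_(k < (size w).+1) I1 (a, take k w, x) * I1 (x, drop k w, b).
Proof.
apply/eqP; rewrite -subr_eq0.
under eq_bigr do rewrite -!calI1_pi_gen -rmorphM.
rewrite -calI1_pi_gen -rmorph_sum -rmorphB.
by apply/eqP/calI1_pi_rel/RelPath.
Qed.

Lemma I1_001 : I1 (false, [:: false], true) = 0.
Proof.
apply/eqP; rewrite /I1 -[0](rmorph0 (\pi_{ideal_quot ideal_I001} : {rmorphism calI -> calI1})).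
by rewrite -Quotient.idealrBE subr0; apply: ideal_span_gen.
Qed.

Opaque I1 calI1_pi.

Lemma I1_letter0 a b : I1 (a, [:: false], b) = 0.
Proof.
case: (eqVneq a b) => [->|ab]; first exact: I1_loop.
case: a b ab => -[] // _; last exact: I1_001.
have := I1_path true [:: false] true false.
rewrite I1_loop // !big_ord_recr big_ord0 /= !I1_unit I1_001 mulr0 !add0r mulr1.
by move=> <-.
Qed.

Lemma I1_insert0 a w b : \sum_(w' <- sh [:: false] w) I1 (a, w', b) = 0.
Proof. by rewrite -I1_shuffle I1_letter0 mul0r. Qed.

Definition I01 : Sha -> calI1 := slext (fun w => I1 (false, w, true)).

HB.instance Definition _ :=
  GRing.isLinear.Build rat Sha calI1 *:%R I01
    (linearP (slext (fun w => I1 (false, w, true)))).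

Lemma I01U w : I01 (wd w) = I1 (false, w, true). Proof. exact: slextU. Qed.

Fact I01_monoid : monoid_morphism I01.
Proof.
split=> [|x y]; first by rewrite -wd0 I01U I1_unit.
elim/Sha_ind: x => [|u|a x x' IH IH'].
- by rewrite mul0r linear0 mul0r.
- elim/Sha_ind: y => [|v|a y y' IH IH'].
  + by rewrite mulr0 linear0 mulr0.
  + rewrite !I01U wdM linear_sum I1_shuffle.
    by apply: eq_bigr => w _; rewrite -I01U.
  + by rewrite mulrDr -scalerAr !linearP /= mulrDr -scalerAr IH IH'.
- by rewrite mulrDl -scalerAl !linearP /= mulrDl -scalerAl IH IH'.
Qed.

HB.instance Definition _ := GRing.isMonoidMorphism.Build Sha calI1 I01 I01_monoid.

(** Path composition of the loop from 0 through 1 back to 0, and the antipode identity transported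
    by [I01], are relations of the same shape; induction on the length identifies their terms one by
    one, leaving the longest. *)
Lemma I1_rev10 w : I1 (true, w, false) = (-1) ^+ size w *: I1 (false, rev w, true).
Proof.
elim: {w}_.+1 {-2}w (ltnSn (size w)) => // N IHN w wN.
have [->|w0] := eqVneq w [::]; first by rewrite scale1r !I1_unit.
have := congr1 I01 (antipoder w0); rewrite linear0 linear_sum big_ord_recl /=.
have := I1_path false w false true; rewrite I1_loop // big_ord_recl /=.
rewrite take0 drop0 I1_unit mul1r => h1.
rewrite [in X in X + _]linearZ /= rmorphM /= wd0 rmorph1 mul1r I01U subn0.
move=> /eqP; rewrite addr_eq0 => /eqP ->; move/eqP: h1; rewrite eq_sym addr_eq0 => /eqP ->.
congr (- _); apply: eq_bigr => k _; rewrite linearZ /= rmorphM /= !I01U.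
rewrite IHN ?size_drop; last first.
  by rewrite /bump leq0n; move: wN; case: (size w) k => [[]|p] //= k; lia.
by rewrite scalerAr.
Qed.

Lemma I1_rev a w b : I1 (a, w, b) = (-1) ^+ size w *: I1 (b, rev w, a).
Proof.
case: (eqVneq a b) => [->|ab].
  have [->|w0] := eqVneq w [::]; first by rewrite scale1r.
  by rewrite !I1_loop ?scaler0 // -size_eq0 size_rev size_eq0.
case: a b ab => -[] // _; first exact: I1_rev10.
by rewrite I1_rev10 size_rev revK scalerA -expr2 sqrr_sign scale1r.
Qed.

Definition index_set : set calI1 := [set I1_index n | n in [set n | all (leq 1) n]].

(** As [I(0;0;1) = 0], the symbol of a word equals that of its regularisation by [lreg false], which
    involves only words not starting with 0, that is, index words. Paths from 1 to 0 follow by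
    reversal. *)
Lemma I1_span s : I1 s \in lin_span index_set.
Proof.
have f w : I1 (false, w, true) \in lin_span index_set.
  rewrite -I01U -(linear_lreg (f := I01) (b := false)) => [|y]; last first.
    by rewrite rmorphM /= I01U I1_001 mul0r.
  move: (lreg_span false (wd w)); move: (lreg _ _) => x.
  elim/lin_span_ind => [|_ [v /= v0 <-]|a y z IH IH'].
  - by rewrite linear0 lin_span0.
  - have [n n1 ->] := starts_index v0; rewrite I01U.
    by apply: lin_span_gen; exists n.
  - by rewrite linearP lin_spanP.
case: s => [[a w] b]; case: (eqVneq a b) => [->|ab].
  have [->|w0] := eqVneq w [::]; last by rewrite I1_loop // lin_span0.
  rewrite I1_unit -(I1_unit false true); exact: f.
have : (a = true /\ b = false) \/ (a = false /\ b = true).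
  by case: a b ab => -[] // _; [left|right].
by case=> -[-> ->]; rewrite ?I1_rev10; [apply: lin_spanZ|]; exact: f.
Qed.

Lemma index_set_mul x y : x \in lin_span index_set -> y \in lin_span index_set ->
  x * y \in lin_span index_set.
Proof.
move=> xL yL; elim/lin_span_ind: x / xL => [|_ [n _ <-]|a x x' IH IH'].
- by rewrite mul0r lin_span0.
- elim/lin_span_ind: y / yL => [|_ [m _ <-]|a y y' IH IH'].
  + by rewrite mulr0 lin_span0.
  + by rewrite I1_shuffle; apply: lin_span_sum => w _; exact: I1_span.
  + by rewrite mulrDr -scalerAr lin_spanP.
- by rewrite mulrDl -scalerAl lin_spanP.
Qed.

Lemma calI1_gen_span s (y : free_symb) : calI1_pi y \in lin_span index_set ->
  calI1_pi (gen s * y) \in lin_span index_set.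
Proof.
by move=> yL; rewrite calI1_piM calI1_pi_gen; apply: index_set_mul yL; exact: I1_span.
Qed.

(** Peeling one symbol off a monomial reduces to products of two elements of the span, which the
    shuffle product expands again. *)
Lemma calI1_span x : x \in lin_span index_set.
Proof.
have [y ->] := calI1_pi_surj x.
elim/malg_lin_ind: y => [|m|a y z IH IH'].
- by rewrite rmorph0 lin_span0.
- elim: {m}_.+1 {-2}m (ltnSn (mdeg m)) => // N IHN m mN.
  have [->|m1] := eqVneq m (mone : {cmonom symb}).
    have -> : << (mone : {cmonom symb}) >> = 1 :> free_symb by [].
    by rewrite rmorph1 -(I1_unit false true) I1_span.
  have [s sm] : exists s, s \in finsupp m.
    apply/fset0Pn; apply: contra m1 => /eqP m0; apply/cmP => i.
    by rewrite cm1; apply/eqP; rewrite cmE_eq0 m0 in_fset0.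
  have mE : m = mmul (ucm s) (divcm m (ucm s)).
    apply/eqP/cmP => i; rewrite cmM divcmE cmU subnKC //.
    by case: eqP => // <-; rewrite lt0n cmE_neq0.
  have -> : << m >> = gen s * << divcm m (ucm s) >> :> free_symb.
    by rewrite {1}mE [RHS]malgM_def fgmulUU mulr1.
  have IH : calI1_pi << divcm m (ucm s) >> \in lin_span index_set.
    apply: IHN; move: mN; rewrite {1}mE mdegM mdegU.
    by rewrite add1n ltnS.
  exact: calI1_gen_span IH.
- by rewrite rmorphD rat_alg_morphZ lin_spanP.
Qed.

End SymbolRelations.

(** * The Goncharov coproduct *)

Section BitMasks.

Fixpoint bits (n : nat) : seq bitseq :=
  if n is n'.+1 then map (cons true) (bits n') ++ map (cons false) (bits n')
  else [:: [::]].

Lemma mem_bits n t : (t \in bits n) = (size t == n).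
Proof.
elim: n t => [|n IHn] [|b t] //=; rewrite ?inE // mem_cat.
  by apply/negP => /orP[] /mapP[].
have cmem c : (b :: t \in map (cons c) (bits n)) = (b == c) && (size t == n).
  apply/mapP/andP => [[t' t'n [-> ->]]|[/eqP-> tn]]; first by rewrite -IHn.
  by exists t; rewrite ?IHn.
by rewrite !cmem eqSS; clear cmem; case: b; rewrite /= ?orbF.
Qed.

Lemma uniq_bits n : uniq (bits n).
Proof.
elim: n => //= n IHn; rewrite cat_uniq !map_inj_uniq ?IHn //; try by move=> ? ? [].
by rewrite andbT; apply/hasPn => _ /mapP[t _ ->]; apply/negP => /mapP[].
Qed.

Lemma perm_bits_rev n : perm_eq (map rev (bits n)) (bits n).
Proof.
apply: uniq_perm; rewrite ?map_inj_uniq ?uniq_bits //; first exact: (can_inj revK).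
move=> t; rewrite mem_bits; apply/mapP/idP => [[t' + ->]|/eqP tn].
  by rewrite mem_bits size_rev.
by exists (rev t); rewrite ?revK // mem_bits size_rev tn.
Qed.

(** Subsets are replaced by bit masks so that sums over them can follow the letters of a word. *)
Lemma sum_set_bits (V : nmodType) n (phi : bitseq -> V) :
  \sum_(S : {set 'I_n}) phi [seq i \in S | i <- enum 'I_n] = \sum_(t <- bits n) phi t.
Proof.
set f := fun S : {set 'I_n} => [seq i \in S | i <- enum 'I_n].
rewrite -(big_map f xpredT phi); apply: perm_big; apply: uniq_perm.
- rewrite map_inj_uniq ?index_enum_uniq // => S S' /eq_in_map h.
  by apply/setP => i; apply: h; rewrite mem_enum.
- exact: uniq_bits.
move=> t; rewrite mem_bits; apply/mapP/eqP => [[S _ ->]|tn].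
  by rewrite size_map size_enum_ord.
pose S : {set 'I_n} := finset (fun i : 'I_n => nth false t i).
exists S; rewrite ?mem_index_enum // /f.
have fS : size (f S) = n by rewrite size_map size_enum_ord.
apply: (@eq_from_nth _ false); rewrite tn ?fS // => i i_n.
by rewrite (nth_map (Ordinal i_n)) ?size_enum_ord // inE nth_enum_ord.
Qed.

End BitMasks.

Section InsertLetter.

Definition insert_at (p : nat) (c : bool) w : seq bool := take p w ++ c :: drop p w.

Lemma sum_sh1 (V : zmodType) (phi : seq bool -> V) c w :
  \sum_(w' <- sh [:: c] w) phi w' = \sum_(p < (size w).+1) phi (insert_at p c w).
Proof.
elim: w phi => [|d w IHw] phi; first by rewrite shs0 big_seq1 big_ord1.
rewrite sum_sh_cons sh0s big_seq1 IHw [RHS]big_ord_recl /=.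
by congr (_ + _); apply: eq_bigr.
Qed.

End InsertLetter.

Section GoncharovSum.
Variables (A : comAlgType rat) (I : symb -> A).
Implicit Types (a b c : bool) (w u buf : seq bool).

(* The left factor of a term of the coproduct: [t] marks the letters that are
   kept, [a] is the last one and [buf] the run of letters dropped since. *)
Fixpoint lfac a buf w (t : bitseq) b : A :=
  match w, t with
  | c :: w', true :: t' => I (a, buf, c) * lfac c [::] w' t' b
  | c :: w', false :: t' => lfac a (rcons buf c) w' t' b
  | _, _ => I (a, buf ++ w, b)
  end.

Lemma lfac_cat a buf w1 t1 c w2 t2 b : size t1 = size w1 ->
  lfac a buf (w1 ++ c :: w2) (t1 ++ true :: t2) b =
  lfac a buf w1 t1 c * lfac c [::] w2 t2 b.
Proof.
elim: w1 t1 a buf => [|d w1 IHw] [|[] t1] a buf //=.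
- by rewrite cats0.
- by case=> /IHw->; rewrite mulrA.
- by case=> /IHw->.
Qed.

Lemma lfac_nosel a buf w b n : lfac a buf w (nseq n false) b = I (a, buf ++ w, b).
Proof.
elim: w n a buf => [|c w IHw] [|n] a buf //=.
by rewrite IHw cat_rcons.
Qed.

Hypothesis I_rev : forall a w b, I (a, w, b) = (-1) ^+ size w *: I (b, rev w, a).

(** Each segment is reversed and contributes the sign of its length; the lengths add up to the
    number of dropped letters. *)
Lemma lfac_rev a w t b : size t = size w ->
  lfac a [::] w t b =
  (-1) ^+ (size w - count id t) *: lfac b [::] (rev w) (rev t) a.
Proof.
elim: {w}_.+1 {-2}w (ltnSn (size w)) a t b => // N IHN w wN a t b tw.
have [tt|] := boolP (has id t); last first.
  rewrite has_count -leqNgt leqn0 => /eqP t0.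
  have -> : t = nseq (size w) false.
    rewrite -tw; elim: (t) t0 => //= -[] // t' IHt' /IHt' e.
    by rewrite {1}e.
  rewrite count_nseq mul0n subn0 rev_nseq !lfac_nosel /=.
  exact: I_rev.
have [j [t2 tE]] : exists j t2, t = nseq j false ++ true :: t2.
  elim: (t) tt => //= -[] t' IHt' tt; first by exists 0%N, t'.
  by have [j [t2 ->]] := IHt' tt; exists j.+1, t2.
have jw : (j < size w)%N by rewrite -tw tE size_cat /= size_nseq addnS ltnS leq_addr.
have wE : w = take j w ++ nth false w j :: drop j.+1 w.
  by rewrite -drop_nth // cat_take_drop.
set c := nth false w j in wE; set p := take j w in wE; set q := drop j.+1 w in wE.
have pj : size p = j by rewrite size_take jw.
have tq : size t2 = size q.
  by move: tw; rewrite tE wE !size_cat /= size_nseq pj; lia.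
rewrite tE wE lfac_cat ?size_nseq ?pj // lfac_nosel.
have revE (T : Type) (s1 s2 : seq T) x : rev (s1 ++ x :: s2) = rev s2 ++ x :: rev s1.
  by rewrite rev_cat rev_cons cat_rcons.
rewrite !revE lfac_cat ?size_rev // rev_nseq lfac_nosel.
rewrite IHN //; last by move: wN; rewrite wE size_cat /= pj; lia.
rewrite I_rev -scalerAl -scalerAr scalerA mulrC -exprD.
congr (_ ^+ _ *: _); last by rewrite mulrC.
have := count_size id t2; rewrite tq => cq.
rewrite !size_cat count_cat count_nseq /= mul0n pj add0n add1n addnS subSS.
by rewrite addnC addnBA.
Qed.

Variable V : zmodType.
Implicit Type F : A -> seq bool -> V.

Definition sel F a buf c (x : A) u : V := F (I (a, buf, c) * x) (c :: u).

(** The sum over all choices of kept letters, arranged as a recursion along the word ([gsumE]):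
    [sel] records in [F] each completed segment and kept letter. *)
Fixpoint gsum F a buf w b : V :=
  if w is c :: w' then
    gsum (sel F a buf c) c [::] w' b + gsum F a (rcons buf c) w' b
  else F (I (a, buf, b)) [::].

Lemma gsum_cons F a buf c w b : gsum F a buf (c :: w) b =
  gsum (sel F a buf c) c [::] w b + gsum F a (rcons buf c) w b.
Proof. by []. Qed.

Lemma gsumE F a buf w b :
  gsum F a buf w b = \sum_(t <- bits (size w)) F (lfac a buf w t b) (mask t w).
Proof.
elim: w F a buf => [|c w IHw] F a buf; first by rewrite /= big_seq1 cats0.
by rewrite /= big_cat !big_map !IHw.
Qed.

Lemma eq_gsum F F' a buf w b : (forall x u, F x u = F' x u) ->
  gsum F a buf w b = gsum F' a buf w b.
Proof. by move=> FF'; rewrite !gsumE; apply: eq_bigr. Qed.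

Lemma gsum_sum (J : Type) (r : seq J) (F : J -> A -> seq bool -> V) a buf w b :
  \sum_(i <- r) gsum (F i) a buf w b =
  gsum (fun x u => \sum_(i <- r) F i x u) a buf w b.
Proof.
rewrite gsumE exchange_big; apply: eq_bigr => i _.
by rewrite gsumE.
Qed.

Lemma gsumD F F' a buf w b :
  gsum F a buf w b + gsum F' a buf w b = gsum (fun x u => F x u + F' x u) a buf w b.
Proof. by rewrite !gsumE big_split. Qed.

Lemma gsum0 F a buf w b : (forall x u, F x u = 0) -> gsum F a buf w b = 0.
Proof. by move=> F0; rewrite gsumE big1. Qed.

Definition ins_sum (phi : seq bool -> V) u : V :=
  \sum_(p < (size u).+1) phi (insert_at p false u).

Hypothesis I_unit : forall a b, I (a, [::], b) = 1.
Hypothesis I_path : forall a w b x, I (a, w, b) =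
  \sum_(k < (size w).+1) I (a, take k w, x) * I (x, drop k w, b).
Hypothesis I_insert0 : forall a w b,
  \sum_(p < (size w).+1) I (a, insert_at p false w, b) = 0.

Lemma sum_insert_rcons (phi : seq bool -> V) buf c :
  \sum_(p < (size buf).+1) phi (rcons (insert_at p false buf) c) =
  \sum_(p < size (rcons buf c)) phi (insert_at p false (rcons buf c)).
Proof.
rewrite size_rcons; apply: eq_bigr => p _; congr phi.
rewrite /insert_at -!cats1 -catA take_cat drop_cat.
case: ltnP => [//|pb]; have -> : nat_of_ord p = size buf.
  by apply/eqP; rewrite eqn_leq pb -ltnS ltn_ord.
by rewrite subnn take_size drop_size /= cats0.
Qed.

(** A letter 0 is inserted everywhere and is then dropped or kept. Dropped, its insertions into one
    segment add up to zero by [I_insert0]. Kept, it cuts a segment in two and [I_path] glues the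
    halves, so that what remains is its insertion into the kept word. The two sums over
    [p < size buf] account for insertions into the pending run; the last place of the run is already
    the first place of [w]. *)
Lemma gsum_insert0 F a buf w b :
    (forall u, {morph F^~ u : x y / x + y}) ->
  ins_sum (fun w' => gsum F a buf w' b) w +
  \sum_(p < size buf) gsum F a (insert_at p false buf) w b +
  \sum_(p < size buf) gsum (sel F a (take p buf) false) false (drop p buf) w b =
  gsum (fun x => ins_sum (F x)) a buf w b.
Proof.
elim: w F a buf => [|c w IHw] F a buf FD.
  have F0 u : F 0 u = 0 by apply: (addrI (F 0 u)); rewrite -FD !addr0.
  rewrite /ins_sum big_ord1 /= big_ord1.
  transitivity (\sum_(p < (size buf).+1) F (I (a, insert_at p false buf, b)) [::] +
     \sum_(p < (size buf).+1)
       F (I (a, take p buf, false) * I (false, drop p buf, b)) [:: false]).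
    rewrite !big_ord_recr /= /insert_at take_size drop_size I_unit mulr1 -cats1.
    rewrite /sel mulr1 -!addrA [LHS]addrC -!addrA addrCA.
    by [].
  rewrite -(big_morph (F^~ _) (FD _) (F0 _)) -(big_morph (F^~ _) (FD _) (F0 _)).
  by rewrite I_insert0 F0 add0r -I_path.
have F0 u : F 0 u = 0 by apply: (addrI (F 0 u)); rewrite -FD !addr0.
have selD buf' d u : {morph (sel F a buf' d)^~ u : x y / x + y}.
  by move=> x y; rewrite /sel mulrDr FD.
have ac (s t i j y z : V) : s + t + (i + j) + y + z = (s + z) + (t + y) + (i + j).
  rewrite -!addrA; congr (s + _); rewrite [RHS]addrCA; congr (t + _).
  by rewrite addrA [RHS]addrA [RHS]addrC [z + y]addrC.
have IH1 := IHw (sel F a buf c) c [::] (selD buf c).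
rewrite !big_ord0 !addr0 in IH1.
have IH2 := IHw F a (rcons buf c) FD.
have XE : ins_sum (fun w' => gsum F a buf w' b) (c :: w) =
    gsum (sel F a buf false) false [::] (c :: w) b +
    gsum F a (rcons buf false) (c :: w) b +
    (ins_sum (fun w' => gsum (sel F a buf c) c [::] w' b) w +
     ins_sum (fun w' => gsum F a (rcons buf c) w' b) w).
  by rewrite /ins_sum big_ord_recl -big_split.
(* Insertions into the run that are dropped: if [c] is kept they add up to zero, otherwise the run
   grows by [c]. *)
have E1 : gsum F a (rcons buf false) (c :: w) b +
    \sum_(p < size buf) gsum F a (insert_at p false buf) (c :: w) b =
    \sum_(p < size (rcons buf c)) gsum F a (insert_at p false (rcons buf c)) w b.
  rewrite -(sum_insert_rcons (fun buf' => gsum F a buf' w b)).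
  transitivity (\sum_(p < (size buf).+1) gsum F a (insert_at p false buf) (c :: w) b).
    rewrite big_ord_recr addrC /=; congr (_ + _).
    by rewrite /insert_at take_size drop_size cats1.
  rewrite big_split /= gsum_sum gsum0 ?add0r // => x u.
  rewrite /sel -(big_morph (F^~ _) (FD _) (F0 _)) -mulr_suml I_insert0.
  by rewrite mul0r F0.
(* Insertions into the run that are kept: if [c] is kept, the two pieces are glued into one segment
   and 0 precedes [c] in the kept word; otherwise the run grows by [c]. *)
have E2 : gsum (sel F a buf false) false [::] (c :: w) b +
    \sum_(p < size buf) gsum (sel F a (take p buf) false) false (drop p buf) (c :: w) b =
    gsum (fun x u => F (I (a, buf, c) * x) (false :: c :: u)) c [::] w b +
    \sum_(p < size (rcons buf c))
      gsum (sel F a (take p (rcons buf c)) false) false (drop p (rcons buf c)) w b.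
  have -> : gsum (fun x u => F (I (a, buf, c) * x) (false :: c :: u)) c [::] w b =
    \sum_(p < (size buf).+1)
      gsum (sel (sel F a (take p buf) false) false (drop p buf) c) c [::] w b.
    rewrite gsum_sum; apply: eq_gsum => x u.
    rewrite /sel -(big_morph (F^~ _) (FD _) (F0 _)); congr F.
    by rewrite (I_path a buf c false) mulr_suml; apply: eq_bigr => p _; rewrite mulrA.
  have -> : \sum_(p < size (rcons buf c))
      gsum (sel F a (take p (rcons buf c)) false) false (drop p (rcons buf c)) w b =
    \sum_(p < (size buf).+1)
      gsum (sel F a (take p buf) false) false (rcons (drop p buf) c) w b.
    rewrite size_rcons; apply: eq_bigr => p _.
    have pb : (p <= size buf)%N by rewrite -ltnS.
    by rewrite -cats1 takel_cat // drop_cat -cats1; case: ltnP => // h;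
      have -> : nat_of_ord p = size buf by [apply/eqP; rewrite eqn_leq pb];
      rewrite subnn drop_size drop0.
  transitivity (\sum_(p < (size buf).+1)
      gsum (sel F a (take p buf) false) false (drop p buf) (c :: w) b).
    by rewrite big_ord_recr addrC /= take_size drop_size.
  by rewrite big_split.
rewrite XE ac E1 E2 IH1 gsum_cons.
have -> : gsum (sel (fun x => ins_sum (F x)) a buf c) c [::] w b =
    gsum (fun x u => F (I (a, buf, c) * x) (false :: c :: u)) c [::] w b +
    gsum (fun x => ins_sum (sel F a buf c x)) c [::] w b.
  rewrite gsumD; apply: eq_gsum => x u.
  by rewrite /sel /ins_sum big_ord_recl.
rewrite -IH2 -!addrA; congr (_ + _).
by rewrite addrA [LHS]addrC -addrA; congr (_ + (_ + _)); rewrite addrC.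
Qed.

End GoncharovSum.

Section GoncharovFormula.
Variables (A : comAlgType rat) (I : symb -> A).
Implicit Types (a b c : bool) (w u buf L : seq bool).

Fixpoint pair_prod (G : nat -> nat -> A) (i : nat) (ps : seq nat) (e : nat) : A :=
  if ps is p :: ps' then G i p * pair_prod G p ps' e else G i e.

Lemma pair_prodE G i ps e :
  \prod_(p < (size ps).+1) G (nth 0%N (i :: rcons ps e) p) (nth 0%N (i :: rcons ps e) p.+1) =
  pair_prod G i ps e.
Proof.
elim: ps i => [|p ps IHps] i; first by rewrite big_ord1.
by rewrite big_ord_recl /= -IHps.
Qed.

Definition segm L (i j : nat) : symb :=
  (nth false L i, take (j - i.+1) (drop i.+1 L), nth false L j).

Lemma segmE L i a buf c w : drop i L = a :: buf ++ c :: w ->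
  segm L i (i + size buf).+1 = (a, buf, c).
Proof.
move=> LE.
have nthE k : nth false L (i + k) = nth false (a :: buf ++ c :: w) k.
  by rewrite -nth_drop LE.
rewrite /segm -addnS nthE -[X in nth _ _ X]addn0 nthE /= nth_cat ltnn subnn.
rewrite addnS subSS addKn -add1n -drop_drop LE /= drop0.
by rewrite take_size_cat.
Qed.

Lemma pair_prod_lfac L i a buf w t b :
  drop i L = a :: buf ++ rcons w b -> size t = size w ->
  pair_prod (fun i j => I (segm L i j)) i
    (mask t (iota (i + size buf).+1 (size w))) (i + size buf + size w).+1 =
  lfac I a buf w t b.
Proof.
elim: w t i a buf => [|c w IHw] [|x t] i a buf //= LE tw.
  by rewrite addn0 (segmE LE) cats0.
case: tw => tw; case: x => /=.
- rewrite (segmE LE); congr (_ * _).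
  have /IHw : drop (i + size buf).+1 L = c :: [::] ++ rcons w b.
    by rewrite -addnS -addnC -drop_drop LE /= drop_size_cat.
  by rewrite addn0 => /(_ _ tw) <-; rewrite addSnnS.
- have /IHw : drop i L = a :: rcons buf c ++ rcons w b by rewrite LE cat_rcons.
  by move=> /(_ _ tw) <-; rewrite size_rcons !addnS !addSn.
Qed.

End GoncharovFormula.

Lemma positions_mask (s : symb) (S : {set 'I_(size s.1.2)}) :
  positions S = mask [seq i \in S | i <- enum 'I_(size s.1.2)] (iota 1 (size s.1.2)).
Proof.
have -> : iota 1 (size s.1.2) = [seq (val i).+1 | i <- enum 'I_(size s.1.2)].
  transitivity (map succn (map val (enum 'I_(size s.1.2)))).
    by rewrite val_enum_ord -[1%N]addn0 iotaDl.
  by rewrite -map_comp.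
rewrite -map_mask -filter_mask /positions; congr map.
by rewrite enumT /enum_mem.
Qed.

Section TensorRelations.
Variables (K : comNzRingType) (U V : lmodType K).
Implicit Types (u : U) (v : V).

Lemma tens_rel (x : {malg K[(U * V)%type]}) : bilin_rel x -> \pi_(tensor U V) x = 0.
Proof.
move=> xrel; apply/eqP.
rewrite -[0](raddf0 (\pi_(tensor U V) : {additive {malg K[(U * V)%type]} -> tensor U V})).
by rewrite -Quotient.idealrBE subr0; apply: lin_span_gen.
Qed.

Lemma tensDl u u' v : tens (u + u') v = tens u v + tens u' v.
Proof.
apply/eqP; rewrite -subr_eq0 opprD addrA /tens -!raddfB.
by apply/eqP/tens_rel/BilinAddl.
Qed.

Lemma tensDr u v v' : tens u (v + v') = tens u v + tens u v'.
Proof.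
apply/eqP; rewrite -subr_eq0 opprD addrA /tens -!raddfB.
by apply/eqP/tens_rel/BilinAddr.
Qed.

Lemma tensZl a u v : tens (a *: u) v = a *: tens u v.
Proof.
transitivity (tensor_scale a (tens u v)); last by [].
rewrite /tens pi_tensor_scale; apply/eqP; rewrite -subr_eq0 -raddfB.
by apply/eqP/tens_rel/BilinScalel.
Qed.

Lemma tensZr a u v : tens u (a *: v) = a *: tens u v.
Proof.
transitivity (tensor_scale a (tens u v)); last by [].
rewrite /tens pi_tensor_scale; apply/eqP; rewrite -subr_eq0 -raddfB.
by apply/eqP/tens_rel/BilinScaler.
Qed.

Lemma tens0l v : tens (0 : U) v = 0.
Proof. by apply: (addrI (tens (0 : U) v)); rewrite -tensDl !addr0. Qed.

Lemma tens0r u : tens u (0 : V) = 0.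
Proof. by apply: (addrI (tens u (0 : V))); rewrite -tensDr !addr0. Qed.

Lemma tens_sumr (J : Type) (r : seq J) u (v : J -> V) :
  tens u (\sum_(i <- r) v i) = \sum_(i <- r) tens u (v i).
Proof. exact: (big_morph (tens u) (tensDr u) (tens0r u)). Qed.

End TensorRelations.

Section TensorSum.
Variables (A : comAlgType rat) (I : symb -> A).
Implicit Types (a b c : bool) (w u : seq bool).
Local Notation T := (tensor A A).

Definition tensor_goncharov a w b : T :=
  gsum I (fun x u => tens x (I (a, u, b))) a [::] w b.

Hypothesis I_unit : forall a b, I (a, [::], b) = 1.
Hypothesis I_loop : forall a w, w != [::] -> I (a, w, a) = 0.
Hypothesis I_path : forall a w b x, I (a, w, b) =
  \sum_(k < (size w).+1) I (a, take k w, x) * I (x, drop k w, b).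
Hypothesis I_insert0 : forall a w b,
  \sum_(p < (size w).+1) I (a, insert_at p false w, b) = 0.
Hypothesis I_rev : forall a w b, I (a, w, b) = (-1) ^+ size w *: I (b, rev w, a).

(** The relation [I(0;0;1) = 0] passes to the coproduct: by [gsum_insert0] the inserted 0 ends up in
    the right factor, where its insertions cancel again. *)
Lemma tensor_goncharov_insert0 a w b :
  \sum_(w' <- sh [:: false] w) tensor_goncharov a w' b = 0.
Proof.
rewrite (sum_sh1 (fun w' => tensor_goncharov a w' b)).
have := gsum_insert0 I_unit I_path I_insert0 (F := fun x u => tens x (I (a, u, b))) a [::] w b.
rewrite !big_ord0 !addr0 => h; rewrite [LHS]h => [|u x y]; last exact: tensDl.
apply: gsum0 => x u; rewrite /ins_sum -tens_sumr I_insert0.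
exact: tens0r.
Qed.

Lemma mask_nil (t : bitseq) w : size t = size w -> mask t w = [::] -> t = nseq (size w) false.
Proof. by elim: t w => [|[] t IHt] [|c w] //= [tw] /(IHt _ tw) <-. Qed.

(** Keeping no letter makes the left factor a loop; keeping some makes the right factor one. *)
Lemma tensor_goncharov_loop a w : w != [::] -> tensor_goncharov a w a = 0.
Proof.
move=> w0; rewrite /tensor_goncharov gsumE big_seq big1 // => t.
rewrite mem_bits => /eqP tw; case: (eqVneq (mask t w) [::]) => [/(mask_nil tw) ->|m0].
  by rewrite lfac_nosel I_loop // tens0l.
by rewrite (I_loop a m0) tens0r.
Qed.

Lemma tensor_goncharov_nil a b : tensor_goncharov a [::] b = tens 1 1.
Proof. by rewrite /tensor_goncharov /= !I_unit. Qed.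

(** The sign of the left factor counts the dropped letters, that of the right factor the kept
    ones. *)
Lemma tensor_goncharov_rev a w b :
  tensor_goncharov a w b = (-1) ^+ size w *: tensor_goncharov b (rev w) a.
Proof.
rewrite /tensor_goncharov !gsumE size_rev.
rewrite -[in RHS](perm_big _ (perm_bits_rev (size w))) big_map /= scaler_sumr.
apply: eq_big_seq => t; rewrite mem_bits => /eqP tw.
rewrite (lfac_rev I_rev) // [I (a, mask t w, b)]I_rev tensZl tensZr scalerA -exprD.
have -> : (size w - count id t + size (mask t w) = size w)%N.
  by rewrite size_mask // subnK // -tw count_size.
by rewrite rev_mask.
Qed.

End TensorSum.

Lemma goncharov_formulaE (s : symb) :
  goncharov_formula s = tensor_goncharov I1 s.1.1 s.1.2 s.2.
Proof.
case: s => [[a w] b]; rewrite /goncharov_formula /tensor_goncharov gsumE /=.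
rewrite -(@sum_set_bits _ (size w)).
apply: eq_bigr => S _; set t := [seq i \in S | i <- _].
have tw : size t = size w by rewrite size_map size_enum_ord.
have pE : positions (s := (a, w, b)) S = mask t (iota 1 (size w)).
  exact: (@positions_mask (a, w, b)).
have L : left_factor (s := (a, w, b)) S = lfac I1 a [::] w t b.
  rewrite /left_factor pE.
  have -> : #|S| = size (mask t (iota 1 (size w))).
    by rewrite -pE size_map -cardE.
  have := @pair_prod_lfac _ I1 (a :: rcons w b) 0 a [::] w t b (drop0 _) tw.
  by rewrite !add0n => <-; rewrite -pair_prodE.
have R : right_factor (s := (a, w, b)) S = I1 (a, mask t w, b).
  rewrite /right_factor pE map_mask.
  have -> : [seq nth false (a :: rcons w b) i | i <- iota 1 (size w)] = w; last by [].
  apply: (@eq_from_nth _ false); rewrite ?size_map ?size_iota // => i iw.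
  by rewrite (nth_map 0%N) ?size_iota // nth_iota //= nth_rcons iw.
by rewrite L R.
Qed.

Lemma I1_insert_at0 a w b : \sum_(p < (size w).+1) I1 (a, insert_at p false w, b) = 0.
Proof. by rewrite -(sum_sh1 (fun w' => I1 (a, w', b))) I1_insert0. Qed.

Definition goncharov_sha : Sha -> tensor calI1 calI1 :=
  slext (fun w => tensor_goncharov I1 false w true).

HB.instance Definition _ :=
  GRing.isLinear.Build rat Sha (tensor calI1 calI1) *:%R goncharov_sha
    (linearP (slext (fun w => tensor_goncharov I1 false w true))).

Lemma goncharov_shaU w : goncharov_sha (wd w) = tensor_goncharov I1 false w true.
Proof. exact: slextU. Qed.

Lemma goncharov_sha_lreg x : goncharov_sha (lreg false x) = goncharov_sha x.
Proof.
apply: (linear_lreg (f := goncharov_sha)) => y.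
elim/Sha_ind: y => [|w|a y z IH IH'].
- by rewrite mulr0 linear0.
- rewrite wdM linear_sum.
  rewrite -[RHS](tensor_goncharov_insert0 I1_unit I1_path I1_insert_at0 false w true).
  by apply: eq_bigr => w' _; exact: goncharov_shaU.
- by rewrite mulrDr -scalerAr linearP IH IH' scaler0 addr0.
Qed.

(** A map defined on words and composed with [kappa] is well defined and linear from the start; what
    remains is that the formula respects regularisation, loops and reversal. *)
Lemma coproduct_exists : is_coproduct (goncharov_sha \o kappa).
Proof.
split=> [a x y|s].
  have k : kappa (a *: x + y) = a *: kappa x + kappa y.
    by rewrite (rmorphD kappa) kappaZ.
  transitivity (goncharov_sha (a *: kappa x + kappa y)); first by rewrite -k.
  by rewrite linearP.
transitivity (goncharov_sha (kappa (I1 s))); first by [].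
rewrite kappaE goncharov_sha_lreg goncharov_formulaE; case: s => [[a w] b] /=.
case: (eqVneq a b) => [->|ab].
  have [->|w0] := eqVneq w [::].
    by rewrite -wd0 goncharov_shaU !(tensor_goncharov_nil I1_unit).
  by rewrite linear0 (tensor_goncharov_loop I1_loop).
case: a b ab => -[] // _; last exact: goncharov_shaU.
rewrite linearZ /= goncharov_shaU.
by rewrite [RHS](tensor_goncharov_rev I1_rev).
Qed.

Lemma coproductE s : coproduct (I1 s) = goncharov_formula s.
Proof.
have /= h := xgetPex (fun=> 0) (ex_intro is_coproduct _ coproduct_exists).
by case: h => _ h; exact: h.
Qed.

(** * Regularised multiple zeta values *)

Lemma sh_last (T : eqType) (x0 : T) u v w : last x0 u = x0 -> last x0 v = x0 ->
  w \in sh u v -> last x0 w = x0.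
Proof.
elim: u v w => [|a u IHu] v w; first by rewrite sh0s inE => _ ? /eqP->.
elim: v w => [|b v IHv] w ua vb; first by rewrite shs0 inE => /eqP->.
have tl c s y : last x0 (c :: s) = x0 -> last x0 y = x0 ->
    (s = [::] -> c = x0) -> (y = [::] -> c = x0) -> last x0 (c :: y) = x0.
  by case: y => [|d y] //= _ _ _ ->.
rewrite sh_cons mem_cat => /orP[] /mapP[w' w'P ->].
  have lw : last x0 w' = x0 by apply: IHu w'P => //; case: (u) ua.
  by case: w' w'P lw => //; move=> /size_sh; case: (u) => //=.
have lw : last x0 w' = x0 by apply: IHv w'P => //; case: (v) vb.
by case: w' w'P lw => //; move=> /size_sh.
Qed.

Section Convolution.
Variable R : comNzRingType.
Implicit Types f g h : nat -> R.

Definition conv f g (M : nat) : R := \sum_(i < M.+1) f i * g (M - i)%N.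

Lemma conv_poly N f g M : (M < N)%N ->
  conv f g M = ((\poly_(i < N) f i) * (\poly_(i < N) g i))`_M.
Proof.
move=> MN; rewrite coefM; apply: eq_bigr => i _; rewrite !coef_poly.
by rewrite (leq_ltn_trans (leq_subr _ _) MN) (leq_trans (ltn_ord i) MN).
Qed.

Lemma convC f g M : conv f g M = conv g f M.
Proof. by rewrite !(@conv_poly M.+1) // mulrC. Qed.

Lemma convA f g h M : conv (conv f g) h M = conv f (conv g h) M.
Proof.
transitivity ((\poly_(i < M.+1) f i * \poly_(i < M.+1) g i * \poly_(i < M.+1) h i)`_M).
  rewrite coefM; apply: eq_bigr => i _; rewrite -(@conv_poly M.+1) //.
  by rewrite coef_poly ltnS leq_subr.
rewrite -mulrA coefM; apply: eq_bigr => i _; rewrite -(@conv_poly M.+1) ?ltnS ?leq_subr //.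
by rewrite coef_poly ltn_ord.
Qed.

Lemma eq_conv f f' g g' M : (forall i, (i <= M)%N -> f i = f' i) ->
  (forall i, (i <= M)%N -> g i = g' i) -> conv f g M = conv f' g' M.
Proof.
by move=> ff gg; apply: eq_bigr => i _; rewrite ff ?gg ?leq_subr // -ltnS.
Qed.

Lemma conv_natM f g M :
  conv f g M *+ M = conv (fun i => f i *+ i) g M + conv f (fun i => g i *+ i) M.
Proof.
rewrite -sumrMnl -big_split; apply: eq_bigr => i _.
by rewrite /= mulrnAl mulrnAr -mulrnDr subnKC // -ltnS.
Qed.

Lemma sum_conv f g K : \sum_(M < K) conv f g M = \sum_(i < K) f i * \sum_(j < K - i) g j.
Proof.
elim: K => [|K IHK]; first by rewrite !big_ord0.
rewrite big_ord_recr /= IHK [RHS]big_ord_recr /= subSnn big_ord1.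
rewrite /conv big_ord_recr /= subnn addrA -big_split; congr (_ + _).
apply: eq_bigr => i _; rewrite /= -mulrDr; congr (_ * _).
by rewrite subSn 1?ltnW // big_ord_recr.
Qed.

End Convolution.

(** * Coefficients of multiple polylogarithms *)

Section Polylog.
Variable R : realType.
Implicit Types (u v w : seq bool) (M K : nat).

(* The coefficients of the multiple polylogarithm of a word read from right to
   left: prepending a letter integrates against dt/t or dt/(1-t). *)
Fixpoint li w M : R :=
  match w with
  | [::] => (M == 0)%:R
  | true :: w' => M%:R^-1 * \sum_(m < M) li w' m
  | false :: w' => M%:R^-1 * li w' M
  end.

Definition psum w K : R := \sum_(M < K) li w M.

Lemma li_ge0 w M : 0 <= li w M.
Proof.
elim: w M => [|[] w IHw] M /=; first by rewrite ler0n.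
  by rewrite mulr_ge0 ?invr_ge0 ?ler0n // sumr_ge0.
by rewrite mulr_ge0 ?invr_ge0 ?ler0n.
Qed.

Lemma li0 w : w != [::] -> li w 0 = 0.
Proof. by case: w => [|[] w] //= _; rewrite invr0 mul0r. Qed.

(** On coefficients, multiplication by [t / (1 - t)] or by 1: what [t d/dt] leaves of the two kinds
    of integration. *)
Let bw (c : bool) (f : nat -> R) (M : nat) : R := if c then \sum_(m < M) f m else f M.
Let pos (M : nat) : R := (0 < M)%N%:R.

Lemma bw_conv c f M : bw c f M = if c then conv f pos M else f M.
Proof.
case: c => //=; rewrite /conv big_ord_recr /= subnn /pos mulr0 addr0.
by apply: eq_bigr => i _; rewrite subn_gt0 ltn_ord mulr1.
Qed.

Lemma conv_bwl c f g M : conv (bw c f) g M = bw c (conv f g) M.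
Proof.
rewrite bw_conv; case: c; last by apply: eq_conv.
rewrite convA (eq_conv (f' := conv f pos) (g' := g)) => [|i _|//]; last exact: bw_conv true f i.
rewrite convA; apply: eq_conv => // i _; exact: convC.
Qed.

Lemma conv_bwr c f g M : conv f (bw c g) M = bw c (conv f g) M.
Proof.
rewrite convC conv_bwl; case: c => //=; last exact: convC.
by apply: eq_bigr => i _; exact: convC.
Qed.

Lemma li_cons c w M : last true (c :: w) -> li (c :: w) M *+ M = bw c (li w) M.
Proof.
move=> cw; case: M => [|M].
  by rewrite mulr0n /bw; case: c cw => /= cw; rewrite ?big_ord0 // li0 //; case: (w) cw.
rewrite -mulr_natl; case: c cw => /= _; by rewrite mulVKf ?pnatr_eq0.
Qed.

Lemma bw_sum c (r : seq (seq bool)) M :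
  bw c (fun i => \sum_(w <- r) li w i) M = \sum_(w <- r) bw c (li w) M.
Proof. by rewrite /bw; case: c => //; rewrite exchange_big. Qed.

Lemma eq_bw c f g M : f =1 g -> bw c f M = bw c g M.
Proof. by move=> fg; rewrite /bw; case: c => //; apply: eq_bigr => i _. Qed.

Lemma conv_li0 f M : conv (li [::]) f M = f M.
Proof.
rewrite /conv big_ord_recl subn0 mul1r big1 ?addr0 // => i _.
by rewrite /= mul0r.
Qed.

(** Multiplying the coefficient of index [M] by [M] is [t d/dt], a derivation for [conv]. It strips
    the first letter of either word, which is the recursion of [sh]; the last letter 1 keeps the
    constant series from being integrated against [dt/t]. *)
Lemma li_shuffle u v M : last true u -> last true v ->
  conv (li u) (li v) M = \sum_(w <- sh u v) li w M.
Proof.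
have lc c w : last true (c :: w) -> last true w by case: w.
elim: u v M => [|c u IHu] v M uT vT.
  by rewrite sh0s big_seq1 conv_li0.
elim: v M vT => [|d v IHv] M vT.
  by rewrite shs0 big_seq1 convC conv_li0.
case: M => [|M].
  rewrite /conv big_ord1 li0 // mul0r big1_seq // => w /andP[_ /size_sh ws].
  by rewrite li0 // -size_eq0 ws.
apply: (pmulrnI (ltn0Sn M)); move: M.+1 => {}M.
rewrite conv_natM -sumrMnl.
rewrite (eq_conv (f' := bw c (li u)) (g' := li (d :: v))) => [|i _|//]; last exact: li_cons.
rewrite (eq_conv (f := li (c :: u)) (f' := li (c :: u)) (g' := bw d (li v))) => [|//|i _]; last exact: li_cons.
rewrite conv_bwl conv_bwr (eq_bw _ _ (fun i => IHu _ i (lc _ _ uT) vT)).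
rewrite (eq_bw _ _ (fun i => IHv i (lc _ _ vT))) !bw_sum sum_sh_cons.
have ww w : w \in sh (c :: u) (d :: v) -> last true w.
  by move=> /(sh_last uT vT) ->.
congr (_ + _); apply: eq_big_seq => w ws; rewrite li_cons //; apply: ww;
  rewrite sh_cons mem_cat map_f ?orbT //.
Qed.

Lemma psumS w K : psum w K.+1 = psum w K + li w K.
Proof. by rewrite /psum big_ord_recr. Qed.

Lemma psum_ge0 w K : 0 <= psum w K.
Proof. by apply: sumr_ge0 => i _; exact: li_ge0. Qed.

Lemma psum_nd w : {homo psum w : K K' / (K <= K')%N >-> K <= K'}.
Proof.
by apply/nondecreasing_seqP => K; rewrite psumS lerDl li_ge0.
Qed.

Lemma sqrt_step M : (Num.sqrt M.+1%:R)^-1 <= 2 * (Num.sqrt M.+1%:R - Num.sqrt M%:R) :> R.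
Proof.
set a := Num.sqrt M.+1%:R; set b := Num.sqrt M%:R.
have a0 : 0 < a by rewrite sqrtr_gt0 ltr0n.
have b0 : 0 <= b by rewrite sqrtr_ge0.
have a2 : a ^+ 2 = M%:R + 1 by rewrite sqr_sqrtr ?ler0n // -natr1.
have b2 : b ^+ 2 = M%:R by rewrite sqr_sqrtr ?ler0n.
rewrite -[leLHS]mul1r ler_pdivrMr //.
have : 0 <= (a - b) ^+ 2 by rewrite sqr_ge0.
nra.
Qed.

(** The true size is at most a power of [log M] over [M]; square roots are a cruder bound, stable
    under prepending either letter. *)
Lemma li_bound w : exists2 C : R, 1 <= C &
  forall M, li w M.+1 <= C * (Num.sqrt M.+1%:R)^-1 /\ psum w M.+1 <= C * Num.sqrt M.+1%:R.
Proof.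
have sge1 M : 1 <= Num.sqrt M.+1%:R :> R.
  by rewrite -[leLHS]sqrtr1 ler_sqrt ?ltr0n // ler1n.
have sV M : M.+1%:R^-1 * Num.sqrt M.+1%:R = (Num.sqrt M.+1%:R)^-1 :> R.
  have s0 : Num.sqrt M.+1%:R != 0 :> R by rewrite sqrtr_eq0 -ltNge ltr0n.
  by rewrite -{1}[M.+1%:R]sqr_sqrtr ?ler0n // expr2 invfM -mulrA mulVf // mulr1.
have aux v C : v != [::] -> 1 <= C ->
    (forall M, li v M.+1 <= C * (Num.sqrt M.+1%:R)^-1) ->
    exists2 C : R, 1 <= C & forall M, li v M.+1 <= C * (Num.sqrt M.+1%:R)^-1 /\
      psum v M.+1 <= C * Num.sqrt M.+1%:R.
  move=> v0 C1 vC; have C0 : 0 <= C by rewrite (le_trans _ C1).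
  exists (2 * C) => [|M]; first by lra.
  split; first by rewrite (le_trans (vC M)) // ler_wpM2r ?invr_ge0 ?sqrtr_ge0 //; lra.
  apply: (@le_trans _ _ (2 * C * Num.sqrt M%:R)); last first.
    by rewrite ler_wpM2l ?ler_sqrt ?ltr0n ?ler_nat //; lra.
  elim: M => [|M IHM]; first by rewrite /psum big_ord1 li0 // sqrtr0 mulr0.
  rewrite psumS; apply: (le_trans (lerD IHM (vC M))).
  have := ler_wpM2l C0 (sqrt_step M); lra.
elim: w => [|c w [C C1 IH]].
  exists 1 => // M; split; first by rewrite /= mul1r invr_ge0 sqrtr_ge0.
  by rewrite /psum big_ord_recl big1 // addr0 mul1r.
have C0 : 0 <= C by rewrite (le_trans _ C1).
apply: (aux _ C) => // M; case: c => /=.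
  rewrite -sV mulrCA ler_wpM2l ?invr_ge0 ?ler0n //.
  by have [_] := IH M.
have [h _] := IH M; apply: le_trans h.
by rewrite ler_piMl ?li_ge0 // invf_le1 ?ltr0n // ler1n.
Qed.

(** By [li_bound] the terms are [O(M ^ (-3/2))]; their sum is compared with [3 - 2 M ^ (-1/2)],
    whose increments dominate them and whose value at [M = 1] is 1. *)
Lemma psum_bound w : exists C : R, forall K, psum (false :: w) K <= C.
Proof.
have [C C1 wC] := li_bound w; have C0 : 0 <= C by rewrite (le_trans _ C1).
suff h M : psum (false :: w) M.+2 <= C * (3 - 2 * (Num.sqrt M.+1%:R)^-1).
  exists (C * 3) => K; apply: le_trans (psum_nd (false :: w) (leqW (leqnSn K))) _.
  apply: (le_trans (h K)); rewrite ler_wpM2l //.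
  have : 0 <= (Num.sqrt K.+1%:R)^-1 :> R by rewrite invr_ge0 sqrtr_ge0.
  lra.
elim: M => [|M IHM].
  rewrite /psum !big_ord_recr big_ord0 /= invr0 mul0r !add0r invr1 mul1r sqrtr1 invr1.
  by have [] := wC 0; rewrite sqrtr1 invr1; lra.
rewrite psumS; apply: (le_trans (lerD IHM _)).
  rewrite [li _ _]/=; apply: ler_wpM2l; first by rewrite invr_ge0.
  by have [h _] := wC M.+1; exact: h.
set a := Num.sqrt M.+2%:R; set b := Num.sqrt M.+1%:R.
have b0 : 0 < b by rewrite sqrtr_gt0 ltr0n.
have ab : b <= a by rewrite ler_sqrt ?ltr0n // ler_nat.
have a0 : 0 < a by rewrite (lt_le_trans b0).
have a2 : M.+2%:R = a ^+ 2 by rewrite sqr_sqrtr.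
rewrite a2; have := sqrt_step M.+1; rewrite -/a -/b => h.
suff : (a ^+ 2)^-1 * a^-1 <= 2 * b^-1 - 2 * a^-1 by nra.
have -> : 2 * b^-1 - 2 * a^-1 = 2 * (a - b) * (a^-1 * b^-1).
  by field; rewrite !gt_eqF.
apply: (@le_trans _ _ (a^-1 * (a^-1 * b^-1))); last first.
  by apply: ler_wpM2r => //; apply: mulr_ge0; rewrite invr_ge0 ltW.
have ai : 0 <= a^-1 by rewrite invr_ge0 ltW.
rewrite -exprVn expr2 -mulrA; apply: ler_wpM2l => //; apply: ler_wpM2l => //.
by rewrite lef_pV2.
Qed.

End Polylog.

Section MultipleZetaValues.
Variable R : realType.
Implicit Types (u v w : seq bool) (n : seq nat) (M K : nat).
Local Notation psum := (@psum R).
Local Notation li := (@li R).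

Lemma psum_cvg w : psum (false :: w) @ \oo --> limn (psum (false :: w)).
Proof.
have [C wC] := psum_bound R w.
apply: nondecreasing_is_cvgn; first exact: psum_nd.
by exists C => _ [K _ <-].
Qed.

(** The words of [H^0], read from right to left. *)
Definition H0r w := last true w && ~~ starts true w.

Lemma psum_cvg0 w : H0r w -> psum w @ \oo --> limn (psum w).
Proof.
case: w => [|[] w] //; last by move=> _; exact: psum_cvg.
  move=> _; suff h : psum [::] @ \oo --> (1 : R) by rewrite (cvg_lim _ h).
  apply: cvg_near_cst; exists 1%N => // -[|K] _ //=.
  by rewrite /psum big_ord_recl big1 // addr0.
by rewrite /H0r andbF.
Qed.

Lemma limn_psum_nil : limn (psum [::]) = 1.
Proof.
apply: cvg_lim => //; apply: cvg_near_cst; exists 1%N => // -[|K] _ //=.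
by rewrite /psum big_ord_recl big1 // addr0.
Qed.

Lemma psum_shuffle u v K : last true u -> last true v ->
  \sum_(w <- sh u v) psum w K = \sum_(i < K) li u i * psum v (K - i).
Proof.
move=> uT vT; rewrite -sum_conv exchange_big; apply: eq_bigr => i _.
by rewrite li_shuffle.
Qed.

(** The square [i, j < K] lies between the triangles [i + j < K] and [i + j < 2K], and all terms are
    nonnegative. *)
Lemma psum_shuffle_le u v K : last true u -> last true v ->
  \sum_(w <- sh u v) psum w K <= psum u K * psum v K <=
  \sum_(w <- sh u v) psum w (K + K).
Proof.
move=> uT vT; rewrite !psum_shuffle // mulr_suml; apply/andP; split.
  by apply: ler_sum => i _; rewrite ler_wpM2l ?li_ge0 // psum_nd // leq_subr.
rewrite big_split_ord /= -[leLHS]addr0 lerD //; last first.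
  by apply: sumr_ge0 => i _; rewrite mulr_ge0 ?li_ge0 ?psum_ge0.
apply: ler_sum => i _; rewrite ler_wpM2l ?li_ge0 // psum_nd //.
have := ltn_ord i; lia.
Qed.

Lemma limn_psum_shuffle u v : H0r u -> H0r v ->
  limn (psum u) * limn (psum v) = \sum_(w <- sh u v) limn (psum w).
Proof.
move=> uH vH; have [/andP[uT u1] /andP[vT v1]] := (uH, vH).
have wH w : w \in sh u v -> H0r w.
  by move=> ws; rewrite /H0r (sh_last uT vT ws) (sh_starts u1 v1 ws).
have cs : (fun K => \sum_(w <- sh u v) psum w K) @ \oo --> \sum_(w <- sh u v) limn (psum w).
  rewrite big_seq; under eq_fun do rewrite big_seq.
  by apply: cvg_big => [|w ws]; [exact: add_continuous|exact/psum_cvg0/wH].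
have c1 : (fun K => psum u K * psum v K) @ \oo --> limn (psum u) * limn (psum v).
  by apply: cvgM; exact: psum_cvg0.
have c2 : (fun K => psum u K * psum v K) @ \oo --> \sum_(w <- sh u v) limn (psum w).
  apply: (squeeze_cvgr (f := fun K => \sum_(w <- sh u v) psum w K)
                       (h := fun K => \sum_(w <- sh u v) psum w (K + K))).
  - by apply: nearW => K; exact: psum_shuffle_le.
  - exact: cs.
  - apply: (cvg_comp (fun K => (K + K)%N) (fun K => \sum_(w <- sh u v) psum w K) _ cs).
    move=> A [N _ NA]; exists N => // K /= NK; apply: NA => /=.
    by rewrite (leq_trans NK) // leq_addr.
exact: (cvg_unique _ c1 c2).
Qed.

Fixpoint incs (r K : nat) : seq (seq nat) :=
  if r is r'.+1 then flatten [seq [seq rcons m j.+1 | m <- incs r' j] | j <- iota 0 K]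
  else [:: [::]].

Lemma mem_incs r K (m : seq nat) :
  (m \in incs r K) = [&& size m == r, path ltn 0%N m & (last 0 m <= K)%N].
Proof.
elim: r K m => [|r IHr] K m; first by rewrite inE; case: m.
apply/flatten_mapP/and3P => [[j + /mapP[m' + ->]]|].
  rewrite mem_iota IHr => jK /and3P[/eqP m'r pm' lm'].
  by rewrite size_rcons m'r rcons_path pm' last_rcons /= !ltnS.
case: m / lastP => [[]|m j] //; rewrite size_rcons rcons_path last_rcons eqSS.
move=> [mr /andP[pm /= lm] jK]; exists j.-1; first by rewrite mem_iota; lia.
by apply/mapP; exists m; [rewrite IHr mr pm /=; lia|rewrite prednK //; lia].
Qed.

Lemma uniq_incs r K : uniq (incs r K).
Proof.
elim: r K => // r IHr K /=; apply: allpairs_uniq_dep => //=.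
- exact: iota_uniq.
- by move=> [j m] [j' m'] _ _ /= /rcons_inj[-> ->].
Qed.

Definition zterm n (m : seq nat) : R := \prod_(p <- zip m n) (p.1%:R ^- p.2).

Lemma rev_index_rcons n k : (0 < k)%N ->
  rev (index_word (rcons n k)) = nseq k.-1 false ++ true :: rev (index_word n).
Proof.
move=> k0; rewrite /index_word map_rcons flatten_rcons rev_cat rev_cons rev_nseq.
by rewrite cat_rcons.
Qed.

Lemma li_index n k M : (0 < k)%N ->
  li (rev (index_word (rcons n k))) M = M%:R ^- k * psum (rev (index_word n)) M.
Proof.
move=> k0; rewrite rev_index_rcons //.
have h j : li (nseq j false ++ true :: rev (index_word n)) M =
    M%:R ^- j.+1 * psum (rev (index_word n)) M.
  elim: j => [|j IHj] /=; first by rewrite expr1.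
  by rewrite IHj mulrA -invfM -exprS.
by rewrite h prednK.
Qed.

Lemma psum_incs n K : all (leq 1) n ->
  psum (rev (index_word n)) K.+1 = \sum_(m <- incs (size n) K) zterm n m.
Proof.
elim/last_ind: n K => [|n k IHn] K.
  by rewrite /psum /zterm big_seq1 big_nil big_ord_recl big1 ?addr0.
rewrite all_rcons => /andP[k0 n1]; rewrite /psum big_ord_recl li0; last first.
  by rewrite rev_index_rcons //; case: (k.-1).
rewrite add0r size_rcons /= big_flatten /= big_map.
have -> : iota 0 K = index_iota 0 K by rewrite /index_iota subn0.
rewrite big_mkord.
apply: eq_bigr => j _; rewrite /= /bump leq0n add1n li_index // IHn // big_map mulr_sumr.
apply: eq_big_seq => m; rewrite mem_incs => /and3P[/eqP mr _ _].
by rewrite /zterm zip_rcons // -cats1 big_cat big_seq1 mulrC.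
Qed.

Lemma zterm_ge0 n m : 0 <= zterm n m.
Proof. by apply: prodr_ge0 => p _; rewrite invr_ge0 exprn_ge0 ?ler0n. Qed.

Lemma H0r_index n : admissible n -> H0r (rev (index_word n)).
Proof.
case: n / lastP => [|n k] //; rewrite /admissible all_rcons last_rcons => /andP[/andP[k1 n1] k2].
rewrite rev_index_rcons // /H0r -(prednK k1) /=; case: k k2 {k1} => [|[|k]] //= _.
rewrite andbT last_cat /=.
elim/last_ind: n n1 => [|n j IHn] //; rewrite all_rcons => /andP[j1 n1].
by rewrite rev_index_rcons // last_cat /= IHn.
Qed.

Lemma mzeta_limn n : admissible n -> mzeta R n = limn (psum (rev (index_word n))).
Proof.
move=> nA; have n1 : all (leq 1) n by case/andP: nA.
set w := rev _; have cw := psum_cvg0 (H0r_index nA).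
have le_lim K : psum w K <= limn (psum w).
  by apply: nondecreasing_cvgn_le; [exact: psum_nd|apply/cvg_ex; exists (limn (psum w))].
rewrite /mzeta; set S := [set m | _].
suff -> : \esum_(m in S) (zterm n m)%:E = (limn (psum w))%:E by [].
apply/eqP; rewrite eq_le; apply/andP; split.
  apply: ub_ereal_sup => _ [A [Afin AS] <-].
  rewrite fsbig_finite //= sumEFin lee_fin.
  set s := fset_set A.
  (* A finite set of increasing sequences is contained in the set of those with last entry at most
     [K], so it is dominated by a partial sum. *)
  pose K := \max_(m <- s) last 0%N m.
  apply: le_trans (le_lim K.+1); rewrite psum_incs //.
  have sub : {subset s <= incs (size n) K}.
    move=> m ms; have : m \in A by rewrite -(in_fset_set Afin).
    rewrite inE => /AS [mn pm]; rewrite mem_incs mn eqxx pm /=.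
    by rewrite /K (big_rem m) //= leq_maxl.
  rewrite [leRHS](bigID (mem s)) /= -[leLHS]addr0 lerD ?sumr_ge0 // => [|*]; last exact: zterm_ge0.
  have E : perm_eq s [seq m <- incs (size n) K | m \in s]; last first.
    by rewrite -[leRHS]big_filter [leLHS](perm_big _ E).
  apply: uniq_perm; rewrite ?fset_uniq ?filter_uniq ?uniq_incs // => m.
  by rewrite mem_filter; case: (boolP (m \in s)) => //= /sub ->.
have ge K : ((psum w K.+1)%:E <= \esum_(m in S) (zterm n m)%:E)%E.
  rewrite psum_incs //; apply: esum_ge.
  exists [set m | m \in incs (size n) K].
    split; first exact: finite_seq.
    by move=> m /=; rewrite mem_incs => /and3P[/eqP ? ? _].
  by rewrite -fsbig_seq ?uniq_incs // sumEFin.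
case: (\esum_(m in S) _) ge => [x| |] ge.
- rewrite lee_fin; apply: limr_le; first by apply/cvg_ex; exists (limn (psum w)).
  by exists 1%N => // -[|K] //= _; have := ge K; rewrite lee_fin.
- by rewrite leey.
- by have := ge 0%N.
Qed.

End MultipleZetaValues.

(* An alias, since [S] may carry another structure of rational vector space. *)
Definition rat_mod (S : comNzRingType) (phi : {rmorphism rat -> S}) : Type := S.

Section RatModule.
Variables (S : comNzRingType) (phi : {rmorphism rat -> S}).
Local Notation V := (rat_mod phi).

HB.instance Definition _ := GRing.Zmodule.copy V S.

Definition rat_scale (a : rat) (x : V) : V := phi a * (x : S).

Fact rat_scaleA a b x : rat_scale a (rat_scale b x) = rat_scale (a * b) x.
Proof. by rewrite /rat_scale rmorphM mulrA. Qed.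

Fact rat_scale1 : left_id 1 rat_scale.
Proof. by move=> x; rewrite /rat_scale rmorph1 mul1r. Qed.

Fact rat_scaleDr : right_distributive rat_scale +%R.
Proof. by move=> a x y; rewrite /rat_scale [LHS]mulrDr. Qed.

Fact rat_scaleDl x : {morph rat_scale^~ x : a b / a + b}.
Proof. by move=> a b; rewrite /rat_scale rmorphD [LHS]mulrDl. Qed.

HB.instance Definition _ := GRing.Zmodule_isLmodule.Build rat V
  rat_scaleA rat_scale1 rat_scaleDr rat_scaleDl.

Definition wlext (h : seq bool -> S) : Sha -> S := slext (h : seq bool -> V).

Lemma wlextU h w : wlext h (wd w) = h w.
Proof. exact: (@slextU V (h : seq bool -> V) w). Qed.

Lemma wlext_linear h : linear_for (phi \; *%R) (wlext h).
Proof. by move=> a x y; exact: (linearP (slext (h : seq bool -> V))). Qed.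

End RatModule.

Section LinearFor.
Variables (U : lmodType rat) (S : comNzRingType) (phi : {rmorphism rat -> S}).
Variable f : U -> S.
Hypothesis fl : linear_for (phi \; *%R) f.

Lemma linear_forD x y : f (x + y) = f x + f y.
Proof. by have := fl 1 x y; rewrite scale1r /= rmorph1 mul1r. Qed.

Lemma linear_for0 : f 0 = 0.
Proof. by apply: (addrI (f 0)); rewrite -linear_forD !addr0. Qed.

Lemma linear_forZ a x : f (a *: x) = phi a * f x.
Proof. by have := fl a x 0; rewrite addr0 linear_for0 addr0. Qed.

Lemma linear_for_sum (T : Type) (r : seq T) (F : T -> U) :
  f (\sum_(i <- r) F i) = \sum_(i <- r) f (F i).
Proof. exact: (big_morph f linear_forD linear_for0). Qed.

End LinearFor.

Section Zsh.
Variable R : realType.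
Implicit Types (u v w : seq bool) (n : seq nat) (x y : Sha).

Definition spanP (Q : pred (seq bool)) : {pred Sha} := lin_span [set wd w | w in [set w | Q w]].

Lemma spanP_wd (Q : pred (seq bool)) w : Q w -> wd w \in spanP Q.
Proof. by move=> Qw; apply: lin_span_gen; exists w. Qed.

Lemma spanP_lext (Q Q' : pred (seq bool)) (h : seq bool -> Sha) x :
  (forall w, Q w -> h w \in spanP Q') -> x \in spanP Q -> slext h x \in spanP Q'.
Proof.
move=> hQ; elim/lin_span_ind => [|_ [w /= Qw <-]|a y z IH IH'].
- by rewrite linear0 lin_span0.
- by rewrite slextU hQ.
- by rewrite linearP lin_spanP.
Qed.

Lemma spanP_mul (Q : pred (seq bool)) x y :
  (forall u v w, Q u -> Q v -> w \in sh u v -> Q w) ->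
  x \in spanP Q -> y \in spanP Q -> x * y \in spanP Q.
Proof.
move=> QM xQ yQ; elim/lin_span_ind: x / xQ => [|_ [u /= Qu <-]|a x x' IH IH'].
- by rewrite mul0r lin_span0.
- elim/lin_span_ind: y / yQ => [|_ [v /= Qv <-]|a y y' IH IH'].
  + by rewrite mulr0 lin_span0.
  + rewrite wdM big_seq; apply: lin_span_sum => w ws.
    by apply: spanP_wd; exact: QM Qu Qv ws.
  + by rewrite mulrDr -scalerAr lin_spanP.
- by rewrite mulrDl -scalerAl lin_spanP.
Qed.

(** The words of [H^1], read from right to left. *)
Let L : pred (seq bool) := last true.

Lemma ddl_L k x : x \in spanP L -> ddl true k x \in spanP L.
Proof.
move=> xL; rewrite /ddl; apply: lin_spanZ.
elim: k => //= k; apply: spanP_lext => -[|c w] /=; first by rewrite lin_span0.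
by move=> wL; case: eqP => _; rewrite ?lin_span0 // spanP_wd //; case: w wL.
Qed.

Lemma lreg_L x : x \in spanP L -> lreg true x \in spanP L.
Proof.
move=> xL; rewrite (@lregE _ (sha_deg true x)) => [|k]; last exact: ddl_deg.
have LM u v w : L u -> L v -> w \in sh u v -> L w.
  by move=> uL vL ws; rewrite /L (sh_last uL vL ws).
apply: lin_span_sum => k _; apply: spanP_mul => //; last exact: ddl_L.
elim: (nat_of_ord k) => [|j IHj]; first by rewrite expr0 -wd0 spanP_wd.
rewrite exprS; apply: spanP_mul => //.
by rewrite -scaleN1r; apply: lin_spanZ; exact: spanP_wd.
Qed.

Lemma lreg_H0r x : x \in spanP L -> lreg true x \in spanP H0r.
Proof.
move=> /lreg_L xL; move: (dl_lreg true x); move: (lreg true x) xL => {}x xL dx.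
have -> : x = slext (fun w => if starts true w then 0 else wd w : Sha) x + pre true (dl true x).
  elim/Sha_ind: (x) => [|w|a y z IH IH'].
  - by rewrite !linear0 addr0.
  - rewrite slextU; case: w => [|c w] /=; first by rewrite dlU linear0 addr0.
    rewrite dl_cons; case: eqP => [->|_]; last by rewrite scale0r linear0 addr0.
    by rewrite scale1r preU add0r.
  - by rewrite !linearP /= addrACA -scalerDr -IH -IH'.
rewrite dx linear0 addr0; apply: spanP_lext xL => w wL.
by case: ifPn => wt; [rewrite lin_span0|apply: spanP_wd; rewrite /H0r wt andbT].
Qed.

Let Zlin : Sha -> R := wlext (ratr : {rmorphism rat -> R}) (fun w => limn (psum R w)).

Lemma Zlin_mul x y : x \in spanP H0r -> y \in spanP H0r -> Zlin (x * y) = Zlin x * Zlin y.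
Proof.
have Zl := wlext_linear (ratr : {rmorphism rat -> R}) (fun w => limn (psum R w)).
rewrite -/Zlin in Zl.
move=> xQ yQ; elim/lin_span_ind: x / xQ => [|_ [u /= Qu <-]|a x x' IH IH'].
- by rewrite mul0r (linear_for0 Zl) mul0r.
- elim/lin_span_ind: y / yQ => [|_ [v /= Qv <-]|a y y' IH IH'].
  + by rewrite mulr0 (linear_for0 Zl) mulr0.
  + rewrite wdM (linear_for_sum Zl) /Zlin !wlextU limn_psum_shuffle //.
    by apply: eq_bigr => w _; rewrite wlextU.
  + by rewrite mulrDr -scalerAr !Zl /= IH IH' mulrDr mulrCA.
- by rewrite mulrDl -scalerAl !Zl /= IH IH' mulrDl mulrA.
Qed.

(* exp((T - 1) d/d1), read from right to left: the constant term of its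
   coefficients are computed by the regularisation killing the letter 1. *)
Definition Zreg w : {poly R} :=
  \poly_(k < sha_deg true (wd (rev w))) Zlin (lreg true (ddl true k (wd (rev w)))).

Lemma coef_Zreg w k : (Zreg w)`_k = Zlin (lreg true (ddl true k (wd (rev w)))).
Proof.
rewrite coef_poly; case: ltnP => // /ddl_deg->.
have Zl := wlext_linear (ratr : {rmorphism rat -> R}) (fun w => limn (psum R w)).
by rewrite raddf0 -/Zlin [RHS](linear_for0 Zl).
Qed.

Lemma in_H1_rev w : in_H1 w = L (rev w).
Proof. by case: w => [|c w] //; rewrite rev_cons /L last_rcons. Qed.

Lemma Zreg_is_Zsh : is_Zsh Zreg.
Proof.
have Zl := wlext_linear (ratr : {rmorphism rat -> R}) (fun w => limn (psum R w)).
have ddl1 k : ddl true k.+1 1 = 0 by rewrite -wd0 ddl_wd0.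
split.
- apply/polyP => k; rewrite coef_Zreg coef1 /=; case: k => [|k].
    by rewrite ddl0 wd0 rmorph1 -wd0 /Zlin wlextU limn_psum_nil.
  by rewrite wd0 ddl1 raddf0 [LHS](linear_for0 Zl).
- move=> u v uH vH; apply/polyP => k; rewrite coefM coef_sum sum_shuffles.
  under [RHS]eq_bigr do rewrite coef_Zreg.
  rewrite -(sum_sh_rev (fun w => Zlin (lreg true (ddl true k (wd w))))).
  transitivity (Zlin (lreg true (ddl true k (wd (rev u) * wd (rev v))))); last first.
    by rewrite wdM (raddf_sum (ddl true k)) (raddf_sum (lreg true)) /Zlin (linear_for_sum Zl).
  rewrite ddlM (raddf_sum (lreg true)) /Zlin (linear_for_sum Zl); apply: eq_bigr => i _.
  rewrite !coef_Zreg /= (rmorphM (lreg true)) -/Zlin Zlin_mul //; apply: lreg_H0r; apply: ddl_L;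
    apply: spanP_wd; by rewrite -in_H1_rev.
- move=> n nA; apply/polyP => k; rewrite coef_Zreg coefC.
  have /andP[_ n1] := H0r_index nA; have dn : dl true (wd (rev (index_word n))) = 0.
    by case: (rev _) n1 => [|c w] /=; rewrite ?wd0 ?dl1 // dl_cons => /negPf->; rewrite scale0r.
  case: k => [|k]; last first.
    rewrite /ddl iterSr dn; have -> : iter k (dl true) 0 = 0.
      by elim: k => //= k ->; rewrite linear0.
    by rewrite scaler0 raddf0 [LHS](linear_for0 Zl).
  by rewrite ddl0 lreg_id ?mzeta_limn // /Zlin wlextU.
- apply/polyP => k; rewrite coef_Zreg coefX; case: k => [|[|k]].
  + by rewrite ddl0 lreg_letter [LHS](linear_for0 Zl).
  + rewrite /ddl /= dl_cons eqxx !invr1 !scale1r wd0 rmorph1 -wd0 /Zlin wlextU.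
    exact: limn_psum_nil.
  + by rewrite ddl_wd0 // raddf0 [LHS](linear_for0 Zl).
Qed.

Lemma Zsh_is_Zsh : is_Zsh (Zsh R).
Proof. exact: (xgetPex (fun=> 0) (ex_intro _ _ Zreg_is_Zsh)). Qed.

Lemma zeta_sh_admissible n : admissible n -> zeta_sh R n = mzeta R n.
Proof. by move=> nA; have [_ _ h _] := Zsh_is_Zsh; rewrite /zeta_sh h // hornerC. Qed.

Lemma zsh_is_zsh : is_zsh (zsh R).
Proof.
suff h : is_zsh (fun x : calI1 => wlext (ratr : {rmorphism rat -> R})
    (fun w => (Zsh R w).[0]) (kappa x)).
  exact: (xgetPex (fun=> 0) (ex_intro _ _ h)).
have zl := wlext_linear (ratr : {rmorphism rat -> R}) (fun w => (Zsh R w).[0]).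
split=> [a x y|n n1]; first by rewrite (rmorphD kappa) kappaZ zl.
by rewrite kappa_index wlextU.
Qed.

(** Two index words shuffle into index words, on which [zsh] is the constant term of the shuffle
    morphism [Zsh]; the corresponding elements span. *)
Lemma zshM (x y : calI1) : zsh R (x * y) = zsh R x * zsh R y.
Proof.
have [zl zn] := zsh_is_zsh; have [_ Zsh_M _ _] := Zsh_is_Zsh.
have z01 w : in_H1 w -> zsh R (I1 (false, w, true)) = (Zsh R w).[0].
  by rewrite head_starts => /starts_index[n n1 ->]; exact: (zn n n1).
have := calI1_span y; have := calI1_span x => xQ yQ.
elim/lin_span_ind: x / xQ => [|_ [n /= n1 <-]|a x x' IH IH'].
- by rewrite mul0r (linear_for0 zl) mul0r.
- elim/lin_span_ind: y / yQ => [|_ [m /= m1 <-]|a y y' IH IH'].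
  + by rewrite mulr0 (linear_for0 zl) mulr0.
  + rewrite I1_shuffle (linear_for_sum zl).
    have nH := starts_index_word n; have mH := starts_index_word m.
    transitivity (zeta_sh R n * zeta_sh R m); last first.
      by congr (_ * _); apply: esym; exact: zn.
    rewrite /zeta_sh -hornerM Zsh_M ?head_starts // horner_sum sum_shuffles.
    apply: eq_big_seq => w ws; apply: z01; rewrite head_starts.
    exact: sh_starts nH mH ws.
  + by rewrite mulrDr -scalerAr !zl /= IH IH' mulrDr mulrCA.
- by rewrite mulrDl -scalerAl !zl /= IH IH' mulrDl mulrA.
Qed.

End Zsh.

Section Gsh.
Variable R : realType.

(** Inverse of [index_word]. The word is read from the right, the head of the state counting the
    zeros since the last 1 met; [behead] finally discards the count of leading zeros. *)
Definition index_dec (w : seq bool) : seq nat :=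
  behead (foldr (fun (c : bool) s => if c then 0%N :: (head 0%N s).+1 :: behead s
                                     else (head 0%N s).+1 :: behead s) [:: 0%N] w).

Lemma index_decK n : all (leq 1) n -> index_dec (index_word n) = n.
Proof.
rewrite /index_dec; set f := foldr _ _ => n1.
suff -> : f (index_word n) = 0%N :: n by [].
elim: n n1 => //= k n IHn /andP[k1 /IHn IH].
rewrite /index_word /= -/(index_word n); rewrite /f /= foldr_cat -/f.
rewrite IH.
have -> j : foldr (fun (c : bool) s => if c then 0%N :: (head 0%N s).+1 :: behead s
    else (head 0%N s).+1 :: behead s) (0%N :: n) (nseq j false) = j :: n.
  by elim: j => //= j ->.
by rewrite /= prednK.
Qed.

Lemma gsh_is_gsh : is_gsh (gsh R).
Proof.
pose h k w := gsh_index R (index_dec w) k.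
suff hg : is_gsh (fun (x : calI1) k => wlext (ratr : {rmorphism rat -> Cplx R}) (h k) (kappa x)).
  exact: (xgetPex (fun _ _ => 0) (ex_intro _ _ hg)).
split=> [k a x y|n n1]; first by rewrite (rmorphD kappa) kappaZ wlext_linear.
by apply/funext => k; rewrite kappa_index wlextU /h index_decK.
Qed.

End Gsh.

(** * The Lipschitz formula *)

Section ComplexNorm.
Variable R : realType.
Local Notation C := (Cplx R).
Implicit Types (x y z s : C) (t : R).

Definition nrm (z : C) : R := Normc.normc z.

Lemma nrmE z : `|z| = ((nrm z)%:C)%C. Proof. by []. Qed.

Lemma nrm_ge0 z : 0 <= nrm z. Proof. by case: z => a b; exact: sqrtr_ge0. Qed.

Lemma nrmM x y : nrm (x * y) = nrm x * nrm y. Proof. exact: Normc.normcM. Qed.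

Lemma nrmV x : nrm x^-1 = (nrm x)^-1. Proof. exact: Normc.normcV. Qed.

Lemma nrm0 : nrm 0 = 0. Proof. exact: Normc.normc0. Qed.

Lemma nrm1 : nrm 1 = 1. Proof. exact: Normc.normc1. Qed.

Lemma nrmX x n : nrm (x ^+ n) = nrm x ^+ n.
Proof. by elim: n => [|n IHn]; rewrite ?expr0 ?nrm1 // !exprS nrmM IHn. Qed.

Lemma nrmN x : nrm (- x) = nrm x.
Proof. by apply: (@complexI R); rewrite -!nrmE normrN. Qed.

Lemma nrmB x y : nrm (x - y) = nrm (y - x).
Proof. by rewrite -nrmN opprB. Qed.

Lemma nrmD x y : nrm (x + y) <= nrm x + nrm y.
Proof. by rewrite -lecR rmorphD -!nrmE; exact: ler_normD. Qed.

Lemma nrm_sum (I : Type) (r : seq I) (P : pred I) (F : I -> C) :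
  nrm (\sum_(i <- r | P i) F i) <= \sum_(i <- r | P i) nrm (F i).
Proof.
elim/big_ind2: _ => [|x a y b xa yb|//]; first by rewrite nrm0.
exact: le_trans (nrmD _ _) (lerD xa yb).
Qed.

Lemma nrm_prod (I : Type) (r : seq I) (P : pred I) (F : I -> C) :
  nrm (\prod_(i <- r | P i) F i) = \prod_(i <- r | P i) nrm (F i).
Proof.
elim/big_ind2: _ => [|x a y b <- <-|//]; first exact: nrm1.
exact: nrmM.
Qed.

Lemma nrm_eq0 z : (nrm z == 0) = (z == 0).
Proof.
apply/eqP/eqP => [/Normc.eq0_normc //|->]; exact: nrm0.
Qed.

Lemma nrm_gt0 z : (0 < nrm z) = (z != 0).
Proof. by rewrite lt_def nrm_ge0 andbT nrm_eq0. Qed.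

Lemma nrm_real t : nrm (t%:C)%C = `|t|.
Proof. by rewrite /nrm /= expr0n /= addr0 sqrtr_sqr. Qed.

Lemma nrm_nat n : nrm n%:R = n%:R.
Proof.
have -> : n%:R = (n%:R%:C)%C :> C by rewrite rmorph_nat.
by rewrite nrm_real ger0_norm.
Qed.

Lemma nrm_sqr z : nrm z ^+ 2 = complex.Re z ^+ 2 + complex.Im z ^+ 2.
Proof. by case: z => a b; rewrite sqr_sqrtr // addr_ge0 ?sqr_ge0. Qed.

Lemma nrm_geRe z : `|complex.Re z| <= nrm z.
Proof.
rewrite -(ler_pXn2r (ltn0Sn 1)) ?nnegrE ?nrm_ge0 // nrm_sqr real_normK ?num_real //.
by rewrite lerDl sqr_ge0.
Qed.

Lemma nrm_geIm z : `|complex.Im z| <= nrm z.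
Proof.
rewrite -(ler_pXn2r (ltn0Sn 1)) ?nnegrE ?nrm_ge0 // nrm_sqr real_normK ?num_real //.
by rewrite lerDr sqr_ge0.
Qed.

Lemma nrm_leD z : nrm z <= `|complex.Re z| + `|complex.Im z|.
Proof.
rewrite -(ler_pXn2r (ltn0Sn 1)) ?nnegrE ?nrm_ge0 ?addr_ge0 // nrm_sqr sqrrD.
by rewrite !real_normK ?num_real // addrAC lerDl mulrn_wge0 // mulr_ge0.
Qed.

Lemma cvgC_near (u : nat -> C) (l : C) (e : nat -> R) :
  (\forall n \near \oo, nrm (u n - l) <= e n) -> e @ \oo --> 0 -> u @ \oo --> l.
Proof.
move=> ue e0; apply/cvgrPdist_le => eps eps0.
have [epsE Re0] : eps = ((complex.Re eps)%:C)%C /\ 0 < complex.Re eps.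
  by move: eps0; case: eps => a b; rewrite ltcE /= => /andP[/eqP-> ->].
have /cvgr0Pnorm_le/(_ _ Re0) := e0; apply: filterS2 ue => n un en.
rewrite epsE nrmE lecR nrmB (le_trans un) //.
exact: le_trans (ler_norm _) en.
Qed.

Lemma cvgC_le (u : nat -> C) (l : C) (e : nat -> R) :
  (forall n, nrm (u n - l) <= e n) -> e @ \oo --> 0 -> u @ \oo --> l.
Proof. by move=> ue; apply: cvgC_near; exact: nearW. Qed.

Lemma cvgC_sum (I : Type) (r : seq I) (P : pred I) (f : I -> nat -> C) (l : I -> C) :
  (forall i, P i -> f i @ \oo --> l i) ->
  (fun n => \sum_(i <- r | P i) f i n) @ \oo --> \sum_(i <- r | P i) l i.
Proof. by move=> fl; apply: cvg_big => //; exact: add_continuous. Qed.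

Lemma cvgC_prod (I : Type) (r : seq I) (P : pred I) (f : I -> nat -> C) (l : I -> C) :
  (forall i, P i -> f i @ \oo --> l i) ->
  (fun n => \prod_(i <- r | P i) f i n) @ \oo --> \prod_(i <- r | P i) l i.
Proof. by move=> fl; apply: cvg_big => //; exact: mul_continuous. Qed.

Lemma cvgC_real (u : nat -> R) (l : R) :
  u @ \oo --> l -> (fun n => ((u n)%:C)%C : C) @ \oo --> ((l%:C)%C : C).
Proof.
move=> ul; apply: (@cvgC_le _ _ (fun n => `|u n - l|)).
  by move=> n; rewrite -rmorphB nrm_real.
have /cvg_norm : (fun n => u n - l) @ \oo --> l - l by apply: cvgB => //; exact: cvg_cst.
by rewrite subrr normr0.
Qed.

End ComplexNorm.

Section ComplexExp.
Variable R : realType.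
Local Notation C := (Cplx R).
Implicit Types (s z w : C) (x t : R).
Local Notation Re := complex.Re.
Local Notation Im := complex.Im.

Lemma ReD z w : Re (z + w) = Re z + Re w. Proof. by case: z; case: w. Qed.
Lemma ImD z w : Im (z + w) = Im z + Im w. Proof. by case: z; case: w. Qed.

Lemma cexpD z w : cexp (z + w) = cexp z * cexp w.
Proof.
rewrite /cexp ReD ImD expRD cosD sinD; apply/eqP.
by rewrite eq_complex /=; apply/andP; split; apply/eqP; ring.
Qed.

Lemma cexp0 : cexp (0 : C) = 1.
Proof. by rewrite /cexp /= expR0 cos0 sin0 mulr1 mulr0. Qed.

Lemma cexpMn z n : cexp (z *+ n) = cexp z ^+ n.
Proof. by elim: n => [|n IHn]; rewrite ?cexp0 // mulrS exprS cexpD IHn. Qed.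

Lemma nrm_cexp z : nrm (cexp z) = expR (Re z).
Proof.
rewrite /nrm /cexp /= !exprMn -mulrDr cos2Dsin2 mulr1 sqrtr_sqr.
by rewrite ger0_norm // expR_ge0.
Qed.

Lemma sin_MVT x : 0 <= x -> exists2 c, 0 <= c <= x & sin x = cos c * x.
Proof.
move=> x0; have [|c] := @MVT_segment R sin cos 0 x x0.
  by apply: continuous_subspaceT => y; exact: continuous_sin.
by rewrite in_itv /= sin0 !subr0 => cx ->; exists c.
Qed.

Lemma norm_sin_le x : `|sin x| <= `|x|.
Proof.
wlog x0 : x / 0 <= x.
  move=> h; have [/h //|x0] := leP 0 x.
  by have := h (- x); rewrite sinN !normrN oppr_ge0; apply; exact: ltW.
have [c _ ->] := sin_MVT x0.
by rewrite normrM ler_piMl // cos_max.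
Qed.

Lemma one_sub_cos x : 1 - cos x = 2 * sin (x / 2) ^+ 2.
Proof.
have -> : cos x = cos ((x / 2) *+ 2) by congr cos; rewrite -mulr_natr divfK.
rewrite cos_mulr2n sin2cos2; ring.
Qed.

Lemma one_sub_cos_le x : 0 <= 1 - cos x <= x ^+ 2 / 2.
Proof.
rewrite one_sub_cos; apply/andP; split; first by rewrite mulr_ge0 // sqr_ge0.
have h : sin (x / 2) ^+ 2 <= (x / 2) ^+ 2.
  rewrite -real_normK ?num_real // -[leRHS]real_normK ?num_real //.
  by rewrite lerXn2r ?nnegrE // norm_sin_le.
have : 2 * sin (x / 2) ^+ 2 <= 2 * (x / 2) ^+ 2 by lra.
by move/le_trans; apply; rewrite le_eqVlt; apply/orP; left; apply/eqP; field.
Qed.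

Lemma sin_sub_id x : `|sin x - x| <= x ^+ 2.
Proof.
wlog x0 : x / 0 <= x.
  move=> h; have [/h //|x0] := leP 0 x.
  have := h (- x); have -> : sin (- x) - - x = - (sin x - x) by rewrite sinN; ring.
  by rewrite normrN sqrrN oppr_ge0; apply; exact: ltW.
have [c /andP[c0 cx] ->] := sin_MVT x0.
have -> : cos c * x - x = - ((1 - cos c) * x) by ring.
rewrite normrN normrM (ger0_norm x0) expr2 ler_wpM2r //.
have /andP[h0 _] := one_sub_cos_le c; rewrite ger0_norm // one_sub_cos.
have s0 : `|sin (c / 2)| <= 1 by exact: sin_max.
have s1 : `|sin (c / 2)| <= c / 2.
  by have := norm_sin_le (c / 2); rewrite (ger0_norm (x := c / 2)) // divr_ge0.
rewrite -real_normK ?num_real //; have : 0 <= `|sin (c / 2)| by [].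
nra.
Qed.

Lemma expR_sub_le x : x <= 0 -> `|expR x - 1| <= `|x| /\ `|expR x - 1 - x| <= x ^+ 2.
Proof.
move=> x0; have h1 := expR_ge1Dx x; have h2 := expR_ge1Dx (- x).
have e0 := expR_gt0 x; have e1 : expR x <= 1 by rewrite -expR0 ler_expR.
have h3 : expR x * (1 - x) <= 1.
  by rewrite -[leRHS](mulfV (lt0r_neq0 e0)) -expRN ler_wpM2l // ltW.
split; first by rewrite ler0_norm ?(ler0_norm x0); lra.
rewrite ger0_norm; last by lra.
nra.
Qed.

(** Where [Re s <= 0] the modulus of the exponential is at most 1, so the quadratic bounds for its
    real and imaginary parts hold with one constant. *)
Lemma cexp_taylor s : Re s <= 0 -> nrm (cexp s - 1 - s) <= 3 * nrm s ^+ 2.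
Proof.
move=> s0; rewrite nrm_sqr; apply: (le_trans (nrm_leD _)).
set x := Re s in s0 *; set t := Im s.
have -> : Re (cexp s - 1 - s) = (expR x - 1 - x) + expR x * (cos t - 1).
  by rewrite /cexp /x /t; case: (s) => a b /=; ring.
have -> : Im (cexp s - 1 - s) = (expR x - 1) * sin t + (sin t - t).
  by rewrite /cexp /x /t; case: (s) => a b /=; ring.
have [h1 h2] := expR_sub_le s0.
have e1 : 0 <= expR x <= 1 by rewrite expR_ge0 /= -expR0 ler_expR.
have /andP[c0 c1] := one_sub_cos_le t.
have h3 : `|expR x * (cos t - 1)| <= t ^+ 2 / 2.
  rewrite normrM ger0_norm ?expR_ge0 // distrC ger0_norm //.
  case/andP: e1 => ? ?; nra.
have h4 : `|(expR x - 1) * sin t| <= (x ^+ 2 + t ^+ 2) / 2.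
  rewrite normrM; apply: (@le_trans _ _ (`|x| * `|t|)); first by rewrite ler_pM // norm_sin_le.
  have : 0 <= (`|x| - `|t|) ^+ 2 by rewrite sqr_ge0.
  rewrite sqrrB !real_normK ?num_real //; lra.
have h5 := sin_sub_id t.
have := ler_normD (expR x - 1 - x) (expR x * (cos t - 1)).
have := ler_normD ((expR x - 1) * sin t) (sin t - t).
have := sqr_ge0 x; have := sqr_ge0 t; lra.
Qed.

(** By duplication and the mean value theorem, for [t >= 0] the sine is [cos (t / 2) * cos c * t]
    with [c] between 0 and [t / 2], where both cosines are at least [cos (3 pi / 8)]. *)
Lemma sin_lower : exists2 c : R, 0 < c & forall t, `|t| <= pi * 3 / 4 -> c * `|t| <= `|sin t|.
Proof.
have pi0 := pi_gt0 R.
have c0 : 0 < cos (pi * 3 / 8) :> R by apply: cos_gt0_pihalf; apply/andP; split; lra.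
exists (cos (pi * 3 / 8) ^+ 2) => [|t]; first by rewrite exprn_gt0.
wlog t0 : t / 0 <= t.
  move=> h; have [/h //|t0] := leP 0 t.
  by have := h (- t); rewrite sinN !normrN oppr_ge0; apply; exact: ltW.
rewrite (ger0_norm t0) => tpi.
have h2 : 0 <= t / 2 by lra.
have tE : t = (t / 2) *+ 2 by rewrite -mulr_natr divfK.
have cos_le u v : 0 <= u -> u <= v -> v <= pi -> cos v <= cos u :> R.
  move=> u0 uv vpi; rewrite leNgt ltr_cos ?in_itv /= -?leNgt // ?u0 ?vpi ?andbT //=.
  - exact: le_trans u0 uv.
  - exact: le_trans uv vpi.
have ct : cos (pi * 3 / 8) <= cos (t / 2) :> R by apply: cos_le; lra.
have [c /andP[cc ct2] sE] := sin_MVT h2.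
have cct : cos (t / 2) <= cos c by apply: cos_le => //; lra.
rewrite {2}tE sin_mulr2n sE ger0_norm.
  have -> : (cos (t / 2) * (cos c * (t / 2))) *+ 2 = cos (t / 2) * cos c * t.
    by rewrite mulr2n; field.
  by rewrite ler_wpM2r //; nra.
by rewrite mulrn_wge0 // !mulr_ge0 //; lra.
Qed.

(** The region stays away from the nonzero multiples of [2 pi i]. With [s = x + i t], the square of
    [|1 - e^s|] is [(1 - e^x)^2 + 4 e^x sin(t/2)^2], and the two terms are bounded below
    separately. *)
Lemma cexp_lower : exists2 c : R, 0 < c &
  forall s, -1 <= Re s <= 0 -> `|Im s| <= pi * 3 / 2 -> c * nrm s <= nrm (1 - cexp s).
Proof.
have [c c0 sin_c] := sin_lower.
(* The value [1 / 2] serves the real part and [e^(-1/2) c] the imaginary part, since [e^x >= e^(-1)]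
   for [x >= -1]. *)
pose d : R := Num.min (1 / 2) (Num.sqrt (expR (-1)) * c).
have d0 : 0 < d.
  by rewrite /d lt_min; apply/andP; split; [lra|rewrite mulr_gt0 // sqrtr_gt0 expR_gt0].
exists d => // s /andP[x1 x0] tpi.
rewrite -(ler_pXn2r (ltn0Sn 1)) ?nnegrE ?nrm_ge0 ?mulr_ge0 ?nrm_ge0 ?(ltW d0) //.
rewrite exprMn !nrm_sqr.
set x := Re s in x1 x0 *; set t := Im s in tpi *.
have -> : Re (1 - cexp s) ^+ 2 + Im (1 - cexp s) ^+ 2 =
    (1 - expR x) ^+ 2 + 4 * expR x * sin (t / 2) ^+ 2.
  have -> : Re (1 - cexp s) = 1 - expR x * cos t by rewrite /cexp /x /t; case: (s).
  have -> : Im (1 - cexp s) = - (expR x * sin t) by rewrite /cexp /x /t; case: (s) => a b /=; ring.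
  have h := one_sub_cos t.
  have -> : 4 * expR x * sin (t / 2) ^+ 2 = 2 * expR x * (1 - cos t) by rewrite h; ring.
  by rewrite sqrrN exprMn sin2cos2; ring.
have d2 : d <= 1 / 2 by rewrite /d ge_min lexx.
have d3 : d ^+ 2 <= expR (-1) * c ^+ 2.
  rewrite -(sqr_sqrtr (expR_ge0 (-1))) -exprMn lerXn2r ?nnegrE ?(ltW d0) //.
    by rewrite mulr_ge0 ?sqrtr_ge0 // ltW.
  by rewrite /d ge_min lexx orbT.
have ex : expR (-1) <= expR x by rewrite ler_expR.
have s1 : (c * `|t / 2|) ^+ 2 <= sin (t / 2) ^+ 2.
  rewrite -[leRHS]real_normK ?num_real // lerXn2r ?nnegrE ?mulr_ge0 ?(ltW c0) //.
  apply: sin_c; have -> : `|t / 2| = `|t| / 2; last by lra.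
  by rewrite normrM [X in _ * X]ger0_norm.
rewrite exprMn real_normK ?num_real // in s1.
have h1 : (x / 2) ^+ 2 <= (1 - expR x) ^+ 2.
  have h2 := expR_ge1Dx (- x); have e0 := expR_gt0 x.
  have h3 : expR x * (1 - x) <= 1.
    by rewrite -[leRHS](mulfV (lt0r_neq0 e0)) -expRN ler_wpM2l // ltW.
  have : - x / 2 <= 1 - expR x by nra.
  nra.
have e0 := expR_gt0 (-1 : R).
have h4 : d ^+ 2 * t ^+ 2 <= 4 * expR x * sin (t / 2) ^+ 2.
  have t2 := sqr_ge0 t.
  apply: (@le_trans _ _ (expR (-1) * c ^+ 2 * t ^+ 2)); first by rewrite ler_wpM2r.
  apply: (@le_trans _ _ (4 * expR (-1) * sin (t / 2) ^+ 2)).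
    have -> : expR (-1) * c ^+ 2 * t ^+ 2 = 4 * expR (-1) * (c ^+ 2 * (t / 2) ^+ 2) by field.
    by rewrite ler_wpM2l // mulr_ge0 // ltW.
  by rewrite ler_wpM2r ?sqr_ge0 // ler_wpM2l.
have h5 : d ^+ 2 * x ^+ 2 <= (1 - expR x) ^+ 2.
  apply: le_trans h1; have -> : (x / 2) ^+ 2 = (1 / 2) ^+ 2 * x ^+ 2 by field.
  by rewrite ler_wpM2r ?sqr_ge0 // lerXn2r ?nnegrE ?(ltW d0) //; lra.
by rewrite mulrDr lerD.
Qed.

End ComplexExp.

Section PowerSums.
Variable R : realType.
Local Notation C := (Cplx R).
Local Notation Re := complex.Re.
Local Notation Im := complex.Im.
Implicit Types (s y z w : C) (k D M N : nat).

Lemma pow_exp_bound k (r : R) : 0 < r < 1 ->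
  exists2 B : R, 0 <= B & forall D, D%:R ^+ k * r ^+ D <= B.
Proof.
elim: k r => [|k IHk] r /andP[r0 r1].
  by exists 1 => // D; rewrite expr0 mul1r exprn_ile1 // ltW.
(* The decay of [r ^+ D] is split into two halves: one absorbs a factor [D], the other the remaining
   power. *)
pose s := Num.sqrt r; have s0 : 0 < s by rewrite sqrtr_gt0.
have rs : r = s * s by rewrite -expr2 sqr_sqrtr // ltW.
have s1 : s < 1 by rewrite -sqrtr1 ltr_sqrt.
have [B B0 sB] : exists2 B : R, 0 <= B & forall D, D%:R ^+ k * s ^+ D <= B.
  by apply: IHk; rewrite s0.
have g D : D%:R * s ^+ D <= (1 - s)^-1.
  have s1' : 0 < 1 - s by rewrite subr_gt0.
  have geo : (\sum_(i < D) s ^+ i) * (1 - s) = 1 - s ^+ D.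
    by rewrite -opprB mulrN mulrC -subrX1 opprB.
  rewrite -[leRHS]mul1r ler_pdivlMr //.
  apply: (@le_trans _ _ ((\sum_(i < D) s ^+ i) * (1 - s))); last first.
    by rewrite geo gerBl exprn_ge0 // ltW.
  rewrite ler_wpM2r ?(ltW s1') // mulr_natl -[X in _ *+ X]card_ord -sumr_const.
  apply: ler_sum => i _; rewrite ler_wiXn2l ?(ltW s0) ?(ltW s1) //.
  exact: ltnW.
exists (B * (1 - s)^-1) => [|D]; first by rewrite mulr_ge0 // invr_ge0 subr_ge0 ltW.
have -> : D%:R ^+ k.+1 * r ^+ D = (D%:R ^+ k * s ^+ D) * (D%:R * s ^+ D).
  by rewrite rs exprMn exprSr; ring.
by rewrite ler_pM // ?mulr_ge0 ?exprn_ge0 ?ler0n // ltW.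
Qed.

Lemma pow_exp_cvg0 k (r : R) : 0 <= r < 1 -> D%:R ^+ k * r ^+ D @[D --> \oo] --> 0.
Proof.
move=> /andP[]; rewrite le_eqVlt => /predU1P[<- _|r0 r1].
  apply: cvg_near_cst; exists 1%N => // -[|D] _ //=.
  by rewrite expr0n /= mulr0.
pose s := Num.sqrt r; have s0 : 0 < s by rewrite sqrtr_gt0.
have rs : r = s * s by rewrite -expr2 sqr_sqrtr // ltW.
have s1 : s < 1 by rewrite -sqrtr1 ltr_sqrt.
have [|B B0 sB] := @pow_exp_bound k s; first by rewrite s0.
have c0 : B * s ^+ D @[D --> \oo] --> 0.
  rewrite -[X in _ --> X](mulr0 B); apply: cvgM; first exact: cvg_cst.
  by apply: cvg_expr; rewrite ger0_norm // ltW.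
apply: squeeze_cvgr (cvg_cst 0) c0; apply: nearW => D.
rewrite rs exprMn mulrA; apply/andP; split.
  by rewrite !mulr_ge0 ?exprn_ge0 ?ler0n // ltW.
by rewrite ler_wpM2r ?exprn_ge0 // ltW.
Qed.

Definition powsum k D y : C := \sum_(d < D) d.+1%:R ^+ k * y ^+ d.+1.

(** The polylogarithm of order [- k], that is, the sum of the [d^k y^d] over [d >= 1]. *)
Definition polylog_neg k y : C := lim (powsum k D y @[D --> \oo]).

Definition diffpow k i : C := - ((-1) ^+ (k.+1 - i) *+ 'C(k.+1, i)).

Lemma diffpowE k (d : C) :
  d ^+ k.+1 - (d - 1) ^+ k.+1 = \sum_(i < k.+1) diffpow k i * d ^+ i.
Proof.
rewrite [d - 1]addrC exprDn big_ord_recr /= subnn expr0 mul1r binn mulr1n.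
rewrite opprD addrCA subrr addr0 -sumrN; apply: eq_bigr => i _.
by rewrite /diffpow mulNr mulrnAl.
Qed.

Lemma diffpow_last k : diffpow k k = k.+1%:R.
Proof. by rewrite /diffpow subSnn expr1 binSn mulNrn opprK. Qed.

(** Abel summation: multiplication by [1 - y] replaces the coefficients [d^(k+1)] by their
    differences, of degree [k] in [d]. *)
Lemma powsum_rec k D y : (1 - y) * powsum k.+1 D y =
  \sum_(i < k.+1) diffpow k i * powsum i D y - D%:R ^+ k.+1 * y ^+ D.+1.
Proof.
elim: D => [|D IHD].
  rewrite /powsum big_ord0 mulr0 big1 ?expr0n /= ?mul0r ?subr0 // => i _.
  by rewrite big_ord0 mulr0.
have pS j : powsum j D.+1 y = powsum j D y + D.+1%:R ^+ j * y ^+ D.+1.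
  by rewrite /powsum big_ord_recr.
rewrite pS mulrDr IHD; under [in RHS]eq_bigr do rewrite pS mulrDr mulrA.
rewrite big_split /= -mulr_suml -diffpowE -[D.+1%:R - 1]/(_ - _) -[in X in (_ - X ^+ _)]natr1.
rewrite addrK [y ^+ D.+2]exprS; ring.
Qed.

Lemma powsum0 D y : y != 1 -> powsum 0 D y = y * (1 - y ^+ D) / (1 - y).
Proof.
move=> y1; rewrite /powsum; have y1' : 1 - y != 0 by rewrite subr_eq0 eq_sym.
apply: (mulIf y1'); rewrite divfK //.
elim: D => [|D IHD]; first by rewrite big_ord0 expr0 subrr mulr0 mul0r.
by rewrite big_ord_recr /= mulrDl IHD expr0 mul1r !exprS; ring.
Qed.

Lemma cvgC_pow_exp k y (c : C) : nrm y < 1 ->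
  (D%:R ^+ k * y ^+ D * c : C) @[D --> \oo] --> (0 : C).
Proof.
move=> y1; apply: (@cvgC_le _ _ _ (fun D => D%:R ^+ k * nrm y ^+ D * nrm c)) => [D|].
  by rewrite subr0 !nrmM !nrmX nrm_nat.
rewrite -[X in _ --> X](mul0r (nrm c)); apply: cvgM; last exact: cvg_cst.
by apply: pow_exp_cvg0; rewrite nrm_ge0.
Qed.

Lemma nrm_lt1_neq1 y : nrm y < 1 -> y != 1.
Proof. by apply: contraTneq => ->; rewrite nrm1 ltxx. Qed.

Lemma powsum_cvg_rec k y : nrm y < 1 ->
  (forall i, (i <= k)%N -> powsum i D y @[D --> \oo] --> polylog_neg i y) ->
  powsum k.+1 D y @[D --> \oo] -->
    (1 - y)^-1 * \sum_(i < k.+1) diffpow k i * polylog_neg i y.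
Proof.
move=> y1 IH; have y1' : 1 - y != 0 by rewrite subr_eq0 eq_sym nrm_lt1_neq1.
have E : (fun D => powsum k.+1 D y) = (fun D => (1 - y)^-1 *
    (\sum_(i < k.+1) diffpow k i * powsum i D y - D%:R ^+ k.+1 * y ^+ D * y)).
  by apply/funext => D; rewrite -mulrA -exprSr -powsum_rec mulKf.
rewrite E; apply: cvgM; first exact: cvg_cst.
rewrite -[X in _ --> X]subr0; apply: cvgB; last exact: cvgC_pow_exp.
apply: cvgC_sum => i _; apply: cvgM; first exact: cvg_cst.
by apply: IH; rewrite -ltnS.
Qed.

Lemma powsum_cvg0 y : nrm y < 1 -> powsum 0 D y @[D --> \oo] --> y / (1 - y).
Proof.
move=> y1; have E : (fun D => powsum 0 D y) = (fun D => y / (1 - y) - D%:R ^+ 0 * y ^+ D * (y / (1 - y))).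
  by apply/funext => D; rewrite powsum0 ?nrm_lt1_neq1 // expr0; ring.
rewrite E -[X in _ --> X]subr0; apply: cvgB; first exact: cvg_cst.
exact: cvgC_pow_exp.
Qed.

Lemma powsum_cvg k y : nrm y < 1 -> powsum k D y @[D --> \oo] --> polylog_neg k y.
Proof.
move=> y1; elim: {k}_.+1 {-2}k (ltnSn k) => // n IHn [|k] kn.
  by have h := powsum_cvg0 y1; rewrite /polylog_neg (cvg_lim _ h).
have h : powsum k.+1 D y @[D --> \oo] -->
    (1 - y)^-1 * \sum_(i < k.+1) diffpow k i * polylog_neg i y.
  by apply: powsum_cvg_rec => // i ik; apply: IHn; exact: leq_ltn_trans ik _.
by rewrite [polylog_neg k.+1 y](cvg_lim _ h).
Qed.

Lemma polylog_neg0 y : nrm y < 1 -> polylog_neg 0 y = (1 - y)^-1 - 1.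
Proof.
move=> y1; rewrite /polylog_neg (cvg_lim _ (powsum_cvg0 y1)) //.
have y1' : 1 - y != 0 by rewrite subr_eq0 eq_sym nrm_lt1_neq1.
by field.
Qed.

Lemma polylog_negS k y : nrm y < 1 -> polylog_neg k.+1 y =
  (1 - y)^-1 * \sum_(i < k.+1) diffpow k i * polylog_neg i y.
Proof.
move=> y1; apply: cvg_lim => //; apply: powsum_cvg_rec => // i _.
exact: powsum_cvg.
Qed.

(** In its closure 0 is the only zero of [e^s - 1]. For large [M] it contains the points
    [2 pi i (w + m) / (2M + 1)] with [|m| <= M]: their imaginary parts approach [pi] at the ends,
    and [3 pi / 2] leaves room for the real part of [w]. *)
Definition exp_region s := [/\ -1 <= Re s, Re s < 0 & `|Im s| <= pi * 3 / 2].

Lemma exp_region_lt1 s : exp_region s -> nrm (cexp s) < 1.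
Proof. by case=> _ s0 _; rewrite nrm_cexp -expR0 ltr_expR. Qed.

Lemma exp_region_inv : exists2 K : R, 0 <= K & forall s, exp_region s ->
  nrm (1 - cexp s)^-1 <= K * (nrm s)^-1 /\ nrm ((1 - cexp s)^-1 + s^-1) <= K.
Proof.
have [c c0 lower] := cexp_lower R.
exists (3 * c^-1 + c^-1) => [|s [s1 s0 st]].
  by rewrite addr_ge0 ?mulr_ge0 ?invr_ge0 ?ltW.
have ns : 0 < nrm s.
  rewrite nrm_gt0; apply: contraTneq s0 => ->; by rewrite ltxx.
have low : c * nrm s <= nrm (1 - cexp s) by apply: lower => //; rewrite s1 ltW.
have cn : 0 < c * nrm s by rewrite mulr_gt0.
have n1 : 0 < nrm (1 - cexp s) by exact: lt_le_trans low.
have ci : 0 < c^-1 by rewrite invr_gt0.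
have inv_le : nrm (1 - cexp s)^-1 <= c^-1 * (nrm s)^-1.
  by rewrite nrmV -invfM lef_pV2.
split.
  apply: (le_trans inv_le); rewrite ler_wpM2r ?invr_ge0 ?nrm_ge0 //; lra.
have e0 : 1 - cexp s != 0 by rewrite -nrm_gt0.
have s00 : s != 0 by rewrite -nrm_gt0.
have -> : (1 - cexp s)^-1 + s^-1 = (1 - cexp s)^-1 * s^-1 * - (cexp s - 1 - s).
  by field; rewrite s00.
rewrite !nrmM nrmN (nrmV s); have h := cexp_taylor (ltW s0).
apply: (@le_trans _ _ (c^-1 * (nrm s)^-1 * (nrm s)^-1 * (3 * nrm s ^+ 2))).
  by rewrite ler_pM ?mulr_ge0 ?invr_ge0 ?nrm_ge0 // ler_wpM2r // invr_ge0 nrm_ge0.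
have -> : c^-1 * (nrm s)^-1 * (nrm s)^-1 * (3 * nrm s ^+ 2) = 3 * c^-1.
  by field; rewrite gt_eqF // gt_eqF.
lra.
Qed.

Lemma exp_region_bounded : exists2 B : R, 1 <= B & forall s, exp_region s -> 1 <= B * (nrm s)^-1.
Proof.
exists (1 + pi * 3 / 2) => [|s [s1 s0 st]]; first by have := pi_ge0 R; lra.
have ns : 0 < nrm s.
  rewrite nrm_gt0; apply: contraTneq s0 => ->; by rewrite ltxx.
rewrite ler_pdivlMr // mul1r (le_trans (nrm_leD s)) // lerD //.
by rewrite ler0_norm; lra.
Qed.

(** The leading pole at [y = 1], by the recursion [polylog_negS]: [1 / (1 - e^s)] is [- 1 / s] up to
    a bounded term, and only the summand [i = k] reaches the highest order, with coefficient
    [k + 1]. The region being bounded, lower powers of [1 / |s|] are absorbed by higher ones. *)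
Lemma polylog_neg_asymp k : exists2 K : R, 0 <= K & forall s, exp_region s ->
  nrm (polylog_neg k (cexp s) - k`!%:R * (- s) ^- k.+1) <= K * (nrm s)^-1 ^+ k.
Proof.
have [K0 K00 inv] := exp_region_inv; have [B B1 bnd] := exp_region_bounded.
have B0 : 0 <= B by rewrite (le_trans _ B1).
elim: {k}_.+1 {-2}k (ltnSn k) => // n IHn [|k] kn.
  exists (K0 + 1) => [|s sr]; first by rewrite addr_ge0.
  rewrite polylog_neg0 ?exp_region_lt1 // expr0 mulr1 fact0 mul1r expr1 invrN opprK.
  have [_ h] := inv s sr; rewrite addrAC; apply: le_trans (nrmD _ _) _.
  by rewrite nrmN nrm1 lerD.
have bound i : (i < k.+1)%N -> exists2 K : R, 0 <= K & forall s, exp_region s ->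
    nrm (diffpow k i * polylog_neg i (cexp s) -
         (i == k)%:R * (k.+1`!%:R * (- s) ^- k.+1)) <= K * (nrm s)^-1 ^+ k.
  move=> ik; have [K K_ge0 KP] := IHn i (leq_trans ik kn).
  have [ii|ii] := eqVneq i k.
    subst i; exists (k.+1%:R * K) => [|s sr]; first by rewrite mulr_ge0 ?ler0n.
    rewrite mul1r diffpow_last factS natrM -mulrA -mulrBr nrmM nrm_nat -mulrA.
    by rewrite ler_wpM2l ?ler0n // KP.
  have {ik ii}ik : (i < k)%N by rewrite ltn_neqAle ii -ltnS.
  exists (nrm (diffpow k i) * (K * B ^+ (k - i) + i`!%:R * B ^+ (k - i.+1))) => [|s sr].
    by rewrite mulr_ge0 ?nrm_ge0 // addr_ge0 ?mulr_ge0 ?exprn_ge0 ?ler0n.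
  rewrite mul0r subr0 nrmM -mulrA ler_wpM2l ?nrm_ge0 // mulrDl.
  have t0 : 0 <= (nrm s)^-1 by rewrite invr_ge0 nrm_ge0.
  have grow j : (j <= k)%N -> (nrm s)^-1 ^+ j <= B ^+ (k - j) * (nrm s)^-1 ^+ k.
    move=> jk; rewrite -{2}(subnK jk) exprD mulrA -exprMn.
    rewrite ler_peMl ?exprn_ge0 // -(expr1n _ (k - j)) lerXn2r ?nnegrE ?mulr_ge0 //.
    exact: bnd.
  rewrite -[polylog_neg _ _](subrK (i`!%:R * (- s) ^- i.+1)).
  apply: (le_trans (nrmD _ _)); apply: lerD.
    by apply: (le_trans (KP s sr)); rewrite -mulrA ler_wpM2l // grow // ltnW.
  rewrite nrmM nrm_nat nrmV nrmX nrmN -exprVn -mulrA ler_wpM2l ?ler0n //.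
  exact: grow.
have [f fP] := choice (fun i : 'I_k.+1 =>
  let: ex_intro2 K K1 K2 := bound i (ltn_ord i) in ex_intro (fun K => 0 <= K /\ _) K (conj K1 K2)).
exists (K0 * (\sum_i f i) + K0 * k.+1`!%:R) => [|s sr].
  by rewrite addr_ge0 ?mulr_ge0 ?ler0n // sumr_ge0 // => i _; have [] := fP i.
rewrite polylog_negS ?exp_region_lt1 //.
set S := \sum_(i < _) _; set S0 : C := k.+1`!%:R * (- s) ^- k.+1.
have SB : nrm (S - S0) <= (\sum_i f i) * (nrm s)^-1 ^+ k.
  have -> : S - S0 = \sum_(i < k.+1) (diffpow k i * polylog_neg i (cexp s) - (i == k :> nat)%:R * S0).
    rewrite sumrB -mulr_suml; congr (_ - _).
    rewrite (bigD1 ord_max) //= eqxx big1 ?addr0 ?mul1r // => i ik.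
    by rewrite (_ : (i == k :> nat) = (i == ord_max)) // (negPf ik).
  rewrite mulr_suml; apply: (le_trans (nrm_sum _ _ _)); apply: ler_sum => i _.
  by have [_] := fP i; exact.
have [inv1 inv2] := inv s sr.
have s00 : s != 0.
  by case: sr => _ s0 _; apply: contraTneq s0 => ->; rewrite ltxx.
have -> : (1 - cexp s)^-1 * S - k.+1`!%:R * (- s) ^- k.+2 =
    (1 - cexp s)^-1 * (S - S0) + ((1 - cexp s)^-1 + s^-1) * S0.
  rewrite /S0 [(- s) ^+ k.+2]exprS invfM invrN; ring.
apply: (le_trans (nrmD _ _)); rewrite !nrmM mulrDl.
have t0 : 0 <= (nrm s)^-1 by rewrite invr_ge0 nrm_ge0.
have f0 : 0 <= \sum_i f i by rewrite sumr_ge0 // => i _; have [] := fP i.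
apply: lerD.
  apply: (@le_trans _ _ (K0 * (nrm s)^-1 * ((\sum_i f i) * (nrm s)^-1 ^+ k))).
    by rewrite ler_pM ?nrm_ge0.
  by rewrite exprS le_eqVlt; apply/orP; left; apply/eqP; ring.
rewrite nrm_nat nrmV nrmX nrmN -exprVn -mulrA.
by rewrite ler_wpM2r // mulr_ge0 ?ler0n ?exprn_ge0.
Qed.

End PowerSums.

Section HarmonicSums.
Variable R : realType.

Definition hsum (M : nat) : R := \sum_(a < M.+1) a.+1%:R^-1.

Lemma hsum_le M : hsum M <= 2 * Num.sqrt M.+1%:R.
Proof.
rewrite /hsum; elim: M.+1 => {M}[|M IHM]; first by rewrite big_ord0 sqrtr0 mulr0.
rewrite big_ord_recr /=; have h := sqrt_step R M.
suff h2 : M.+1%:R^-1 <= (Num.sqrt M.+1%:R)^-1 :> R.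
  apply: (le_trans (lerD IHM (le_trans h2 h))).
  by rewrite mulrBr addrC subrK.
have s1 : 1 <= Num.sqrt M.+1%:R :> R by rewrite -[leLHS]sqrtr1 ler_sqrt ?ltr0n // ler1n.
rewrite lef_pV2 ?posrE ?ltr0n ?(lt_le_trans ltr01 s1) //.
by rewrite -[leRHS]sqr_sqrtr ?ler0n // expr2 ler_peMl // (le_trans ler01).
Qed.

Lemma hsum_ge0 M : 0 <= hsum M.
Proof. by apply: sumr_ge0 => i _; rewrite invr_ge0 ler0n. Qed.

Lemma hsum_small (c : R) : c * (hsum M / M.+1%:R) @[M --> \oo] --> 0.
Proof.
rewrite -[X in _ --> X](mulr0 c); apply: cvgM; first exact: cvg_cst.
have c0 : 2 * Num.sqrt (@harmonic R M) @[M --> \oo] --> 0.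
  rewrite -[X in _ --> X](mulr0 2); apply: cvgM; first exact: cvg_cst.
  rewrite -(@sqrtr0 R); apply: continuous_cvg; first exact: sqrt_continuous.
  exact: cvg_harmonic.
apply: squeeze_cvgr (cvg_cst 0) c0; apply: nearW => M.
rewrite mulr_ge0 ?hsum_ge0 ?invr_ge0 ?ler0n //= /harmonic sqrtrV ?ler0n //.
have s0 : Num.sqrt M.+1%:R != 0 :> R by rewrite sqrtr_eq0 -ltNge ltr0n.
have -> : (Num.sqrt M.+1%:R)^-1 = Num.sqrt M.+1%:R / M.+1%:R :> R.
  by rewrite -{3}[M.+1%:R]sqr_sqrtr ?ler0n // expr2 invfM mulrA divff // mul1r.
by rewrite mulrA ler_wpM2r ?invr_ge0 ?ler0n // hsum_le.
Qed.

Definition dist (M i : nat) : nat := `|i%:Z - M%:Z|%N.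

Lemma sum_dist (f : nat -> R) M : (forall a, 0 <= f a) ->
  \sum_(i < M.*2.+1) f (dist M i) <= 2 * \sum_(a < M.+1) f a.
Proof.
move=> f0; have -> : M.*2.+1 = (M + M.+1)%N by rewrite addnS addnn.
rewrite big_split_ord /= mulr_natl mulr2n lerD //.
  rewrite (reindex_inj rev_ord_inj) /= [leRHS]big_ord_recl -[leLHS]add0r lerD //.
  apply: ler_sum => i _; rewrite le_eqVlt; apply/orP; left; apply/eqP; congr f.
  rewrite /dist lift0; have := ltn_ord i; lia.
apply: ler_sum => i _; rewrite le_eqVlt; apply/orP; left; apply/eqP; congr f.
rewrite /dist; lia.
Qed.

Lemma dist_le M i : (i < M.*2.+1)%N -> (dist M i <= M)%N.
Proof. rewrite /dist; lia. Qed.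

Lemma sum_invf (u v : R) : u != 0 -> v != 0 -> u + v != 0 ->
  u^-1 * v^-1 = (u + v)^-1 * (u^-1 + v^-1).
Proof. by move=> h1 h2 h3; field; rewrite h1 h2 h3. Qed.

(** Partial fractions: [1 / (a b) = (1 / a + 1 / b) / (a + b)], here with [a + b = M + 2]. *)
Lemma sum_hsum M : \sum_(a < M.+1) (a.+1%:R^-1 * (M - a).+1%:R^-1) = 2 / M.+2%:R * hsum M.
Proof.
have E (a : 'I_M.+1) : a.+1%:R^-1 * (M - a).+1%:R^-1 =
    M.+2%:R^-1 * (a.+1%:R^-1 + (M - a).+1%:R^-1) :> R.
  have -> : M.+2%:R = a.+1%:R + (M - a).+1%:R :> R.
    by rewrite -natrD; congr _%:R; have := ltn_ord a; lia.
  have h1 : a.+1%:R != 0 :> R by rewrite pnatr_eq0.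
  have h2 : (M - a).+1%:R != 0 :> R by rewrite pnatr_eq0.
  have h3 : a.+1%:R + (M - a).+1%:R != 0 :> R by rewrite -natrD pnatr_eq0.
  exact: sum_invf.
rewrite (eq_bigr _ (fun a _ => E a)) -mulr_sumr big_split /= -/(hsum M).
have -> : \sum_(i < M.+1) (M - i).+1%:R^-1 = hsum M.
  rewrite (reindex_inj rev_ord_inj) /=; apply: eq_bigr => i _.
  by congr (_%:R^-1); have := ltn_ord i; lia.
by ring.
Qed.

End HarmonicSums.

Section Lipschitz.
Variable R : realType.
Local Notation C := (Cplx R).
Local Notation Re := complex.Re.
Local Notation Im := complex.Im.
Local Notation tpi := (two_pi_i R).
Implicit Types (s y z w : C) (k D M N : nat).

Lemma nomeD z w : nome (z + w) = nome z * nome w.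
Proof. by rewrite /nome mulrDr cexpD. Qed.

Lemma nome0 : nome (0 : C) = 1. Proof. by rewrite /nome mulr0 cexp0. Qed.

Lemma nomeMn z n : nome (z *+ n) = nome z ^+ n.
Proof. by rewrite /nome mulrnAr cexpMn. Qed.

Lemma nome1 : nome (1 : C) = 1.
Proof.
rewrite /nome mulr1 /cexp /two_pi_i /= expR0 !mul1r.
have -> : 2 * pi = pi *+ 2 :> R by rewrite mulr_natl.
by rewrite cos2pi sin2pi.
Qed.

Lemma nome_nat n : nome (n%:R : C) = 1.
Proof. by rewrite nomeMn nome1 expr1n. Qed.

Lemma nomeN_nat n : nome (- n%:R : C) = 1.
Proof.
have := nomeD (- n%:R) n%:R; rewrite addNr nome0 nome_nat mulr1.
by move=> <-.
Qed.

Lemma nome_real_neq1 (x : R) : 0 < x < 1 -> nome ((x%:C)%C : C) != 1.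
Proof.
move=> /andP[x0 x1]; apply/eqP => /(congr1 (@complex.Re R)).
rewrite /nome /cexp /two_pi_i /= mul0r mulr0 subrr expR0 mul1r mul0r add0r => h.
have := one_sub_cos (2 * pi * x); rewrite h subrr => /esym/eqP.
rewrite mulf_eq0 sqrf_eq0 pnatr_eq0 /=; apply/negP; rewrite gt_eqF //.
have -> : 2 * pi * x / 2 = pi * x by field.
have pi0 := pi_gt0 R; apply: sin_gt0_pi; apply/andP; split; first by rewrite mulr_gt0.
by rewrite gtr_pMr.
Qed.

Lemma sum_root_unity N d : (0 < N)%N ->
  \sum_(i < N) (nome ((N%:R : C)^-1) ^+ d) ^+ i = (if (N %| d)%N then N%:R else 0).
Proof.
move=> N0; have N0' : N%:R != 0 :> C by rewrite pnatr_eq0 -lt0n.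
set z := nome _ ; have zN : z ^+ N = 1.
  by rewrite /z -nomeMn -[_ *+ N]mulr_natr mulVf // nome1.
case: ifPn => [/dvdnP[e ->]|Nd].
  rewrite mulnC exprM zN expr1n; under eq_bigr do rewrite expr1n.
  by rewrite sumr_const card_ord.
have zd : z ^+ d != 1.
  rewrite (divn_eq d N) exprD mulnC exprM zN expr1n mul1r -nomeMn.
  have -> : (N%:R : C)^-1 *+ (d %% N) = (((d %% N)%:R / N%:R)%:C)%C.
    by rewrite -[LHS]mulr_natl rmorphM fmorphV !rmorph_nat.
  apply: nome_real_neq1; rewrite divr_gt0 ?ltr0n // ?ltr_pdivrMr ?ltr0n //= ?lt0n //.
  by rewrite mul1r ltr_nat ltn_mod.
apply: (mulfI (x := z ^+ d - 1)); first by rewrite subr_eq0.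
by rewrite mulr0 -subrX1 -exprM mulnC exprM zN expr1n subrr.
Qed.

Definition shift_pt M w (i : nat) : C := w + (i%:Z - M%:Z)%:~R.

(** Distribution relation: the integers [m] with [|m| <= M] represent all residues modulo [N], and
    summing over the N-th roots of unity keeps only the exponents divisible by [N]. *)
Lemma powsum_distr k M D w (N := M.*2.+1) :
  \sum_(i < N) powsum k (N * D) (nome (shift_pt M w i / N%:R)) =
  N%:R ^+ k.+1 * powsum k D (nome w).
Proof.
have N0 : N%:R != 0 :> C by rewrite pnatr_eq0.
set a := nome ((w - M%:R) / N%:R); set z := nome ((N%:R : C)^-1).
have yE i : nome (shift_pt M w i / N%:R) = a * z ^+ i.
  rewrite /a /z -nomeMn -nomeD; congr nome.
  by rewrite /shift_pt rmorphB /= -!pmulrn -[_ *+ i]mulr_natl; field.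
have aN : a ^+ N = nome w.
  by rewrite /a -nomeMn -[_ *+ N]mulr_natr divfK // nomeD nomeN_nat mulr1.
transitivity (\sum_(d < N * D) d.+1%:R ^+ k * a ^+ d.+1 * (if (N %| d.+1)%N then N%:R else 0)).
  rewrite exchange_big; apply: eq_bigr => d _.
  rewrite -(sum_root_unity _ (ltn0Sn _)) mulr_sumr; apply: eq_bigr => i _.
  by rewrite yE exprMn mulrA -/z exprAC.
elim: D => [|D IHD]; first by rewrite muln0 /powsum !big_ord0 mulr0.
rewrite mulnSr big_split_ord /= IHD [powsum k D.+1 _]big_ord_recr /= mulrDr; congr (_ + _).
rewrite big_ord_recr /= big1 ?add0r => [|i _]; last first.
  rewrite ifN ?mulr0 // -addnS dvdn_addr ?dvdn_mulr //.
  by apply/negP => /dvdn_leq /=; rewrite -/N ltnS => /(_ isT); have := ltn_ord i; lia.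
have -> : (N * D + M.*2).+1 = (N * D.+1)%N by rewrite mulnSr /N addnS.
rewrite dvdn_mulr // natrM exprMn exprM aN [N%:R ^+ k.+1]exprSr.
by rewrite [RHS]mulrAC [in RHS]mulrA.
Qed.

Lemma nrm_nome w : nrm (nome w) = expR (- (2 * pi * Im w)).
Proof.
by rewrite /nome nrm_cexp; congr expR; case: w => a b /=; ring.
Qed.

Lemma nome_lt1 w : 0 < Im w -> nrm (nome w) < 1.
Proof.
move=> w0; rewrite nrm_nome -expR0 ltr_expR oppr_lt0 !mulr_gt0 //.
exact: pi_gt0.
Qed.

Lemma Im_shift M w i : Im (shift_pt M w i) = Im w.
Proof.
rewrite /shift_pt ImD; have -> : (i%:Z - M%:Z)%:~R = (((i%:Z - M%:Z)%:~R)%:C)%C :> C.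
  by rewrite rmorph_int.
by rewrite addr0.
Qed.

Lemma Re_shift M w i : Re (shift_pt M w i) = Re w + (i%:Z - M%:Z)%:~R.
Proof.
rewrite /shift_pt ReD; congr (_ + _).
have -> : (i%:Z - M%:Z)%:~R = (((i%:Z - M%:Z)%:~R)%:C)%C :> C by rewrite rmorph_int.
by [].
Qed.

Lemma ReIm_divN z N : Re (z / N%:R) = Re z / N%:R /\ Im (z / N%:R) = Im z / N%:R.
Proof.
have -> : (N%:R : C) = (N%:R%:C)%C by rewrite rmorph_nat.
rewrite -fmorphV; case: z => a b /=; split; ring.
Qed.

Lemma polylog_distr k M w (N := M.*2.+1) : 0 < Im w ->
  \sum_(i < N) polylog_neg k (nome (shift_pt M w i / N%:R)) =
  N%:R ^+ k.+1 * polylog_neg k (nome w).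
Proof.
move=> w0.
have c1 : (fun D => \sum_(i < N) powsum k (N * D) (nome (shift_pt M w i / N%:R))) @ \oo -->
    \sum_(i < N) polylog_neg k (nome (shift_pt M w i / N%:R)).
  apply: cvgC_sum => i _; apply: (cvg_comp (fun D => (N * D)%N) (fun D => powsum k D (nome (shift_pt M w i / N%:R)))); last first.
    apply: powsum_cvg; apply: nome_lt1.
    by rewrite (ReIm_divN _ _).2 Im_shift divr_gt0 ?ltr0n.
  move=> A [n _ nA]; exists n => // m /= nm; apply: nA => /=.
  by rewrite (leq_trans nm) // leq_pmull.
have c2 : (fun D => N%:R ^+ k.+1 * powsum k D (nome w)) @ \oo -->
    N%:R ^+ k.+1 * polylog_neg k (nome w).
  by apply: cvgM; [exact: cvg_cst|apply: powsum_cvg; exact: nome_lt1].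
have E : (fun D => \sum_(i < N) powsum k (N * D) (nome (shift_pt M w i / N%:R))) =
    (fun D => N%:R ^+ k.+1 * powsum k D (nome w)).
  by apply/funext => D; exact: powsum_distr.
rewrite E in c1; exact: (cvg_unique _ c1 c2).
Qed.

(** As [|m| <= |w + m| + |Re w|] and [|w + m| >= Im w], the quotient of [1 + |m|] by [|w + m|] is at
    most [1 + A / Im w] with [A = |Re w| + 1]. *)
Lemma shift_lower w : 0 < Im w -> exists2 c : R, 0 < c &
  forall M i, c * (dist M i).+1%:R <= nrm (shift_pt M w i).
Proof.
move=> w0; set A := `|Re w| + 1; have A0 : 0 < A by rewrite ltr_wpDl.
exists (1 + A / Im w)^-1 => [|M i]; first by rewrite invr_gt0 addr_gt0 // divr_gt0.
rewrite ler_pdivrMl ?addr_gt0 ?divr_gt0 //.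
have h1 : Im w <= nrm (shift_pt M w i).
  by rewrite -(Im_shift M w i) (le_trans (ler_norm _)) // nrm_geIm.
have h2 : (dist M i).+1%:R <= nrm (shift_pt M w i) + A.
  rewrite -natr1 /dist natr_absz /A addrA lerD2r.
  have := nrm_geRe (shift_pt M w i); rewrite Re_shift intr_norm => h.
  apply: (@le_trans _ _ (`|Re w + (i%:Z - M%:Z)%:~R| + `|Re w|)); last by rewrite lerD2r.
  have := ler_normB (Re w + (i%:Z - M%:Z)%:~R) (Re w).
  by rewrite [_ + _ - _]addrC addKr.
apply: (le_trans h2); rewrite mulrDl mul1r lerD2l -mulrA ler_peMr ?(ltW A0) //.
by rewrite mulrC ler_pdivlMr // mul1r.
Qed.

Definition monotangent k M w : C := \sum_(i < M.*2.+1) shift_pt M w i ^- k.+1.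

(** In the distribution relation each value is replaced by its pole. The poles add up to the
    monotangent; the errors, divided by [N^(k+1)], add up to [O(1/N)] times the sum of the
    [(1 + |m|)^(-k)], hence tend to 0 when [k > 0]. For [k = 0] the limit has a further term
    [- pi i]. *)
Lemma lipschitz k w : (0 < k)%N -> 0 < Im w ->
  monotangent k M w @[M --> \oo] --> (- tpi) ^+ k.+1 / k`!%:R * polylog_neg k (nome w).
Proof.
move=> k0 w0; have [K K0 asy] := polylog_neg_asymp R k.
have [c c0 low] := shift_lower w0.
have tpi0 : tpi != 0.
  rewrite eq_complex /= eqxx /= mulf_eq0 pnatr_eq0 /= gt_eqF //; exact: pi_gt0.
have kf : k`!%:R != 0 :> C by rewrite pnatr_eq0 -lt0n fact_gt0.
have tn0 : 0 < nrm tpi by rewrite nrm_gt0.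
set B := nrm ((- tpi) ^+ k.+1 / k`!%:R) * (K * ((nrm tpi)^-1 ^+ k * c^-1 ^+ k) * 2).
have E0 : 0 <= (nrm tpi)^-1 ^+ k * c^-1 ^+ k.
  by rewrite mulr_ge0 // exprn_ge0 // invr_ge0 ?nrm_ge0 // ltW.
apply: (@cvgC_near _ _ _ (fun M => B * (hsum R M / M.+1%:R))); last exact: hsum_small.
(* From here on all points [2 pi i (w + m) / N] lie in [exp_region]: the first summand controls
   their real parts, the second their imaginary parts. *)
have [M0 hM0] : exists M0 : nat, 2 * pi * Im w + 2 * `|Re w| <= M0%:R.
  by exists (Num.truncn (2 * pi * Im w + 2 * `|Re w|)).+1; apply/ltW/truncnS_gt.
exists M0 => // M /= M0M; set N := M.*2.+1.
have N0 : N%:R != 0 :> C by rewrite pnatr_eq0.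
have NR : 0 < N%:R :> R by rewrite ltr0n.
have hM : 2 * pi * Im w + 2 * `|Re w| <= M%:R by rewrite (le_trans hM0) // ler_nat.
have NM : N%:R = 2 * M%:R + 1 :> R by rewrite /N -natr1 -muln2 natrM mulrC.
have piw : 0 < 2 * pi * Im w by rewrite !mulr_gt0 //; exact: pi_gt0.
have pi0 := pi_gt0 R.
pose s i := tpi * (shift_pt M w i / N%:R).
have sr (i : 'I_N) : exp_region (s i).
  have [r1 r2] := ReIm_divN (shift_pt M w i) N.
  have ReE : Re (s i) = - (2 * pi * Im w / N%:R).
    rewrite /s; have : Re (tpi * (shift_pt M w i / N%:R)) = - (2 * pi * Im (shift_pt M w i / N%:R)).
      by case: (shift_pt M w i / N%:R) => a b /=; ring.
    by move=> ->; rewrite r2 Im_shift mulrA.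
  have ImE : Im (s i) = 2 * pi * (Re w + (i%:Z - M%:Z)%:~R) / N%:R.
    rewrite /s; have : Im (tpi * (shift_pt M w i / N%:R)) = 2 * pi * Re (shift_pt M w i / N%:R).
      by case: (shift_pt M w i / N%:R) => a b /=; ring.
    by move=> ->; rewrite r1 Re_shift mulrA.
  split.
  - rewrite ReE lerNl opprK ler_pdivrMr // mul1r NM.
    have : 0 <= `|Re w| by []. lra.
  - by rewrite ReE oppr_lt0 divr_gt0.
  - have jM : `|(i%:Z - M%:Z)%:~R| <= M%:R :> R.
      rewrite -intr_norm.
      have -> : M%:R = (M%:Z)%:~R :> R by [].
      by rewrite ler_int lez_nat; exact: dist_le.
    have := ler_normD (Re w) (i%:Z - M%:Z)%:~R => h.
    have h3 : `|Re w + (i%:Z - M%:Z)%:~R| < 3 / 4 * N%:R.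
      rewrite NM; have : 0 <= `|Re w| by []. lra.
    rewrite ImE !normrM (ger0_norm (x := 2)) // (ger0_norm (x := pi)) ?ltW //.
    rewrite (ger0_norm (x := N%:R^-1)) ?invr_ge0 ?ltW // ltr_pdivrMr //.
    have : 2 * pi * `|Re w + (i%:Z - M%:Z)%:~R| < 2 * pi * (3 / 4 * N%:R).
      by rewrite ltr_pM2l // mulr_gt0.
    by congr (_ < _); field.
have wj (i : 'I_N) : shift_pt M w i != 0.
  by rewrite -nrm_gt0 (lt_le_trans _ (low M i)) // mulr_gt0 // ltr0n.
pose e i := polylog_neg k (cexp (s i)) - k`!%:R * (- s i) ^- k.+1.
have PE : N%:R ^+ k.+1 * polylog_neg k (nome w) =
    \sum_(i < N) e i + k`!%:R * N%:R ^+ k.+1 * (- tpi) ^- k.+1 * monotangent k M w.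
  rewrite -polylog_distr // mulr_sumr -big_split; apply: eq_bigr => i _ /=.
  rewrite /e -/(s i); have -> : nome (shift_pt M w i / N%:R) = cexp (s i) by [].
  have -> : - s i = (- tpi) * shift_pt M w i * N%:R^-1 by rewrite /s; ring.
  rewrite !exprMn !invfM exprVn invrK; ring.
have -> : monotangent k M w - (- tpi) ^+ k.+1 / k`!%:R * polylog_neg k (nome w) =
    - ((- tpi) ^+ k.+1 / k`!%:R * (N%:R ^- k.+1 * \sum_(i < N) e i)).
  have -> : polylog_neg k (nome w) = N%:R ^- k.+1 * (N%:R ^+ k.+1 * polylog_neg k (nome w)).
    by rewrite mulKf // expf_neq0.
  rewrite PE; have t1 : (- tpi) ^+ k.+1 != 0 by rewrite expf_neq0 // oppr_eq0.
  have t2 : N%:R ^+ k.+1 != 0 :> C by rewrite expf_neq0.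
  by move: (monotangent _ _ _) (\sum_(i < N) _) => u v; field; rewrite kf t1 t2.
rewrite nrmN nrmM /B -[leRHS]mulrA ler_wpM2l ?nrm_ge0 //.
have eB (i : 'I_N) : nrm (e i) <=
    K * ((nrm tpi)^-1 ^+ k * c^-1 ^+ k) * N%:R ^+ k * (dist M i).+1%:R^-1.
  apply: (le_trans (asy _ (sr i))); rewrite -!mulrA ler_wpM2l //.
  rewrite /s !nrmM nrmV nrm_nat !invfM invrK !exprMn ler_wpM2l //.
    by rewrite exprn_ge0 // invr_ge0 nrm_ge0.
  rewrite [leLHS]mulrC [leRHS]mulrCA ler_wpM2l ?exprn_ge0 ?(ltW NR) //.
  have d1 : 1 <= (dist M i).+1%:R :> R by rewrite ler1n.
  have dV : 0 <= (dist M i).+1%:R^-1 :> R by rewrite invr_ge0 ler0n.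
  have l2 : (nrm (shift_pt M w i))^-1 <= c^-1 * (dist M i).+1%:R^-1.
    rewrite -invfM lef_pV2 ?posrE ?low //; last by rewrite mulr_gt0 // ltr0n.
    by rewrite nrm_gt0.
  apply: (@le_trans _ _ ((c^-1 * (dist M i).+1%:R^-1) ^+ k)).
    by rewrite lerXn2r ?nnegrE ?invr_ge0 ?nrm_ge0 // mulr_ge0 // invr_ge0 ltW.
  rewrite exprMn ler_wpM2l ?exprn_ge0 ?invr_ge0 ?(ltW c0) //.
  case: (k) k0 => // k' _; rewrite exprS ler_piMr // exprn_ile1 // invf_le1 //.
rewrite nrmM nrmV nrmX nrm_nat.
have S1 : nrm (\sum_(i < N) e i) <=
    K * ((nrm tpi)^-1 ^+ k * c^-1 ^+ k) * N%:R ^+ k * (2 * hsum R M).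
  apply: (le_trans (nrm_sum _ _ _)); apply: (le_trans (ler_sum _ (fun i _ => eB i))).
  rewrite -mulr_sumr ler_wpM2l ?mulr_ge0 ?exprn_ge0 ?ler0n ?invr_ge0 ?nrm_ge0 ?(ltW c0) //.
  by apply: (sum_dist (f := fun a => a.+1%:R^-1)) => a; rewrite invr_ge0 ler0n.
apply: (@le_trans _ _ (N%:R ^- k.+1 *
    (K * ((nrm tpi)^-1 ^+ k * c^-1 ^+ k) * N%:R ^+ k * (2 * hsum R M)))).
  by rewrite ler_wpM2l // invr_ge0 exprn_ge0 // ler0n.
have -> : N%:R ^- k.+1 * (K * ((nrm tpi)^-1 ^+ k * c^-1 ^+ k) * N%:R ^+ k * (2 * hsum R M)) =
    K * ((nrm tpi)^-1 ^+ k * c^-1 ^+ k) * 2 * (hsum R M * N%:R^-1).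
  have n0 : N%:R != 0 :> R by rewrite gt_eqF.
  rewrite exprS; have := expf_neq0 k n0; move: (N%:R ^+ k) n0 => u n0 u0.
  move: (_ * _ ^+ k) => v.
  by field; rewrite n0 u0.
apply: ler_wpM2l; first by rewrite mulr_ge0 // mulr_ge0.
apply: ler_wpM2l; first exact: hsum_ge0.
by rewrite lef_pV2 ?posrE ?ltr0n // ler_nat /N ltnS -addnn leq_addr.
Qed.

End Lipschitz.

(** * Multitangent functions *)

Section Subsequences.
Variable T : eqType.
Implicit Types s m : seq T.

Fixpoint subs p s : seq (seq T) :=
  match p, s with
  | 0, _ => [:: [::]]
  | _.+1, [::] => [::]
  | p'.+1, x :: s' => [seq x :: m | m <- subs p' s'] ++ subs p s'
  end.

Lemma subs0 s : subs 0 s = [:: [::]]. Proof. by case: s. Qed.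

Lemma mem_subs p s m : m \in subs p s -> size m = p /\ subseq m s.
Proof.
elim: s p m => [|x s IHs] [|p] m //=; rewrite ?inE; try by move=> /eqP->.
rewrite mem_cat => /orP[/mapP[m' /IHs[<- h] ->]|/IHs[h1 h2]].
  by rewrite /= eqxx.
by split=> //; case: m h1 h2 => //= y m _ h; case: ifP => // _; apply: cons_subseq h.
Qed.

Variable V : nmodType.
Implicit Type F : seq T -> V.

Lemma sum_subs0 s F : \sum_(m <- subs 0 s) F m = F [::].
Proof. by rewrite subs0 big_seq1. Qed.

Lemma sum_subs_cons p x s F : \sum_(m <- subs p.+1 (x :: s)) F m =
  \sum_(m <- subs p s) F (x :: m) + \sum_(m <- subs p.+1 s) F m.
Proof. by rewrite /= big_cat big_map. Qed.

Lemma sum_subs_nil p F : \sum_(m <- subs p.+1 [::]) F m = 0.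
Proof. by rewrite big_nil. Qed.

Lemma sum_subs_split x0 j q s F : \sum_(m <- subs (j + q.+1) s) F m =
  \sum_(i < size s) \sum_(l <- subs j (take i s)) \sum_(r <- subs q (drop i.+1 s))
    F (l ++ nth x0 s i :: r).
Proof.
elim: s j F => [|x s IHs] j F.
  by rewrite addnS sum_subs_nil big_ord0.
rewrite big_ord_recl /= addnS sum_subs_cons -addnS; case: j => [|j].
  congr (_ + _); first by rewrite big_seq1 drop0.
  by rewrite (IHs 0%N); apply: eq_bigr => i _; rewrite sum_subs0 big_seq1.
have e : (j.+1 + q = j + q.+1)%N by rewrite addSnnS.
rewrite big_nil add0r e !IHs -big_split /=.
by apply: eq_bigr => i _; rewrite big_cat big_map.
Qed.

Lemma sum_subs_cat p s t F : \sum_(m <- subs p (s ++ t)) F m =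
  \sum_(j < p.+1) \sum_(l <- subs j s) \sum_(r <- subs (p - j) t) F (l ++ r).
Proof.
elim: s p F => [|x s IHs] p F.
  rewrite big_ord_recl sum_subs0 subn0 [X in _ + X]big1 ?addr0 // => i _.
  by rewrite lift0 sum_subs_nil.
case: p => [|p]; first by rewrite big_ord1 !sum_subs0.
rewrite /= -/(subs p.+1 (s ++ t)) sum_subs_cons !IHs [in RHS]big_ord_recl.
rewrite [X in _ + X]big_ord_recl !sum_subs0 addrCA; congr (_ + _).
  by rewrite big_seq1.
rewrite -big_split; apply: eq_bigr => i _ /=.
by rewrite /bump /= add1n subSS add0n big_cat big_map.
Qed.

Lemma sum_subs_rcons p s x F : \sum_(m <- subs p.+1 (rcons s x)) F m =
  \sum_(m <- subs p s) F (rcons m x) + \sum_(m <- subs p.+1 s) F m.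
Proof.
elim: s p F => [|y s IHs] p F.
  rewrite /= cats0 big_map big_nil addr0.
  by case: p => [|p]; rewrite ?subs0 ?big_seq1 ?big_nil.
rewrite rcons_cons !sum_subs_cons IHs; case: p => [|p].
  by rewrite !sum_subs0 addrCA.
by rewrite IHs sum_subs_cons addrACA.
Qed.

Lemma sum_subs_rev p s F : \sum_(m <- subs p (rev s)) F m = \sum_(m <- subs p s) F (rev m).
Proof.
elim: s p F => [|x s IHs] [|p] F; rewrite ?sum_subs0 ?sum_subs_nil //.
rewrite rev_cons sum_subs_rcons sum_subs_cons !IHs.
by congr (_ + _); apply: eq_bigr => m _; rewrite rev_cons.
Qed.

End Subsequences.

Lemma subs_map (T U : eqType) (g : T -> U) p s : subs p (map g s) = [seq map g m | m <- subs p s].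
Proof.
elim: s p => [|x s IHs] [|p] //=.
by rewrite map_cat -!map_comp !IHs -map_comp.
Qed.

(* Sequences [nat -> R] stand for formal power series, [conv] for their product. *)
Section FormalSeries.
Variable R : realType.
Implicit Types (f g h : nat -> R) (D : R) (n c : nat).

Definition fps1 : nat -> R := fun c => (c == 0)%:R.
Definition fps_shift f : nat -> R := fun c => if c is c'.+1 then f c' else 0.

Lemma conv1f f : conv fps1 f = f.
Proof.
apply/funext => c; rewrite /conv big_ord_recl subn0 mul1r big1 ?addr0 // => i _.
by rewrite mul0r.
Qed.

Lemma convf1 f : conv f fps1 = f.
Proof. by rewrite -[RHS]conv1f; apply/funext => c; exact: convC. Qed.

Lemma convCf f g : conv f g = conv g f. Proof. by apply/funext => c; exact: convC. Qed.
Lemma convAf f g h : conv (conv f g) h = conv f (conv g h).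
Proof. by apply/funext => c; exact: convA. Qed.

Lemma conv_lin D f g h : conv (fun c => D * f c + g c) h = fun c => D * conv f h c + conv g h c.
Proof.
apply/funext => c; rewrite /conv mulr_sumr -big_split; apply: eq_bigr => i _ /=.
by rewrite mulrDl mulrA.
Qed.

Lemma conv_shift f g : conv (fps_shift f) g = fps_shift (conv f g).
Proof.
apply/funext => -[|c]; first by rewrite /conv big_ord1 mul0r.
by rewrite /conv big_ord_recl mul0r add0r.
Qed.

(* The expansion of [(D + X) ^- n]. *)
Definition neg_binom n D : nat -> R := fun c =>
  if n is n'.+1 then (-1) ^+ c * 'C(n' + c, c)%:R * D^-1 ^+ (n + c) else fps1 c.

Lemma neg_binom0 D : neg_binom 0 D = fps1. Proof. by []. Qed.

(** [(D + X) ^- n] is [D + X] times [(D + X) ^- n.+1]. *)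
Lemma neg_binom_step n D : D != 0 ->
  neg_binom n D = fun c => D * neg_binom n.+1 D c + fps_shift (neg_binom n.+1 D) c.
Proof.
move=> D0; apply/funext => -[|c]; rewrite /fps_shift /neg_binom.
    case: n => [|n]; rewrite !expr0 ?addn0 ?bin0 ?mul1r ?addr0 /=.
    by rewrite expr1 divff.
  by rewrite [D^-1 ^+ n.+2]exprS mulrA divff // mul1r.
have E k : D * D^-1 ^+ k.+1 = D^-1 ^+ k by rewrite exprS mulrA divff // mul1r.
case: n => [|n].
  by rewrite !add0n !binn !mulr1 add1n mulrCA E exprS mulN1r mulNr addNr.
have e1 := E (n.+1 + c.+1)%N.
have e2 : (n.+2 + c = n.+1 + c.+1)%N by rewrite addSnnS.
have e3 : 'C(n.+1 + c.+1, c.+1)%:R = 'C(n + c.+1, c.+1)%:R + 'C(n.+1 + c, c)%:R :> R.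
  by rewrite addSn binS natrD addSnnS.
rewrite [D * _]mulrCA [(n.+2 + c.+1)%N]addSn e1 e2 e3 exprS.
move: (_ ^+ c) (_%:R) (_%:R) (D^-1 ^+ _) => a b d e; ring.
Qed.

Lemma neg_binom_deriv n D c :
  neg_binom n D c.+1 *+ c.+1 = - (n%:R * neg_binom n.+1 D c).
Proof.
case: n => [|n]; first by rewrite /= mul0rn mul0r oppr0.
have E : 'C(n + c.+1, c.+1)%:R * c.+1%:R = n.+1%:R * 'C(n.+1 + c, c)%:R :> R.
  rewrite -!natrM mulnC mul_bin_left; congr (_ * _)%:R; last by rewrite addSnnS.
  by rewrite addnS subSn ?leq_addl // addnK.
rewrite -[LHS]mulr_natr /neg_binom exprS.
have -> : (n.+2 + c = n.+1 + c.+1)%N by rewrite addSnnS.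
rewrite [n.+1%:R * _]mulrA [n.+1%:R * _]mulrCA -E.
move: (_ ^+ c) (_%:R) (_%:R) (D^-1 ^+ _) => a b d e; ring.
Qed.

Lemma neg_binomN n D c : neg_binom n (- D) c = (-1) ^+ (n + c) * neg_binom n D c.
Proof.
case: n => [|n]; first by case: c => [|c]; rewrite /= ?mulr0 // mulr1.
by rewrite /neg_binom invrN [(- D^-1) ^+ _]exprNn [LHS]mulrCA.
Qed.

(** The difference of [D + X] and [D' + X] is constant; multiplying the product of negative powers
    by it lowers one exponent at a time. *)
Lemma conv_neg_binom n n' D D' : D != 0 -> D' != 0 ->
  (fun c => (D - D') * conv (neg_binom n.+1 D) (neg_binom n'.+1 D') c) =
  (fun c => conv (neg_binom n D) (neg_binom n'.+1 D') c -
    conv (neg_binom n.+1 D) (neg_binom n' D') c).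
Proof.
move=> D0 D0'; rewrite [neg_binom n D]neg_binom_step // conv_lin conv_shift.
rewrite [conv _ (neg_binom n' D')]convCf [neg_binom n' D']neg_binom_step // conv_lin conv_shift.
rewrite [conv (neg_binom n'.+1 D') _]convCf; apply/funext => c; ring.
Qed.

(* The expansion of the product of the [(x - t + X) ^- n], (x, n) in s. *)
Definition nb_prod (s : seq (R * nat)) (t : R) : nat -> R :=
  foldr (fun p => conv (neg_binom p.2 (p.1 - t))) fps1 s.

Lemma nb_prod_cat s s' t : nb_prod (s ++ s') t = conv (nb_prod s t) (nb_prod s' t).
Proof. by elim: s => [|p s IHs] /=; rewrite ?conv1f // IHs convAf. Qed.

Lemma nb_prod_rev s t : nb_prod (rev s) t = nb_prod s t.
Proof.
elim: s => // p s IHs; rewrite rev_cons -cats1 nb_prod_cat IHs /= convf1.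
exact: convCf.
Qed.

End FormalSeries.

Section PartialFractions.
Variable R : realType.
Local Notation C := (Cplx R).
Variable w : C.
Implicit Types (f g : nat -> R) (D t : R) (n c : nat) (s l r : seq (R * nat)).

Definition pt t : C := w + (t%:C)%C.

(** The polar part at [w = - t] of [(w + t) ^- n] times a factor whose expansion in powers of
    [w + t] is [f]. *)
Definition polar n t f : C := \sum_(k < n) pt t ^- k.+1 * ((f (n - k.+1)%N)%:C)%C.

Lemma polar_shift n t f : polar n.+1 t (fps_shift f) = polar n t f.
Proof.
rewrite /polar big_ord_recr /= subnn /= mulr0 addr0; apply: eq_bigr => i _.
have -> : (n.+1 - i.+1 = (n - i.+1).+1)%N by have := ltn_ord i; lia.
by [].

Qed.

Lemma polar_lin n t D f g : polar n t (fun c => D * f c + g c) =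
  (D%:C)%C * polar n t f + polar n t g.
Proof.
rewrite /polar mulr_sumr -big_split; apply: eq_bigr => i _ /=.
by rewrite rmorphD rmorphM mulrDr mulrCA.
Qed.

Lemma polarB n t f g : polar n t (fun c => f c - g c) = polar n t f - polar n t g.
Proof.
rewrite /polar -sumrB; apply: eq_bigr => i _.
by rewrite rmorphB mulrBr.
Qed.

Lemma polarZ n t D f : polar n t (fun c => D * f c) = (D%:C)%C * polar n t f.
Proof.
rewrite /polar mulr_sumr; apply: eq_bigr => i _ /=.
by rewrite rmorphM mulrCA.
Qed.

(* Partial fractions in [w]: each pair of [s] contributes its polar part, and [l]
   holds the pairs already met, last one first. *)
Fixpoint polar_sum l s : C :=
  if s is p :: s' then
    polar p.2 p.1 (conv (nb_prod l p.1) (nb_prod s' p.1)) + polar_sum (p :: l) s'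
  else 0.

Lemma polar_sumE l s : polar_sum l s = \sum_(i < size s)
  polar (nth (0, 0%N) s i).2 (nth (0, 0%N) s i).1
    (conv (nb_prod (rev (take i s) ++ l) (nth (0, 0%N) s i).1)
       (nb_prod (drop i.+1 s) (nth (0, 0%N) s i).1)).
Proof.
elim: s l => [|p s IHs] l; first by rewrite big_ord0.
rewrite big_ord_recl /= drop0 IHs; congr (_ + _); apply: eq_bigr => i _.
by rewrite add0n rev_cons cat_rcons.
Qed.

Lemma polar_sum_nosing l l' t s : polar_sum (l ++ (t, 0%N) :: l') s = polar_sum (l ++ l') s.
Proof.
elim: s l => //= p s IHs l; rewrite -cat_cons IHs; congr (_ + _).
by rewrite !nb_prod_cat /= conv1f.
Qed.

Lemma polar_sum_step t1 t2 n1 n2 l s :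
  (forall p, p \in s -> t1 != p.1 /\ t2 != p.1) ->
  ((t1 - t2)%:C)%C * polar_sum (l ++ [:: (t2, n2.+1); (t1, n1.+1)]) s =
  polar_sum (l ++ [:: (t2, n2.+1); (t1, n1)]) s - polar_sum (l ++ [:: (t2, n2); (t1, n1.+1)]) s.
Proof.
elim: s l => [|p s IHs] l ps /=; first by rewrite subrr mulr0.
rewrite -!cat_cons mulrDr IHs => [|q qs]; last by apply: ps; rewrite inE qs orbT.
rewrite opprD addrACA; congr (_ + _).
have [h1 h2] := ps p (mem_head _ _).
rewrite -polarZ -polarB; congr polar; apply/funext => c.
rewrite !nb_prod_cat /= !convf1 ![conv (conv (nb_prod l _) _) _]convAf.
have e f : conv (nb_prod l p.1) (conv f (nb_prod s p.1)) =
    conv f (conv (nb_prod l p.1) (nb_prod s p.1)).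
  by rewrite -convAf [conv (nb_prod l _) f]convCf convAf.
rewrite !e; set A := conv (nb_prod l _) _.
rewrite ![conv (neg_binom _ (t2 - _)) _]convCf.
have := @conv_neg_binom R n1 n2 (t1 - p.1) (t2 - p.1).
rewrite !subr_eq0 => /(_ h1 h2).
have -> : t1 - p.1 - (t2 - p.1) = t1 - t2 by ring.
set B := conv (neg_binom n1.+1 _) (neg_binom n2.+1 _) => E.
have := congr1 (fun f => conv f A c) E => /=.
rewrite /conv mulr_sumr; under eq_bigr do rewrite -mulrA; move=> -> .
by rewrite -sumrB; apply: eq_bigr => i _; rewrite mulrBl.
Qed.

(** A purely algebraic induction, on the number of pairs plus the sum of the exponents:
    multiplication by [t1 - t2] lowers [n1] or [n2] on both sides alike, and a pair of exponent 0 is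
    removed. *)
Lemma partial_fractions s : uniq (map fst s) -> (0 < sumn (map snd s))%N ->
  (forall p, p \in s -> pt p.1 != 0) ->
  \prod_(p <- s) pt p.1 ^- p.2 = polar_sum [::] s.
Proof.
have [m] := ubnP (size s + sumn (map snd s))%N.
elim: m s => // m IHm [|[t1 n1] s] //= hm /andP[t1s us] n0 s0.
rewrite big_cons /= conv1f.
have ps : forall p, p \in s -> pt p.1 != 0 by move=> p ps; apply: s0; rewrite inE ps orbT.
have p1 : pt t1 != 0 by apply: (s0 (t1, n1)); rewrite mem_head.
case: n1 hm n0 {s0} => [|n1] hm n0.
  have hm' : (size s + sumn [seq i.2 | i <- s] < m)%N by move: hm; rewrite addSn ltnS.
  rewrite expr0 invr1 mul1r (IHm _ hm' us n0 ps).
  by rewrite /polar big_ord0 add0r (polar_sum_nosing [::] [::]).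
case: s t1s us ps hm {n0} => [|[t2 n2] s] /= t1s us ps hm.
  rewrite big_nil mulr1 addr0 /polar big_ord_recr /= subnn mulr1 big1 ?add0r // => i _.
  by rewrite /fps1 subSS subn_eq0 leqNgt ltn_ord mulr0.
have /andP[t2s us'] := us; move: t1s; rewrite inE negb_or => /andP[t12 t1s].
have p2 : pt t2 != 0 by apply: (ps (t2, n2)); rewrite mem_head.
have ps' : forall p, p \in s -> pt p.1 != 0 by move=> p q; apply: ps; rewrite inE q orbT.
have IH a b : (a + b < n1.+1 + n2)%N -> (0 < a + b)%N ->
    pt t1 ^- a * (pt t2 ^- b * \prod_(p <- s) pt p.1 ^- p.2) =
    polar_sum [::] [:: (t1, a), (t2, b) & s].
  move=> ab ab0; rewrite -IHm /=; first by rewrite !big_cons.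
  - lia.
  - by rewrite inE negb_or t12 t1s t2s us'.
  - lia.
  - by move=> p; rewrite !inE => /or3P[/eqP->|/eqP->|/ps'].
case: n2 us ps hm IH => [|n2] us ps hm IH.
  rewrite neg_binom0 conv1f {2}/polar big_ord0 add0r (polar_sum_nosing [::]) /=.
  rewrite big_cons expr0 invr1 mul1r.
  have := IHm ((t1, n1.+1) :: s); rewrite big_cons /= !conv1f => ->.
  - by [].
  - lia.
  - by rewrite t1s.
  - by [].
  - by move=> p; rewrite !inE => /orP[/eqP->|/ps'].
rewrite big_cons /=; set P := \prod_(p <- s) _ in IH *.
have t0 : ((t1 - t2)%:C)%C != 0 :> C by rewrite fmorph_eq0 subr_eq0.
apply: (mulfI t0).
have -> : ((t1 - t2)%:C)%C * (pt t1 ^- n1.+1 * (pt t2 ^- n2.+1 * P)) =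
    pt t1 ^- n1 * (pt t2 ^- n2.+1 * P) - pt t1 ^- n1.+1 * (pt t2 ^- n2 * P).
  have -> : ((t1 - t2)%:C)%C = pt t1 - pt t2 :> C by rewrite rmorphB /pt opprD addrACA subrr add0r.
  have := expf_neq0 n1 p1; have := expf_neq0 n2 p2; rewrite !exprS.
  move: (pt t1) (pt t2) (pt t1 ^+ n1) (pt t2 ^+ n2) p1 p2 => x y a b x0 y0 a0 b0.
  by field; rewrite x0 y0 a0 b0.
rewrite !IH; [|lia..].
rewrite /= !conv1f !convf1 !mulrDr (@polar_sum_step t1 t2 n1 n2 [::]); last first.
  move=> p psn; split.
    by apply: contraNneq t1s => ->; apply: map_f.
  by apply: contraNneq t2s => ->; apply: map_f.
rewrite -!polarZ.
have t21 : t2 - t1 != 0 by rewrite subr_eq0 eq_sym.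
have t12' : t1 - t2 != 0 by rewrite subr_eq0.
(* The polar parts at [t1] and [t2] themselves obey the recursion: a factor [D + X] acts as [D] plus
   a shift, and the shift lowers the order of the pole. *)
rewrite [neg_binom n2 (t2 - t1)]neg_binom_step // conv_lin conv_shift polar_lin polar_shift.
rewrite [neg_binom n1 (t1 - t2)]neg_binom_step // conv_lin conv_shift polar_lin polar_shift.
rewrite !polarZ -[t2 - t1]opprB rmorphN; ring.
Qed.

End PartialFractions.

(** * Truncated multiple zeta values and their rate of convergence *)

Section TruncatedZeta.
Variable R : realType.
Implicit Types (ns m : seq nat) (c K n : nat).

Lemma sum_subs_iota (V : nmodType) p K (F : seq nat -> V) :
  \sum_(m <- subs p.+1 (iota 1 K)) F m =
  \sum_(j < K) \sum_(m <- subs p (iota 1 j)) F (rcons m j.+1).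
Proof.
elim: K => [|K IHK]; first by rewrite big_ord0 sum_subs_nil.
rewrite -[in LHS](addn1 K) iotaD cats1 sum_subs_rcons add1n big_ord_recr /= -IHK.
by rewrite addrC.
Qed.

Definition zt_entries ns m : seq (R * nat) := zip [seq k%:R | k <- m] ns.

(** The coefficient of [X ^+ c] in the sum of the products of the [(m_i + X) ^- n_i] over
    [0 < m_1 < ... < m_r <= K]. *)
Definition zt ns c K : R :=
  \sum_(m <- subs (size ns) (iota 1 K)) nb_prod (zt_entries ns m) 0 c.

Lemma zt_entries_rcons ns m n k : size m = size ns ->
  zt_entries (rcons ns n) (rcons m k) = rcons (zt_entries ns m) (k%:R, n).
Proof. by move=> mn; rewrite /zt_entries map_rcons zip_rcons // size_map mn. Qed.

Lemma neg_binom_coef0 n (D : R) : neg_binom n D 0 = D ^- n.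
Proof. by case: n => [|n]; rewrite /neg_binom ?invr1 // expr0 addn0 bin0 addn0 !mul1r exprVn. Qed.

Lemma conv_coef0 (f g : nat -> R) : conv f g 0 = f 0%N * g 0%N.
Proof. by rewrite /conv big_ord1 subnn. Qed.

Lemma zt0 ns K : all (leq 1) ns -> zt ns 0 K = psum R (rev (index_word ns)) K.+1.
Proof.
elim/last_ind: ns K => [|ns n IHns] K; rewrite /zt.
  by rewrite sum_subs0 /psum big_ord_recl big1 /= ?addr0.
rewrite all_rcons size_rcons => /andP[n0 ns1]; rewrite sum_subs_iota.
rewrite /psum big_ord_recl li_index // expr0n gtn_eqF // invr0 mul0r add0r.
apply: eq_bigr => j _; rewrite lift0 li_index // -IHns // /zt mulr_sumr big_seq [RHS]big_seq.
apply: eq_bigr => m /mem_subs[mn _]; rewrite zt_entries_rcons // -cats1 nb_prod_cat.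
by rewrite conv_coef0 /= conv_coef0 neg_binom_coef0 subr0 mulr1 mulrC.
Qed.

Definition fps_deriv (f : nat -> R) : nat -> R := fun c => f c.+1 *+ c.+1.

Lemma fps_deriv_conv f g c :
  fps_deriv (conv f g) c = conv (fps_deriv f) g c + conv f (fps_deriv g) c.
Proof.
rewrite /fps_deriv conv_natM.
have E h : (fun i => h i *+ i) = fps_shift (fps_deriv h) by apply/funext => -[].
rewrite !E conv_shift; congr (_ + _).
by rewrite convC conv_shift /= convC.
Qed.

Lemma nb_prod_deriv ns m c : size m = size ns ->
  fps_deriv (nb_prod (zt_entries ns m) 0) c =
  - \sum_(i < size ns) (nth 0%N ns i)%:R * nb_prod (zt_entries (incr_nth ns i) m) 0 c.
Proof.
elim: ns m c => [|n ns IHns] [|k m] c //= => [_|[mn]].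
  by rewrite big_ord0 oppr0 /fps_deriv /= /fps1 mul0rn.
rewrite fps_deriv_conv big_ord_recl /= opprD; congr (_ + _).
  rewrite /conv mulr_sumr -sumrN; apply: eq_bigr => i _.
  rewrite /fps_deriv neg_binom_deriv mulNr; congr (- _).
  by rewrite -mulrA.
rewrite -sumrN; transitivity (\sum_(i < size ns) \sum_(j < c.+1) neg_binom n (k%:R - 0) j *
    - ((nth 0%N ns i)%:R * nb_prod (zt_entries (incr_nth ns i) m) 0 (c - j)%N)).
  rewrite exchange_big; apply: eq_bigr => j _ /=.
  by rewrite -/(zt_entries ns m) IHns // -mulr_sumr sumrN.
apply: eq_bigr => i _; rewrite add0n /conv mulr_sumr -sumrN; apply: eq_bigr => j _.
by rewrite mulrN mulrCA.
Qed.

Lemma zt_deriv ns c K :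
  zt ns c.+1 K *+ c.+1 = - \sum_(i < size ns) (nth 0%N ns i)%:R * zt (incr_nth ns i) c K.
Proof.
rewrite /zt -sumrMnl big_seq.
under eq_bigr => m /mem_subs[mn _] do rewrite -[_ *+ _]/(fps_deriv _ c) nb_prod_deriv //.
rewrite -big_seq sumrN exchange_big; congr (- _); apply: eq_bigr => i _ /=.
by rewrite size_incr_nth ltn_ord mulr_sumr.
Qed.

(* The coefficient of [X ^+ c] in the sum of the products of the [(m_i + X) ^- n_i],
   regularised when it diverges. *)
Definition zeta0 ns c : R := zsh R (I1 (false, nseq c false ++ index_word ns, true)).

Lemma sum_sh_nseq (V : zmodType) c w (phi : seq bool -> V) :
  \sum_(w' <- sh [:: false] (nseq c false ++ w)) phi w' =
  phi (nseq c.+1 false ++ w) *+ c + \sum_(w' <- sh [:: false] w) phi (nseq c false ++ w').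
Proof.
elim: c phi => [|c IHc] phi; first by rewrite mulr0n add0r.
rewrite -[nseq c.+1 false ++ w]/(false :: nseq c false ++ w) sum_sh_cons sh0s big_seq1 IHc addrA.
by rewrite mulrSr [_ *+ _ + _]addrC.
Qed.

Lemma sum_sh_index (V : zmodType) ns (phi : seq bool -> V) : all (leq 1) ns ->
  \sum_(w' <- sh [:: false] (index_word ns)) phi w' =
  phi (false :: index_word ns) +
    \sum_(i < size ns) phi (index_word (incr_nth ns i)) *+ nth 0%N ns i.
Proof.
elim: ns phi => [|n ns IHns] phi.
  by move=> _; rewrite big_ord0 addr0 /= big_seq1.
move=> /andP[n0 ns1]; rewrite -[index_word (n :: ns)]/(true :: nseq n.-1 false ++ index_word ns).
rewrite sum_sh_cons sh0s big_seq1; congr (_ + _).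
rewrite sum_sh_nseq IHns // big_ord_recl /= addrA; congr (_ + _).
rewrite -[in RHS](prednK n0) mulrSr; congr (_ + phi (_ :: _)).
by rewrite -[false :: index_word ns]/([:: false] ++ _) catA cats1 -[RHS]/(nseq n.-1.+1 _ ++ _) -(addn1 n.-1) nseqD cats1.
Qed.

(** The shuffle with the single letter 0 vanishes. Inserting 0 within or next to the leading zeros
    gives the same word [c + 1] times, inserting it in the block of [n_i] raises this entry in [n_i]
    ways: this is the recursion of [zt_deriv]. *)
Lemma zeta0_deriv ns c : all (leq 1) ns ->
  zeta0 ns c.+1 *+ c.+1 = - \sum_(i < size ns) (nth 0%N ns i)%:R * zeta0 (incr_nth ns i) c.
Proof.
move=> ns1; have [zl _] := zsh_is_zsh R.
have := congr1 (zsh R) (I1_insert0 false (nseq c false ++ index_word ns) true).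
rewrite (linear_for0 zl) (linear_for_sum zl).
rewrite (sum_sh_nseq c _ (fun w => zsh R (I1 (false, w, true)))).
rewrite (sum_sh_index (fun w => zsh R (I1 (false, nseq c false ++ w, true)))) //.
rewrite addrA => /eqP; rewrite addr_eq0 => /eqP h; rewrite /zeta0 mulrSr.
have e : nseq c.+1 false ++ index_word ns = nseq c false ++ false :: index_word ns.
  by rewrite -[nseq c.+1 _]/(nseq (1 + c) _) addnC nseqD -catA.
rewrite [X in _ + zsh R (I1 (_, X, _))]e [LHS]h -!sumrN; apply: eq_bigr => i _.
by rewrite mulr_natl.
Qed.

Lemma le1_of_le2 ns : all (leq 2) ns -> all (leq 1) ns.
Proof. by apply: sub_all => k /ltnW. Qed.

Lemma adm_of_le2 ns : all (leq 2) ns -> admissible ns.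
Proof.
move=> ns2; rewrite /admissible le1_of_le2 //=; case: ns / lastP ns2 => // ns n.
by rewrite all_rcons last_rcons => /andP[].
Qed.

Lemma zeta0_base ns : all (leq 2) ns -> zeta0 ns 0 = limn (psum R (rev (index_word ns))).
Proof.
move=> ns2; have [_ zn] := zsh_is_zsh R.
rewrite /zeta0 -[I1 _]/(I1_index ns) zn ?le1_of_le2 // zeta_sh_admissible ?adm_of_le2 //.
by rewrite mzeta_limn ?adm_of_le2.
Qed.

Lemma tail_rate (s : nat -> R) (C : R) : 0 <= C -> {homo s : K K' / (K <= K')%N >-> K <= K'} ->
  (forall K, s K.+1 - s K <= C / (K.+1%:R * K.+2%:R)) -> cvgn s ->
  forall K, `|s K - limn s| <= C / K.+1%:R.
Proof.
move=> C0 snd sd cs K.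
(* The bound on the increments is a difference of consecutive values of [C / K.+1%:R], so it
   telescopes. *)
have h d : s (K + d)%N <= s K + C / K.+1%:R - C / (K + d).+1%:R.
  elim: d => [|d IHd]; first by rewrite addn0 addrK.
  have := sd (K + d)%N; rewrite -addnS => h.
  have -> : s (K + d.+1)%N = s (K + d)%N + (s (K + d.+1)%N - s (K + d)%N) by rewrite addrC subrK.
  apply: (le_trans (lerD IHd h)); rewrite -addrA lerD2l addrC -lerBrDr opprK addnS.
  have h1 : (K + d).+1%:R != 0 :> R by rewrite pnatr_eq0.
  have h2 : (K + d).+2%:R != 0 :> R by rewrite pnatr_eq0.
  rewrite le_eqVlt; apply/orP; left; apply/eqP.
  have h3 : (K + d).+2%:R = (K + d).+1%:R + 1 :> R by rewrite natr1.
  rewrite h3 in h2 *; move: ((K + d).+1%:R) h1 h2 => x h1 h2.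
  by field; rewrite h1 h2.
have l1 : limn s <= s K + C / K.+1%:R.
  apply: limr_le => //; exists K => // K' /= KK'; rewrite -(subnKC KK').
  apply: (le_trans (h _)); rewrite lerBlDr lerDl.
  by rewrite divr_ge0 ?ler0n.
have l2 : s K <= limn s by apply: nondecreasing_cvgn_le.
by rewrite distrC ger0_norm ?subr_ge0 // lerBlDr addrC.
Qed.

(** The last exponent being at least 2 and the inner sums bounded, the increments are at most a
    constant times the inverse square of the index. *)
Lemma psum_rate ns : all (leq 2) ns -> exists2 C : R, 0 <= C &
  forall K, `|psum R (rev (index_word ns)) K.+1 - limn (psum R (rev (index_word ns)))| <= C / K.+1%:R.
Proof.
case: ns / lastP => [|ns n].
  move=> _; exists 0 => // K; rewrite limn_psum_nil /psum big_ord_recl big1 //= addr0 subrr.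
  by rewrite normr0 mul0r.
rewrite all_rcons => /andP[n2 ns2]; set w := rev (index_word (rcons ns n)).
have wc : psum R w @ \oo --> limn (psum R w).
  by apply: psum_cvg0; apply: H0r_index; rewrite adm_of_le2 // all_rcons n2.
have vc : psum R (rev (index_word ns)) @ \oo --> limn (psum R (rev (index_word ns))).
  by apply: psum_cvg0; apply: H0r_index; rewrite adm_of_le2.
set B := limn (psum R (rev (index_word ns))).
have vB K : psum R (rev (index_word ns)) K <= B.
  by apply: nondecreasing_cvgn_le; [exact: psum_nd|apply/cvg_ex; exists B].
have B0 : 0 <= B by rewrite (le_trans _ (vB 0%N)) // psum_ge0.
exists (2 * B) => [|K]; first by rewrite mulr_ge0.
have -> : limn (psum R w) = limn (fun K => psum R w K.+1).
  by apply/esym/cvg_lim => //; rewrite (cvg_shiftS (psum R w)).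
apply: (@tail_rate (fun K => psum R w K.+1)) => //.
- by rewrite mulr_ge0.
- by move=> a b ab; apply: psum_nd.
- move=> {}K; rewrite psumS [_ + li _ _ _]addrC addrK /w li_index ?(ltnW n2) //.
  have K1 : 1 <= K.+1%:R :> R by rewrite ler1n.
  have K0 : 0 < K.+1%:R :> R by rewrite ltr0n.
  apply: (@le_trans _ _ (K.+1%:R ^- 2 * B)).
    apply: ler_pM; rewrite ?invr_ge0 ?exprn_ge0 ?ler0n ?psum_ge0 //.
    rewrite lef_pV2 ?posrE ?exprn_gt0 // ler_weXn2l //.
  rewrite [2 * B]mulrC -mulrA [leLHS]mulrC ler_wpM2l //.
  rewrite expr2 !invfM mulrCA ler_wpM2l ?invr_ge0 ?(ltW K0) //.
  rewrite ler_pdivlMr ?ltr0n // mulrC ler_pdivrMr // -natrM ler_nat; lia.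
- by apply/cvg_ex; exists (limn (psum R w)); rewrite (cvg_shiftS (psum R w)).
Qed.

(** Truncated and regularised values obey the same recursion in [c], which only raises entries of
    the index, so the rate of the convergent case [c = 0] propagates. *)
Lemma zt_rate c ns : all (leq 2) ns -> exists2 C : R, 0 <= C &
  forall K, `|zt ns c K - zeta0 ns c| <= C / K.+1%:R.
Proof.
elim: c ns => [|c IHc] ns ns2.
  have [C C0 h] := psum_rate ns2; exists C => // K.
  by rewrite zt0 ?le1_of_le2 // zeta0_base.
have ns2' (i : 'I_(size ns)) : all (leq 2) (incr_nth ns i).
  apply/(all_nthP 0%N) => j; rewrite size_incr_nth ltn_ord => js.
  rewrite nth_incr_nth (leq_trans _ (leq_addl _ _)) //.
  by move/(all_nthP 0%N): ns2; apply.
have /choice[C hC] : forall i : 'I_(size ns), exists C : R, 0 <= C /\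
    forall K, `|zt (incr_nth ns i) c K - zeta0 (incr_nth ns i) c| <= C / K.+1%:R.
  by move=> i; have [C C0 h] := IHc _ (ns2' i); exists C.
exists (\sum_(i < size ns) (nth 0%N ns i)%:R * C i) => [|K].
  by apply: sumr_ge0 => i _; rewrite mulr_ge0 ?ler0n //; case: (hC i).
have c1 : 1 <= c.+1%:R :> R by rewrite ler1n.
apply: (@le_trans _ _ (`|zt ns c.+1 K - zeta0 ns c.+1| *+ c.+1)).
  by rewrite -[_ *+ _]mulr_natr ler_peMr.
rewrite -normrMn mulrnBl zt_deriv zeta0_deriv ?le1_of_le2 // -opprD normrN -sumrB.
rewrite (le_trans (ler_norm_sum _ _ _)) // mulr_suml; apply: ler_sum => i _.
rewrite -mulrBr normrM normr_nat -mulrA ler_wpM2l ?ler0n //.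
by case: (hC i).
Qed.

End TruncatedZeta.

Arguments subs : simpl never.

Section Cuts.
Variable V : nmodType.
Implicit Types (w : seq bool) (phi : seq bool -> seq bool -> V) (ns : seq nat).

Definition cut_sum phi w : V := \sum_(k < (size w).+1) phi (take k w) (drop k w).

Lemma cut_sum_cons phi x w :
  cut_sum phi (x :: w) = phi [::] (x :: w) + cut_sum (fun u v => phi (x :: u) v) w.
Proof. by rewrite /cut_sum big_ord_recl. Qed.

Lemma cut_sum_nseq phi e w : cut_sum phi (nseq e false ++ w) =
  \sum_(c < e) phi (nseq c false) (nseq (e - c) false ++ w) +
  cut_sum (fun u v => phi (nseq e false ++ u) v) w.
Proof.
elim: e phi => [|e IHe] phi; first by rewrite big_ord0 add0r.
by rewrite big_ord_recl /= cut_sum_cons IHe addrA.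
Qed.

(** A cut falls among the leading zeros, or just after [1 0^c] in the block of the entry [j]. *)
Lemma cut_sum_index phi e ns : all (leq 1) ns ->
  cut_sum phi (nseq e false ++ index_word ns) =
  \sum_(c < e.+1) phi (nseq c false) (nseq (e - c) false ++ index_word ns) +
  \sum_(j < size ns) \sum_(c < nth 0%N ns j)
    phi (nseq e false ++ index_word (rcons (take j ns) c.+1))
      (nseq ((nth 0%N ns j).-1 - c) false ++ index_word (drop j.+1 ns)).
Proof.
elim: ns phi e => [|n ns IHns] phi e.
  move=> _; rewrite big_ord0 addr0 cut_sum_nseq big_ord_recr /= subnn; congr (_ + _).
  by rewrite /cut_sum big_ord1 cats0.
move=> /andP[n0 ns1]; rewrite cut_sum_nseq.
rewrite -[index_word (n :: ns)]/(true :: nseq n.-1 false ++ index_word ns).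
rewrite cut_sum_cons IHns // addrA [X in _ = X + _]big_ord_recr /= subnn cats0.
congr (_ + _); rewrite [RHS]big_ord_recl /= drop0 (prednK n0); congr (_ + _).
by apply: eq_bigr => c _; rewrite /index_word /= cats0.
Qed.

End Cuts.

Lemma index_word_cat l r : index_word (l ++ r) = index_word l ++ index_word r.
Proof. by rewrite /index_word map_cat flatten_cat. Qed.

Lemma size_index_word ns : all (leq 1) ns -> size (index_word ns) = sumn ns.
Proof.
elim: ns => //= n ns IHns /andP[n0 ns1].
by rewrite size_cat size_nseq -/(index_word ns) IHns // -addSn prednK.
Qed.

Lemma rev_index_run e c l : all (leq 1) l ->
  rev (nseq e false ++ index_word (rcons l c.+1)) = nseq c false ++ index_word (rev (e.+1 :: l)).
Proof.
elim: l e => [|x l IHl] e /=.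
  by move=> _; rewrite /index_word /= !cats0 rev_cat rev_cons !rev_nseq cat_rcons.
move=> /andP[x0 l1]; rewrite -[index_word (x :: _)]/(true :: nseq x.-1 false ++ index_word (rcons l c.+1)).
rewrite rev_cat rev_cons IHl // (prednK x0) rev_nseq -[e.+1 :: x :: l]cat1s rev_cat index_word_cat.
by rewrite catA cat_rcons /index_word /= cats0.
Qed.

Lemma zip_take (T U : Type) j (s : seq T) (t : seq U) : zip (take j s) (take j t) = take j (zip s t).
Proof. by elim: j s t => [|j IHj] [|x s] [|y t] //=; rewrite IHj. Qed.

Lemma zip_drop (T U : Type) j (s : seq T) (t : seq U) : size s = size t ->
  zip (drop j s) (drop j t) = drop j (zip s t).
Proof. by elim: j s t => [|j IHj] [|x s] [|y t] //= [st]; rewrite IHj. Qed.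

Lemma nth_leq_sumn s j : (nth 0 s j <= sumn s)%N.
Proof.
elim: s j => [|x s IHs] [|j] //=; first by rewrite leq_addr.
by rewrite (leq_trans (IHs j)) // leq_addl.
Qed.

Section Multitangent.
Variable R : realType.
Local Notation C := (Cplx R).
Implicit Types (w : C) (ns : seq nat) (M N i j k c : nat).

Definition multitangent M ns w : C :=
  \sum_(m <- subs (size ns) (iota 0 M.*2.+1)) \prod_(p <- zip m ns) shift_pt M w p.1 ^- p.2.

(** Seen from the pole, the points before it lie at negative distances whose absolute values
    decrease along the chain; hence the sign and the reversed index. *)
Definition left_zt ns i : nat -> R := fun c => (-1) ^+ (sumn ns + c) * zt R (rev ns) c i.

Lemma nb_prod_opp (xs : seq R) ns t c : size xs = size ns ->
  nb_prod (zip [seq t - x | x <- xs] ns) t c = (-1) ^+ (sumn ns + c) * nb_prod (zip xs ns) 0 c.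
Proof.
elim: xs ns c => [|x xs IHxs] [|n ns] c //=.
  by case: c => [|c] _; rewrite /fps1 ?mulr0 // mulr1.
move=> [sz]; rewrite /conv mulr_sumr; apply: eq_bigr => i _.
rewrite IHxs // addrAC subrr add0r subr0 neg_binomN mulrACA -exprD; congr (_ ^+ _ * _).
by have := ltn_ord i; lia.
Qed.

Lemma nb_prod_shift (xs : seq R) ns t : nb_prod (zip [seq t + x | x <- xs] ns) t = nb_prod (zip xs ns) 0.
Proof.
elim: xs ns => [|x xs IHxs] [|n ns] //=; rewrite IHxs; congr (conv (neg_binom _ _) _).
by rewrite addrAC subrr add0r subr0.
Qed.

Definition mt_entries M (m : seq nat) ns : seq (R * nat) := zip [seq i%:R - M%:R | i <- m] ns.

Lemma sum_left_zt M i ns c :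
  \sum_(l <- subs (size ns) (iota 0 i)) nb_prod (mt_entries M l ns) (i%:R - M%:R) c = left_zt ns i c.
Proof.
have -> : iota 0 i = rev [seq (i - d)%N | d <- iota 1 i].
  apply: (@eq_from_nth _ 0%N) => [|j]; first by rewrite size_rev size_map !size_iota.
  rewrite size_iota => ji; rewrite nth_rev ?size_map ?size_iota // nth_iota //.
  by rewrite (nth_map 0%N) ?size_iota ?nth_iota; lia.
rewrite sum_subs_rev subs_map big_map /left_zt /zt size_rev mulr_sumr big_seq [RHS]big_seq.
apply: eq_bigr => m /mem_subs[sm ssm].
have -> : mt_entries M (rev [seq (i - d)%N | d <- m]) ns =
    rev (zip [seq (i%:R - M%:R) - x | x <- [seq d%:R | d <- m]] (rev ns)).
  rewrite -[in LHS](revK ns) /mt_entries map_rev rev_zip ?size_map ?size_rev //.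
  congr zip; congr rev; rewrite -!map_comp; apply/eq_in_map => d dm /=.
  have : d \in iota 1 i by exact: (mem_subseq ssm).
  by rewrite mem_iota add1n ltnS => /andP[_ di]; rewrite natrB // addrAC.
by rewrite nb_prod_rev nb_prod_opp ?size_map ?size_rev // sumn_rev.
Qed.

Lemma sum_right_zt M i n ns c :
  \sum_(l <- subs (size ns) (iota i.+1 n)) nb_prod (mt_entries M l ns) (i%:R - M%:R) c = zt R ns c n.
Proof.
have -> : iota i.+1 n = [seq (i + d)%N | d <- iota 1 n] by rewrite -iotaDl addn1.
rewrite subs_map big_map; apply: eq_bigr => m _.
have -> : mt_entries M [seq (i + d)%N | d <- m] ns =
    zip [seq (i%:R - M%:R) + x | x <- [seq d%:R | d <- m]] ns.
  congr zip; rewrite -!map_comp; apply: eq_map => d /=.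
  by rewrite natrD addrAC.
by rewrite nb_prod_shift.
Qed.

Lemma shift_ptE M w i : shift_pt M w i = pt w (i%:R - M%:R).
Proof.
rewrite /shift_pt /pt; congr (_ + _).
by rewrite rmorphB rmorphB /= !rmorph_nat -!pmulrn.
Qed.

Lemma prod_zip_map (T U : Type) (f : T -> U) (G : U -> nat -> C) (m : seq T) ns :
  \prod_(p <- zip (map f m) ns) G p.1 p.2 = \prod_(p <- zip m ns) G (f p.1) p.2.
Proof.
elim: m ns => [|x m IHm] [|n ns]; rewrite ?big_nil //=.
by rewrite !big_cons IHm.
Qed.

(** After partial fractions in each product, the sum is sorted by the pole: its position [j] in the
    chain and its place [i] in the row. The other points are then chosen independently, among the
    [i] places on its left and the [2M - i] on its right. *)
Lemma multitangentE M ns w : 0 < complex.Im w -> ns != [::] -> all (leq 1) ns ->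
  multitangent M ns w = \sum_(j < size ns) \sum_(i < M.*2.+1) \sum_(k < nth 0%N ns j)
    shift_pt M w i ^- k.+1 * ((conv (left_zt (take j ns) i)
       (fun c => zt R (drop j.+1 ns) c (M.*2 - i)%N) (nth 0%N ns j - k.+1)%N)%:C)%C.
Proof.
move=> w0 ns0 ns1; have [c c0 low] := shift_lower w0.
have x0 i : pt w (i%:R - M%:R) != 0.
  by rewrite -shift_ptE -nrm_gt0 (lt_le_trans _ (low M i)) // mulr_gt0 // ltr0n.
have inj : injective (fun i : nat => i%:R - M%:R : R).
  by move=> a b /addIr /eqP; rewrite eqr_nat => /eqP.
transitivity (\sum_(m <- subs (size ns) (iota 0 M.*2.+1)) polar_sum w [::] (mt_entries M m ns)).
  rewrite /multitangent big_seq [RHS]big_seq; apply: eq_bigr => m /mem_subs[sm ssm].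
  have sz : size [seq i%:R - M%:R : R | i <- m] = size ns by rewrite size_map.
  rewrite -partial_fractions.
  - rewrite /mt_entries (prod_zip_map _ (fun t n => pt w t ^- n)).
    by apply: eq_bigr => p _; rewrite shift_ptE.
  - rewrite -/(unzip1 _) unzip1_zip ?sz // map_inj_uniq //.
    by apply: subseq_uniq ssm (iota_uniq _ _).
  - rewrite -/(unzip2 _) unzip2_zip ?sz //.
    by case: (ns) ns0 ns1 => //= n ? _ /andP[n1 _]; rewrite addn_gt0 n1.
  - move=> p /(map_f fst); rewrite -/(unzip1 _) unzip1_zip ?sz // => /mapP[i _ ->].
    exact: x0.
transitivity (\sum_(m <- subs (size ns) (iota 0 M.*2.+1)) \sum_(j < size ns)
    polar w (nth 0%N ns j) ((nth 0%N m j)%:R - M%:R)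
     (conv (nb_prod (mt_entries M (take j m) (take j ns)) ((nth 0%N m j)%:R - M%:R))
       (nb_prod (mt_entries M (drop j.+1 m) (drop j.+1 ns)) ((nth 0%N m j)%:R - M%:R)))).
  rewrite big_seq [RHS]big_seq; apply: eq_bigr => m /mem_subs[sm ssm].
  have sz : size [seq i%:R - M%:R : R | i <- m] = size ns by rewrite size_map.
  rewrite polar_sumE size_zip sz minnn; apply: eq_bigr => j _.
  rewrite cats0 nb_prod_rev nth_zip //= (nth_map 0%N) ?sm //.
  by rewrite /mt_entries !map_take !map_drop !zip_take !zip_drop.
rewrite exchange_big; apply: eq_bigr => j _ /=.
move: (nat_of_ord j) (ltn_ord j) => {}j js; set q := (size ns - j.+1)%N.
have sE : (j + q.+1 = size ns)%N by rewrite /q -subSn // subSS subnKC // ltnW.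
rewrite -[0%N :: iota 1 _]/(iota 0 M.*2.+1) -sE (sum_subs_split 0%N) size_iota; apply: eq_bigr => i _.
have tk : take i (iota 0 M.*2.+1) = iota 0 i by rewrite take_iota (minn_idPl (ltnW (ltn_ord i))).
have dp : drop i.+1 (iota 0 M.*2.+1) = iota i.+1 (M.*2 - i) by rewrite drop_iota add0n subSS.
rewrite tk dp nth_iota // add0n.
pose t : R := i%:R - M%:R; set n := nth 0%N ns j.
transitivity (polar w n t (conv
    (fun c => \sum_(l <- subs (size (take j ns)) (iota 0 i)) nb_prod (mt_entries M l (take j ns)) t c)
    (fun c => \sum_(r <- subs (size (drop j.+1 ns)) (iota i.+1 (M.*2 - i)))
       nb_prod (mt_entries M r (drop j.+1 ns)) t c))); last first.
  rewrite /polar; apply: eq_bigr => k _; rewrite -shift_ptE; congr (_ * (_%:C)%C).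
  apply: eq_bigr => a _; rewrite sum_left_zt; congr (_ * _); exact: sum_right_zt.
rewrite size_take js size_drop -/q.
transitivity (\sum_(l <- subs j (iota 0 i)) \sum_(r <- subs q (iota i.+1 (M.*2 - i)))
    polar w n t (conv (nb_prod (mt_entries M l (take j ns)) t) (nb_prod (mt_entries M r (drop j.+1 ns)) t))).
  rewrite big_seq [RHS]big_seq; apply: eq_bigr => l /mem_subs[sl _].
  apply: eq_bigr => r _.
  rewrite nth_cat sl ltnn subnn /= take_size_cat // -/t.
  by rewrite -cat_rcons drop_size_cat // size_rcons sl.
rewrite /polar exchange_big [RHS]/=.
under eq_bigr => r _ do rewrite exchange_big /=.
rewrite exchange_big; apply: eq_bigr => k _ /=.
under eq_bigr => r _ do rewrite -mulr_sumr -rmorph_sum.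
rewrite -mulr_sumr -rmorph_sum; congr (_ * (_%:C)%C).
rewrite /conv; under eq_bigr => r _ do rewrite exchange_big /=.
rewrite exchange_big; apply: eq_bigr => a _ /=.
rewrite mulr_suml exchange_big; apply: eq_bigr => l _ /=.
by rewrite mulr_sumr.
Qed.

Definition left_zeta ns : nat -> R := fun c => (-1) ^+ (sumn ns + c) * zeta0 R (rev ns) c.

(** Limit of the coefficient in [multitangentE] as [i] and [2M - i] both grow; it is the same for
    all points of a row. *)
Definition mt_term ns j k : R :=
  conv (left_zeta (take j ns)) (zeta0 R (drop j.+1 ns)) (nth 0%N ns j - k.+1)%N.

Definition mt_coef ns k : R := \sum_(j < size ns) (if (k < nth 0%N ns j)%N then mt_term ns j k else 0).

Lemma left_rev_zeta u c ns e : all (leq 1) ns -> u = nseq e false ++ index_word (rcons ns c.+1) ->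
  zsh R (I1 (true, u, false)) = left_zeta (e.+1 :: ns) c.
Proof.
move=> ns1 uE; have [zl _] := zsh_is_zsh R.
rewrite I1_rev (linear_forZ zl) rmorphXn rmorphN1 uE rev_index_run //.
congr (_ ^+ _ * _); rewrite size_cat size_nseq size_index_word; last by rewrite all_rcons.
by rewrite sumn_rcons /=; lia.
Qed.

Lemma mt_coef0 ns : all (leq 2) ns -> mt_coef ns 0 = 0.
Proof.
case: ns => [|n ns] h; first by rewrite /mt_coef big_ord0.
have /andP[n2 ns2] := h; have [zl _] := zsh_is_zsh R.
have ns1 := le1_of_le2 ns2.
(* The index word without its first letter 1, which becomes the base point of the loop. *)
pose W := nseq n.-1 false ++ index_word ns.
have W0 : W != [::] by rewrite /W; case: n n2 {h} W => [|[|n]].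
have := congr1 (zsh R) (I1_path true W true false).
rewrite I1_loop // (linear_for0 zl) (linear_for_sum zl).
under eq_bigr => k _ do rewrite zshM.
move/esym; rewrite -/(cut_sum (fun u v => zsh R (I1 (true, u, false)) * zsh R (I1 (false, v, true))) W).
rewrite /W cut_sum_index // => <-; rewrite /mt_coef big_ord_recl /= (ltnW n2) (prednK (ltnW n2)).
congr (_ + _).
  rewrite /mt_term /= drop0 /conv subn1 (prednK (ltnW n2)); apply: eq_bigr => c _.
  congr (_ * _); rewrite I1_rev (linear_forZ zl) rmorphXn rmorphN1 size_nseq rev_nseq.
  by rewrite /left_zeta /= add0n /zeta0 cats0.
apply: eq_bigr => j _; have js := ltn_ord j; rewrite add0n.
have nj : (0 < nth 0%N ns j)%N by move/(all_nthP 0%N): ns1; exact.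
rewrite nj /mt_term /= add0n /conv subn1 (prednK nj); apply: eq_bigr => c _; congr (_ * _).
rewrite (@left_rev_zeta _ c (take j ns) n.-1) ?(prednK (ltnW n2)) //.
by apply/allP => x /mem_take; move/allP: ns1; exact.
Qed.

(** The rates [a] and [b] are bounded by 1, so that the product of two errors is still bounded
    linearly in them. *)
Lemma conv_rate (I : Type) (f g : I -> nat -> R) (F G : nat -> R) (a b : I -> R) n :
  (forall p, 0 <= a p <= 1) -> (forall p, 0 <= b p <= 1) ->
  (forall c, exists2 A, 0 <= A & forall p, `|f p c - F c| <= A * a p) ->
  (forall c, exists2 B, 0 <= B & forall p, `|g p c - G c| <= B * b p) ->
  exists2 K, 0 <= K & forall p, `|conv (f p) (g p) n - conv F G n| <= K * (a p + b p).
Proof.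
move=> a01 b01 fA gB.
have fA' : forall c, exists A, 0 <= A /\ forall i : I, `|f i c - F c| <= A * a i.
  by move=> c; have [A A0 h] := fA c; exists A.
have gB' : forall c, exists B, 0 <= B /\ forall i : I, `|g i c - G c| <= B * b i.
  by move=> c; have [B B0 h] := gB c; exists B.
have [A hA] := choice fA'; have [B hB] := choice gB'.
exists (\sum_(c < n.+1) (A c * (`|G (n - c)%N| + B (n - c)%N) + `|F c| * B (n - c)%N)) => [|i].
  apply: sumr_ge0 => c _; have [A0 _] := hA c; have [B0 _] := hB (n - c)%N.
  by rewrite addr_ge0 // mulr_ge0 // addr_ge0.
rewrite /conv -sumrB (le_trans (ler_norm_sum _ _ _)) // mulr_suml; apply: ler_sum => c _.
have [A0 fh] := hA c; have [B0 gh] := hB (n - c)%N; have {fh} fh := fh i; have {gh} gh := gh i.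
have /andP[ai0 ai1] := a01 i; have /andP[bi0 bi1] := b01 i.
have -> : f i c * g i (n - c)%N - F c * G (n - c)%N =
    (f i c - F c) * g i (n - c)%N + F c * (g i (n - c)%N - G (n - c)%N) by ring.
rewrite (le_trans (ler_normD _ _)) // !normrM mulrDl lerD //.
  have gb : `|g i (n - c)%N| <= `|G (n - c)%N| + B (n - c)%N.
    have -> : g i (n - c)%N = G (n - c)%N + (g i (n - c)%N - G (n - c)%N) by rewrite addrC subrK.
    rewrite (le_trans (ler_normD _ _)) // lerD2l (le_trans gh) // ler_piMr //.
  apply: (@le_trans _ _ (A c * a i * (`|G (n - c)%N| + B (n - c)%N))).
    by apply: ler_pM.
  rewrite mulrAC ler_wpM2l ?lerDl // mulr_ge0 // addr_ge0 //.
rewrite -mulrA ler_wpM2l // (le_trans gh) // ler_wpM2l // lerDr //.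
Qed.

Lemma left_zt_rate ns c : all (leq 2) ns -> exists2 A, 0 <= A &
  forall i, `|left_zt ns i c - left_zeta ns c| <= A * i.+1%:R^-1.
Proof.
move=> ns2; have [|A A0 h] := @zt_rate R c (rev ns); first by rewrite all_rev.
exists A => // i; rewrite /left_zt /left_zeta -mulrBr normrM normrX normrN1 expr1n mul1r.
exact: h.
Qed.

Lemma cvgC_dist (f : nat -> C) (l : C) (g : nat -> R) :
  g @ \oo --> 0 -> (forall M, nrm (f M - l) <= g M) -> f @ \oo --> l.
Proof. by move=> g0 h; apply: (cvgC_near (e := g)) => //; apply: nearW. Qed.

Lemma cvgC_sum0 (I : Type) (r : seq I) (P : pred I) (f : I -> nat -> C) :
  (forall t : I, P t -> f t @ \oo --> 0) -> (fun n => \sum_(t <- r | P t) f t n) @ \oo --> 0.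
Proof.
move=> h; have e : \sum_(t <- r | P t) (fun=> 0 : C) t = 0 by rewrite big1.
exact: (eq_ind _ (fun l : C => (fun n => \sum_(t <- r | P t) f t n) @ \oo --> l)
  (@cvgC_sum _ I r P f (fun=> 0) h) 0 e).
Qed.

Definition psi k w : C := (- two_pi_i R) ^+ k.+1 / k`!%:R * polylog_neg k (nome w).

(** Both [i] and [2M - i] are at least [M - dist M i]; folding the row at its centre then leads to
    [sum_hsum]. Each of these three steps contributes a factor 2. *)
Lemma dist_hsum (M : nat) :
  \sum_(i < M.*2.+1) ((dist M i).+1%:R^-1 * (i.+1%:R^-1 + (M.*2 - i).+1%:R^-1)) <=
  8 * (hsum R M / M.+1%:R).
Proof.
have inv_le (a b : nat) : (a <= b)%N -> b.+1%:R^-1 <= a.+1%:R^-1 :> R.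
  by move=> ab; rewrite lef_pV2 ?posrE ?ltr0n // ler_nat.
apply: (@le_trans _ _ (\sum_(i < M.*2.+1)
    (fun a => (a.+1%:R^-1 * (2 * (M - a).+1%:R^-1)) : R) (dist M i))).
  apply: ler_sum => i _; rewrite ler_wpM2l ?invr_ge0 ?ler0n // mulr_natl mulr2n lerD //.
    by apply: inv_le; have := ltn_ord i; rewrite /dist; lia.
  by apply: inv_le; have := ltn_ord i; rewrite /dist; lia.
apply: (le_trans (@sum_dist R (fun a => a.+1%:R^-1 * (2 * (M - a).+1%:R^-1)) M _)) => [a|].
  by rewrite !mulr_ge0 ?invr_ge0 ?ler0n.
under eq_bigr => a _ do rewrite mulrCA.
rewrite -mulr_sumr sum_hsum -!mulrA.
have -> : 8 = 2 * (2 * 2) :> R by rewrite -!natrM.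
rewrite -!mulrA !ler_wpM2l // mulrC ler_wpM2l ?hsum_ge0 //.
by apply: inv_le.
Qed.

Definition mt_limit ns w : C := \sum_(1 <= k < sumn ns) ((mt_coef ns k)%:C)%C * psi k w.

Lemma multitangent_cvg ns w : 0 < complex.Im w -> ns != [::] -> all (leq 2) ns ->
  multitangent M ns w @[M --> \oo] --> mt_limit ns w.
Proof.
move=> w0 ns0 ns2; have ns1 := le1_of_le2 ns2.
have [c c0 low] := shift_lower w0.
(* The error made by replacing the coefficient at each point by its limit. It tends to 0 even for
   [k = 0], where the sum of the [1 / |w + m|] is unbounded. *)
pose E M j k : C := \sum_(i < M.*2.+1) shift_pt M w i ^- k.+1 *
  (((conv (left_zt (take j ns) i) (fun c => zt R (drop j.+1 ns) c (M.*2 - i)%N)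
     (nth 0%N ns j - k.+1)%N) - mt_term ns j k)%:C)%C.
have e2 : forall j, all (leq 2) (take j ns) /\ all (leq 2) (drop j ns).
  by move=> j; apply/andP; rewrite -all_cat cat_take_drop.
have Ecvg j k : E M j k @[M --> \oo] --> 0.
  have [K K0 hK] : exists2 K : R, 0 <= K & forall M i, (i < M.*2.+1)%N ->
      `|conv (left_zt (take j ns) i) (fun c => zt R (drop j.+1 ns) c (M.*2 - i)%N)
         (nth 0%N ns j - k.+1)%N - mt_term ns j k| <= K * (i.+1%:R^-1 + (M.*2 - i).+1%:R^-1).
    have inv1 (a : nat) : 0 <= (a.+1%:R^-1 : R) <= 1.
      by rewrite invr_ge0 ler0n /= invf_le1 ?ltr0n // ler1n.
    have [||K K0 hK] := @conv_rate (nat * nat)%type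
      (fun p => left_zt (take j ns) p.1)
      (fun p c => zt R (drop j.+1 ns) c p.2)
      (left_zeta (take j ns)) (zeta0 R (drop j.+1 ns))
      (fun p => p.1.+1%:R^-1) (fun p => p.2.+1%:R^-1)
      (nth 0%N ns j - k.+1)%N (fun=> inv1 _) (fun=> inv1 _).
    - move=> c'; have [A A0 h] := left_zt_rate c' (e2 j).1.
      by exists A => // p; exact: h.
    - move=> c'; have [A A0 h] := zt_rate R c' (e2 j.+1).2.
      by exists A => // p; exact: h.
    - by exists K => // M i _; exact: (hK (i, (M.*2 - i)%N)).
  apply: (@cvgC_dist _ _ (fun M => (c^-1 ^+ k.+1 * K * 8) * (hsum R M / M.+1%:R))).
    exact: hsum_small.
  move=> M; rewrite subr0 (le_trans (nrm_sum _ _ _)) // -mulrA.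
  apply: (@le_trans _ _ (\sum_(i < M.*2.+1) c^-1 ^+ k.+1 * K *
     ((dist M i).+1%:R^-1 * (i.+1%:R^-1 + (M.*2 - i).+1%:R^-1)))).
    apply: ler_sum => i _; rewrite nrmM nrmV nrmX nrm_real.
    rewrite [leRHS]mulrACA ler_pM ?invr_ge0 ?exprn_ge0 ?nrm_ge0 ?hK //.
    have d0 : 0 < (dist M i).+1%:R :> R by rewrite ltr0n.
    apply: (@le_trans _ _ ((c * (dist M i).+1%:R) ^- k.+1)).
      rewrite lef_pV2 ?posrE ?exprn_gt0 ?mulr_gt0 //; last first.
        by rewrite (lt_le_trans _ (low M i)) // mulr_gt0.
      by rewrite lerXn2r ?nnegrE ?nrm_ge0 // mulr_ge0 ?ltW.
    rewrite exprMn invfM exprVn ler_wpM2l ?invr_ge0 ?exprn_ge0 ?(ltW c0) //.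
    rewrite lef_pV2 ?posrE ?exprn_gt0 // exprS ler_peMr ?(ltW d0) //.
    by rewrite exprn_ege1 // ler1n.
  rewrite -mulr_sumr ler_wpM2l ?dist_hsum //.
  by rewrite mulr_ge0 // exprn_ge0 // invr_ge0 ltW.
have D : (fun M => multitangent M ns w) = (fun M =>
    \sum_(j < size ns) \sum_(k < nth 0%N ns j) E M j k +
    \sum_(1 <= k < sumn ns) ((mt_coef ns k)%:C)%C * monotangent k M w).
  apply/funext => M; rewrite multitangentE //.
  have s0 : (0 < sumn ns)%N.
    by case: (ns) ns0 ns1 => //= n ? _ /andP[n1 _]; rewrite addn_gt0 n1.
  (* The monotangent of order one enters with coefficient zero by [mt_coef0], so its symmetric sums
     never have to be evaluated. *)
  have -> : \sum_(1 <= k < sumn ns) ((mt_coef ns k)%:C)%C * monotangent k M w =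
      \sum_(k < sumn ns) ((mt_coef ns k)%:C)%C * monotangent k M w.
    by rewrite -[RHS](big_mkord xpredT (fun k => ((mt_coef ns k)%:C)%C * monotangent k M w)) [RHS]big_ltn // mt_coef0 // mul0r add0r.
  have -> : \sum_(k < sumn ns) ((mt_coef ns k)%:C)%C * monotangent k M w =
      \sum_(j < size ns) \sum_(k < nth 0%N ns j) ((mt_term ns j k)%:C)%C * monotangent k M w.
    under eq_bigr => k _ do rewrite /mt_coef rmorph_sum mulr_suml.
    rewrite exchange_big; apply: eq_bigr => j _ /=.
    have nj := nth_leq_sumn ns j.
    rewrite (big_ord_widen _ (fun k => ((mt_term ns j k)%:C)%C * monotangent k M w) nj).
    rewrite [RHS]big_mkcond; apply: eq_bigr => k _.
    by case: ifP => //; rewrite mul0r.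
  rewrite -big_split; apply: eq_bigr => j _ /=.
  rewrite exchange_big -big_split; apply: eq_bigr => k _ /=.
  rewrite /E /monotangent mulr_sumr -big_split; apply: eq_bigr => i _ /=.
  by rewrite rmorphB /= mulrBr [X in _ + X]mulrC subrK.
rewrite D -[mt_limit ns w]add0r; apply: cvgD.
  by apply: cvgC_sum0 => j _; apply: cvgC_sum0 => k _; exact: Ecvg.
rewrite /mt_limit big_nat.
have -> : (fun M => \sum_(1 <= k < sumn ns) ((mt_coef ns k)%:C)%C * monotangent k M w) =
   (fun M => \sum_(1 <= k < sumn ns | (1 <= k < sumn ns)%N) ((mt_coef ns k)%:C)%C * monotangent k M w).
  by apply/funext => M; rewrite big_nat.
apply: cvgC_sum => k /andP[k1 _]; apply: cvgM; first exact: cvg_cst.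
exact: lipschitz.
Qed.

End Multitangent.

(** * Summation over the lattice *)

Lemma eq_cvgn (V : topologicalType) (f g : nat -> V) (l : V) :
  f =1 g -> g @ \oo --> l -> f @ \oo --> l.
Proof. by move=> /funext ->. Qed.

Lemma cvgC_cst (R : realType) (c : Cplx R) : (fun _ : nat => c) @ \oo --> c.
Proof. exact: cvg_cst. Qed.

Section SortedTuples.
Variables (A : nmodType) (X : eqType) (T : finType) (e : T -> X) (lt : rel X) (s : seq X).
Hypothesis lt_trans : transitive lt.
Hypothesis lt_irr : irreflexive lt.
Hypothesis s_sorted : pairwise lt s.
Hypothesis e_s : forall Phi : X -> A, \sum_(y : T) Phi (e y) = \sum_(z <- s) Phi z.

Lemma sum_subs_first p t (G : seq X -> A) : pairwise lt t ->
  \sum_(m <- subs p.+1 t) G m =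
  \sum_(z <- t) \sum_(m <- subs p [seq y <- t | lt z y]) G (z :: m).
Proof.
elim: t => [|z t IHt]; first by rewrite sum_subs_nil big_nil.
rewrite pairwise_cons => /andP[zt tp]; rewrite sum_subs_cons IHt // big_cons /= lt_irr.
rewrite (all_filterP zt); congr (_ + _); rewrite big_seq [RHS]big_seq.
apply: eq_bigr => y yt; rewrite ifN //; apply/negP => yz.
by have := lt_trans yz (allP zt _ yt); rewrite lt_irr.
Qed.

Lemma sum_tuple_cons p (Phi : p.+1.-tuple T -> A) (P : pred (p.+1.-tuple T)) :
  \sum_(a | P a) Phi a =
  \sum_y \sum_(a : p.-tuple T | P (cons_tuple y a)) Phi (cons_tuple y a).
Proof.
rewrite pair_big_dep (reindex (fun q : T * p.-tuple T => cons_tuple q.1 q.2)) //.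
exists (fun a : p.+1.-tuple T => (thead a, behead_tuple a)) => [[y a] _|a _] /=.
  by rewrite theadE; congr pair; apply/val_inj.
by case/tupleP: a => y a; rewrite theadE; apply/val_inj.
Qed.

(** An increasing chain of points is a subsequence of the sorted list of points; the induction fixes
    the first point of the chain. *)
Lemma sum_sorted_tuples p x (G : seq X -> A) :
  \sum_(a : p.-tuple T | path lt x [seq e q | q <- a]) G [seq e q | q <- a] =
  \sum_(m <- subs p [seq y <- s | lt x y]) G m.
Proof.
elim: p x G => [|p IHp] x G.
  rewrite sum_subs0 (bigD1 [tuple]) //= big1 ?addr0 // => a /andP[_ /eqP []].
  exact: tuple0.
rewrite sum_tuple_cons sum_subs_first ?pairwise_filter //.
rewrite big_filter [RHS]big_mkcond /=.
rewrite -(e_s (fun z => if lt x z then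
  \sum_(m <- subs p [seq y <- [seq y <- s | lt x y] | lt z y]) G (z :: m) else 0)).
apply: eq_bigr => y _; case: ifP => xy; last by rewrite big_pred0.
rewrite -filter_predI (eq_filter (a2 := lt (e y))) => [|z /=]; last first.
  by case yz: (lt (e y) z) => //=; rewrite (lt_trans xy yz).
by rewrite -(IHp (e y) (fun m => G (e y :: m))).
Qed.

End SortedTuples.

Lemma prod_tuple_zip (A : comNzRingType) (T : Type) (X : eqType) (e : T -> X) (F : X -> nat -> A) ns
    (a : (size ns).-tuple T) :
  \prod_(j < size ns) F (e (tnth a j)) (nth 0%N ns j) =
  \prod_(q <- zip [seq e q | q <- a] ns) F q.1 q.2.
Proof.
elim: ns a => [|n ns IHns] a.
  by rewrite big_ord0; case: a => -[|? ?] // ?; rewrite big_nil.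
case/tupleP: a => y a; rewrite big_ord_recl tnth0 big_cons -(IHns a).
by congr (_ * _); apply: eq_bigr => j _; rewrite tnthS.
Qed.

Section SubSums.
Variables (A : comNzRingType) (X : eqType) (F : X -> nat -> A).

Definition sub_sum (t : seq X) (ns : seq nat) : A :=
  \sum_(m <- subs (size ns) t) \prod_(p <- zip m ns) F p.1 p.2.

Lemma sub_sum_cons z t n ns :
  sub_sum (z :: t) (n :: ns) = F z n * sub_sum t ns + sub_sum t (n :: ns).
Proof.
rewrite /sub_sum sum_subs_cons mulr_sumr; congr (_ + _).
by apply: eq_bigr => m _; rewrite big_cons.
Qed.

Lemma sub_sum0 t : sub_sum t [::] = 1.
Proof. by rewrite /sub_sum sum_subs0 big_nil. Qed.

Lemma sub_sum_nil n ns : sub_sum [::] (n :: ns) = 0.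
Proof. by rewrite /sub_sum sum_subs_nil. Qed.

Lemma sub_sum_cat t u ns : sub_sum (t ++ u) ns =
  \sum_(j < (size ns).+1) sub_sum t (take j ns) * sub_sum u (drop j ns).
Proof.
rewrite /sub_sum sum_subs_cat; apply: eq_bigr => j _.
have jn : (j <= size ns)%N by rewrite -ltnS.
rewrite size_drop size_takel // mulr_suml big_seq [RHS]big_seq; apply: eq_bigr => l /mem_subs[sl _].
rewrite mulr_sumr; apply: eq_bigr => r _.
by rewrite -{1}(cat_take_drop j ns) zip_cat ?size_takel // big_cat.
Qed.

End SubSums.

Lemma sub_sum_map (A : comNzRingType) (X Y : eqType) (g : X -> Y) (F : Y -> nat -> A) t ns :
  sub_sum F (map g t) ns = sub_sum (fun x => F (g x)) t ns.
Proof.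
rewrite /sub_sum subs_map big_map; apply: eq_bigr => m _.
elim: m ns => [|x m IHm] [|n ns]; rewrite ?big_nil //=.
by rewrite !big_cons IHm.
Qed.

Section Lattice.
Implicit Types (L M : nat) (p : int * int).

Lemma lattice_ltE p q : lattice_lt p q = (p.1 < q.1) || (p.1 == q.1) && (p.2 < q.2).
Proof. by rewrite /lattice_lt /lattice_pos /= !subr_gt0 subr_eq0 eq_sym. Qed.

Lemma lattice_lt_trans : transitive lattice_lt.
Proof. move=> [a b] [c d] [f g]; rewrite !lattice_ltE /=; lia. Qed.

Lemma lattice_lt_irr : irreflexive lattice_lt.
Proof. by move=> [a b]; rewrite lattice_ltE /= !ltxx andbF. Qed.

Definition lrow M (l : int) : seq (int * int) := [seq (l, m%:Z - M%:Z) | m <- iota 0 M.*2.+1].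

Definition lpoints L M : seq (int * int) :=
  flatten [seq lrow M (l%:Z - L%:Z) | l <- iota 0 L.*2.+1].

Lemma pairwise_lrow M l : pairwise lattice_lt (lrow M l).
Proof.
rewrite /lrow pairwise_map (@sub_pairwise _ ltn) -?sorted_pairwise ?iota_ltn_sorted //.
  by move=> a b /=; rewrite lattice_ltE /=; lia.
exact: ltn_trans.
Qed.

Lemma pairwise_lpoints L M : pairwise lattice_lt (lpoints L M).
Proof.
have : pairwise ltn (iota 0 L.*2.+1).
  by rewrite -sorted_pairwise ?iota_ltn_sorted //; exact: ltn_trans.
rewrite /lpoints; elim: (iota _ _) => [//|l t IHt]; rewrite pairwise_cons => /andP[lt tp].
rewrite map_cons -[flatten (_ :: _)]/(lrow M (l%:Z - L%:Z) ++ flatten _) pairwise_cat pairwise_lrow IHt // !andbT.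
apply/allrelP => p q /mapP[m _ ->] /flattenP[_ /mapP[l' l't ->] /mapP[m' _ ->]].
by rewrite lattice_ltE /=; have := allP lt _ l't; rewrite /=; lia.
Qed.

Lemma sum_lpoints (V : nmodType) L M (Phi : int * int -> V) :
  \sum_(y : 'I_L.*2.+1 * 'I_M.*2.+1) Phi (box_pt y) = \sum_(z <- lpoints L M) Phi z.
Proof.
transitivity (\sum_(0 <= l < L.*2.+1) \sum_(0 <= j < M.*2.+1) Phi (l%:Z - L%:Z, j%:Z - M%:Z)).
  rewrite big_mkord -(pair_bigA _ (fun i j => Phi (box_pt (i, j)))); apply: eq_bigr => l _.
  by rewrite big_mkord.
rewrite /lpoints big_flatten big_map /index_iota subn0; apply: eq_bigr => l _.
by rewrite /lrow big_map subn0.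
Qed.

Lemma filter_lpoints L M : [seq y <- lpoints L M | lattice_lt (0, 0) y] =
  [seq (0, m%:Z) | m <- iota 1 M] ++ flatten [seq lrow M u%:Z | u <- iota 1 L].
Proof.
have e K : iota 0 K.*2.+1 = iota 0 K ++ K :: iota K.+1 K.
  by rewrite -addnn -addnS iotaD.
have e1 K : iota K.+1 K = [seq (K + i)%N | i <- iota 1 K] by rewrite -iotaDl addn1.
have fl (x : seq (int * int)) t : flatten (x :: t) = x ++ flatten t by [].
rewrite /lpoints e map_cat map_cons flatten_cat fl filter_cat.
have -> : [seq y <- flatten [seq lrow M (l%:Z - L%:Z) | l <- iota 0 L] | lattice_lt (0, 0) y] = [::].
  apply/eqP; rewrite -(negbK (_ == _)) -has_filter; apply/negP => /hasP[y].
  move=> /flattenP[_ /mapP[l lL ->] /mapP[m _ ->]]; rewrite lattice_ltE /=.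
  by move: lL; rewrite mem_iota; lia.
rewrite cat0s subrr filter_cat; congr (_ ++ _).
  rewrite /lrow e map_cat /= filter_cat /= lattice_ltE /= subrr !ltxx /=.
  have -> : [seq y <- [seq (0, m%:Z - M%:Z) | m <- iota 0 M] | lattice_lt (0, 0) y] = [::].
    apply/eqP; rewrite -(negbK (_ == _)) -has_filter; apply/negP => /hasP[y /mapP[m mM ->]].
    by rewrite lattice_ltE /=; move: mM; rewrite mem_iota; lia.
  rewrite cat0s e1 -map_comp; set f := (_ \o _); rewrite (all_filterP _).
    by apply: eq_map => m; rewrite /f /=; congr pair; lia.
  by apply/allP => y /mapP[m mM ->]; rewrite lattice_ltE /=; move: mM; rewrite mem_iota; lia.
rewrite e1 -map_comp (all_filterP _).
  by congr flatten; apply: eq_map => u /=; congr lrow; lia.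
apply/allP => y /flattenP[_ /mapP[u uL ->] /mapP[m _ ->]]; rewrite lattice_ltE /=.
by move: uL; rewrite mem_iota; lia.
Qed.

End Lattice.

Section Omega.
Variable R : realType.
Local Notation C := (Cplx R).
Implicit Types (h : seq nat -> C) (m ns ks : seq nat).

(* [m] is cut into nonempty blocks, each block being replaced by the monotangents
   in the expansion of its multitangent; [h] receives the list of their orders. *)
Fixpoint omega_fuel f h m : C :=
  if m is [::] then h [::] else
  if f is f'.+1 then
    \sum_(j < size m) \sum_(1 <= k < sumn (take j.+1 m))
      ((mt_coef R (take j.+1 m) k)%:C)%C * omega_fuel f' (fun ks => h (k.+1 :: ks)) (drop j.+1 m)
  else 0.

Definition omega h m := omega_fuel (size m) h m.

Lemma omega_fuelE f f' h m : (size m <= f)%N -> (size m <= f')%N ->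
  omega_fuel f h m = omega_fuel f' h m.
Proof.
elim: f f' h m => [|f IHf] [|f'] h [|n m] //= mf mf'.
apply: eq_bigr => j _; apply: eq_bigr => k _; congr (_ * _).
by apply: IHf; rewrite size_drop (leq_trans (leq_subr _ _)).
Qed.

Lemma omega_nil h : omega h [::] = h [::]. Proof. by []. Qed.

Lemma omegaE h m : m != [::] -> omega h m =
  \sum_(j < size m) \sum_(1 <= k < sumn (take j.+1 m))
    ((mt_coef R (take j.+1 m) k)%:C)%C * omega (fun ks => h (k.+1 :: ks)) (drop j.+1 m).
Proof.
case: m => // n m _; rewrite {1}/omega /=; apply: eq_bigr => j _; apply: eq_bigr => k _.
congr (_ * _); apply: omega_fuelE => //.
by rewrite size_drop leq_subr.
Qed.

Lemma omega_fuel_lin f a h g m : omega_fuel f (fun ks => a * h ks + g ks) m =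
  a * omega_fuel f h m + omega_fuel f g m.
Proof.
elim: f h g m => [|f IHf] h g [|n m] //=; first by rewrite mulr0 addr0.
rewrite mulr_sumr -big_split; apply: eq_bigr => j _ /=.
rewrite mulr_sumr -big_split; apply: eq_bigr => k _ /=.
by rewrite IHf mulrDr mulrCA.
Qed.

Lemma omega_lin a h g m : omega (fun ks => a * h ks + g ks) m = a * omega h m + omega g m.
Proof. exact: omega_fuel_lin. Qed.

Lemma omega_cvg (hs : nat -> seq nat -> C) h m :
  (forall ks, all (leq 2) ks -> hs L ks @[L --> \oo] --> h ks) ->
  omega (hs L) m @[L --> \oo] --> omega h m.
Proof.
rewrite /omega; move: (size m) => f; elim: f hs h m => [|f IHf] hs h [|n m] hl /=; try exact: hl.
  exact: cvgC_cst.
apply: cvgC_sum => j _; rewrite big_nat.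
apply: eq_cvgn => [L|]; first by rewrite big_nat; reflexivity.
apply: cvgC_sum => k /andP[k1 _]; apply: cvgM; first exact: cvg_cst.
apply: (IHf (fun L ks => hs L (k.+1 :: ks)) (fun ks => h (k.+1 :: ks))) => ks ks2.
by apply: hl; rewrite /= ltnS k1.
Qed.

Variable tau : C.

Definition mt_lim ns (u : nat) : C := if ns is [::] then 1 else mt_limit ns (u%:R * tau).

Fixpoint row_sum (us : seq nat) ns : C :=
  if us is u :: us' then
    \sum_(j < (size ns).+1) mt_lim (take j ns) u * row_sum us' (drop j ns)
  else (ns == [::])%:R.

Definition psi_sum (us : seq nat) ks : C := sub_sum (fun u k => psi k.-1 (u%:R * tau)) us ks.

(** Either the row [u] carries no point of the chain, or it carries a first block, whose
    monotangents supply the factor of [u] in [sub_sum_cons]. *)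
Lemma row_sumE us ns : row_sum us ns = omega (psi_sum us) ns.
Proof.
elim: us ns => [|u us IHus] ns /=.
  case: ns => [|n ns]; first by rewrite omega_nil /psi_sum sub_sum0.
  rewrite omegaE // big1 // => j _; rewrite big1 // => k _.
  have -> : (fun ks => psi_sum [::] (k.+1 :: ks)) = (fun ks => 0 * 0 + 0).
    by apply/funext => ks; rewrite /psi_sum sub_sum_nil mulr0 addr0.
  rewrite (omega_lin 0 (fun=> 0) (fun=> 0)) mul0r add0r.
  set z := omega _ _; have : z = z + z.
    rewrite -{2}[z]mul1r -omega_lin; congr omega; apply/funext => ks.
    by rewrite mulr0 addr0.
  by move/eqP; rewrite addrC -subr_eq subrr => /eqP <-; rewrite mulr0.
case: ns => [|n ns].
  by rewrite big_ord1 /= IHus !omega_nil /psi_sum !sub_sum0 mul1r.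
rewrite big_ord_recl take0 drop0 mul1r IHus omegaE // [RHS]omegaE // addrC -big_split.
apply: eq_bigr => j _ /=; rewrite IHus /mt_limit mulr_suml -big_split.
apply: eq_bigr => k _ /=; rewrite -mulrA -mulrDr; congr (_ * _).
rewrite -omega_lin; congr omega; apply/funext => ks.
by rewrite /psi_sum sub_sum_cons.
Qed.

Hypothesis tau0 : 0 < complex.Im tau.

Lemma Im_natM (u : nat) : complex.Im (u%:R * tau) = u%:R * complex.Im tau.
Proof.
have -> : (u%:R : C) = (u%:R%:C)%C by rewrite rmorph_nat.
by case: tau => a b /=; rewrite mul0r addr0.
Qed.

Lemma sub_sum_lrow M (u : nat) ns :
  sub_sum (fun p k => lattice_pt tau p ^- k) (lrow M u%:Z) ns = multitangent M ns (u%:R * tau).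
Proof. exact: sub_sum_map. Qed.

Lemma sub_sum_row0 M ns : all (leq 1) ns ->
  sub_sum (fun p k => lattice_pt tau p ^- k) [seq (0, i%:Z) | i <- iota 1 M] ns =
  ((zt R ns 0 M)%:C)%C.
Proof.
move=> ns1; rewrite sub_sum_map /sub_sum /zt rmorph_sum big_seq [RHS]big_seq.
apply: eq_bigr => m /mem_subs[sm _]; elim: m (ns) sm {ns1} => [|x m IHm] [|n ns'] //=.
  by move=> _; rewrite big_nil.
move=> [sm]; rewrite big_cons /= conv_coef0 neg_binom_coef0 subr0 rmorphM /= IHm //.
by rewrite /lattice_pt /= mul0r add0r fmorphV rmorphXn /= rmorph_nat.
Qed.

Lemma rows_cvg us ns : all (leq 1) us -> all (leq 2) ns ->
  (fun M => sub_sum (fun p k => lattice_pt tau p ^- k) (flatten [seq lrow M u%:Z | u <- us]) ns) @ \oo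
    --> row_sum us ns.
Proof.
elim: us ns => [|u us IHus] ns.
  by move=> _ _; apply: cvg_near_cst; apply: nearW => M; case: ns => [|n ns]; rewrite ?sub_sum0 ?sub_sum_nil.
move=> /andP[u1 us1] ns2; rewrite [row_sum _ _]/=.
have fl (x : seq (int * int)) t : flatten (x :: t) = x ++ flatten t by [].
apply: eq_cvgn => [M|]; first by rewrite map_cons fl sub_sum_cat; reflexivity.
apply: cvgC_sum => j _; have /andP[t2 d2] : all (leq 2) (take j ns) && all (leq 2) (drop j ns).
  by rewrite -all_cat cat_take_drop.
apply: cvgM; last exact: IHus.
apply: eq_cvgn => [M|]; first by rewrite sub_sum_lrow; reflexivity.
case E : (take j ns) t2 => [|n t] t2 /=; last first.
  by apply: multitangent_cvg => //; rewrite Im_natM mulr_gt0 // ltr0n.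
have -> : (fun M => multitangent M [::] (u%:R * tau)) = fun=> 1.
  by apply/funext => M; rewrite /multitangent sum_subs0 big_nil.
exact: cvgC_cst.
Qed.

(** The common shape of both sides: the first [j] entries give a zeta value, from the row 0 on the
    analytic side and from the segment before the first kept letter on the algebraic side. *)
Definition split_sum h ns : C :=
  \sum_(j < (size ns).+1) ((zeta0 R (take j ns) 0)%:C)%C * omega h (drop j ns).

(** For fixed [L] a chain splits into its part on the row 0, which gives a truncated zeta value, and
    its parts on the finitely many rows 1 to [L]; each factor converges separately. *)
Lemma eisenstein_sum_cvg ns L : all (leq 2) ns ->
  eisenstein_sum ns tau L M @[M --> \oo] --> split_sum (psi_sum (iota 1 L)) ns.
Proof.
move=> ns2.
have -> : (fun M => eisenstein_sum ns tau L M) = (fun M =>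
    sub_sum (fun p k => lattice_pt tau p ^- k)
     ([seq (0, i%:Z) | i <- iota 1 M] ++ flatten [seq lrow M u%:Z | u <- iota 1 L]) ns).
  apply/funext => M; rewrite -filter_lpoints.
  rewrite /sub_sum -(@sum_sorted_tuples _ _ _ (@box_pt L M) _ _ lattice_lt_trans lattice_lt_irr) //.
  - apply: eq_bigr => a _; exact: (prod_tuple_zip (@box_pt L M) (fun p k => lattice_pt tau p ^- k)).
  - exact: pairwise_lpoints.
  - exact: sum_lpoints.
apply: eq_cvgn => [M|]; first by rewrite sub_sum_cat; reflexivity.
apply: cvgC_sum => j _; have /andP[t2 d2] : all (leq 2) (take j ns) && all (leq 2) (drop j ns).
  by rewrite -all_cat cat_take_drop.
apply: cvgM; last first.
  rewrite -row_sumE; apply: rows_cvg => //.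
  by apply/allP => u; rewrite mem_iota => /andP[].
apply: eq_cvgn => [M|]; first by rewrite sub_sum_row0 ?le1_of_le2 //; reflexivity.
apply: cvgC_real; rewrite zeta0_base //.
apply: eq_cvgn => [M|]; first by rewrite zt0 ?le1_of_le2 //; reflexivity.
rewrite (cvg_shiftS (psum R (rev (index_word (take j ns))))).
by apply: psum_cvg0; apply: H0r_index; apply: adm_of_le2.
Qed.

End Omega.

(** * The coproduct of an iterated integral *)

Lemma sum_triangle (V : nmodType) n (F : nat -> nat -> V) :
  \sum_(i < n.+1) \sum_(c < (n - i).+1) F i c = \sum_(c < n.+1) \sum_(i < (n - c).+1) F i c.
Proof.
have w (G : nat -> nat -> V) (i : 'I_n.+1) : \sum_(c < (n - i).+1) G i c =
    \sum_(c < n.+1 | (c + i <= n)%N) G i c.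
  have le : ((n - i).+1 <= n.+1)%N by rewrite ltnS leq_subr.
  rewrite (big_ord_widen _ _ le); apply: eq_bigl => c.
  by have := ltn_ord i; rewrite !ltnS => ?; rewrite leq_subRL // addnC.
under eq_bigr => i _ do rewrite w.
under [RHS]eq_bigr => c _ do rewrite (w (fun c i => F i c)).
rewrite (exchange_big_dep xpredT) //=; apply: eq_bigr => c _; apply: eq_bigl => i.
by rewrite addnC.
Qed.

Section SegmentSum.
Variable C : comNzRingType.
Variable phi : bool -> seq bool -> bool -> C.
Hypothesis phi_unit : forall a b, phi a [::] b = 1.
Hypothesis phi_loop : forall a w, w != [::] -> phi a w a = 0.
Implicit Types (h : seq bool -> C) (a c : bool) (buf w : seq bool) (ns m : seq nat) (e : nat).

(* The sum over the terms of the Goncharov coproduct of a word ending at [true]. *)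
Fixpoint seg_sum h a buf w : C :=
  if w is c :: w' then
    phi a buf c * seg_sum (fun u => h (c :: u)) c [::] w' + seg_sum h a (rcons buf c) w'
  else phi a buf true * h [::].

Definition run_sum h ns : C :=
  if ns is n :: ns' then seg_sum (fun u => h (true :: u)) true [::] (nseq n.-1 false ++ index_word ns')
  else h [::].

Lemma index_word_cons n ns : index_word (n :: ns) = true :: nseq n.-1 false ++ index_word ns.
Proof. by []. Qed.

(** The last kept letter is 0 and no adjacent 0 follows, so keeping a further 0 next would close a
    loop. The next kept letter is the 1 opening some block, or there is none. *)
Lemma seg_sum_after0 h buf e ns : (buf != [::]) || (e == 0%N) ->
  seg_sum h false buf (nseq e false ++ index_word ns) =
  \sum_(j < (size ns).+1)
    phi false (buf ++ nseq e false ++ index_word (take j ns)) true * run_sum h (drop j ns).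
Proof.
elim: ns buf e => [|n ns IHns] buf e; elim: e buf => [|e IHe] buf be.
- by rewrite big_ord1 /= cats0.
- have b0 : buf != [::] by rewrite orbF in be.
  rewrite /= phi_loop // mul0r add0r IHe ?big_ord1 /= ?cat_rcons //.
  by rewrite -size_eq0 size_rcons.
- rewrite big_ord_recl index_word_cons /= cats0 IHns; last by rewrite -size_eq0 size_rcons.
  congr (_ + _); apply: eq_bigr => j _.
  by rewrite index_word_cons /= cat_rcons.
have b0 : buf != [::] by rewrite orbF in be.
rewrite /= -/(seg_sum _ _ _ _) phi_loop // mul0r add0r IHe; last first.
  by rewrite -size_eq0 size_rcons.
by apply: eq_bigr => j _; rewrite cat_rcons.
Qed.

(** After a kept 0 the zeros kept next must be adjacent: the first [i] of them, before the jump to a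
    later 1 or to the end. *)
Lemma seg_sum_zeros h e ns : seg_sum h false [::] (nseq e false ++ index_word ns) =
  \sum_(i < e.+1) \sum_(j < (size ns).+1)
    phi false (nseq (e - i) false ++ index_word (take j ns)) true *
    run_sum (fun u => h (nseq i false ++ u)) (drop j ns).
Proof.
elim: e h => [|e IHe] h; first by rewrite big_ord1 seg_sum_after0.
rewrite big_ord_recl /= phi_unit mul1r IHe addrC; congr (_ + _).
by rewrite seg_sum_after0.
Qed.

(** After a kept 1 the next kept letter must be a 0, among the pending zeros or in a block [j] after
    its 1 and [c] zeros; keeping a 1 or stopping would close a loop. *)
Lemma seg_sum_after1 h buf e ns : all (leq 2) ns -> (buf != [::]) || (0 < e)%N ->
  seg_sum h true buf (nseq e false ++ index_word ns) =
  \sum_(c < e) phi true (buf ++ nseq c false) false *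
     seg_sum (fun u => h (false :: u)) false [::] (nseq (e.-1 - c) false ++ index_word ns) +
  \sum_(j < size ns) \sum_(c < (nth 0%N ns j).-1)
    phi true (buf ++ nseq e false ++ index_word (rcons (take j ns) c.+1)) false *
    seg_sum (fun u => h (false :: u)) false [::]
      (nseq ((nth 0%N ns j).-2 - c) false ++ index_word (drop j.+1 ns)).
Proof.
elim: ns buf e => [|n ns IHns] buf e ns2; elim: e buf => [|e IHe] buf be.
- by rewrite !big_ord0 addr0 /= phi_loop ?mul0r //; rewrite orbF in be.
- rewrite big_ord_recl [LHS]/= -addrA; congr (_ + _); first by rewrite /= !cats0 subn0.
  rewrite cats0.
  rewrite -[nseq e false](cats0 _) -[nseq e false ++ [::]]/(nseq e false ++ index_word [::]).
  rewrite IHe; last by rewrite -size_eq0 size_rcons.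
  rewrite !big_ord0 !addr0; apply: eq_bigr => c _.
  by rewrite cat_rcons lift0 -[_ :: nseq c _]/(nseq c.+1 _); case: (e) c => [[]|e'] // c.
- have /andP[n2 ns2'] := ns2; have b0 : buf != [::] by rewrite orbF in be.
  rewrite big_ord0 add0r index_word_cons /= phi_loop // mul0r add0r.
  rewrite IHns //; last by rewrite -size_eq0 size_rcons.
  rewrite big_ord_recl /= drop0; congr (_ + _).
    by apply: eq_bigr => c _; rewrite cat_rcons /index_word /= cats0.
  by apply: eq_bigr => j _; apply: eq_bigr => c _; rewrite cat_rcons index_word_cons.
rewrite big_ord_recl [LHS]/= -addrA; congr (_ + _); first by rewrite /= cats0 subn0.
rewrite -/(index_word (n :: ns)) IHe; last by rewrite -size_eq0 size_rcons.
congr (_ + _).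
  apply: eq_bigr => c _.
  by rewrite cat_rcons lift0 -[_ :: nseq c _]/(nseq c.+1 _); case: (e) c => [[]|e'] // c.
by apply: eq_bigr => j _; apply: eq_bigr => c _; rewrite cat_rcons.
Qed.

End SegmentSum.

Section CoproductSum.
Variable R : realType.
Local Notation C := (Cplx R).
Implicit Types (h : seq bool -> C) (ns m : seq nat).

Definition zphi a u b : C := ((zsh R (I1 (a, u, b)))%:C)%C.

Lemma zsh1 : zsh R 1 = 1.
Proof.
have [_ zn] := zsh_is_zsh R; rewrite -(I1_unit false true) -[I1 _]/(I1_index [::]) zn //.
by rewrite zeta_sh_admissible // mzeta_limn // limn_psum_nil.
Qed.

Lemma zphi_unit a b : zphi a [::] b = 1.
Proof. by rewrite /zphi I1_unit zsh1. Qed.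

Lemma zphi_loop a w : w != [::] -> zphi a w a = 0.
Proof.
by move=> w0; have [zl _] := zsh_is_zsh R; rewrite /zphi I1_loop // (linear_for0 zl).
Qed.

Lemma left_zeta_run m j c : all (leq 1) m -> (j < size m)%N ->
  zphi true (behead (index_word (rcons (take j m) c.+1))) false = ((left_zeta R (take j m) c)%:C)%C.
Proof.
move=> m1 jm; congr ((_%:C)%C); have [zl _] := zsh_is_zsh R.
case: m m1 jm => // n m /andP[n1 m1]; case: j => [|j] jm.
  rewrite /index_word /= cats0 I1_rev (linear_forZ zl) rmorphXn rmorphN1 size_nseq rev_nseq.
  by rewrite /left_zeta /= add0n /zeta0 cats0.
rewrite [take _ _]/= rcons_cons index_word_cons [behead _]/=.
rewrite (@left_rev_zeta _ _ c (take j m) n.-1) ?(prednK n1) //.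
by apply/allP => x /mem_take; move/allP: m1; exact.
Qed.

Lemma zphi0 e ns : zphi false (nseq e false ++ index_word ns) true = ((zeta0 R ns e)%:C)%C.
Proof. by []. Qed.

(** Between the kept 1 and the first kept 0, found in block [j], lies a segment from 1 to 0, whose
    value is a [left_zeta]: block [j] plays the part of the pole of a multitangent. *)
Lemma run_sum_step h m : m != [::] -> all (leq 2) m ->
  run_sum zphi h m = \sum_(j < size m) \sum_(c < (nth 0%N m j).-1)
    ((left_zeta R (take j m) c)%:C)%C *
    seg_sum zphi (fun u => h [:: true, false & u]) false [::]
      (nseq ((nth 0%N m j).-2 - c) false ++ index_word (drop j.+1 m)).
Proof.
case: m => // n m _ m2; have /andP[n2 m2'] := m2.
rewrite /run_sum (seg_sum_after1 zphi_loop) //=; last by case: n n2 {m2} => [|[]].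
rewrite big_ord_recl /= drop0; congr (_ + _).
  apply: eq_bigr => c _; congr (_ * _).
  have -> : nseq c false = behead (index_word (rcons (take 0 (n :: m)) c.+1)).
    by rewrite /index_word /= cats0.
  exact: (@left_zeta_run (n :: m) 0%N c (le1_of_le2 m2) isT).
apply: eq_bigr => j _; apply: eq_bigr => c _; congr (_ * _).
exact: (@left_zeta_run (n :: m) j.+1 c (le1_of_le2 m2) (ltn_ord j)).
Qed.

Lemma sum_from (V : nmodType) N j (G : nat -> V) :
  \sum_(J < N | (j <= J)%N) G J = \sum_(j' < N - j) G (j + j')%N.
Proof.
have -> : \sum_(J < N | (j <= J)%N) G J = \sum_(j <= J < N) G J.
  by rewrite big_geq_mkord; apply: eq_bigl => J.
rewrite -{1}[j]add0n big_addn big_mkord; apply: eq_bigr => i _.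
by rewrite addnC.
Qed.

Lemma sum_cut (V : nmodType) n S (X : nat -> V) : (0 < n <= S)%N ->
  \sum_(1 <= k < S) (if (k < n)%N then X k else 0) = \sum_(i < n.-1) X i.+1.
Proof.
move=> /andP[n0 nS]; rewrite (big_cat_nat (n := n)) //= [X in _ + X]big_nat [X in _ + X]big1 => [|k]; last first.
  by case/andP => nk _; rewrite ltnNge nk.
rewrite addr0 big_nat.
under eq_bigr => k /andP[_ kn] do rewrite kn.
by rewrite -big_nat -(prednK n0) big_add1 /= big_mkord.
Qed.

(** [omega] first chooses the end [J] of a block of the cut and then the position [j] of the pole in
    it, whereas the coproduct meets [j] first. The sums are exchanged and the convolution in
    [mt_coef] is unfolded. *)
Lemma omega_step (h : seq nat -> C) m : m != [::] -> all (leq 2) m -> omega h m =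
  \sum_(j < size m) \sum_(c < (nth 0%N m j).-1) ((left_zeta R (take j m) c)%:C)%C *
    \sum_(i < ((nth 0%N m j).-2 - c).+1) \sum_(j' < (size (drop j.+1 m)).+1)
      ((zeta0 R (take j' (drop j.+1 m)) ((nth 0%N m j).-2 - c - i)%N)%:C)%C *
      omega (fun ks => h (i.+2 :: ks)) (drop j' (drop j.+1 m)).
Proof.
move=> m0 m2; rewrite omegaE //.
pose T j J k : C := ((conv (left_zeta R (take j m)) (zeta0 R (drop j.+1 (take J.+1 m)))
   (nth 0%N m j - k.+1)%N)%:C)%C.
pose W J k := omega (fun ks => h (k.+1 :: ks)) (drop J.+1 m).
have n2 (j : nat) : (j < size m)%N -> (2 <= nth 0%N m j)%N by move=> jm; move/(all_nthP 0%N): m2; apply.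
transitivity (\sum_(J < size m) \sum_(1 <= k < sumn (take J.+1 m))
   \sum_(j < size m | (j <= J)%N) (if (k < nth 0%N m j)%N then T j J k * W J k else 0)).
  apply: eq_bigr => J _; apply: eq_bigr => k _; rewrite /mt_coef rmorph_sum mulr_suml.
  have Jm : (J.+1 <= size m)%N by [].
  rewrite size_takel // (big_ord_widen _ (fun j => ((if (k < nth 0%N (take J.+1 m) j)%N
    then mt_term R (take J.+1 m) j k else 0)%:C)%C * omega (fun ks => h (k.+1 :: ks)) (drop J.+1 m)) Jm).
  apply: eq_big => [j|j]; rewrite ltnS // => jJ.
  rewrite nth_take //; case: ifP => _; last by rewrite mul0r.
  by rewrite /T /mt_term take_takel ?(leqW jJ) // nth_take.
transitivity (\sum_(j < size m) \sum_(J < size m | (j <= J)%N)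
    \sum_(i < (nth 0%N m j).-1) T j J i.+1 * W J i.+1).
  under eq_bigr => J _ do rewrite exchange_big /=.
  rewrite (exchange_big_dep xpredT) //=; apply: eq_bigr => j _; apply: eq_bigr => J jJ.
  rewrite (sum_cut (fun k => T j J k * W J k)) // (ltnW (n2 _ (ltn_ord j))) /=.
  by rewrite -(nth_take 0%N (n0 := J.+1)) // nth_leq_sumn.
apply: eq_bigr => j _; have nj := n2 _ (ltn_ord j).
rewrite (sum_from (size m) j (fun J => \sum_(i < (nth 0%N m j).-1) T j J i.+1 * W J i.+1)).
have -> : (size m - j = (size (drop j.+1 m)).+1)%N by rewrite size_drop subnSK.
transitivity (\sum_(j' < (size (drop j.+1 m)).+1) \sum_(i < (nth 0%N m j).-2.+1)
   \sum_(c < ((nth 0%N m j).-2 - i).+1) ((left_zeta R (take j m) c)%:C)%C *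
    (((zeta0 R (take j' (drop j.+1 m)) ((nth 0%N m j).-2 - c - i)%N)%:C)%C *
      omega (fun ks => h (i.+2 :: ks)) (drop j' (drop j.+1 m)))).
  have eN : (nth 0%N m j).-1 = (nth 0%N m j).-2.+1 by case: (nth _ _ _) nj => [|[]].
  apply: eq_bigr => j' _; rewrite eN; apply: eq_bigr => i _.
  have eS : (nth 0%N m j - i.+2 = (nth 0%N m j).-2 - i)%N by lia.
  rewrite /T eS /conv rmorph_sum mulr_suml; apply: eq_bigr => c _.
  by rewrite rmorphM -mulrA take_drop addnS [(j' + _)%N]addnC /W drop_drop addnS [(j' + _)%N]addnC subnAC.
(* The orders [c] on the left, [i] at the pole and that of the zeta value on the right add up to
   [n_j - 2]; the two free ones are exchanged. *)
under eq_bigr => j' _ do rewrite (sum_triangle (nth 0%N m j).-2 (fun i c => ((left_zeta R (take j m) c)%:C)%C *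
    (((zeta0 R (take j' (drop j.+1 m)) ((nth 0%N m j).-2 - c - i)%N)%:C)%C *
      omega (fun ks => h (i.+2 :: ks)) (drop j' (drop j.+1 m))))).
have eN : (nth 0%N m j).-1 = (nth 0%N m j).-2.+1 by case: (nth _ _ _) nj => [|[]].
rewrite exchange_big eN; apply: eq_bigr => c _ /=.
rewrite exchange_big mulr_sumr; apply: eq_bigr => i _ /=.
by rewrite mulr_sumr.
Qed.

Lemma run_sum_omega h m : all (leq 2) m ->
  run_sum zphi h m = omega (fun ks => h (index_word ks)) m.
Proof.
have [N] := ubnP (size m); elim: N m h => // N IHN m h mN m2.
have [->|m0] := eqVneq m [::]; first by [].
rewrite run_sum_step // omega_step //; apply: eq_bigr => j _; apply: eq_bigr => c _.
congr (_ * _); rewrite (seg_sum_zeros zphi_unit zphi_loop); apply: eq_bigr => i _.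
apply: eq_bigr => j' _; rewrite zphi0; congr (_ * _); rewrite IHN //.
- rewrite !size_drop (leq_ltn_trans (leq_subr _ _)) //.
  have lt : (size m - j.+1 < size m)%N by rewrite ltn_subrL (leq_ltn_trans _ (ltn_ord j)).
  by rewrite size_drop; exact: leq_trans lt mN.
- apply/allP => x /mem_drop /mem_drop xm; exact: (allP m2).
Qed.

Lemma seg_sum_split h ns : all (leq 2) ns ->
  seg_sum zphi h false [::] (index_word ns) = split_sum (fun ks => h (index_word ks)) ns.
Proof.
move=> ns2; rewrite -[index_word ns]/(nseq 0 false ++ index_word ns) (seg_sum_after0 zphi_loop) //.
rewrite /split_sum; apply: eq_bigr => j _; rewrite run_sum_omega; last first.
  by apply/allP => x /mem_drop xm; exact: (allP ns2).
by [].
Qed.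

(** Multiplicativity of [zsh] turns the value of a product of segments into a product of values; [k]
    accumulates those already met. *)
Lemma gsum_seg_sum h k a buf w :
  gsum I1 (fun x u => k * (((zsh R x)%:C)%C * h u)) a buf w true = k * seg_sum zphi h a buf w.
Proof.
elim: w h k a buf => [|c w IHw] h k a buf; first by [].
rewrite gsum_cons IHw [seg_sum zphi h a buf _]/= mulrDr mulrA -(IHw (fun u => h (c :: u)) (k * zphi a buf c)); congr (_ + _).
apply: eq_gsum => x u; rewrite /sel zshM rmorphM -!mulrA; reflexivity.
Qed.

Lemma tensor_lift_add (b : calI1 -> calI1 -> C) s t :
  (forall v, linear_for ((ratr : {rmorphism rat -> C}) \; *%R) (b^~ v)) ->
  (forall u, linear_for ((ratr : {rmorphism rat -> C}) \; *%R) (b u)) ->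
  tensor_lift (ratr : {rmorphism rat -> C}) b (s + t) =
  tensor_lift (ratr : {rmorphism rat -> C}) b s + tensor_lift (ratr : {rmorphism rat -> C}) b t.
Proof.
move=> bl br; rewrite -[s]reprK -[t]reprK.
rewrite -(raddfD (\pi_(tensor calI1 calI1) : {additive _ -> _})) !tensor_lift_pi //.
exact: raddfD.
Qed.

Lemma eq_omega (h h' : seq nat -> C) m :
  (forall ks, all (leq 2) ks -> h ks = h' ks) -> omega h m = omega h' m.
Proof.
rewrite /omega; move: (size m) => f; elim: f h h' m => [|f IHf] h h' [|n m] hh' //=; try exact: hh'.
apply: eq_bigr => j _; rewrite big_nat [RHS]big_nat; apply: eq_bigr => k /andP[k1 _].
congr (_ * _); apply: IHf => ks ks2.
by apply: hh'; rewrite /= ltnS k1.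
Qed.

Lemma GshE ns k : all (leq 2) ns -> Gsh R ns k = split_sum (fun ks => gsh_index R ks k) ns.
Proof.
move=> ns2; rewrite /Gsh; set b := fun _ => _.
have [zl _] := zsh_is_zsh R; have [gl gn] := gsh_is_gsh R.
have bl v : linear_for ((ratr : {rmorphism rat -> C}) \; *%R) (b^~ v).
  by move=> q x y; rewrite /b zl rmorphD rmorphM /= fmorph_rat mulrDl mulrA.
have br u : linear_for ((ratr : {rmorphism rat -> C}) \; *%R) (b u).
  by move=> q x y; rewrite /b gl mulrDr mulrCA.
have bD s t := tensor_lift_add s t bl br.
have b0 : tensor_lift (ratr : {rmorphism rat -> C}) b 0 = 0.
  by have := bD 0 0; rewrite addr0 => /eqP; rewrite -subr_eq0 opprD addrA subrr add0r oppr_eq0 => /eqP.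
have bU u v : tensor_lift (ratr : {rmorphism rat -> C}) b (tens u v) = b u v.
  by rewrite /tens tensor_lift_pi // mmapU /= (rmorph1 (ratr : {rmorphism rat -> C})) mul1r.
rewrite /I1_index coproductE goncharov_formulaE.
transitivity (gsum I1 (fun x u => 1 * (((zsh R x)%:C)%C * gsh R (I1 (false, u, true)) k))
    false [::] (index_word ns) true).
  rewrite /tensor_goncharov !gsumE (big_morph _ bD b0); apply: eq_bigr => t _.
  rewrite bU mul1r; reflexivity.
rewrite (gsum_seg_sum (fun u => gsh R (I1 (false, u, true)) k)) mul1r seg_sum_split //.
apply: eq_bigr => j _; congr (_ * _); apply: eq_omega => ks ks2.
by rewrite -[I1 _]/(I1_index ks) gn ?le1_of_le2.
Qed.

End CoproductSum.

(** * The generating series of the q-series *)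

Section TruncatedExp.
Variables (S : comNzRingType) (P : comAlgType S) (inv : nat -> S).
Hypothesis inv_fact : forall d, inv d * (d`!)%:R = 1.
Implicit Types (p q y z : P) (D d : nat).

Definition texp D y : P := \sum_(d < D.+1) inv d *: y ^+ d.

Lemma inv_bin d i : (i <= d)%N -> inv d * 'C(d, i)%:R = inv i * inv (d - i)%N.
Proof.
move=> di; have := congr1 (fun n => n%:R : S) (bin_fact di); rewrite !natrM => E.
transitivity (inv d * 'C(d, i)%:R * ((inv i * (i`!)%:R) * (inv (d - i)%N * ((d - i)`!)%:R))).
  by rewrite !inv_fact !mulr1.
transitivity ((inv d * ('C(d, i)%:R * ((i`!)%:R * ((d - i)`!)%:R))) * (inv i * inv (d - i)%N)).
  rewrite [X in _ * X = _]mulrACA; move: (inv i * inv (d - i)%N) ((i`!)%:R * _) => a b.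
  by rewrite [a * b]mulrC !mulrA.
by rewrite E inv_fact mul1r.
Qed.

Lemma texpD D y z : texp D y * texp D z - texp D (y + z) =
  \sum_(i < D.+1) \sum_(j < D.+1 | (D.+1 - i <= j)%N) (inv i * inv j) *: (y ^+ i * z ^+ j).
Proof.
pose T i j : P := (inv i * inv j) *: (y ^+ i * z ^+ j).
have -> : texp D y * texp D z = \sum_(i < D.+1) \sum_(j < D.+1) T i j.
  rewrite /texp mulr_suml; apply: eq_bigr => i _; rewrite mulr_sumr; apply: eq_bigr => j _.
  by rewrite -scalerAl -scalerAr scalerA.
have -> : texp D (y + z) = \sum_(i < D.+1) \sum_(j < D.+1 - i) T i j.
  transitivity (\sum_(d < D.+1) \sum_(i < D.+1 | (i <= d)%N) T i (d - i)%N).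
    apply: eq_bigr => d _; rewrite addrC exprDn scaler_sumr.
    have dD : (d.+1 <= D.+1)%N by exact: ltn_ord.
    rewrite (big_ord_widen _ (fun i => inv d *: ((z ^+ (d - i) * y ^+ i) *+ 'C(d, i))) dD).
    apply: eq_big => [i|i]; rewrite ltnS // => id.
    by rewrite -scaler_nat scalerA inv_bin // [z ^+ _ * _]mulrC.
  rewrite (exchange_big_dep xpredT) //=; apply: eq_bigr => i _.
  rewrite (sum_from D.+1 i (fun d => T i (d - i)%N)).
  by apply: eq_bigr => j _; rewrite addKn.
rewrite -sumrB; apply: eq_bigr => i _.
have iD : (D.+1 - i <= D.+1)%N by exact: leq_subr.
rewrite (big_ord_widen _ (fun j => T i j) iD) (bigID (fun j : 'I_D.+1 => (j < D.+1 - i)%N)) /=.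
rewrite addrAC subrr add0r; apply: eq_bigl => j; by rewrite -leqNgt.
Qed.

Lemma texp0 D : texp D 0 = 1.
Proof.
rewrite /texp big_ord_recl big1 ?addr0 => [|i _]; last by rewrite lift0 expr0n scaler0.
by have := inv_fact 0; rewrite mulr1 => ->; rewrite scale1r.
Qed.

(** An abstract order of vanishing, that is, a decreasing filtration compatible with products. *)
Variable van : nat -> P -> Prop.
Hypothesis van0 : forall p, van 0 p.
Hypothesis van_zero : forall d, van d 0.
Hypothesis vanD : forall d p q, van d p -> van d q -> van d (p + q).
Hypothesis vanZ : forall d c p, van d p -> van d (c *: p).
Hypothesis vanM : forall d d' p q, van d p -> van d' q -> van (d + d') (p * q).
Hypothesis van_le : forall d d' p, (d' <= d)%N -> van d p -> van d' p.

Lemma van_sum (I : Type) (s : seq I) (Q : pred I) (F : I -> P) d :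
  (forall i, Q i -> van d (F i)) -> van d (\sum_(i <- s | Q i) F i).
Proof. by move=> vF; apply: (big_ind (van d)) => // x y; exact: vanD. Qed.

Lemma vanX d y : van 1 y -> van d (y ^+ d).
Proof.
by move=> vy; elim: d => [|d IHd]; [exact: van0|rewrite exprS -add1n; exact: vanM].
Qed.

Lemma texp_prod D (I : Type) (s : seq I) (F : I -> P) : (forall i, van 1 (F i)) ->
  van D.+1 (\prod_(i <- s) texp D (F i) - texp D (\sum_(i <- s) F i)).
Proof.
move=> vF; elim: s => [|i s IHs]; first by rewrite !big_nil texp0 subrr.
rewrite !big_cons; set A := \prod_(j <- s) _ in IHs *; set B := \sum_(j <- s) _ in IHs *.
have -> : texp D (F i) * A - texp D (F i + B) =
    texp D (F i) * (A - texp D B) + (texp D (F i) * texp D B - texp D (F i + B)).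
  by rewrite mulrBr addrA subrK.
apply: vanD; first by rewrite -[D.+1]add0n; apply: vanM.
rewrite texpD; apply: van_sum => k _; apply: van_sum => j kj; apply: vanZ.
apply: (@van_le (k + j)); first by rewrite -leq_subLR.
by apply: vanM; apply: vanX => //; apply: van_sum.
Qed.

End TruncatedExp.

Section MonomialCoefficients.
Variables (S : comNzRingType) (r : nat) (inv : nat -> S).
Hypothesis inv_fact : forall d, inv d * (d`!)%:R = 1.
Local Notation P := {malg S['X_{1..r}]}.
Implicit Types (p q : P) (D d : nat) (m : 'X_{1..r}).

(* Truncated exponentials are multiplicative only up to terms of high order. *)
Definition vanish d p := forall m, (mdeg m < d)%N -> mcoeff m p = 0.

Lemma vanishD d p q : vanish d p -> vanish d q -> vanish d (p + q).
Proof. by move=> vp vq m md; rewrite mcoeffD vp // vq // addr0. Qed.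

Lemma vanishZ d c p : vanish d p -> vanish d (c *: p).
Proof. by move=> vp m md; rewrite mcoeffZ vp // mulr0. Qed.

Lemma vanishM d d' p q : vanish d p -> vanish d' q -> vanish (d + d') (p * q).
Proof.
move=> vp vq m md; rewrite mcoeffMl big1 // => k1 _; rewrite big1 // => k2 _.
have [k12|] := eqVneq (mmul k1 k2) m; last by rewrite mulr0n.
have : (mdeg k1 < d)%N || (mdeg k2 < d')%N.
  by move: md; rewrite -k12 mdegM; lia.
by case/orP => [/vp|/vq] ->; rewrite ?mul0r ?mulr0 mul0rn.
Qed.

Definition xvar (i : 'I_r) : P := << ucm i >>.

Lemma vanish_xvar c i : vanish 1 (c *: xvar i).
Proof.
move=> m; rewrite ltnS leqn0 mdeg_eq0 => /eqP ->.
by rewrite mcoeffZ /xvar mcoeffU1 cm1_eq1 mulr0.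
Qed.

Lemma monomM (k1 k2 : 'X_{1..r}) : (<< k1 >> : P) * << k2 >> = << mmul k1 k2 >>.
Proof. by rewrite malgM_def fgmulUU mulr1. Qed.

Lemma prod_xvar (g : 'I_r -> nat) : exists2 k : 'X_{1..r},
  \prod_i xvar i ^+ g i = << k >> & forall i, k i = g i.
Proof.
have X i n : exists2 k : 'X_{1..r}, xvar i ^+ n = << k >> & forall j, k j = (n * (i == j))%N.
  elim: n => [|n [k kE kv]]; first by exists mone => [//|j]; rewrite cm1.
  exists (mmul (ucm i) k); first by rewrite exprS kE; exact: monomM.
  by move=> j; rewrite cmM kv cmU mulSn.
have [k kE kv] : exists2 k : 'X_{1..r}, \prod_(i <- index_enum 'I_r) xvar i ^+ g i = << k >> &
    forall j, k j = (\sum_(i <- index_enum 'I_r) g i * (i == j))%N.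
  elim: (index_enum _) => [|i s [k kE kv]].
    by exists mone => [|j]; rewrite !big_nil ?cm1.
  have [k' kE' kv'] := X i (g i); exists (mmul k' k); first by rewrite big_cons kE kE'; exact: monomM.
  by move=> j; rewrite cmM kv kv' big_cons.
exists k => // j; rewrite kv (bigD1 j) //= eqxx muln1 big1 ?addn0 // => i /negPf ->.
by rewrite muln0.
Qed.

Lemma mcoeff_texp_prod D (I : Type) (s : seq I) (F : I -> P) m : (mdeg m <= D)%N ->
  (forall i, vanish 1 (F i)) ->
  mcoeff m (\prod_(i <- s) texp inv D (F i)) = mcoeff m (texp inv D (\sum_(i <- s) F i)).
Proof.
move=> mD vF; have := @texp_prod S P inv inv_fact vanish _ _ vanishD vanishZ vanishM _ D I s F vF m.
rewrite ltnS mcoeffB => h; apply/eqP; rewrite -subr_eq0; apply/eqP; apply: h => //.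
- by move=> d k _; rewrite mcoeff0.
- by move=> d d' p dd vp k kd; apply: vp; exact: leq_trans dd.
Qed.

(** Up to degree [D] the exponential of a linear form is the product of those of its terms, in which
    a monomial selects one power of each variable. *)
Lemma mcoeff_texp D (c : 'I_r -> S) m : (mdeg m <= D)%N ->
  mcoeff m (texp inv D (\sum_i c i *: xvar i)) = \prod_i (inv (m i) * c i ^+ m i).
Proof.
move=> mD; rewrite -(mcoeff_texp_prod _ mD) => [|i]; last exact: vanish_xvar.
rewrite /texp bigA_distr_bigA /= raddf_sum /=.
have mi i : (m i <= D)%N.
  apply: leq_trans mD; rewrite mdegE; have [im|im] := boolP (i \in finsupp m).
    by rewrite (big_fsetD1 i) //= leq_addr.
  by move: im; rewrite -cmE_eq0 => /eqP ->.
have T (g : {ffun 'I_r -> 'I_D.+1}) : mcoeff m (\prod_i (inv (g i) *: (c i *: xvar i) ^+ g i)) =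
    \prod_i (inv (g i) * c i ^+ g i) * [forall i, m i == g i]%:R.
  under eq_bigr => i _ do rewrite exprZn scalerA.
  rewrite scaler_prod mcoeffZ; have [k -> kv] := prod_xvar (fun i => g i).
  rewrite mcoeffU1; congr (_ * (nat_of_bool _)%:R).
  apply/eqP/forallP => [<- i|h]; first by rewrite kv.
  by apply/eqP/cmP => i; rewrite kv (eqP (h i)).
rewrite (eq_bigr _ (fun g _ => T g)).
rewrite (bigD1 [ffun i => inord (m i)]) //= [X in _ + X]big1 ?addr0 => [|g gm].
  rewrite (_ : [forall i, _] = true) ?mulr1; last by apply/forallP => i; rewrite ffunE inordK ?ltnS ?mi.
  by apply: eq_bigr => i _; rewrite ffunE inordK ?ltnS ?mi.
case: forallP => [h|_]; last by rewrite mulr0.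
by case/eqP: gm; apply/ffunP => i; apply/val_inj; rewrite ffunE /= inordK ?ltnS ?mi // (eqP (h i)).
Qed.

End MonomialCoefficients.

(** * Tuples, partial sums and their weights *)

Section Sequences.
Implicit Types (u v d : seq nat) (r N a n : nat).

Fixpoint tups r N : seq (seq nat) :=
  if r is r'.+1 then [seq x :: d | x <- iota 1 N, d <- tups r' N] else [:: [::]].

Lemma mem_tups r N d : d \in tups r N -> size d = r /\ all (leq 1) d.
Proof.
elim: r d => [|r IHr] d /=; first by rewrite inE => /eqP ->.
case/allpairsP => -[x d'] /= [xN /IHr[<- d1] ->]; split=> //=.
by rewrite d1 andbT; move: xN; rewrite mem_iota => /andP[].
Qed.

(** The increasing sequence, starting after [a], whose successive gaps are listed by [d]. *)
Fixpoint psums a d : seq nat := if d is x :: d' then (a + x)%N :: psums (a + x) d' else [::].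

Lemma size_psums a d : size (psums a d) = size d.
Proof. by elim: d a => //= x d IHd a; rewrite IHd. Qed.

Lemma psums_rcons a d x : psums a (rcons d x) = rcons (psums a d) (a + sumn d + x)%N.
Proof. by elim: d a => [|y d IHd] a /=; rewrite ?addn0 // IHd addnA. Qed.

Definition wt u v : nat := \sum_(p <- zip u v) p.1 * p.2.

Lemma wt_cons x u y v : wt (x :: u) (y :: v) = (x * y + wt u v)%N.
Proof. by rewrite /wt big_cons. Qed.

Lemma wt_rcons u v x y : size u = size v -> wt (rcons u x) (rcons v y) = (wt u v + x * y)%N.
Proof. by move=> uv; rewrite /wt zip_rcons // -cats1 big_cat big_seq1. Qed.

Lemma wt_psums a d v : size d = size v -> wt (psums a d) v = (a * sumn v + wt (psums 0 d) v)%N.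
Proof.
elim: d v a => [|x d IHd] [|y v] a //=; first by rewrite muln0.
move=> [dv]; rewrite !wt_cons add0n (IHd _ (a + x)%N) // (IHd _ x) //.
by rewrite !mulnDl mulnDr; lia.
Qed.

(* Both sides are the sum of the [d_i v_j] with i <= j. *)
Lemma wt_conj d v : size d = size v -> wt (psums 0 d) v = wt (psums 0 (rev v)) (rev d).
Proof.
elim: d v => [|x d IHd] [|y v] //= [dv].
rewrite wt_cons add0n wt_psums // IHd // !rev_cons psums_rcons wt_rcons ?size_psums ?size_rev //.
by rewrite sumn_rev add0n; lia.
Qed.

Variable V : nmodType.

Lemma sum_tups_cons r N (F : seq nat -> V) :
  \sum_(d <- tups r.+1 N) F d = \sum_(x <- iota 1 N) \sum_(d <- tups r N) F (x :: d).
Proof. by rewrite /= big_allpairs_dep. Qed.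

Lemma sum_tups_rcons r N (F : seq nat -> V) :
  \sum_(d <- tups r.+1 N) F d = \sum_(d <- tups r N) \sum_(x <- iota 1 N) F (rcons d x).
Proof.
elim: r F => [|r IHr] F.
  rewrite sum_tups_cons /= big_seq1; apply: eq_bigr => x _.
  by rewrite big_seq1.
rewrite sum_tups_cons [RHS]sum_tups_cons; apply: eq_bigr => x _.
exact: (IHr (fun d => F (x :: d))).
Qed.

Lemma sum_tups_rev r N (F : seq nat -> V) :
  \sum_(d <- tups r N) F d = \sum_(d <- tups r N) F (rev d).
Proof.
elim: r F => [|r IHr] F; first by rewrite !big_seq1.
rewrite sum_tups_cons [RHS]sum_tups_rcons [RHS]exchange_big; apply: eq_bigr => x _ /=.
rewrite (IHr (fun d => F (x :: d))); apply: eq_bigr => d _.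
by rewrite rev_rcons.
Qed.

Lemma filter_iota_gt N z a : (a < z)%N -> [seq y <- iota a.+1 (N - a) | (z < y)%N] = iota z.+1 (N - z).
Proof.
move=> az; have [zN|Nz] := leqP z N.
  have -> : (N - a = (z - a) + (N - z))%N by lia.
  rewrite iotaD filter_cat; have -> : (a.+1 + (z - a) = z.+1)%N by lia.
  rewrite (_ : [seq y <- iota a.+1 (z - a) | (z < y)%N] = [::]) ?cat0s.
    by apply/all_filterP/allP => y; rewrite mem_iota; lia.
  apply/eqP; rewrite -(negbK (_ == _)) -has_filter; apply/negP => /hasP[y].
  by rewrite mem_iota; lia.
have -> : (N - z = 0)%N by lia.
apply/eqP; rewrite -(negbK (_ == _)) -has_filter; apply/negP => /hasP[y].
by rewrite mem_iota; lia.
Qed.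

(** Increasing sequences are parametrised by their gaps. Tuples of gaps may overshoot [N], but [F]
    vanishes there. *)
Lemma sum_subs_psums r N a (F : seq nat -> V) : (a <= N)%N ->
  (forall u, has (ltn N) u -> F u = 0) ->
  \sum_(u <- subs r (iota a.+1 (N - a))) F u = \sum_(d <- tups r N) F (psums a d).
Proof.
elim: r a F => [|r IHr] a F aN F0; first by rewrite sum_subs0 big_seq1.
rewrite (@sum_subs_first _ _ ltn ltn_trans ltnn); last first.
  by rewrite -sorted_pairwise ?iota_ltn_sorted //; exact: ltn_trans.
have eI : iota 1 N = iota 1 (N - a) ++ iota (1 + (N - a)) a by rewrite -iotaD subnK.
rewrite sum_tups_cons eI big_cat /=.
rewrite [X in _ = _ + X]big1_seq ?addr0 => [|x /andP[_]]; last first.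
  by rewrite mem_iota => xN; rewrite big1 // => d _; apply: F0 => /=; apply/orP; left; lia.
have -> : iota a.+1 (N - a) = [seq (a + x)%N | x <- iota 1 (N - a)] by rewrite -iotaDl addn1.
rewrite big_map big_seq [RHS]big_seq; apply: eq_bigr => x; rewrite mem_iota => xN.
rewrite -iotaDl addn1 (@filter_iota_gt N (a + x) a); last lia.
rewrite (IHr (a + x)%N (fun u => F ((a + x)%N :: u))) //; first lia.
by move=> u uN; apply: F0; rewrite /= uN orbT.
Qed.

Lemma sum_subs_stable r N U (F : seq nat -> V) : (N <= U)%N ->
  (forall u, has (ltn N) u -> F u = 0) ->
  \sum_(u <- subs r (iota 1 U)) F u = \sum_(u <- subs r (iota 1 N)) F u.
Proof.
move=> NU F0; rewrite -(subnKC NU); elim: (U - N)%N => [|k IHk]; first by rewrite addn0.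
rewrite addnS -[(N + k).+1]addn1 iotaD cats1; case: r IHk => [|r] IHk; first by rewrite !subs0.
rewrite sum_subs_rcons IHk big1 ?add0r // => u _; apply: F0.
by rewrite has_rcons add1n /= ltnS leq_addr.
Qed.

Lemma sum_tups_stable r N U (F : seq nat -> V) : (N <= U)%N ->
  (forall u, has (ltn N) u -> F u = 0) ->
  \sum_(u <- tups r U) F u = \sum_(u <- tups r N) F u.
Proof.
move=> NU; elim: r F => [|r IHr] F F0; first by rewrite !big_seq1.
have eI : iota 1 U = iota 1 N ++ iota (1 + N) (U - N) by rewrite -iotaD subnKC.
rewrite !sum_tups_cons eI big_cat [X in _ + X = _]big1_seq ?addr0 => [|x /andP[_]]; last first.
  by rewrite mem_iota => xN; rewrite big1 // => d _; apply: F0 => /=; apply/orP; left; lia.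
apply: eq_bigr => x _; apply: (IHr (fun d => F (x :: d))) => u uN.
by apply: F0; rewrite /= uN orbT.
Qed.

End Sequences.

Section LinearForms.
Variables (S : comNzRingType) (P : lmodType S).
Implicit Types (xs Y : seq P) (il u V : seq nat).

Definition pairing Y V : P := \sum_(p <- zip Y V) p.1 *+ p.2.

Lemma pairing_rev Y V : size Y = size V -> pairing (rev Y) V = pairing Y (rev V).
Proof.
move=> YV; rewrite /pairing -{1}(revK V) -rev_zip ?size_rev //.
by apply: perm_big; rewrite perm_rev.
Qed.

(** Summation by parts: differences of the variables become differences of the weights. Past the end
    [nth] returns 0, which gives the last difference. *)
Lemma pairing_diff x0 xs V : size xs = size V ->
  pairing (pairmap (fun a b => b - a) x0 xs) V =
  \sum_(i < size xs) ((nth 0%N V i)%:R - (nth 0%N V i.+1)%:R) *: nth 0 xs i - x0 *+ head 0%N V.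
Proof.
elim: xs V x0 => [|x xs IHxs] [|v V] x0 //=.
  by rewrite /pairing big_nil big_ord0 mulr0n subrr.
move=> [sz]; rewrite /pairing big_cons /= -/(pairing _ _) IHxs // big_ord_recl /= nth0.
rewrite scalerBl !scaler_nat mulrnBl -!addrA; congr (_ + _).
have E (a b c : P) : - a + (b - c) = - c + (b - a).
  by rewrite addrCA [RHS]addrCA [- a - c]addrC.
exact: E.
Qed.

(** In an exponent of [h] all variables of a block are multiplied by the same [u_j]; this lists
    these multipliers, one for each variable. *)
Definition repeats il u : seq nat := flatten [seq nseq p.1 p.2 | p <- zip il u].

Lemma blocks_pairing il u Y : size il = size u -> size Y = sumn il ->
  \sum_(j < size il) nth 0 [seq \sum_(z <- b) z | b <- reshape il Y] j *+ nth 0%N u j =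
  pairing Y (repeats il u).
Proof.
elim: il u Y => [|a il IHil] [|x u] Y //=.
  by move=> _ /eqP; rewrite size_eq0 => /eqP ->; rewrite big_ord0 /pairing big_nil.
move=> [sz] sY; rewrite big_ord_recl /= IHil ?size_drop ?sY ?addKn //.
have st : size (take a Y) = a by rewrite size_takel // sY leq_addr.
rewrite /pairing /repeats /= -/(repeats il u) -{3}(cat_take_drop a Y) zip_cat ?size_nseq ?st // big_cat /=.
congr (_ + _); have E (Y' : seq P) :
    (\sum_(z <- Y') z) *+ x = \sum_(p <- zip Y' (nseq (size Y') x)) p.1 *+ p.2.
  by rewrite -sumrMnl; elim: Y' => [|y Y' IH]; rewrite ?big_nil //= !big_cons IH.
by have := E (take a Y); rewrite st => ->.
Qed.

Lemma size_repeats il u : size il = size u -> size (repeats il u) = sumn il.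
Proof.
elim: il u => [|a il IHil] [|x u] //= [sz].
by rewrite /repeats /= size_cat size_nseq -/(repeats il u) IHil.
Qed.

Lemma repeats_eq il u : size il = size u -> has (leq 2) il ->
  exists2 t, (t.+1 < sumn il)%N & nth 0%N (repeats il u) t = nth 0%N (repeats il u) t.+1.
Proof.
elim: il u => [|a il IHil] [|x u] //= [sz]; rewrite /repeats /= -/(repeats il u).
case/orP => [a2|/(IHil _ sz)[t ts tE]].
  exists 0%N; first by rewrite (leq_trans a2) // leq_addr.
  by rewrite !nth_cat size_nseq !nth_nseq (ltnW a2) a2.
exists (a + t)%N; first by rewrite -addnS ltn_add2l.
by rewrite -addnS !nth_cat size_nseq !ltnNge !leq_addr /= !addKn.
Qed.

Lemma repeats_rev_eq il u : size il = size u -> has (leq 2) il ->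
  exists2 i, (i < sumn il)%N & nth 0%N (rev (repeats il u)) i = nth 0%N (rev (repeats il u)) i.+1.
Proof.
move=> sz il2; have [t ts tE] := repeats_eq sz il2.
exists (sumn il - t.+2)%N; first lia.
rewrite !nth_rev ?size_repeats //; try lia.
have -> : (sumn il - (sumn il - t.+2).+1 = t.+1)%N by lia.
by have -> : (sumn il - (sumn il - t.+2).+2 = t)%N by lia.
Qed.

Lemma repeats1 u : repeats (nseq (size u) 1%N) u = u.
Proof. by elim: u => //= x u IHu; rewrite /repeats /= -/(repeats _ _) IHu. Qed.

End LinearForms.

Lemma sum_path_tuples (A : comNzRingType) p N (f : nat -> nat -> A) :
  \sum_(u : p.-tuple 'I_N.+1 | path ltn 0%N [seq val i | i <- u]) \prod_(j < p) f (tnth u j) j =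
  \sum_(u <- subs p (iota 1 N)) \prod_(j < p) f (nth 0%N u j) j.
Proof.
have -> : iota 1 N = [seq y <- iota 0 N.+1 | (0 < y)%N].
  by rewrite /=; apply/esym/all_filterP/allP => y; rewrite mem_iota => /andP[].
rewrite -(@sum_sorted_tuples _ _ _ (val : 'I_N.+1 -> nat) ltn (iota 0 N.+1) ltn_trans ltnn).
- apply: eq_bigr => u _; apply: eq_bigr => j _; congr f.
  by rewrite (nth_map (tnth u j)) ?size_tuple // -tnth_nth.
- by rewrite -sorted_pairwise ?iota_ltn_sorted //; exact: ltn_trans.
- by move=> Phi; rewrite -[iota 0 N.+1]/(index_iota 0 N.+1) big_mkord.
Qed.

Lemma nth_ord_map (V : nmodType) r (f : 'I_r -> V) (i : 'I_r) : nth 0 [seq f i | i : 'I_r] i = f i.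
Proof. by rewrite (nth_map i) ?size_enum_ord // nth_ord_enum. Qed.

Section NthClosed.
Variables (P : zmodType) (Q : P -> Prop).
Hypothesis Q0 : Q 0.
Hypothesis QD : forall x y, Q x -> Q y -> Q (x + y).
Hypothesis QB : forall x y, Q x -> Q y -> Q (x - y).

Lemma nth_rev_pairmap xs : (forall i, Q (nth 0 xs i)) ->
  forall i, Q (nth 0 (rev (pairmap (fun a b => b - a) 0 xs)) i).
Proof.
move=> Qxs i; have [ip|pi] := ltnP i (size (pairmap (fun a b => b - a) 0 xs)); last first.
  by rewrite nth_default // size_rev.
rewrite nth_rev //; move: (_ - _)%N => {ip}j.
have h : forall x0 j, Q x0 -> Q (nth 0 (pairmap (fun a b => b - a) x0 xs) j).
  elim: xs Qxs => [|x xs IHxs] Qxs x0 [|k] Qx0 //=; first exact: QB (Qxs 0%N) Qx0.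
  by apply: IHxs; [move=> i'; exact: (Qxs i'.+1)|exact: (Qxs 0%N)].
exact: h.
Qed.

Lemma nth_blocks il Y : (forall i, Q (nth 0 Y i)) ->
  forall j, Q (nth 0 [seq \sum_(z <- b) z | b <- reshape il Y] j).
Proof.
elim: il Y => [|a il IHil] Y QY [|j] //=.
  elim: a Y QY => [|a IHa] [|y Y] QY //=; rewrite ?big_nil // big_cons.
  by apply: QD; [exact: (QY 0%N)|apply: IHa => k; exact: (QY k.+1)].
by apply: IHil => k; rewrite nth_drop.
Qed.

End NthClosed.

Section GserCoefficient.
Variable R : realType.
Local Notation C := (Cplx R).
Local Notation S := {poly C}.
Implicit Types (ks u v d il : seq nat) (N D r : nat).

Definition inv_factorial (k : nat) : S := Defs.cst ((k`!)%:R^-1 : C).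

Lemma inv_factorialK k : inv_factorial k * (k`!)%:R = 1.
Proof.
rewrite /inv_factorial /Defs.cst -(rmorph_nat (polyC : {rmorphism C -> S})) -rmorphM mulVf //.
Qed.

Local Notation t := (- two_pi_i R).

Variables (N : nat) (ks : seq nat).
Hypothesis ks2 : all (leq 2) ks.
Local Notation r := (size ks).
Local Notation D := (sumn [seq j.-1 | j <- ks]).
Local Notation P := {malg S['X_{1..r}]}.
Let m := index_monom ks.

Lemma index_monomE i : m i = (nth 0%N ks i).-1.
Proof.
have X (j i' : 'I_r) n : expcmn (ucm j) n i' = (n * (j == i'))%N.
  case: n => [|n]; first by rewrite /expcmn /= onecmE.
  elim: n => [|n IHn]; first by rewrite /expcmn /= ucmE mul1n.
  by rewrite /expcmn /= -/(expcmn (ucm j) n.+1) mulcmE IHn ucmE mulSn.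
rewrite /m /index_monom.
have -> : (\big[mmul/mone]_(j < r) expcmn (ucm j) (nth 0%N ks j).-1) i =
    (\sum_(j < r) expcmn (ucm j) (nth 0%N ks j).-1 i)%N.
  by elim/big_rec2: _ => [|j a b _ <-]; rewrite ?cm1 ?cmM.
rewrite (bigD1 i) //= X eqxx muln1 big1 ?addn0 // => j /negPf ji.
by rewrite X ji muln0.
Qed.

Lemma mdeg_index_monom : mdeg m = D.
Proof.
have X (i : 'I_r) n : mdeg (expcmn (ucm i) n) = n.
  case: n => [|n]; first by rewrite /expcmn /= mdeg1.
  elim: n => [|n IHn]; first by rewrite /expcmn /= mdegU.
  by rewrite /expcmn /= -/(expcmn (ucm i) n.+1) mdegM mdegU IHn.
rewrite /m /index_monom (big_morph _ (@mdegM _) (@mdeg1 _)).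
under eq_bigr => i _ do rewrite X.
elim: (ks) => [|k l IHl] /=; first by rewrite big_ord0.
by rewrite big_ord_recl /= -IHl.
Qed.

Definition lin_forms : seq P := rev (pairmap (fun a b => b - a) 0 (scaled_vars R r)).

Lemma size_lin_forms : size lin_forms = r.
Proof. by rewrite size_rev size_pairmap size_map size_enum_ord. Qed.

Lemma nth_scaled_vars (i : 'I_r) : nth 0 (scaled_vars R r) i = Defs.cst t *: xvar S i.
Proof. exact: (nth_ord_map (fun i : 'I_r => Defs.cst t *: xvar S i)). Qed.

Lemma vanish_block il (u : seq nat) j :
  vanish 1 (nth 0 [seq \sum_(z <- b) z | b <- reshape il lin_forms] j *+ nth 0%N u j).
Proof.
suff v : vanish 1 (nth 0 [seq \sum_(z <- b) z | b <- reshape il lin_forms] j).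
  by move=> k kd; rewrite mcoeffMn v // mul0rn.
have v0 : vanish 1 (0 : P) by move=> k _; rewrite mcoeff0.
apply: (@nth_blocks P (vanish 1)) => //; try exact: vanishD.
have vB (p q : P) : vanish 1 p -> vanish 1 q -> vanish 1 (p - q).
  by move=> vp vq k kd; rewrite mcoeffB vp // vq // subr0.
apply: nth_rev_pairmap => //; try exact: vanishD.
move=> i; have [ir|ri] := ltnP i r.
  by rewrite (nth_scaled_vars (Ordinal ir)); exact: vanish_xvar.
by rewrite nth_default // size_map size_enum_ord.
Qed.

(** The coefficient of [index_monom ks] in the product of exponentials, [V] listing the multipliers
    in the order of the variables; the missing last neighbour is the default 0 of [nth]. *)
Definition diff_weight V : C :=
  \prod_(i < r) (((nth 0%N ks i).-1)`!%:R^-1 * (((nth 0%N V i)%:R - (nth 0%N V i.+1)%:R) * t) ^+ (nth 0%N ks i).-1).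

Lemma mcoeff_block il u : size il = size u -> sumn il = r ->
  mcoeff m (\prod_(j < size il) (qfrac R N (nth 0%N u j) ^+ nth 0%N il j *:
     expx D (nth 0 [seq \sum_(z <- b) z | b <- reshape il lin_forms] j *+ nth 0%N u j))) =
  (\prod_(j < size il) qfrac R N (nth 0%N u j) ^+ nth 0%N il j) *
  (diff_weight (rev (repeats il u)))%:P.
Proof.
move=> sz sr; rewrite scaler_prod mcoeffZ; congr (_ * _).
have sY : size lin_forms = sumn il by rewrite size_lin_forms.
have -> : \prod_(j < size il) expx D (nth 0 [seq \sum_(z <- b) z | b <- reshape il lin_forms] j *+ nth 0%N u j) =
    \prod_(j < size il) texp inv_factorial D (nth 0 [seq \sum_(z <- b) z | b <- reshape il lin_forms] j *+ nth 0%N u j).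
  by [].
rewrite (mcoeff_texp_prod inv_factorialK) ?mdeg_index_monom //; last first.
  by move=> j; exact: vanish_block.
have sx : size (scaled_vars R r) = r by rewrite size_map -cardE card_ord.
rewrite blocks_pairing //; set V := rev (repeats il u).
have sV : size (scaled_vars R r) = size V by rewrite size_rev size_repeats // sr.
have -> : pairing lin_forms (repeats il u) =
    \sum_(i < r) (((nth 0%N V i)%:R - (nth 0%N V i.+1)%:R) * Defs.cst t) *: xvar S i.
  have sp : size (pairmap (fun a b => b - a) 0 (scaled_vars R r)) = size (repeats il u).
    by rewrite size_pairmap sx size_repeats // sr.
  rewrite /lin_forms (pairing_rev sp) (pairing_diff 0 sV) mul0rn subr0 sx.
  by apply: eq_bigr => i _; rewrite nth_scaled_vars scalerA.
rewrite (mcoeff_texp inv_factorialK) ?mdeg_index_monom // /diff_weight rmorph_prod.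
apply: eq_bigr => i _; rewrite index_monomE rmorphM rmorphXn rmorphM rmorphB !rmorph_nat.
by [].
Qed.

(** As [n_i >= 2] the exponent of the difference is positive. Every composition with a part at least
    2 repeats a multiplier and is thereby eliminated from [h]. *)
Lemma diff_weight_eq V i : (i < r)%N -> nth 0%N V i = nth 0%N V i.+1 -> diff_weight V = 0.
Proof.
move=> ir Vi; rewrite /diff_weight (bigD1 (Ordinal ir)) //= Vi subrr mul0r expr0n.
have : (2 <= nth 0%N ks i)%N by move/(all_nthP 0%N): ks2; exact.
by case: (nth 0%N ks i) => [|[|k]] //= _; rewrite mulr0 mul0r.
Qed.

Lemma HserE il : mcoeff m (Hser N D il [seq \sum_(z <- b) z | b <- reshape il lin_forms]) =
  \sum_(u <- subs (size il) (iota 1 N)) mcoeff m (\prod_(j < size il) (qfrac R N (nth 0%N u j) ^+ nth 0%N il j *: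
     expx D (nth 0 [seq \sum_(z <- b) z | b <- reshape il lin_forms] j *+ nth 0%N u j))).
Proof.
rewrite -raddf_sum; congr (mcoeff m _).
exact: (sum_path_tuples (size il) N (fun x j => qfrac R N x ^+ nth 0%N il j *:
     expx D (nth 0 [seq \sum_(z <- b) z | b <- reshape il lin_forms] j *+ x))).
Qed.

Lemma mcoeff_gser : mcoeff m (gser N D (scaled_vars R r)) =
  \sum_(u <- subs r (iota 1 N)) (\prod_(x <- u) qfrac R N x) * (diff_weight (rev u))%:P.
Proof.
rewrite /gser -/lin_forms /hser size_lin_forms raddf_sum.
have one (il : seq nat) : all (leq 1) il -> sumn il = r -> ~~ has (leq 2) il -> il = nseq r 1%N.
  move=> i1 sr /hasPn i2; have e : il = nseq (size il) 1%N.
    apply/all_pred1P/allP => x xi /=; have := allP i1 x xi; have := i2 x xi; lia.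
  by rewrite [LHS]e; congr nseq; rewrite -sr [X in _ = sumn X]e sumn_nseq mul1n.
have zero (il : seq nat) : all (leq 1) il -> sumn il = r -> has (leq 2) il ->
    mcoeff m (Hser N D il [seq \sum_(z <- b) z | b <- reshape il lin_forms]) = 0.
  move=> i1 sr i2; rewrite HserE big_seq big1 // => u /mem_subs[su _].
  have [i ir iE] := @repeats_rev_eq il u (esym su) i2.
  by rewrite mcoeff_block // (diff_weight_eq (i := i)) -?sr // polyC0 mulr0.
have main : mcoeff m (Hser N D (nseq r 1%N) [seq \sum_(z <- b) z | b <- reshape (nseq r 1%N) lin_forms]) =
    \sum_(u <- subs r (iota 1 N)) (\prod_(x <- u) qfrac R N x) * (diff_weight (rev u))%:P.
  rewrite HserE size_nseq big_seq [RHS]big_seq; apply: eq_bigr => u /mem_subs[su _].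
  have h := @mcoeff_block (nseq r 1%N) u; rewrite size_nseq sumn_nseq mul1n in h.
  have eR : repeats (nseq r 1%N) u = u by rewrite -su repeats1.
  apply: (etrans (h (esym su) erefl)); rewrite eR; congr (_ * _); rewrite [RHS](big_nth 0%N) big_mkord su.
  by apply: eq_bigr => j _; rewrite nth_nseq ltn_ord expr1.
(* Only the composition into ones survives; it has [r] parts, the largest possible number. *)
rewrite (bigD1 ord_max) //= [X in _ + X]big1 ?addr0 => [|j jr].
  pose o : r.-tuple 'I_r.+1 := [tuple of nseq r (inord 1)].
  have oE : [seq val j | j <- o] = nseq r 1%N.
    by rewrite map_nseq /=; case: (r) => // n; rewrite inordK.
  rewrite raddf_sum (bigD1 o) /=; last first.
    by rewrite oE sumn_nseq mul1n eqxx andbT; apply/allP => x /nseqP[->].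
  rewrite [X in _ + X]big1 ?addr0 => [|i /andP[/andP[i1 /eqP isum] io]].
    rewrite mcoeffZ oE main -[RHS]mul1r; congr (_ * _).
    have -> : (\prod_(j <- o) (val j)`! = 1)%N.
      rewrite -(big_map val xpredT factorial) oE.
      by elim: (r) => [|n IHn]; rewrite ?big_nil //= big_cons IHn.
    by rewrite invr1.
  rewrite mcoeffZ; have [i2|i2] := boolP (has (leq 2) [seq val j | j <- i]).
    by rewrite zero // mulr0.
  case/eqP: io; apply/val_inj/(inj_map val_inj); rewrite [RHS]oE; exact: one.
rewrite raddf_sum big1 // => i /andP[i1 /eqP isum] /=; rewrite mcoeffZ.
have [i2|i2] := boolP (has (leq 2) [seq val j | j <- i]); first by rewrite zero // mulr0.
have /(congr1 size) := one _ i1 isum i2; rewrite size_map size_tuple size_nseq => jE.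
by case/eqP: jr; apply/val_inj.
Qed.

Lemma prod_qfrac u : \prod_(x <- u) qfrac R N x = \sum_(v <- tups (size u) N) 'X^(wt u v).
Proof.
elim: u => [|x u IHu]; first by rewrite big_nil big_seq1 /wt /= big_nil expr0.
rewrite big_cons IHu sum_tups_cons /qfrac mulr_suml /index_iota subSS subn0.
apply: eq_bigr => v _; rewrite mulr_sumr; apply: eq_bigr => v' _.
by rewrite wt_cons exprD.
Qed.

Definition qweight d : C := \prod_(i < r) (nth 0%N d i)%:R ^+ (nth 0%N ks i).-1.

Definition qconst : C := \prod_(k <- ks) (t ^+ k / (k.-1)`!%:R).

Lemma nth_rev_psums d i : (i < size d)%N ->
  (nth 0%N (rev (psums 0 d)) i)%:R - (nth 0%N (rev (psums 0 d)) i.+1)%:R = (nth 0%N (rev d) i)%:R :> C.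
Proof.
elim/last_ind: d i => [|d x IHd] // i; rewrite psums_rcons !rev_rcons add0n size_rcons.
case: i => [|i] /= id; last exact: IHd.
rewrite nth0; have -> : head 0%N (rev (psums 0 d)) = sumn d.
  case: d / lastP {IHd id} => // d y; rewrite psums_rcons rev_rcons /= sumn_rcons add0n //.
by rewrite natrD addrAC subrr add0r.
Qed.

Lemma diff_weight_psums d : size d = r ->
  t ^+ r * diff_weight (rev (psums 0 d)) = qconst * qweight (rev d).
Proof.
move=> sd; rewrite -(card_ord r) -prodr_const /qconst (big_nth 0%N) big_mkord /qweight -!big_split /=.
apply: eq_bigr => i _; rewrite nth_rev_psums ?sd // exprMn.
have : (2 <= nth 0%N ks i)%N by move/(all_nthP 0%N): ks2; apply.
case: (nth 0%N ks i) => // k _ /=; rewrite exprS.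
by move: (t ^+ k) ((k`!)%:R^-1) ((nth _ _ _)%:R ^+ k) => a b c; ring.
Qed.

Lemma wt_gt u v K : size u = size v -> all (leq 1) v -> has (ltn K) u -> (K < wt u v)%N.
Proof.
elim: u v => [|x u IHu] [|y v] //= [sz] /andP[y1 v1]; rewrite wt_cons.
case/orP => [Kx|/(IHu _ sz v1) h]; last by rewrite (leq_trans h) // leq_addl.
by rewrite (leq_trans Kx) // (leq_trans _ (leq_addr _ _)) // leq_pmulr.
Qed.

Definition qcoef U K n : C :=
  \sum_(u <- subs r (iota 1 U)) \sum_(d <- tups r K) (wt u d == n)%:R * qweight d.

(** The exponentials yield powers of the gaps of [u], and the geometric series the multiplicities
    [v]. Under conjugation of partitions the gaps become the new multiplicities [d] and the partial
    sums of the reversed [v] the new [u]; [wt_conj] preserves the exponent of [q]. *)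
Lemma gsh_indexE : gsh_index R ks N = qconst * qcoef N N N.
Proof.
rewrite /gsh_index -/m mcoeff_gser coef_sum mulr_sumr.
pose F u : C := \sum_(v <- tups r N) (wt u v == N)%:R * (t ^+ r * diff_weight (rev u)).
have F0 (G : seq nat -> seq nat -> C) u : has (ltn N) u ->
    \sum_(v <- tups r N) (wt u v == N)%:R * G u v = 0 \/ size u <> r.
  move=> uN; have [su|su] := eqVneq (size u) r; [left|by right; apply/eqP].
  rewrite big_seq big1 // => v /mem_tups[sv v1].
  by have := @wt_gt u v N; rewrite su sv => /(_ erefl v1 uN); case: ltngtP; rewrite ?mul0r.
transitivity (\sum_(u <- subs r (iota 1 N)) (if size u == r then F u else 0)).
  rewrite big_seq [RHS]big_seq; apply: eq_bigr => u /mem_subs[su _]; rewrite su eqxx.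
  rewrite coefMC prod_qfrac su coef_sum mulr_suml mulr_sumr; apply: eq_bigr => v _.
  by rewrite coefXn eq_sym mulrCA.
have sp := @sum_subs_psums C r N 0; rewrite subn0 in sp.
rewrite sp // => [|u uN]; last first.
  case: eqP => // su; have [//|/(_ su)//] := F0 (fun u v => t ^+ r * diff_weight (rev u)) u uN.
rewrite /qcoef.
transitivity (qconst * \sum_(u <- subs r (iota 1 N))
   (if size u == r then \sum_(d <- tups r N) (wt u d == N)%:R * qweight d else 0)); last first.
  congr (_ * _); rewrite big_seq [RHS]big_seq; apply: eq_bigr => u /mem_subs[su _].
  by rewrite su eqxx.
rewrite sp // => [|u uN]; last first.
  case: eqP => // su; have [//|/(_ su)//] := F0 (fun u v => qweight v) u uN.
rewrite mulr_sumr sum_tups_rev.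
under eq_big_seq => d /mem_tups[sd _] do
  rewrite size_psums size_rev sd eqxx /F -mulr_suml diff_weight_psums ?size_rev // revK.
under [RHS]eq_big_seq => d /mem_tups[sd _] do rewrite size_psums sd eqxx.
rewrite -[RHS]mulr_sumr exchange_big mulr_sumr.
under eq_bigr => d _ do rewrite mulrCA mulr_suml.
rewrite big_seq [RHS]big_seq; apply: eq_bigr => d /mem_tups[sd _]; congr (qconst * _).
rewrite [LHS]sum_tups_rev; apply: eq_big_seq => v /mem_tups[sv _].
by rewrite wt_conj ?size_rev ?sd // !revK.
Qed.

End GserCoefficient.

(** * Convergence *)

Section BoxSums.
Variable A : comNzRingType.
Implicit Types (u d ks : seq nat) (y : A).

Definition pow_weight ks d : A := \prod_(i < size ks) (nth 0%N d i)%:R ^+ (nth 0%N ks i).-1.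

Lemma tups_weight K ks u y : size u = size ks ->
  \sum_(d <- tups (size ks) K) pow_weight ks d * y ^+ wt u d =
  \prod_(p <- zip u ks) \sum_(x <- iota 1 K) x%:R ^+ p.2.-1 * y ^+ (p.1 * x).
Proof.
elim: ks u => [|k ks IHks] [|x u] //=.
  by move=> _; rewrite big_seq1 /pow_weight /wt /= big_ord0 !big_nil expr0 mulr1.
move=> [sz]; rewrite big_cons -IHks // -/(tups (size ks).+1 K) sum_tups_cons mulr_suml.
apply: eq_bigr => d _; rewrite mulr_sumr; apply: eq_bigr => d' _.
by rewrite /pow_weight big_ord_recl /= wt_cons exprD mulrACA.
Qed.

End BoxSums.

(** Dropping the condition that the points increase only adds nonnegative terms. *)
Lemma sub_sum_le (R : realType) (X : eqType) (F : X -> nat -> R) t ns : (forall x n, 0 <= F x n) ->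
  sub_sum F t ns <= \prod_(n <- ns) \sum_(x <- t) F x n.
Proof.
move=> F0; have S0 s ms : 0 <= \prod_(n <- ms) \sum_(x <- s) F x n.
  by apply: prodr_ge0 => n _; apply: sumr_ge0.
elim: t ns => [|z t IHt] [|n ns]; rewrite ?sub_sum0 ?sub_sum_nil ?big_nil //.
have le ms : \prod_(n <- ms) \sum_(x <- t) F x n <= \prod_(n <- ms) \sum_(x <- z :: t) F x n.
  apply: ler_prod => k _; rewrite sumr_ge0 //= big_cons lerDr //.
rewrite sub_sum_cons big_cons [\sum_(x <- z :: t) F x n]big_cons mulrDl lerD //.
  by rewrite ler_wpM2l // (le_trans (IHt ns)).
rewrite (le_trans (IHt (n :: ns))) // big_cons ler_wpM2l ?sumr_ge0 //.
Qed.

Lemma prod_zip_mul (A : comNzRingType) (F G : nat -> nat -> A) (c : nat -> A) u ks :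
  size u = size ks -> (forall x k, k \in ks -> F x k = c k * G x k) ->
  \prod_(p <- zip u ks) F p.1 p.2 = \prod_(k <- ks) c k * \prod_(p <- zip u ks) G p.1 p.2.
Proof.
elim: ks u => [|k ks IHks] [|x u] //=; first by move=> _ _; rewrite !big_nil mulr1.
move=> [su] FG; rewrite !big_cons /= FG ?mem_head // IHks // => [|y l lks]; first by rewrite mulrACA.
by rewrite FG // inE lks orbT.
Qed.

Lemma cvg_of_diff (K : numFieldType) (f g : nat -> K) (l : K) : g @ \oo --> l ->
  (fun N => f N - g N) @ \oo --> (0 : K) -> f @ \oo --> l.
Proof. by move=> gl fg; apply: cvg_sub0 gl. Qed.

Section Analysis.
Variable R : realType.
Local Notation C := (Cplx R).
Local Notation t := (- two_pi_i R).
Implicit Types (ks ns : seq nat) (y z : C) (N U K n k : nat).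

Lemma ler_lim_nrm (f : nat -> C) (l v : C) (b : R) N : f @ \oo --> l ->
  (forall K, (N <= K)%N -> nrm (f K - v) <= b) -> nrm (l - v) <= b.
Proof.
move=> fl fb; apply/ler_addgt0Pr => e e0.
have ec : 0 < (e%:C)%C :> C by rewrite ltcR.
have [M _ hM] := (cvgrPdist_lt _ _).1 fl _ ec.
have h1 := hM (maxn M N) (leq_maxl _ _); have h2 := fb (maxn M N) (leq_maxr _ _).
move: h1; rewrite /= nrmE ltcR => /ltW h1.
have -> : l - v = (f (maxn M N) - v) + (l - f (maxn M N)).
  by move: (f _) => x; rewrite [RHS]addrC addrA subrK.
by rewrite (le_trans (nrmD _ _)) // lerD.
Qed.

Lemma cauchyR (f : nat -> R) (e : nat -> R) : e @ \oo --> 0 ->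
  (forall N U, (N <= U)%N -> `|f U - f N| <= e N) -> cvgn f.
Proof.
move=> e0 fe; apply/cauchy_cvgP; apply: cauchy_exP => eps eps0.
have /cvgr0Pnorm_lt/(_ _ eps0)[N _ hN] := e0.
exists (f N); exists N => // U /= NU; rewrite /ball /= distrC.
by rewrite (le_lt_trans (fe N U NU)) // (le_lt_trans (ler_norm _)) // hN /=.
Qed.

Lemma cauchyC (f : nat -> C) (e : nat -> R) : e @ \oo --> 0 ->
  (forall N U, (N <= U)%N -> nrm (f U - f N) <= e N) -> exists l : C, f @ \oo --> l.
Proof.
move=> e0 fe.
have cr : cvgn (fun N => complex.Re (f N)).
  apply: (cauchyR e0) => N U /fe; apply: le_trans.
  by have := nrm_geRe (f U - f N); case: (f U) => a b; case: (f N) => c d.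
have ci : cvgn (fun N => complex.Im (f N)).
  apply: (cauchyR e0) => N U /fe; apply: le_trans.
  by have := nrm_geIm (f U - f N); case: (f U) => a b; case: (f N) => c d.
pose a := limn (fun N => complex.Re (f N)); pose b := limn (fun N => complex.Im (f N)).
exists (a +i* b)%C; apply: (@cvgC_le _ _ _ (fun N => `|complex.Re (f N) - a| + `|complex.Im (f N) - b|)).
  move=> N; rewrite (le_trans (nrm_leD _)) //.
  by case: (f N) => c d.
rewrite -[X in _ --> X](addr0 (0 : R)); apply: cvgD.
  by rewrite -[X in _ --> X](normr0 R); apply: cvg_norm; rewrite -[X in _ --> X](subrr a); apply: cvgB => //; exact: cvg_cst.
by rewrite -[X in _ --> X](normr0 R); apply: cvg_norm; rewrite -[X in _ --> X](subrr b); apply: cvgB => //; exact: cvg_cst.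
Qed.

Variable ks : seq nat.
Local Notation r := (size ks).
Variable q : C.
Hypothesis q1 : nrm q < 1.

Definition box U K : C :=
  \sum_(u <- subs r (iota 1 U)) \sum_(d <- tups r K) qweight R ks d * q ^+ wt u d.

Definition polylog_sum U : C := sub_sum (fun u k => polylog_neg k.-1 (q ^+ u)) (iota 1 U) ks.

Lemma powsumE k K y : powsum k K y = \sum_(x <- iota 1 K) x%:R ^+ k * y ^+ x.
Proof.
rewrite /powsum.
have -> : iota 1 K = index_iota 1 K.+1 by rewrite /index_iota subSS subn0.
by rewrite big_add1 /= big_mkord.
Qed.

Lemma boxE U K : box U K = sub_sum (fun u k => powsum k.-1 K (q ^+ u)) (iota 1 U) ks.
Proof.
rewrite /box /sub_sum big_seq [RHS]big_seq; apply: eq_bigr => u /mem_subs[su _].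
rewrite [LHS](tups_weight K q su); apply: eq_bigr => p _.
by rewrite powsumE; apply: eq_bigr => x _; rewrite exprM.
Qed.

Lemma box_cvg U : box U K @[K --> \oo] --> polylog_sum U.
Proof.
apply: eq_cvgn => [K|]; first by rewrite boxE; reflexivity.
rewrite /polylog_sum /sub_sum big_seq.
apply: eq_cvgn => [K|]; first by rewrite /sub_sum big_seq; reflexivity.
apply: cvgC_sum => u /mem_subs[_ us]; rewrite big_seq.
apply: eq_cvgn => [K|]; first by rewrite big_seq; reflexivity.
apply: cvgC_prod => p pz; apply: powsum_cvg; rewrite nrmX.
have p1 : (0 < p.1)%N.
  have : p.1 \in u by move: pz; elim: (u) (ks) => [|x u' IH] [|k ks'] //=; rewrite !inE => /orP[/eqP->|/IH ->]; rewrite ?eqxx ?orbT.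
  by move/(mem_subseq us); rewrite mem_iota => /andP[].
by case: p.1 p1 => // n _; rewrite exprS (le_lt_trans _ q1) // ler_piMr ?nrm_ge0 // exprn_ile1 ?nrm_ge0 // ltW.
Qed.

Definition qsum N : C := \sum_(0 <= n < N) qcoef R ks n n n * q ^+ n.

(** An entry of [u] or [d] above [n] makes the weight exceed [n], so truncation at [n] is already
    exact. *)
Lemma qcoef_stable U K n : (n <= U)%N -> (n <= K)%N -> qcoef R ks U K n = qcoef R ks n n n.
Proof.
move=> nU nK; rewrite /qcoef.
have gt (u d : seq nat) : size u = r -> size d = r -> all (leq 1) u -> all (leq 1) d ->
    has (ltn n) u || has (ltn n) d -> (wt u d == n) = false.
  move=> su sd u1 d1 /orP[h|h].
    by have := @wt_gt u d n; rewrite su sd => /(_ erefl d1 h); case: ltngtP.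
  have wC : wt u d = wt d u.
    by rewrite /wt; elim: (u) (d) => [|x u' IH] [|x' d'] //=; rewrite ?big_nil // !big_cons IH mulnC.
  by have := @wt_gt d u n; rewrite su sd wC => /(_ erefl u1 h); case: ltngtP.
have sub1 V u : u \in subs r (iota 1 V) -> size u = r /\ all (leq 1) u.
  move=> /mem_subs[su us]; split=> //; apply/allP => x /(mem_subseq us).
  by rewrite mem_iota => /andP[].
transitivity (\sum_(u <- subs r (iota 1 U)) if (size u == r) && all (leq 1) u then
    \sum_(d <- tups r K) (wt u d == n)%:R * qweight R ks d else 0).
  by rewrite big_seq [RHS]big_seq; apply: eq_bigr => u /sub1[-> ->]; rewrite eqxx.
rewrite (sum_subs_stable _ nU) => [|u un]; last first.
  case: ifP => // /andP[/eqP su u1]; rewrite big_seq big1 // => d /mem_tups[sd d1].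
  by rewrite gt ?un // mul0r.
rewrite big_seq [RHS]big_seq; apply: eq_bigr => u /sub1[su u1]; rewrite su eqxx u1 /=.
transitivity (\sum_(d <- tups r K) if (size d == r) && all (leq 1) d then
    (wt u d == n)%:R * qweight R ks d else 0).
  by rewrite big_seq [RHS]big_seq; apply: eq_bigr => d /mem_tups[-> ->]; rewrite eqxx.
rewrite (sum_tups_stable _ nK) => [|d dn]; last first.
  by case: ifP => // /andP[/eqP sd d1]; rewrite gt ?dn ?orbT // mul0r.
by rewrite big_seq [RHS]big_seq; apply: eq_bigr => d /mem_tups[-> ->]; rewrite eqxx.
Qed.

Lemma nrm_qweight d : nrm (qweight R ks d) = pow_weight R ks d.
Proof. by rewrite /qweight nrm_prod; apply: eq_bigr => i _; rewrite nrmX nrm_nat. Qed.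

Lemma pow_weight_ge0 d : 0 <= pow_weight R ks d.
Proof. by rewrite -nrm_qweight nrm_ge0. Qed.

(** A radius between [|q|] and 1: boundedness of the sums at [s] gives a geometric gain at [q]. *)
Variable s : R.
Hypothesis qs : nrm q < s.
Hypothesis s1 : s < 1.

Let s0 : 0 < s. Proof. exact: le_lt_trans (nrm_ge0 q) qs. Qed.

Definition real_box U K : R :=
  \sum_(u <- subs r (iota 1 U)) \sum_(d <- tups r K) pow_weight R ks d * s ^+ wt u d.

Lemma sum_geo (x : R) U : 0 < x < 1 -> \sum_(i <- iota 1 U) x ^+ i <= (1 - x)^-1.
Proof.
move=> /andP[x0 x1]; have x1' : 0 < 1 - x by rewrite subr_gt0.
have -> : iota 1 U = index_iota 1 U.+1 by rewrite /index_iota subSS subn0.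
rewrite big_add1 /= big_mkord -[leRHS]mul1r ler_pdivlMr //.
under eq_bigr => i _ do rewrite exprS.
rewrite -mulr_sumr -mulrA; have geo : (\sum_(i < U) x ^+ i) * (1 - x) = 1 - x ^+ U.
  by rewrite -opprB mulrN mulrC -subrX1 opprB.
rewrite geo (@le_trans _ _ x) //; last exact: ltW.
by rewrite ler_piMr ?(ltW x0) // gerBl exprn_ge0 // ltW.
Qed.

(** From [x d >= (x - 1) + d] for [x, d >= 1], the double sum is dominated by a product of two
    geometric series, half of the decay in [d] having absorbed [d^k]. *)
Lemma double_bound k : exists2 B : R, 0 <= B & forall U K,
  \sum_(x <- iota 1 U) \sum_(d <- iota 1 K) d%:R ^+ k * s ^+ (x * d) <= B.
Proof.
pose g := Num.sqrt s; have g0 : 0 < g by rewrite sqrtr_gt0.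
have gs : s = g * g by rewrite -expr2 sqr_sqrtr // ltW.
have g1 : g < 1 by rewrite -sqrtr1 ltr_sqrt.
have [|B B0 hB] := @pow_exp_bound R k g; first by rewrite g0.
exists (B * (1 - g)^-1 * ((1 - s)^-1 * s^-1)) => [|U K].
  by rewrite !mulr_ge0 // invr_ge0 ?subr_ge0 ltW.
apply: (@le_trans _ _ (\sum_(x <- iota 1 U) \sum_(d <- iota 1 K) (B * g ^+ d) * (s ^+ x * s^-1))).
  rewrite big_seq [leRHS]big_seq; apply: ler_sum => x; rewrite mem_iota => /andP[x1 _].
  rewrite big_seq [leRHS]big_seq; apply: ler_sum => d; rewrite mem_iota => /andP[d1 _].
  have -> : s ^+ x * s^-1 = s ^+ x.-1 by rewrite -{1}(prednK x1) exprSr mulfK // gt_eqF.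
  apply: (@le_trans _ _ (d%:R ^+ k * (s ^+ x.-1 * s ^+ d))).
    rewrite ler_wpM2l ?exprn_ge0 ?ler0n // -exprD ler_wiXn2l ?(ltW s0) ?(ltW s1) //.
    by case: (x) x1 (d) d1 => // x' _ [|d'] // _; rewrite /=; nia.
  rewrite [s ^+ x.-1 * _]mulrC mulrA ler_wpM2r ?exprn_ge0 ?(ltW s0) //.
  by rewrite {1}gs exprMn mulrA ler_wpM2r ?exprn_ge0 ?(ltW g0).
under eq_bigr => x _ do rewrite -mulr_suml -mulr_sumr.
rewrite -mulr_sumr -mulr_suml ler_pM ?mulr_ge0 ?sumr_ge0 ?invr_ge0 ?(ltW s0) // => [i _|||].
- by rewrite exprn_ge0 // ltW.
- by move=> i _; rewrite exprn_ge0 // ltW.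
- by rewrite ler_wpM2l // sum_geo // g0.
- by rewrite ler_wpM2r ?invr_ge0 ?(ltW s0) // sum_geo // s0.
Qed.

Lemma real_box_bound : exists2 B : R, 0 <= B & forall U K, real_box U K <= B.
Proof.
have [B hB] := choice (fun k => let: ex_intro2 B B0 h := double_bound k in
  ex_intro (fun B => 0 <= B /\ forall U K,
  \sum_(x <- iota 1 U) \sum_(d <- iota 1 K) d%:R ^+ k * s ^+ (x * d) <= B) B (conj B0 h)).
exists (\prod_(k <- ks) B k.-1) => [|U K].
  by apply: prodr_ge0 => k _; case: (hB k.-1).
have -> : real_box U K = sub_sum (fun u k => \sum_(x <- iota 1 K) x%:R ^+ k.-1 * s ^+ (u * x)) (iota 1 U) ks.
  rewrite /real_box /sub_sum big_seq [RHS]big_seq; apply: eq_bigr => u /mem_subs[su _].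
  exact: tups_weight.
have F0 x k : 0 <= \sum_(d <- iota 1 K) d%:R ^+ k.-1 * s ^+ (x * d).
  by apply: sumr_ge0 => d _; rewrite mulr_ge0 ?exprn_ge0 ?ler0n ?(ltW s0).
rewrite (le_trans (sub_sum_le _ _ F0)) //; apply: ler_prod => k _.
by rewrite sumr_ge0 //=; case: (hB k.-1).
Qed.

(** The terms of weight below [N] are all in the box and cancel; in the others [|q|^wt] is at most
    [(|q| / s)^N s^wt]. *)
Lemma box_qsum N U K : (N <= U)%N -> (N <= K)%N ->
  nrm (box U K - qsum N) <= (nrm q / s) ^+ N * real_box U K.
Proof.
move=> NU NK; pose e := nrm q / s.
have e0 : 0 <= e by rewrite divr_ge0 ?nrm_ge0 // ltW.
have e1 : e <= 1 by rewrite ler_pdivrMr // mul1r ltW.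
have -> : box U K - qsum N =
    \sum_(u <- subs r (iota 1 U)) \sum_(d <- tups r K) (if (wt u d < N)%N then 0 else qweight R ks d * q ^+ wt u d).
  have -> : qsum N = \sum_(u <- subs r (iota 1 U)) \sum_(d <- tups r K)
      (if (wt u d < N)%N then qweight R ks d * q ^+ wt u d else 0).
    rewrite /qsum big_nat; under eq_bigr => n /andP[_ nN] do
      rewrite -(qcoef_stable (ltnW (leq_trans nN NU)) (ltnW (leq_trans nN NK))) /qcoef mulr_suml.
    rewrite -big_nat exchange_big; apply: eq_bigr => u _ /=.
    under eq_bigr => n _ do rewrite mulr_suml.
    rewrite exchange_big; apply: eq_bigr => d _ /=.
    rewrite big_mkord; case: ifPn => [wN|wN].
      rewrite (bigD1 (Ordinal wN)) //= eqxx mul1r big1 ?addr0 // => n nw.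
      have -> : (wt u d == n) = false.
        by apply/negbTE; apply: contraNneq nw => wn; apply/eqP/val_inj.
      by rewrite !mul0r.
    rewrite big1 // => n _; have -> : (wt u d == n) = false.
      by apply/negbTE; apply: contraNneq wN => ->.
    by rewrite !mul0r.
  rewrite /box -sumrB; apply: eq_bigr => u _; rewrite -sumrB; apply: eq_bigr => d _.
  by case: ifP; rewrite ?subrr ?subr0.
rewrite (le_trans (nrm_sum _ _ _)) // /real_box mulr_sumr; apply: ler_sum => u _.
rewrite (le_trans (nrm_sum _ _ _)) // mulr_sumr; apply: ler_sum => d _.
case: ifPn => [_|]; rewrite ?nrm0 ?mulr_ge0 ?pow_weight_ge0 ?exprn_ge0 ?(ltW s0) //.
rewrite -leqNgt => Nw; rewrite nrmM nrm_qweight nrmX mulrCA ler_wpM2l ?pow_weight_ge0 //.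
have -> : nrm q ^+ wt u d = e ^+ wt u d * s ^+ wt u d by rewrite -exprMn divfK // gt_eqF.
by rewrite ler_wpM2r ?exprn_ge0 ?(ltW s0) // ler_wiXn2l.
Qed.

End Analysis.

Section FinalLimit.
Variable R : realType.
Local Notation C := (Cplx R).
Implicit Types (ks ns : seq nat) (q : C).

(** The same series is summed by powers of [q] and by rows. The bound of [box_qsum] is uniform in
    the box, so letting [K] grow compares the two kinds of partial sums directly. *)
Lemma qsum_limit ks q : nrm q < 1 ->
  exists l : C, qsum ks q @ \oo --> l /\ polylog_sum ks q @ \oo --> l.
Proof.
move=> q1; pose s := (1 + nrm q) / 2.
have qs : nrm q < s by rewrite /s; lra.
have s1 : s < 1 by rewrite /s; lra.
have s0 : 0 < s by exact: le_lt_trans (nrm_ge0 q) qs.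
have [B B0 hB] := real_box_bound ks q1 qs s1.
pose e := nrm q / s; pose b N := B * e ^+ N.
have e0 : 0 <= e by rewrite divr_ge0 ?nrm_ge0 // ltW.
have e1 : e < 1 by rewrite ltr_pdivrMr // mul1r.
have b0 : b @ \oo --> 0.
  rewrite -[X in _ --> X](mulr0 B); apply: cvgM; first exact: cvg_cst.
  by apply: cvg_expr; rewrite ger0_norm.
have h N U : (N <= U)%N -> nrm (polylog_sum ks q U - qsum ks q N) <= b N.
  move=> NU.
  have H := @box_cvg R ks q q1 U.
  apply: (@ler_lim_nrm R (box ks q U) _ _ _ N H) => K NK.
  rewrite (le_trans (box_qsum ks qs NU NK)) // /b mulrC ler_wpM2r ?exprn_ge0 //.
have [l hl] : exists l : C, qsum ks q @ \oo --> l.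
  apply: (@cauchyC _ _ (fun N => b N + b N)) => [|N U NU].
    by rewrite -[X in _ --> X](addr0 (0 : R)); apply: cvgD.
  have -> : qsum ks q U - qsum ks q N = (polylog_sum ks q U - qsum ks q N) - (polylog_sum ks q U - qsum ks q U).
    by ring.
  rewrite (le_trans (nrmD _ _)) // nrmN lerD ?h // (le_trans (h U U _)) //.
  by rewrite /b ler_wpM2l // ler_wiXn2l // ltW.
exists l; split=> //.
have d0 : (fun U => polylog_sum ks q U - qsum ks q U) @ \oo --> (0 : C).
  apply: (@cvgC_le _ _ _ b) => [U|]; last exact: b0.
  by rewrite subr0; exact: h.
exact: cvg_of_diff hl d0.
Qed.

Variable tau : C.
Hypothesis tau0 : 0 < complex.Im tau.

Lemma psi_sumE U ks : all (leq 1) ks -> psi_sum tau (iota 1 U) ks = qconst R ks * polylog_sum ks (nome tau) U.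
Proof.
move=> ks1; rewrite /psi_sum /polylog_sum /sub_sum mulr_sumr big_seq [RHS]big_seq.
apply: eq_bigr => u /mem_subs[su us]; rewrite /qconst.
apply: (@prod_zip_mul _ (fun u k => psi k.-1 (u%:R * tau)) (fun u k => polylog_neg k.-1 (nome tau ^+ u))
  (fun k => (- two_pi_i R) ^+ k / (k.-1)`!%:R) u ks su) => x k kks.
have k0 : (0 < k)%N := allP ks1 k kks.
by rewrite mulr_natl /psi nomeMn (prednK k0).
Qed.

Lemma omega0 m : omega (fun=> 0 : C) m = 0.
Proof.
have := omega_lin 1 (fun=> 0 : C) (fun=> 0) m; rewrite mul1r addr0 mul1r.
by move=> /eqP; rewrite -subr_eq subrr => /eqP.
Qed.

Lemma omega_sum (h : nat -> seq nat -> C) (c : nat -> C) N m :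
  omega (fun ks => \sum_(0 <= k < N) h k ks * c k) m = \sum_(0 <= k < N) omega (h k) m * c k.
Proof.
elim: N => [|N IHN].
  rewrite big_geq // -[RHS](omega0 m); apply: eq_omega => ks _; by rewrite big_geq.
rewrite big_nat_recr //= -IHN addrC mulrC -omega_lin; apply: eq_omega => ks _.
by rewrite big_nat_recr //= addrC mulrC.
Qed.

Lemma split_sum_sum (h : nat -> seq nat -> C) (c : nat -> C) N ns :
  split_sum (fun ks => \sum_(0 <= k < N) h k ks * c k) ns = \sum_(0 <= k < N) split_sum (h k) ns * c k.
Proof.
rewrite /split_sum; under eq_bigr => j _ do rewrite omega_sum mulr_sumr.
rewrite exchange_big; apply: eq_bigr => k _; rewrite mulr_suml.
by apply: eq_bigr => j _; rewrite mulrA.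
Qed.

Lemma split_sum_cvg (hs : nat -> seq nat -> C) h ns : all (leq 2) ns ->
  (forall ks, all (leq 2) ks -> hs L ks @[L --> \oo] --> h ks) ->
  split_sum (hs L) ns @[L --> \oo] --> split_sum h ns.
Proof.
move=> ns2 hl; apply: cvgC_sum => j _; apply: cvgM; first exact: cvgC_cst.
exact: omega_cvg.
Qed.

Lemma eq_split_sum (h h' : seq nat -> C) ns : (forall ks, all (leq 2) ks -> h ks = h' ks) ->
  split_sum h ns = split_sum h' ns.
Proof. by move=> hh'; apply: eq_bigr => j _; congr (_ * _); exact: eq_omega. Qed.

Lemma eisenstein_innerE ns L : all (leq 2) ns ->
  eisenstein_inner ns tau L = split_sum (psi_sum tau (iota 1 L)) ns.
Proof. by move=> ns2; apply: cvg_lim => //; exact: eisenstein_sum_cvg. Qed.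

(** [split_sum] is a finite combination whose coefficients depend neither on [L] nor on [N], so it
    commutes with both limits, which agree for each [ks] by [qsum_limit]. *)
Lemma eisenstein_limits ns : all (leq 2) ns -> exists2 l : C,
  eisenstein_inner ns tau @ \oo --> l &
  (\sum_(0 <= k < N) Gsh R ns k * nome tau ^+ k) @[N --> \oo] --> l.
Proof.
move=> ns2.
have [l hl] := choice (fun ks => qsum_limit ks (nome_lt1 tau0)).
exists (split_sum (fun ks => qconst R ks * l ks) ns).
  apply: eq_cvgn => [L|]; first by rewrite eisenstein_innerE //; reflexivity.
  apply: split_sum_cvg => // ks ks2.
  apply: eq_cvgn => [L|]; first by rewrite psi_sumE ?le1_of_le2 //; reflexivity.
  by apply: cvgM; [exact: cvgC_cst|have [] := hl ks].
apply: eq_cvgn => [N|].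
  transitivity (split_sum (fun ks => qconst R ks * qsum ks (nome tau) N) ns); last reflexivity.
  under eq_bigr => k _ do rewrite GshE //.
  rewrite -split_sum_sum; apply: eq_split_sum => ks ks2.
  rewrite /qsum mulr_sumr; apply: eq_bigr => k _.
  by rewrite gsh_indexE // mulrA.
apply: split_sum_cvg => // ks ks2.
by apply: cvgM; [exact: cvgC_cst|have [] := hl ks].
Qed.

End FinalLimit.

(** [lim] takes a default value on divergent sequences; hence the two convergences are asserted
    along with the identity, itself read as the convergence of the q-series to the Eisenstein
    series. *)
Theorem theorem1p3 (R : realType) (n : seq nat) (tau : Cplx R) :
  (1 <= size n)%N -> all (leq 2) n -> 0 < complex.Im tau ->
  [/\ forall L, cvgn (eisenstein_sum n tau L),
      cvgn (eisenstein_inner n tau) &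
      (\sum_(0 <= k < N) Gsh R n k * nome tau ^+ k) @[N --> \oo]
        --> multiple_eisenstein n tau].
Proof.
move=> _ n2 tau0; have [l hl hG] := eisenstein_limits tau0 n2.
split=> [L||].
- have h := @eisenstein_sum_cvg R tau tau0 n L n2; exact: cvgP h.
- exact: cvgP hl.
- by rewrite /multiple_eisenstein (cvg_lim _ hl).
Qed.
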